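(* Let $M$ be a finite dimensional $C^2$ complete connected Riemannian manifold and let $G,H:T^*M\to\mathbb{R}$ be two Tonelli Hamiltonians which Poisson commute. If there exists a function $u:M\to\mathbb{R}$ which is both an $(\alpha,G)$-subsolution and an $(\alpha',H)$-subsolution for some constants $\alpha,\alpha'\in\mathbb{R}$, then there is a $C^{1,1}$ function $u':M\to\mathbb{R}$ which is also both an $(\alpha,G)$-subsolution and an $(\alpha',H)$-subsolution.
   Context: A Hamiltonian $H:T^*M\to\mathbb{R}$ is Tonelli if it is $C^2$ and: (1) for every $K>0$ there is $C^*(K)\in\mathbb{R}$ with $H(x,p)\geqslant K\|p\|-C^*(K)$ for all $(x,p)\in T^*M$; (2) for every $R\geqslant 0$, $\sup\{H(x,p):\|p\|\leqslant R\}<+\infty$; (3) for every $(x,p)\in T^*M$ the second fiber derivative $\partial^2H/\partial p^2(x,p)$ is positive definite. $T^*M$ carries the symplectic form $\Omega=-d\lambda$, $\lambda$ the canonical Liouville form; the Hamiltonian vector field $X_H$ is defined by $\Omega(X_H(x,p),\cdot)=d_{(x,p)}H$. $G$ and $H$ Poisson commute if $\Omega(X_G,X_H)$ vanishes everywhere on $T^*M$. The Lagrangian associated with $H$ is $L_H(x,v)=\max_{p\in T_x^*M}\big(p(v)-H(x,p)\big)$ for $(x,v)\in TM$ (similarly $L_G$). A function $u:M\to\mathbb{R}$ is an $(\alpha,H)$-subsolution if for all $(x,y,t)\in M^2\times\mathbb{R}_+$, $$u(y)-u(x)\leqslant \inf_\gamma\int_0^tL_H(\gamma(\sigma),\dot\gamma(\sigma))\,d\sigma+t\alpha,$$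 the infimum being over all absolutely continuous curves $\gamma:[0,t]\to M$ with $\gamma(0)=x$ and $\gamma(t)=y$; $(\alpha,G)$-subsolutions are defined in the same way with $L_G$. $C^{1,1}$ is understood locally: differentiable with locally Lipschitz differential. *)

(* Defs.v *)
From HB Require Import structures.
From mathcomp Require Import all_boot all_order all_algebra.
From mathcomp Require Import all_classical all_reals all_analysis.

Set Implicit Arguments.
Unset Strict Implicit.
Unset Printing Implicit Defensive.

Import Order.TTheory GRing.Theory Num.Theory.
Import numFieldNormedType.Exports.

Local Open Scope classical_set_scope.
Local Open Scope ring_scope.

(* On an open set of a finite-dimensional space this is the usual notion of a
   C^k map: x |-> 'd f x is continuous (or C^k) iff x |-> 'd f x v is, for
   every vector v. *)
Fixpoint Ck_on (R : realType) (V W : normedModType R) (k : nat)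
    (U : set V) (f : V -> W) : Prop :=
  if k is k'.+1 then
    (forall x, U x -> differentiable f x) /\
    (forall v : V, Ck_on k' U (fun x => 'd f x v))
  else forall x, U x -> {for x, continuous f}.

(* An n-dimensional C^2 manifold given by an atlas [chart] with C^2 transition
   maps.  [phi i] is only meaningful on [dom i], [phi_inv i] only on
   [phi i @` dom i].  As in Mathlib, [chart_at x] is a preferred chart at x;
   the vectors and covectors at x are given by their coordinates in it. *)
Record c2_manifold (R : realType) (n : nat) := C2Manifold {
  carrier :> topologicalType ;
  chart : Type ;
  dom : chart -> set carrier ;
  phi : chart -> carrier -> 'rV[R]_n ;
  phi_inv : chart -> 'rV[R]_n -> carrier ;
  chart_at : carrier -> chart ;
  carrier_hausdorff : hausdorff_space carrier ;
  carrier_second_countable : @second_countable carrier ;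
  dom_open : forall i, open (dom i) ;
  dom_chart_at : forall x, dom (chart_at x) x ;
  codom_open : forall i, open (phi i @` dom i) ;
  phi_invK : forall i x, dom i x -> phi_inv i (phi i x) = x ;
  phi_continuous : forall i x, dom i x -> {for x, continuous (phi i)} ;
  phi_inv_continuous : forall i y, (phi i @` dom i) y ->
    {for y, continuous (phi_inv i)} ;
  transition_C2 : forall i j,
    Ck_on 2 (phi i @` (dom i `&` dom j)) (phi j \o phi_inv i)
}.

Section Manifold.
Variables (R : realType) (n : nat) (M : c2_manifold R n).

(* If v is the coordinate row of a tangent vector at x in the chart i, its
   coordinate row in the chart j is v *m transition_jac i j x. *)
Definition transition_jac (i j : chart M) (x : M) : 'M[R]_n :=
  'J (phi j \o phi_inv i) (phi i x).

(* (x, v) and (x, p) are the tangent vector and the covector at x with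
   coordinates v and p in the preferred chart at x.  The product topology of
   M * 'rV[R]_n plays no role: regularity is always expressed in charts. *)
Definition tangent : Type := (M * 'rV[R]_n)%type.
Definition cotangent : Type := (M * 'rV[R]_n)%type.

Definition pairing (p v : 'rV[R]_n) : R := \sum_k p 0 k * v 0 k.

(* The function H on T^*M read in the canonical coordinates (y, q) of T^*M
   associated with the chart i. *)
Definition local_ham (H : cotangent -> R) (i : chart M)
    (z : 'rV[R]_n * 'rV[R]_n) : R^o :=
  let x := phi_inv i z.1 in
  H (x, z.2 *m (transition_jac (chart_at x) i x)^T).

Definition local_gram (g : M -> 'M[R]_n) (i : chart M) (y : 'rV[R]_n)
    : 'M[R]_n :=
  let x := phi_inv i y in
  let J := transition_jac i (chart_at x) x in J *m g x *m J^T.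

(* [gram x] is the Gram matrix in the preferred chart at x.  On a C^2 manifold
   C^1 is the highest regularity of a metric that charts can detect. *)
Record riemannian_metric := RiemannianMetric {
  gram :> M -> 'M[R]_n ;
  gram_sym : forall x, (gram x)^T = gram x ;
  gram_pos : forall x (v : 'rV[R]_n), v != 0 -> 0 < (v *m gram x *m v^T) 0 0 ;
  gram_C1 : forall i, Ck_on 1 (phi i @` dom i) (local_gram gram i)
}.

Section Metric.
Variable g : riemannian_metric.

Definition tnorm (w : tangent) : R :=
  Num.sqrt ((w.2 *m g w.1 *m w.2^T) 0 0).

Definition conorm (z : cotangent) : R :=
  Num.sqrt ((z.2 *m invmx (g z.1) *m z.2^T) 0 0).

Definition velocity (c : R -> M) (s : R) : 'rV[R]_n :=
  derive1 (phi (chart_at (c s)) \o c) s.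

Definition C1_curve (c : R -> M) : Prop :=
  continuous c /\
  forall i, @Ck_on R R^o 'rV[R]_n 1 (c @^-1` dom i) (phi i \o c).

Definition curve_length (c : R -> M) : \bar R :=
  (\int[lebesgue_measure]_(s in `[0%R, 1%R]) (tnorm (c s, velocity c s))%:E)%E.

(* Piecewise C^1 curves give the same infimum: reparametrize them so that the
   velocity vanishes at the break points and at the end points. *)
Definition riem_dist (x y : M) : \bar R :=
  ereal_inf [set curve_length c | c in
    [set c : R -> M | [/\ C1_curve c, c 0 = x & c 1 = y]]].

Definition riem_complete : Prop :=
  forall a : nat -> M,
    (forall e : R, 0 < e -> exists N, forall k l, (N <= k)%N -> (N <= l)%N ->
       (riem_dist (a k) (a l) < e%:E)%E) ->
    exists x : M, forall e : R, 0 < e -> exists N, forall k, (N <= k)%N ->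
       (riem_dist (a k) x < e%:E)%E.

Definition abs_continuous_curve (t : R) (c : R -> M) : Prop :=
  forall e : R, 0 < e -> exists2 d : R, 0 < d &
    forall (m : nat) (a b : 'I_m -> R),
      (forall k, [/\ 0 <= a k, a k <= b k & b k <= t]) ->
      (forall k l, k != l -> b k <= a l \/ b l <= a k) ->
      \sum_k (b k - a k) < d ->
      (\sum_(k < m) riem_dist (c (a k)) (c (b k)) < e%:E)%E.

(* The second fiber derivative does not depend on the linear coordinates used
   on the fiber, so it may be computed in the preferred chart. *)
Definition tonelli (H : cotangent -> R) : Prop :=
  [/\ forall i, Ck_on 2 ((phi i @` dom i) `*` setT) (local_ham H i),
      forall K : R, 0 < K -> exists C : R, forall z, K * conorm z - C <= H z,
      forall r : R, 0 <= r ->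
        (ereal_sup [set (H z)%:E | z in [set z | (conorm z <= r)%R]] < +oo)%E
    & forall (x : M) (p w : 'rV[R]_n), w != 0 ->
        let h : 'rV[R]_n -> R^o := fun q => H (x, q) in
        0 < 'd (fun q => 'd h q w : R^o) p w].

(* On Tonelli Hamiltonians the supremum is a maximum. *)
Definition lagrangian (H : cotangent -> R) (w : tangent) : R :=
  sup (range (fun p : 'rV[R]_n => pairing p w.2 - H (w.1, p))).

Definition action (H : cotangent -> R) (t : R) (c : R -> M) : \bar R :=
  (\int[lebesgue_measure]_(s in `[0%R, t])
     (lagrangian H (c s, velocity c s))%:E)%E.

Definition subsolution (H : cotangent -> R) (alpha : R) (u : M -> R) : Prop :=
  forall (x y : M) (t : R), 0 <= t ->
    ((u y - u x)%:E <=
       ereal_inf [set action H t c | c in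
         [set c : R -> M | [/\ abs_continuous_curve t c, c 0%R = x & c t = y]]]
       + (t * alpha)%:E)%E.

End Metric.

(* The canonical forms of T^*M in the coordinates (y, q) of a chart. *)
Definition liouville (z w : 'rV[R]_n * 'rV[R]_n) : R^o := pairing z.2 w.1.

Definition ext_deriv (lam : 'rV[R]_n * 'rV[R]_n -> 'rV[R]_n * 'rV[R]_n -> R^o)
    (z X Y : 'rV[R]_n * 'rV[R]_n) : R :=
  'd (fun z' => lam z' Y) z X - 'd (fun z' => lam z' X) z Y.

Definition Omega (z X Y : 'rV[R]_n * 'rV[R]_n) : R :=
  - ext_deriv liouville z X Y.

Definition is_ham_vector (H : cotangent -> R) (i : chart M)
    (z X : 'rV[R]_n * 'rV[R]_n) : Prop :=
  forall Y, Omega z X Y = 'd (local_ham H i) z Y.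

(* Omega is nondegenerate, so the vectors XG and XH exist and are unique. *)
Definition poisson_commute (G H : cotangent -> R) : Prop :=
  forall i (z XG XH : 'rV[R]_n * 'rV[R]_n), (phi i @` dom i) z.1 ->
    is_ham_vector G i z XG -> is_ham_vector H i z XH -> Omega z XG XH = 0.

(* In coordinates the differential of u is the row of its partial
   derivatives. *)
Definition C11 (u : M -> R) : Prop :=
  forall i (y : 'rV[R]_n), (phi i @` dom i) y ->
    let f : 'rV[R]_n -> R^o := u \o phi_inv i in
    exists2 V : set 'rV[R]_n, nbhs y V &
      (forall z, V z -> differentiable f z) /\
      exists k : R,
        k.-lipschitz_V (fun z => \row_j ('d f z (delta_mx 0 j) : R)).

End Manifold.

(* Main.v *)
(** A subsolution is shown to be the same as a locally Lipschitz function whose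
    upper Dini derivatives along the lines of charts are bounded by the
    Lagrangian. Let [T^-_t] be the Lax-Oleinik semigroup of H and [T^+_t] the one
    obtained from it by reversing time. Because G and H commute, [T^-_t] and
    [T^+_t] map common subsolutions to common subsolutions: locally this is a
    discrete computation over small time steps, and completeness of the metric
    makes it global. For t > 0 the function [T^-_t u] is locally semiconcave, and
    for small t semiconvexity constants on compact sets deteriorate only a little;
    [T^+] exchanges the two roles. Hence [T^+_s T^-_t u], with s and t small, is
    both semiconcave and semiconvex near a given compact set, stays close to u,
    and almost keeps the bounds already gained on earlier compact sets. Iterating
    over a countable cover by chart balls and passing to the limit gives a common
    subsolution with locally bounded second differences, that is, of class
    C^{1,1}. *)

Require Import Defs.
From HB Require Import structures.
From mathcomp Require Import all_boot all_order all_algebra ssrAC.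
From mathcomp Require Import all_classical all_reals all_analysis.
From mathcomp Require Import measurable_realfun ring lra.

Set Implicit Arguments.
Unset Strict Implicit.
Unset Printing Implicit Defensive.

Import Order.TTheory GRing.Theory Num.Theory.
Import numFieldNormedType.Exports.

Local Open Scope classical_set_scope.
Local Open Scope ring_scope.

(** No Hamiltonian flow and no minimizing curve is used: the infimum defining T^- is never known to
    be attained. Everything is deduced from one dynamic-programming step of length s with an error
    O(s^2); t/s such steps cost O(s), which vanishes in the limit ([euler_limit]). Commutation
    enters through a single computation: if p is the momentum of a G-step, moving (x, p) along the
    Hamiltonian field of G changes H only to second order in the size of the step. Semiconcavity and
    semiconvexity are not treated alike: T^- creates the first for free, while the second survives
    because strict convexity of L in v absorbs the cross term between a displacement and a change of
    speed, at a rate that depends on the bound already reached, hence only for short times. The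
    obstacle to globality is that a local estimate needs the function on a slightly larger set.
    Since Lagrangians are controlled by the metric norm uniformly over M, information travels at
    bounded Riemannian speed, and completeness keeps it from leaving M in finite time. *)

Ltac clra := clear; intros; lra.
Ltac cnra := clear; intros; nra.

(** * Pairing of covectors with vectors, and the sup norm *)

Lemma pairingDl (R : realType) (n : nat) (p p' v : 'rV[R]_n) : pairing (p + p') v = pairing p v + pairing p' v.
Proof. by rewrite /pairing -big_split; apply: eq_bigr => k _; rewrite mxE mulrDl. Qed.

Lemma pairingDr (R : realType) (n : nat) (p v v' : 'rV[R]_n) : pairing p (v + v') = pairing p v + pairing p v'.
Proof. by rewrite /pairing -big_split; apply: eq_bigr => k _; rewrite mxE mulrDr. Qed.

Lemma pairingZl (R : realType) (n : nat) (a : R) (p v : 'rV[R]_n) : pairing (a *: p) v = a * pairing p v.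
Proof. by rewrite /pairing mulr_sumr; apply: eq_bigr => k _; rewrite mxE mulrA. Qed.

Lemma pairingC (R : realType) (n : nat) (p v : 'rV[R]_n) : pairing p v = pairing v p.
Proof. by apply: eq_bigr => k _; rewrite mulrC. Qed.

Lemma pairingZr (R : realType) (n : nat) (a : R) (p v : 'rV[R]_n) : pairing p (a *: v) = a * pairing p v.
Proof. by rewrite pairingC pairingZl pairingC. Qed.

Lemma pairingNl (R : realType) (n : nat) (p v : 'rV[R]_n) : pairing (- p) v = - pairing p v.
Proof. by rewrite -scaleN1r pairingZl mulN1r. Qed.

Lemma pairingNr (R : realType) (n : nat) (p v : 'rV[R]_n) : pairing p (- v) = - pairing p v.
Proof. by rewrite -scaleN1r pairingZr mulN1r. Qed.

Lemma pairingBl (R : realType) (n : nat) (p p' v : 'rV[R]_n) : pairing (p - p') v = pairing p v - pairing p' v.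
Proof. by rewrite pairingDl pairingNl. Qed.

Lemma pairingBr (R : realType) (n : nat) (p v v' : 'rV[R]_n) : pairing p (v - v') = pairing p v - pairing p v'.
Proof. by rewrite pairingDr pairingNr. Qed.

Lemma pairing0l (R : realType) (n : nat) (v : 'rV[R]_n) : pairing 0 v = 0.
Proof. by rewrite -(scale0r 0) pairingZl mul0r. Qed.

Lemma pairing0r (R : realType) (n : nat) (p : 'rV[R]_n) : pairing p 0 = 0.
Proof. by rewrite pairingC pairing0l. Qed.

Lemma pairing_delta (R : realType) (n : nat) (p : 'rV[R]_n) j : pairing p (delta_mx 0 j) = p 0 j.
Proof.
rewrite /pairing (bigD1 j) //= mxE !eqxx mulr1 big1 ?addr0 // => k kj.
by rewrite mxE (negbTE kj) andbF mulr0.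
Qed.

Lemma pairing_mx (R : realType) (n : nat) (p v : 'rV[R]_n) : pairing p v = (p *m v^T) 0 0.
Proof. by rewrite mxE; apply: eq_bigr => k _; rewrite mxE. Qed.

Lemma pairing_mulmx (R : realType) (n : nat) (p v : 'rV[R]_n) (A : 'M[R]_n) :
  pairing (p *m A^T) v = pairing p (v *m A).
Proof. by rewrite !pairing_mx trmx_mul mulmxA. Qed.

Lemma norm_entry (R : realType) (n : nat) (v : 'rV[R]_n) k : `|v 0 k| <= `|v|.
Proof.
rewrite [`|v|]mx_normrE; exact: (le_bigmax _ (fun i : 'I_1 * 'I_n => `|v i.1 i.2|) (0, k)).
Qed.

Lemma norm_le_entries (R : realType) (n : nat) (v : 'rV[R]_n) (c : R) :
  0 <= c -> (forall k, `|v 0 k| <= c) -> `|v| <= c.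
Proof.
by move=> c0 h; rewrite [`|v|]mx_normrE; apply/bigmax_leP; split=> // [[i k] _] /=; rewrite ord1.
Qed.

Lemma norm_attained (R : realType) (n : nat) (v : 'rV[R]_n) : v = 0 \/ exists k, `|v| = `|v 0 k|.
Proof.
have [v0|v0] := eqVneq (mx_norm v) 0; first by left; exact: mx_norm_eq0.
by have [[i k] /= h] := mx_norm_neq0 v0; right; exists k; rewrite [LHS]h ord1.
Qed.

Lemma pairing_le (R : realType) (n : nat) (p v : 'rV[R]_n) : `|pairing p v| <= n%:R * `|p| * `|v|.
Proof.
apply: (le_trans (ler_norm_sum _ _ _)).
rewrite -mulrA -[n in n%:R]card_ord -sum1_card natr_sum mulr_suml ler_sum // => k _.
by rewrite mul1r normrM ler_pM // norm_entry.
Qed.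

Lemma norm_sq_le (R : realType) (n : nat) (v : 'rV[R]_n) : `|v| ^+ 2 <= pairing v v.
Proof.
have p0 (k : 'I_n) : 0 <= v 0 k * v 0 k by rewrite -expr2 sqr_ge0.
have [->|[k ->]] := norm_attained v.
  by rewrite normr0 expr0n pairing0l.
rewrite /pairing (bigD1 k) //= real_normK ?num_real // expr2 lerDl.
by apply: sumr_ge0.
Qed.

(** * Real-variable tools: small parameters, continuous induction, Dini derivatives *)

Lemma le0_sq_bound (R : realType) (x c : R) :
  (forall e, 0 < e -> e <= 1 -> x * e <= c * e ^+ 2) -> x <= 0.
Proof.
move=> h; rewrite leNgt; apply/negP => x0.
have d0 : 0 < 2 * (`|c| + 1 + x) by have := normr_ge0 c; lra.
pose e := x / (2 * (`|c| + 1 + x)).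
have ex : x = e * (2 * (`|c| + 1 + x)) by rewrite /e; field; rewrite gt_eqF // in d0 *; have := normr_ge0 c; lra.
have e0 : 0 < e by apply: divr_gt0.
have e1 : e <= 1 by rewrite /e ler_pdivrMr // mul1r; have := normr_ge0 c; lra.
have := h _ e0 e1; have := ler_norm c; move: e0 e1 ex x0 (normr_ge0 c).
clear; move: e => e; move: `|c| => d; nra.
Qed.

Lemma young (R : realType) (a x y : R) : 0 < a -> x * y <= a * y ^+ 2 + x ^+ 2 / (4 * a).
Proof.
move=> a0; rewrite -subr_ge0.
have -> : a * y ^+ 2 + x ^+ 2 / (4 * a) - x * y = (2 * a * y - x) ^+ 2 / (4 * a).
  by field; rewrite gt_eqF.
by apply: divr_ge0; [exact: sqr_ge0|lra].
Qed.

Lemma eps_le (R : realType) (x y : R) : (forall e, 0 < e -> x <= y + e) -> x <= y.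
Proof. by move=> h; apply/ler_addgt0Pr => e /h. Qed.

Lemma eps_mul_le (R : realType) (x y c : R) :
  (forall e, 0 < e -> x <= y + c * e) -> x <= y.
Proof.
move=> h; apply: eps_le => e e0.
have c0 : 0 < `|c| + 1 by have := normr_ge0 c; lra.
have := h (e / (`|c| + 1)) (divr_gt0 e0 c0).
move=> /le_trans; apply; rewrite lerD2l mulrCA ler_piMr ?(ltW e0) //.
by rewrite ler_pdivrMr // mul1r; have := ler_norm c; lra.
Qed.

(** A connectedness argument instead of a finite subcover: the supremum of the points reachable from
    [a] is reachable and cannot lie below [b]. The local hypothesis concerns intervals that straddle
    [s0], so it serves both to reach the supremum from the left and to pass beyond it. *)
Lemma itv_glue (R : realType) (P : R -> R -> Prop) (a b : R) :
  (forall x y z, a <= x -> x <= y -> y <= z -> z <= b -> P x y -> P y z -> P x z) ->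
  (forall s0, a <= s0 <= b -> exists2 rho : R, 0 < rho &
     forall s1 s2, a <= s1 -> s1 <= s0 -> s0 <= s2 -> s2 <= b ->
       s0 - rho < s1 -> s2 < s0 + rho -> P s1 s2) ->
  a <= b -> P a b.
Proof.
move=> cat loc ab.
pose S := [set x | a <= x <= b /\ P a x].
have Sa : S a.
  split; first by rewrite lexx ab.
  have [rho r0 h] := loc a (introT andP (conj (lexx a) ab)).
  by apply: h => //; lra.
have Sub : ubound S b by move=> x [/andP[]].
have hs : has_sup S by split; [exists a|exists b].
pose s := sup S.
have as_ : a <= s by apply: ub_le_sup => //; exists b.
have sb : s <= b by apply: ge_sup => //; exists a.
have [rho r0 hr] := loc s (introT andP (conj as_ sb)).
have [x Sx xs] := sup_adherent r0 hs.
have xs' : x <= s by apply: ub_le_sup => //; exists b.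
have [/andP[ax xb] Pax] := Sx.
pose y := Num.min b (s + rho / 2).
have sy : s <= y by rewrite le_min sb /=; lra.
have yb : y <= b by rewrite ge_min lexx.
have yr : y <= s + rho / 2 by rewrite ge_min lexx orbT.
have Pxy : P x y by apply: hr => //; lra.
have Pay : P a y by apply: (cat a x y) => //; lra.
have Sy : S y by split=> //; rewrite (le_trans as_ sy) yb.
have ys : y <= s by apply: ub_le_sup => //; exists b.
suff eb : b = y by rewrite eb.
apply/eqP; rewrite eq_le yb andbT leNgt; apply/negP => yb'.
have : y = s + rho / 2.
  by rewrite /y /Num.min; case: ltP => // h; move: yb'; rewrite /y /Num.min ltNge h lexx.
lra.
Qed.

(** Only the upper right Dini derivative is controlled, which is all that a subsolution offers along
    a line. The good set [S] is an initial interval; continuity puts its supremum in it, and the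
    Dini bound pushes past the supremum. *)
Lemma right_dini_le (R : realType) (f : R -> R) (k a b : R) :
  a <= b ->
  (forall s e, a <= s <= b -> 0 < e -> exists2 rho : R, 0 < rho &
     forall s', a <= s' <= b -> `|s' - s| < rho -> `|f s' - f s| <= e) ->
  (forall s e, a <= s < b -> 0 < e -> exists2 rho : R, 0 < rho &
     forall h, 0 < h < rho -> f (s + h) - f s <= h * (k + e)) ->
  f b - f a <= k * (b - a).
Proof.
move=> ab cf df; apply: (@eps_mul_le _ _ _ (b - a)) => e e0.
rewrite -mulrC -mulrDr.
pose S := [set x | a <= x <= b /\ forall y, a <= y <= x -> f y - f a <= (y - a) * (k + e)].
have Sa : S a.
  split; first by rewrite lexx ab.
  move=> y /andP[h1 h2]; have -> : y = a by lra.
  by rewrite !subrr mul0r lexx.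
have hs : has_sup S by split; [exists a|exists b => x [/andP[]]].
pose s := sup S.
have us x : S x -> x <= s by move=> Sx; apply: ub_le_sup => //; exists b => z [/andP[]].
have as_ : a <= s by exact: us.
have sb : s <= b by apply: ge_sup; [exists a|move=> x [/andP[]]].
have below y : a <= y < s -> f y - f a <= (y - a) * (k + e).
  move=> /andP[ay ys].
  have ys0 : 0 < s - y by lra.
  have [x [_ Sx] xs] := sup_adherent ys0 hs.
  by apply: Sx; rewrite ay /=; move: xs; rewrite -/s; lra.
have ats : f s - f a <= (s - a) * (k + e).
  have [->|as'] := eqVneq s a; first by rewrite !subrr mul0r lexx.
  have as2 : a < s by rewrite lt_neqAle eq_sym as' as_.
  apply: (@eps_mul_le _ _ _ (1 + `|k + e|)) => e' e'0.
  have [rho r0 hr] := cf s e' (introT andP (conj as_ sb)) e'0.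
  pose m := Num.min e' (Num.min (rho / 2) (s - a)).
  have m0 : 0 < m by rewrite !lt_min e'0 /=; apply/andP; split; lra.
  have m1 : m <= e' by rewrite ge_min lexx.
  have m2 : m <= rho / 2 by rewrite !ge_min lexx !orbT.
  have m3 : m <= s - a by rewrite !ge_min lexx !orbT.
  have h1 := below (s - m); have h2 := hr (s - m).
  have {h1} : f (s - m) - f a <= (s - m - a) * (k + e) by apply: h1; lra.
  have {h2} : `|f (s - m) - f s| <= e'.
    by apply: h2; [lra|rewrite ltr_norml; lra].
  rewrite ler_norml => /andP[h2 h2'] h1.
  have : - (m * (k + e)) <= e' * `|k + e|.
    rewrite -mulrN; apply: (@le_trans _ _ (m * `|k + e|)).
      by rewrite ler_pM2l // ler_normr lexx orbT.
    by rewrite ler_wpM2r.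
  by move: h1 h2 h2'; move: (`|k + e|) => c; clear; intros; nra.
suff eb : b = s by rewrite eb.
apply/eqP; rewrite eq_le sb andbT leNgt; apply/negP => sltb.
have [rho r0 hr] := df s e (introT andP (conj as_ sltb)) e0.
pose y := Num.min b (s + rho / 2).
have sy : s < y by rewrite lt_min sltb /=; lra.
have yb : y <= b by rewrite ge_min lexx.
have yr : y <= s + rho / 2 by rewrite ge_min lexx orbT.
suff Sy : S y by have := us _ Sy; lra.
split; first by rewrite yb (le_trans as_ (ltW sy)).
move=> w /andP[aw wy].
have [ws|sw] := ltP w s; first by apply: below; rewrite aw.
have [->//|ws'] := eqVneq w s.
have sw' : s < w by rewrite lt_neqAle eq_sym ws' sw.
have := hr (w - s); rewrite (addrC s) subrK => hw.
have {}hw : f w - f s <= (w - s) * (k + e) by apply: hw; lra.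
by move: hw ats; clear; intros; lra.
Qed.

Lemma lip_continuous (R : realType) (V W : normedModType R) (f : V -> W) (C : R) :
  (forall x y, `|f x - f y| <= C * `|x - y|) -> continuous f.
Proof.
move=> h x; apply/cvgrPdist_le => e e0.
have C0 : 0 < `|C| + 1 by have := normr_ge0 C; lra.
apply/nbhs_ballP; exists (e / (`|C| + 1)); first exact: divr_gt0.
move=> y; rewrite -ball_normE /= ltr_pdivlMr // => xy.
apply: (le_trans (h x y)); apply: le_trans (ltW xy).
rewrite mulrC ler_wpM2l //; have := ler_norm C; clra.
Qed.

Lemma pairing_continuousl (R : realType) (n : nat) (v : 'rV[R]_n) : continuous (fun p : 'rV[R]_n => pairing p v).
Proof.
apply: (@lip_continuous _ _ R^o _ (n%:R * `|v|)) => p p'.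
by rewrite -pairingBl mulrAC; apply: pairing_le.
Qed.

Lemma eps_continuous (R : realType) (V W : normedModType R) (f : V -> W) x :
  (forall e, 0 < e -> exists2 d : R, 0 < d & forall y, `|y - x| < d -> `|f y - f x| <= e) <->
  {for x, continuous f}.
Proof.
split.
  move=> h; apply/cvgrPdist_le => e /h[d d0 hd]; apply/nbhs_ballP; exists d => //.
  by move=> y; rewrite -ball_normE /= distrC => /hd; rewrite distrC.
move=> h e e0; move: h => /cvgrPdist_le/(_ _ e0)/nbhs_ballP[d d0 hd].
exists d => // y yx; rewrite distrC; apply: hd.
by rewrite -ball_normE /= distrC.
Qed.

Lemma continuous_sub_fun (R : realType) (V : normedModType R) (f g : V -> R) :
  continuous f -> continuous g -> continuous (fun x => f x - g x).
Proof. by move=> cf cg x; have := @continuousB R R^o V f g x (cf x) (cg x). Qed.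

(** * Legendre transform *)

Definition lag (R : realType) (n : nat) (T : Type) (F : T -> 'rV[R]_n -> R) (y : T) (v : 'rV[R]_n) : R :=
  sup (range (fun p => pairing p v - F y p)).

(* A Hamiltonian in coordinates near [z], with gradients [Fx] and [Fp]; only
   these bounds, uniform for [p] bounded, are used of its C^2 regularity. *)
Record hamloc (R : realType) (n : nat) (F : 'rV[R]_n -> 'rV[R]_n -> R) (Fx Fp : 'rV[R]_n -> 'rV[R]_n -> 'rV[R]_n) (z : 'rV[R]_n) (r : R)
    : Prop := Hamloc {
  hl_reg : forall P, exists2 C : R, 0 < C & forall y y' p p',
    `|y - z| <= r -> `|y' - z| <= r -> `|p| <= P -> `|p'| <= P ->
    [/\ `|F y' p' - F y p - pairing (Fx y p) (y' - y) - pairing (Fp y p) (p' - p)|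
          <= C * (`|y' - y| ^+ 2 + `|p' - p| ^+ 2),
        `|Fx y p| <= C, `|Fp y p| <= C, `|F y p| <= C
      & `|Fp y' p - Fp y p| <= C * `|y' - y|] ;
  hl_convex : forall P, exists2 a : R, 0 < a & forall y p p',
    `|y - z| <= r -> `|p| <= P -> `|p'| <= P ->
    F y p + pairing (Fp y p) (p' - p) + a * `|p' - p| ^+ 2 <= F y p' ;
  hl_coercive : forall K, exists C : R, forall y p, `|y - z| <= r -> K * `|p| - C <= F y p
}.

Lemma hamloc_sub (R : realType) (n : nat) (F : 'rV[R]_n -> 'rV[R]_n -> R) Fx Fp (z z' : 'rV[R]_n) (r r' : R) :
  hamloc F Fx Fp z r -> `|z' - z| + r' <= r -> hamloc F Fx Fp z' r'.
Proof.
move=> [h1 h2 h3] zr.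
have b y : `|y - z'| <= r' -> `|y - z| <= r.
  by move=> h; have := ler_distD z' y z; move: h zr; clra.
split.
- move=> P; have [C C0 h] := h1 P; exists C => // y y' p p' /b ? /b ?; exact: h.
- move=> P; have [C C0 h] := h2 P; exists C => // y p p' /b ?; exact: h.
- move=> K; have [C h] := h3 K; exists C => // y p /b ?; exact: h.
Qed.

Lemma hamloc_global_convex (R : realType) (n : nat) (F : 'rV[R]_n -> 'rV[R]_n -> R) Fx Fp (z : 'rV[R]_n) (r : R) y p p' :
  hamloc F Fx Fp z r -> `|y - z| <= r -> F y p + pairing (Fp y p) (p' - p) <= F y p'.
Proof.
move=> hF yr; have [a a0 h] := hl_convex hF (`|p| + `|p'|).
have := h y p p' yr (ler_wpDr (normr_ge0 p') (lexx `|p|)) (ler_wpDl (normr_ge0 p) (lexx `|p'|)).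
by have : 0 <= a * `|p' - p| ^+ 2 by [apply: mulr_ge0; [exact: ltW|exact: sqr_ge0]]; clra.
Qed.

Lemma has_sup_lag (R : realType) (n : nat) (F : 'rV[R]_n -> 'rV[R]_n -> R) Fx Fp (z : 'rV[R]_n) (r : R) y v :
  hamloc F Fx Fp z r -> `|y - z| <= r -> has_sup (range (fun p => pairing p v - F y p)).
Proof.
move=> hF yr; split; first by exists (pairing 0 v - F y 0); exists 0.
have [C h] := hl_coercive hF (n%:R * `|v|).
exists C => _ [p _ <-]; have := h y p yr; have := pairing_le p v.
by rewrite ler_norml mulrAC => /andP[_]; clra.
Qed.

Lemma lag_ge (R : realType) (n : nat) (F : 'rV[R]_n -> 'rV[R]_n -> R) Fx Fp (z : 'rV[R]_n) (r : R) y v p :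
  hamloc F Fx Fp z r -> `|y - z| <= r -> pairing p v - F y p <= lag F y v.
Proof.
move=> hF yr; apply: ub_le_sup; last by exists p.
exact: (has_sup_lag v hF yr).2.
Qed.

Lemma lag_argmax (R : realType) (n : nat) (F : 'rV[R]_n -> 'rV[R]_n -> R) Fx Fp (z : 'rV[R]_n) (r : R) y p :
  hamloc F Fx Fp z r -> `|y - z| <= r ->
  lag F y (Fp y p) = pairing p (Fp y p) - F y p.
Proof.
move=> hF yr; apply/eqP; rewrite eq_le (lag_ge _ _ hF yr) andbT.
apply: ge_sup; first by exists (pairing 0 (Fp y p) - F y 0); exists 0.
move=> _ [p' _ <-]; have := hamloc_global_convex p p' hF yr.
by rewrite pairingBr ![pairing (Fp y p) _]pairingC; clra.
Qed.

Lemma closed_ball_compact (R : realType) (n : nat) (z : 'rV[R]_n) (r : R) : compact [set p | `|p - z| <= r].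
Proof.
apply: bounded_closed_compact.
  exists (`|z| + r); split; first exact: num_real.
  move=> x hx p /= hp; apply: ltW; apply: le_lt_trans hx.
  by rewrite -[p](subrK z) addrC (le_trans (ler_normD _ _)) // lerD2l.
have := @closed_closed_ball_ R _ z r; congr closed; apply/seteqP.
by split=> p /=; rewrite /closed_ball_ /= distrC.
Qed.

Lemma hamloc_bound (R : realType) (n : nat) (F : 'rV[R]_n -> 'rV[R]_n -> R) Fx Fp (z : 'rV[R]_n) (r P : R) :
  hamloc F Fx Fp z r -> exists2 C : R, 0 < C & forall y p,
  `|y - z| <= r -> `|p| <= P -> [/\ `|Fx y p| <= C, `|Fp y p| <= C & `|F y p| <= C].
Proof.
move=> hF; have [C C0 h] := hl_reg hF P; exists C => // y p yr pP.
by have [] := h y y p p yr yr pP pP.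
Qed.

Lemma hamloc_continuous (R : realType) (n : nat) (F : 'rV[R]_n -> 'rV[R]_n -> R) Fx Fp (z : 'rV[R]_n) (r : R) y :
  hamloc F Fx Fp z r -> `|y - z| <= r -> continuous (F y).
Proof.
move=> hF yr p; have [C C0 h] := hl_reg hF (`|p| + 1).
apply/eps_continuous => e e0.
have K0 : 0 < (n%:R + 1) * C by apply: mulr_gt0 => //; have := ler0n R n; lra.
pose d := Num.min 1 (e / ((n%:R + 1) * C)).
have d0 : 0 < d by rewrite lt_min ltr01 /= divr_gt0.
exists d => // p' pp'.
have d1 : d <= 1 by rewrite ge_min lexx.
have d2 : ((n%:R + 1) * C) * d <= e.
  by rewrite mulrC -ler_pdivlMr // ge_min lexx orbT.
have pP : `|p| <= `|p| + 1 by clra.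
have pP' : `|p'| <= `|p| + 1.
  by have := ler_normD (p' - p) p; rewrite subrK; move: pp' d1; clra.
have [] := h y y p p' yr yr pP pP'; rewrite subrr normr0 pairing0r expr0n /= add0r subr0.
move=> h1 _ h2 _ _; have h3 := pairing_le (Fp y p) (p' - p).
rewrite -[_ - _](subrK (pairing (Fp y p) (p' - p))).
apply: (le_trans (ler_normD _ _)).
apply: le_trans d2; apply: (le_trans (lerD h1 h3)).
move: h2 pp' d1 C0 d0 (ler0n R n) (normr_ge0 (p' - p)) (normr_ge0 (Fp y p)).
clear; move: d => d; move: n%:R `|Fp y p| `|p' - p| => m A b.
move=> AC bd d1 C0 d0 m0 b0 A0.
have : b ^+ 2 <= b by rewrite expr2; nra.
have : m * A * b <= m * C * b by rewrite ler_wpM2r // ler_wpM2l.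
have : (m + 1) * C * b <= (m + 1) * C * d.
  by rewrite ler_wpM2l ?(ltW bd) //; apply: mulr_ge0; lra.
nra.
Qed.

(* The Legendre transform is onto: coercivity confines the maximum of
   [p.v - F y p] to a ball, and the gradient vanishes at the maximum. *)
Lemma hamloc_argmax (R : realType) (n : nat) (F : 'rV[R]_n -> 'rV[R]_n -> R) Fx Fp (z : 'rV[R]_n) (r V : R) :
  hamloc F Fx Fp z r -> exists2 P : R, 0 < P & forall y v,
  `|y - z| <= r -> `|v| <= V -> exists2 p, `|p| <= P & v = Fp y p.
Proof.
move=> hF.
have [C0 C00 h0] := hamloc_bound 0 hF.
have [C h] := hl_coercive hF (n%:R * V + 1).
have P0 : 0 < `|C| + C0 + 1 by have := normr_ge0 C; lra.
exists (`|C| + C0 + 1) => // y v yr vV.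
have ne : [set p : 'rV[R]_n | `|p - 0| <= `|C| + C0 + 1] !=set0.
  by exists 0; rewrite /= subrr normr0 ltW.
have cF : {within [set p : 'rV[R]_n | `|p - 0| <= `|C| + C0 + 1],
    continuous (fun p => F y p - pairing p v)}.
  apply: continuous_subspaceT; apply: continuous_sub_fun.
    exact: (hamloc_continuous hF yr).
  exact: pairing_continuousl.
have [p] := EVT_min_rV ne (@closed_ball_compact R n 0 _) cF.
rewrite inE /= subr0 => pP pmax; exists p => //.
have {}pmax p' : F y p - pairing p v <= F y p' - pairing p' v.
  have [p'P|p'P] := leP `|p'| (`|C| + C0 + 1).
    by apply: pmax; rewrite inE /= subr0.
  have n0 : `|0 : 'rV[R]_n| <= 0 by rewrite normr0.
  have [_ _] := h0 y 0 yr n0; rewrite ler_norml => /andP[_ F0].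
  have := pmax 0; rewrite inE /= subrr normr0 pairing0l subr0 => /(_ (ltW P0)) h1.
  apply: (le_trans h1); apply: (le_trans F0).
  have := h y p' yr; have := pairing_le p' v; rewrite ler_norml => /andP[_ h2] h3.
  have h4 : n%:R * `|p'| * `|v| <= n%:R * V * `|p'|.
    by rewrite mulrAC ler_wpM2r // ler_wpM2l.
  move: h2 h3 h4 p'P (ler_norm C) C00; rewrite mulrDl mul1r; clra.
suff : `|v - Fp y p| ^+ 2 <= 0.
  move=> h1; apply/eqP; rewrite -subr_eq0 -normr_eq0 -sqrf_eq0.
  by rewrite eq_le h1 sqr_ge0.
move ed : (v - Fp y p) => d; apply: le_trans (norm_sq_le d) _.
have [D D0 hD] := hl_reg hF (`|p| + `|d|).
apply: (@le0_sq_bound _ _ (D * `|d| ^+ 2)) => e e0 e1.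
have b1 : `|p| <= `|p| + `|d| by rewrite lerDl.
have b2 : `|p + e *: d| <= `|p| + `|d|.
  apply: (le_trans (ler_normD _ _)); rewrite lerD2l normrZ gtr0_norm //.
  by rewrite ler_piMl.
have [h1 _ _ _ _] := hD y y p (p + e *: d) yr yr b1 b2.
move: h1; rewrite subrr normr0 pairing0r expr0n /= add0r subr0 [p + _]addrC addrK.
rewrite ler_norml => /andP[_ h1]; have h2 := pmax (e *: d + p).
move: h1 h2; rewrite !pairingDl !pairingZl !pairingZr normrZ gtr0_norm // exprMn.
have -> : pairing d d = pairing d v - pairing (Fp y p) d.
  by rewrite [pairing (Fp _ _) _]pairingC -pairingBr ed.
rewrite [pairing d v]pairingC [pairing (Fp _ _) _]pairingC; clra.
Qed.

(** At (y, Fp y P) the Lagrangian has v-derivative P and y-derivative - Fx y P. Parametrizing by the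
    momentum P spares any differentiation of the Legendre transform: the value at (y', v') is
    attained at some P', and strict convexity of F absorbs the terms in P' - P. *)
Lemma lag_expand_le (R : realType) (n : nat) (F : 'rV[R]_n -> 'rV[R]_n -> R) Fx Fp (z : 'rV[R]_n) (r V B : R) :
  hamloc F Fx Fp z r -> exists2 C : R, 0 < C & forall y y' P v',
  `|y - z| <= r -> `|y' - z| <= r -> `|P| <= B -> `|v'| <= V ->
  lag F y' v' <= lag F y (Fp y P) + pairing P (v' - Fp y P) - pairing (Fx y P) (y' - y)
    + C * (`|y' - y| ^+ 2 + `|v' - Fp y P| ^+ 2).
Proof.
move=> hF; have [B' B'0 hB'] := hamloc_argmax V hF.
pose BB := Num.max B B'.
have [C C0 hC] := hl_reg hF BB.
have [a a0 ha] := hl_convex hF BB.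
have m0 := ler0n R n; set m := n%:R in m0.
have D0 : 0 <= m ^+ 2 * (1 + C ^+ 2) / a.
  by apply: divr_ge0; [apply: mulr_ge0; rewrite ?addr_ge0 ?sqr_ge0|exact: ltW].
exists (C + m ^+ 2 * (1 + C ^+ 2) / a); first by move: C0 D0; clra.
move=> y y' P v' yr y'r PB v'V.
have [P' P'B v'E] := hB' y' v' y'r v'V.
have {}PB : `|P| <= BB by rewrite le_max PB.
have {}P'B : `|P'| <= BB by rewrite le_max P'B orbT.
rewrite [in lag F y' v']v'E (lag_argmax _ hF y'r) -v'E (lag_argmax _ hF yr).
set v := Fp y P; set dv := v' - v; set dy := y' - y.
have h1 := ha y' P P' y'r PB P'B.
have [h2 _ _ _ _] := hC y y' P P yr y'r PB PB.
have [_ _ _ _ h3] := hC y y' P P yr y'r PB PB.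
move: h2; rewrite subrr pairing0r normr0 expr0n /= addr0 subr0 ler_norml => /andP[h2 _].
have h4 : pairing v (P' - P) - pairing (Fp y' P) (P' - P) <= m * C * `|dy| * `|P' - P|.
  rewrite -pairingBl; have := pairing_le (v - Fp y' P) (P' - P).
  rewrite ler_norml => /andP[_ /le_trans]; apply.
  by rewrite ler_wpM2r // -mulrA ler_wpM2l // distrC.
have h5 : pairing dv (P' - P) <= m * `|dv| * `|P' - P|.
  by have := pairing_le dv (P' - P); rewrite ler_norml => /andP[_].
have h6 : pairing P' v' = pairing P v + pairing P dv + pairing v (P' - P) + pairing dv (P' - P).
  rewrite -addrA -pairingDl -pairingDr /dv addrC [v + _]addrC subrK.
  by rewrite [pairing v' _]pairingC -pairingDl subrK.
(* Young's inequality with the convexity constant [a] as weight, so that a |P' - P|^2 cancels. *)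
have h7 := @young R a (m * (`|dv| + C * `|dy|)) `|P' - P| a0.
have h8 : (m * (`|dv| + C * `|dy|)) ^+ 2 / (4 * a) <=
    m ^+ 2 * (1 + C ^+ 2) / a * (`|dy| ^+ 2 + `|dv| ^+ 2).
  rewrite ler_pdivrMr; last by move: a0; clra.
  have -> : m ^+ 2 * (1 + C ^+ 2) / a * (`|dy| ^+ 2 + `|dv| ^+ 2) * (4 * a) =
     m ^+ 2 * ((1 + C ^+ 2) * (`|dy| ^+ 2 + `|dv| ^+ 2) * 4).
    by field; rewrite gt_eqF.
  rewrite exprMn; apply: ler_wpM2l; first exact: sqr_ge0.
  move: C0 (normr_ge0 dv) (normr_ge0 dy).
  clear; move: `|dv| `|dy| => x w C0 x0 w0.
  have := sqr_ge0 (x - C * w); have := sqr_ge0 (C * x); have := sqr_ge0 x.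
  have := sqr_ge0 w; have := sqr_ge0 (C * w); rewrite !expr2; lra.
move: (m ^+ 2 * (1 + C ^+ 2) / a) h8 => D h8.
have h9 : 0 <= C * `|dv| ^+ 2 by rewrite mulr_ge0 ?sqr_ge0 // ltW.
move: h1 h2 h4 h5 h6 h9 (le_trans h7 (lerD (lexx _) h8)); rewrite -/v -/dy.
clra.
Qed.

(** Testing the supremum at (y', v') with the momentum P + e dv, where dv = v' - Fp y P, gains e
    |dv|^2 and loses C e^2 |dv|^2; a small e leaves a strictly convex lower bound. *)
Lemma lag_expand_ge (R : realType) (n : nat) (F : 'rV[R]_n -> 'rV[R]_n -> R) Fx Fp (z : 'rV[R]_n) (r V B : R) :
  0 <= V -> hamloc F Fx Fp z r -> exists C : R, exists2 c : R, 0 < c & 0 < C /\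
  forall y y' P v', `|y - z| <= r -> `|y' - z| <= r -> `|P| <= B -> `|v'| <= V ->
  lag F y (Fp y P) + pairing P (v' - Fp y P) - pairing (Fx y P) (y' - y)
    + c * `|v' - Fp y P| ^+ 2 - C * `|y' - y| ^+ 2 <= lag F y' v'.
Proof.
move=> V0 hF; have [C0 C00 hC0] := hamloc_bound B hF.
have [C Cp hC] := hl_reg hF (B + (V + C0)).
(* This gives C e <= 1/2, so that half of the gain survives, and e <= 1, which keeps the tested
   momentum in the ball where C is valid. *)
pose e := (2 * C + 1)^-1.
have e0 : 0 < e by rewrite invr_gt0; move: Cp; clra.
have eC : e * (2 * C + 1) = 1 by rewrite mulVf // gt_eqF //; move: Cp; clra.
have e1 : e <= 1 by rewrite invf_le1; move: Cp; clra.
exists C; exists (e / 2); first by move: e0; clra.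
split=> // y y' P v' yr y'r PB v'V.
have [_ vC _] := hC0 y P yr PB.
rewrite (lag_argmax _ hF yr).
move: vC; set v := Fp y P; set dv := v' - v; set dy := y' - y => vC.
have dvB : `|dv| <= V + C0 by apply: (le_trans (ler_normB _ _)); apply: lerD.
have PB1 : `|P| <= B + (V + C0) by move: PB V0 C00; clra.
have PB2 : `|P + e *: dv| <= B + (V + C0).
  apply: (le_trans (ler_normD _ _)); apply: lerD => //.
  rewrite normrZ gtr0_norm //; apply: le_trans dvB.
  by rewrite ler_piMl.
have [h1 _ _ _ _] := hC y y' P (P + e *: dv) yr y'r PB1 PB2.
have h2 := lag_ge v' (P + e *: dv) hF y'r.
have h3 : pairing dv v' = pairing dv dv + pairing v dv.
  by rewrite [pairing v _]pairingC -pairingDr subrK.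
have h4 : pairing P v' = pairing P v + pairing P dv by rewrite -pairingDr addrC subrK.
move: h1 h2; rewrite [P + _]addrC addrK -/v -/dy !pairingDl !pairingZl !pairingZr h3 h4.
rewrite normrZ gtr0_norm // exprMn ler_norml => /andP[_ h1] h2.
have h5 := norm_sq_le dv.
have h6 : e * `|dv| ^+ 2 <= e * pairing dv dv by rewrite ler_pM2l.
have h7 : C * (e ^+ 2 * `|dv| ^+ 2) <= e / 2 * `|dv| ^+ 2.
  rewrite mulrA ler_wpM2r ?sqr_ge0 //; move: eC e0 Cp; clear; move: e => e.
  by rewrite expr2 => *; nra.
move: h1 h2 h6 h7; rewrite !mulrDr; clra.
Qed.

Lemma lag_lip (R : realType) (n : nat) (F : 'rV[R]_n -> 'rV[R]_n -> R) Fx Fp (z : 'rV[R]_n) (r V : R) :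
  hamloc F Fx Fp z r -> exists2 C : R, 0 < C & forall y y' v v',
  `|y - z| <= r -> `|y' - z| <= r -> `|v| <= V -> `|v'| <= V ->
  lag F y' v' <= lag F y v + C * (`|y' - y| + `|v' - v|).
Proof.
move=> hF; have [B B0 hB] := hamloc_argmax V hF.
have [C C0 hC] := lag_expand_le V B hF.
have [D D0 hD] := hamloc_bound B hF.
have m0 := ler0n R n; set m := n%:R in m0.
have c0 : 0 <= m * (B + D) by apply: mulr_ge0 => //; move: B0 D0; clra.
exists (m * (B + D) + C * (2 * `|r| + 2 * `|V| + 1)) => [|y y' v v' yr y'r vV v'V].
  apply: ltr_wpDl => //; exact: mulr_gt0.
have [p pB ev] := hB y v yr vV; have [h1 _ _] := hD y p yr pB.
have h := hC y y' p v' yr y'r pB v'V; rewrite -ev in h; apply: (le_trans h).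
have h2 := pairing_le p (v' - v); have h3 := pairing_le (Fx y p) (y' - y).
move: h2 h3; rewrite !ler_norml => /andP[_ h2] /andP[h3 _].
have a1 : `|y' - y| <= 2 * `|r| + 2 * `|V| + 1.
  have := ler_distD z y' y; rewrite [`|z - y|]distrC; move: yr y'r (ler_norm r) (normr_ge0 V).
  by clra.
have a2 : `|v' - v| <= 2 * `|r| + 2 * `|V| + 1.
  have := ler_normB v' v; move: vV v'V (ler_norm V) (normr_ge0 r).
  by clra.
have b1 : C * (`|y' - y| ^+ 2 + `|v' - v| ^+ 2) <= C * (2 * `|r| + 2 * `|V| + 1) * (`|y' - y| + `|v' - v|).
  rewrite -mulrA ler_pM2l // mulrDr; apply: lerD; rewrite expr2; exact: ler_wpM2r.
have b2 : m * `|p| * `|v' - v| <= m * (B + D) * `|v' - v|.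
  by rewrite ler_wpM2r // ler_wpM2l //; move: pB D0; clra.
have b3 : m * `|Fx y p| * `|y' - y| <= m * (B + D) * `|y' - y|.
  by rewrite ler_wpM2r // ler_wpM2l //; move: h1 B0; clra.
rewrite (mulrDl _ _ (`|y' - y| + `|v' - v|)) (mulrDr (m * (B + D))).
move: h2 h3 b1 b2 b3; rewrite -/m; clra.
Qed.

(** * Local Lax-Oleinik semigroups *)

(* [W t x] satisfies, up to [O(s^2)], the dynamic programming principle of the
   Lax-Oleinik semigroup over a time step [s], with speeds bounded by [Rv]. *)
Record local_value (R : realType) (n : nat) (F : 'rV[R]_n -> 'rV[R]_n -> R) (N : 'rV[R]_n -> R) (W : R -> 'rV[R]_n -> R)
    (T : R) (z : 'rV[R]_n) (r Rv : R) : Prop := LocalValue {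
  lv_le : forall V : R, exists C s0 : R, [/\ 0 < C, 0 < s0 & forall t s x v,
    0 <= s -> s <= s0 -> s <= t -> t <= T -> `|x - z| <= r -> `|v| <= V ->
    W t x <= W (t - s) (x - s *: v) + s * lag F x v + C * s ^+ 2] ;
  lv_ge : exists C s0 : R, [/\ 0 < C, 0 < s0 & forall t s x,
    0 <= s -> s <= s0 -> s <= t -> t <= T -> `|x - z| <= r ->
    exists2 v, N v <= Rv & W (t - s) (x - s *: v) + s * lag F x v <= W t x + C * s ^+ 2]
}.

(** An error D s^2 per step adds up over m steps of length t / m to D t^2 / m: this is how discrete
    estimates become exact without solving a differential equation. [P tau e] stands for an estimate
    at time tau with accumulated error e. *)
Lemma euler_limit (R : realType) (P : R -> R -> Prop) (t D s0 : R) :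
  0 <= t -> 0 < s0 -> 0 < D -> P 0 0 ->
  (forall tau s e, 0 <= tau -> 0 < s -> s <= s0 -> tau + s <= t -> 0 <= e ->
     P tau e -> P (tau + s) (e + D * s ^+ 2)) ->
  forall eps, 0 < eps -> exists2 e, e <= eps & P t e.
Proof.
move=> t0 s00 D0 P0 step eps e0.
have [t1|tn] := leP t 0.
  by exists 0; [exact: ltW|have -> : t = 0 by apply/eqP; rewrite eq_le t1 t0].
(* Large enough to make the step t / m at most [s0] and the total error D t^2 / m at most [eps]. *)
pose m := (Num.truncn (t / s0 + D * t ^+ 2 / eps)).+1.
have a0 : 0 <= t / s0 by apply: divr_ge0; exact: ltW.
have b0 : 0 <= D * t ^+ 2 / eps.
  by apply: divr_ge0; [apply: mulr_ge0; [exact: ltW|exact: sqr_ge0]|exact: ltW].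
have mb : t / s0 + D * t ^+ 2 / eps < m%:R by apply: truncnS_gt.
have m0 : 0 < m%:R :> R by rewrite ltr0n.
pose s := t / m%:R.
have s_gt0 : 0 < s by apply: divr_gt0.
have s_le : s <= s0.
  rewrite /s ler_pdivrMr // mulrC -ler_pdivrMr //; apply: ltW.
  by move: mb b0; clra.
have st : m%:R * s = t by rewrite /s mulrCA divff ?mulr1 // gt_eqF.
have claim k : (k <= m)%N -> P (k%:R * s) (k%:R * (D * s ^+ 2)).
  elim: k => [|k IH] km; first by rewrite !mul0r.
  rewrite -addn1 natrD !mulrDl !mul1r; apply: step => //.
  - by apply: mulr_ge0; [exact: ler0n|exact: ltW].
  - have -> : k%:R * s + s = k.+1%:R * s by rewrite -natr1 mulrDl mul1r.
    by rewrite -st ler_pM2r // ler_nat.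
  - by apply: mulr_ge0; [exact: ler0n|apply: mulr_ge0; [exact: ltW|exact: sqr_ge0]].
  - exact/IH/ltnW.
have := claim m (leqnn m); rewrite st; exists (m%:R * (D * s ^+ 2)) => //.
have -> : m%:R * (D * s ^+ 2) = D * t ^+ 2 / m%:R by rewrite /s; field; rewrite gt_eqF.
rewrite ler_pdivrMr // [eps * _]mulrC -ler_pdivrMr //; apply: ltW.
by move: mb a0; clra.
Qed.

Definition sd (R : realType) (n : nat) (f : 'rV[R]_n -> R) (x h : 'rV[R]_n) : R := f (x + h) + f (x - h) - 2 * f x.

(** Midpoint form of semiconcavity, without any continuity; the condition on x and h keeps x - h, x
    and x + h in the ball. *)
Definition semiconcave (R : realType) (n : nat) (f : 'rV[R]_n -> R) (A : R) (z : 'rV[R]_n) (rho : R) : Prop :=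
  forall x h, `|x - z| + `|h| <= rho -> sd f x h <= A * `|h| ^+ 2.

Definition semiconvex (R : realType) (n : nat) (f : 'rV[R]_n -> R) (A : R) (z : 'rV[R]_n) (rho : R) : Prop :=
  forall x h, `|x - z| + `|h| <= rho -> - (A * `|h| ^+ 2) <= sd f x h.

Lemma near_center (R : realType) (n : nat) (x h z : 'rV[R]_n) (rho : R) :
  `|x - z| + `|h| <= rho -> [/\ `|x - z| <= rho, `|x + h - z| <= rho & `|x - h - z| <= rho].
Proof.
move=> b; have h0 := normr_ge0 h; split; first by move: b h0; clra.
  by rewrite addrAC; apply: le_trans b; apply: ler_normD.
by rewrite addrAC; apply: le_trans b; apply: ler_normB.
Qed.

Lemma moved_center (R : realType) (n : nat) (x v z : 'rV[R]_n) (s S c : R) :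
  0 <= s -> `|v| <= S -> `|x - z| <= c -> `|x - s *: v - z| <= c + S * s.
Proof.
move=> s0 vS xc; rewrite addrAC; apply: (le_trans (ler_normB _ _)).
by apply: lerD => //; rewrite normrZ ger0_norm // mulrC ler_wpM2r.
Qed.

(** The velocity that is optimal at x is used at x + h and x - h too, so the second difference is
    transported rigidly: each step adds s times the second difference of L in x, at most 2 C |h|^2
    s. *)
Lemma semiconcave_keep (R : realType) (n : nat) (F : 'rV[R]_n -> 'rV[R]_n -> R) Fx Fp (N : 'rV[R]_n -> R) W (T : R) z (r Rv S : R) :
  hamloc F Fx Fp z r -> local_value F N W T z r Rv ->
  0 <= S -> (forall v, N v <= Rv -> `|v| <= S) ->
  exists2 L : R, 0 < L & forall rho t A, 0 <= t -> t <= T -> rho + S * t <= r ->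
    semiconcave (W 0) A z (rho + S * t) -> semiconcave (W t) (A + L * t) z rho.
Proof.
move=> hF [lvle [C2 [s2 [C20 s20 h2]]]] S0 hN.
have [C1 [s1 [C10 s10 h1]]] := lvle S.
have [B B0 hB] := hamloc_argmax S hF.
have [C C0 hC] := lag_expand_le S B hF.
exists (2 * C) => [|rho t A t0 tT rt sc0]; first by move: C0; clra.
(* The ball shrinks at speed S as tau grows, since one step back moves the centre by at most S s. *)
pose P tau e := forall x h, `|x - z| + `|h| <= rho + S * (t - tau) ->
  sd (W tau) x h <= (A + 2 * C * tau) * `|h| ^+ 2 + e.
suff lim : forall eps, 0 < eps -> exists2 e, e <= eps & P t e.
  move=> x h xh; apply: eps_le => eps /lim[e ee /(_ x h)].
  by rewrite subrr mulr0 addr0 => /(_ xh) => H; move: H ee; clra.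
apply: (@euler_limit R P t (2 * (C1 + C2)) (Num.min s1 s2) t0).
- by rewrite lt_min s10.
- by move: C10 C20; clra.
- by move=> x h; rewrite subr0 mulr0 !addr0; exact: sc0.
move=> tau s e tau0 s0; rewrite le_min => /andP[ss1 ss2] tst e0 IH x h xh.
have {}s0 := ltW s0.
have str : rho + S * (t - (tau + s)) <= r.
  apply: le_trans rt; rewrite lerD2l ler_wpM2l //; move: tau0 s0; clra.
have [xr xpr xmr] := near_center (le_trans xh str).
have sts : s <= tau + s by move: tau0; clra.
have tsT := le_trans tst tT.
have [v Nv] := h2 _ s x s0 ss2 sts tsT xr.
have vS := hN v Nv.
have := h1 _ s (x + h) v s0 ss1 sts tsT xpr vS.
have := h1 _ s (x - h) v s0 ss1 sts tsT xmr vS.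
rewrite !addrK [x + h - s *: v]addrAC [x - h - s *: v]addrAC => i1 i2 i3.
have := IH (x - s *: v) h; rewrite -addrA.
have xsh : `|x - s *: v - z| + `|h| <= rho + S * (t - tau).
  have := @moved_center R n x v z s S `|x - z| s0 vS (lexx _).
  by move: xh; rewrite opprD !mulrDr !mulrN; clra.
rewrite addrA => /(_ xsh); rewrite /sd => i4.
have [p pB ev] := hB x v xr vS.
have := hC x (x + h) p v xr xpr pB vS; have := hC x (x - h) p v xr xmr pB vS.
rewrite -ev subrr pairing0r normr0 expr0n /= addr0 [x + h - x]addrC [x - h - x]addrC !addKr.
rewrite pairingNr normrN addr0 => i5 i6.
have i7 : s * lag F (x + h) v + s * lag F (x - h) v <= 2 * (s * lag F x v) + 2 * C * s * `|h| ^+ 2.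
  have : s * (lag F (x + h) v + lag F (x - h) v) <= s * (2 * lag F x v + 2 * C * `|h| ^+ 2).
    by rewrite ler_wpM2l //; move: i5 i6; clra.
  by rewrite !mulrDr; clra.
move: i1 i2 i3 i4 i7; rewrite !mulrDr !mulrDl; clra.
Qed.

(* The displacement [h] is rescaled linearly in time, so that it vanishes at
   time 0 and no regularity of [W 0] is needed. *)
Lemma semiconcave_gain (R : realType) (n : nat) (F : 'rV[R]_n -> 'rV[R]_n -> R) Fx Fp (N : 'rV[R]_n -> R) W (T : R) z (r Rv S : R) :
  hamloc F Fx Fp z r -> local_value F N W T z r Rv ->
  0 <= S -> (forall v, N v <= Rv -> `|v| <= S) ->
  forall rho t, 0 < t -> t <= T -> 0 <= rho -> rho + S * t <= r ->
  exists2 A : R, 0 < A & semiconcave (W t) A z rho.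
Proof.
move=> hF [lvle [C2 [s2 [C20 s20 h2]]]] S0 hN rho t t0 tT rho0 rt.
have St0 : 0 <= S * t by rewrite mulr_ge0 // ltW.
have r0 : 0 <= r by move: St0 rho0 rt; clra.
(* Bounds the competing velocities v + h / t and v - h / t, because |h| <= r. *)
pose V := S + r / t.
have rt0 : 0 <= r / t by rewrite divr_ge0 // ltW.
have SV : S <= V by rewrite /V; move: rt0; clra.
have [C1 [s1 [C10 s10 h1]]] := lvle V.
have [B B0 hB] := hamloc_argmax V hF.
have [C C0 hC] := lag_expand_le V B hF.
(* From C (|d|^2 + |k|^2) with |d| <= |h| and |k| = |h| / t, once for each sign of the
   displacement. *)
pose K := 2 * C * (1 + t^-1 ^+ 2).
have K0 : 0 < K.
  by apply: mulr_gt0; [move: C0; clra|have := sqr_ge0 (t^-1); clra].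
exists (K * t); first exact: mulr_gt0.
pose P tau e := forall x h, `|x - z| + `|h| <= rho + S * (t - tau) ->
  sd (W tau) x ((tau / t) *: h) <= K * tau * `|h| ^+ 2 + e.
suff lim : forall eps, 0 < eps -> exists2 e, e <= eps & P t e.
  move=> x h xh; apply: eps_le => eps /lim[e ee /(_ x h)].
  rewrite subrr mulr0 addr0 divff ?gt_eqF // scale1r => /(_ xh) => H; move: H ee; clra.
apply: (@euler_limit R P t (2 * (C1 + C2)) (Num.min s1 s2) (ltW t0)).
- by rewrite lt_min s10.
- by move: C10 C20; clra.
- by move=> x h _; rewrite /sd mul0r scale0r subr0 addr0 mulr0 mul0r addr0; clra.
move=> tau s e tau0 s0; rewrite le_min => /andP[ss1 ss2] tst e0 IH x h xh.
have {}s0 := ltW s0.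
have str : rho + S * (t - (tau + s)) <= r.
  apply: le_trans rt; rewrite lerD2l ler_wpM2l //; move: tau0 s0; clra.
pose d := ((tau + s) / t) *: h; pose k := t^-1 *: h.
have ft : 0 <= (tau + s) / t <= 1.
  by rewrite divr_ge0 ?addr_ge0 ?(ltW t0) //= ler_pdivrMr // mul1r.
have dh : `|d| <= `|h|.
  by case/andP: ft => f0 f1; rewrite normrZ ger0_norm // ler_piMl.
have kE : `|k| = t^-1 * `|h| by rewrite normrZ ger0_norm // invr_ge0 ltW.
have hr : `|h| <= r by have := normr_ge0 (x - z); move: xh str; clra.
have kr : `|k| <= r / t by rewrite kE mulrC ler_wpM2r // invr_ge0 ltW.
have dk : d - s *: k = (tau / t) *: h by rewrite /d /k scalerA -scalerBl mulrDl addrK.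
have xd : `|x - z| + `|d| <= r by move: xh str dh; clra.
have [xr xpr xmr] := near_center xd.
have sts : s <= tau + s by move: tau0; clra.
have tsT := le_trans tst tT.
have [v Nv] := h2 _ s x s0 ss2 sts tsT xr.
have vS := hN v Nv.
have vpV : `|v + k| <= V by apply: (le_trans (ler_normD _ _)); apply: lerD.
have vmV : `|v - k| <= V by apply: (le_trans (ler_normB _ _)); apply: lerD.
have := h1 _ s (x + d) (v + k) s0 ss1 sts tsT xpr vpV.
have := h1 _ s (x - d) (v - k) s0 ss1 sts tsT xmr vmV.
have -> : x + d - s *: (v + k) = x - s *: v + (tau / t) *: h.
  by rewrite -dk scalerDr opprD addrACA.
have -> : x - d - s *: (v - k) = x - s *: v - (tau / t) *: h.
  by rewrite -dk scalerBr !opprB addrACA [RHS]addrACA; congr (_ + _); rewrite addrC.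
rewrite addrK => i1 i2 i3.
have := IH (x - s *: v) h.
have xsh : `|x - s *: v - z| + `|h| <= rho + S * (t - tau).
  have := @moved_center R n x v z s S `|x - z| s0 vS (lexx _).
  by move: xh; rewrite opprD !mulrDr !mulrN; clra.
move=> /(_ xsh); rewrite -/d /sd => i4.
have [p pB ev] := hB x v xr (le_trans vS SV).
have := hC x (x + d) p _ xr xpr pB vpV; have := hC x (x - d) p _ xr xmr pB vmV.
rewrite -ev ![_ + _ - x]addrC ![_ + _ - v]addrC !addKr !pairingNr !normrN => i5 i6.
have i7 : s * lag F (x + d) (v + k) + s * lag F (x - d) (v - k)
    <= 2 * (s * lag F x v) + K * s * `|h| ^+ 2.
  have -> : 2 * (s * lag F x v) + K * s * `|h| ^+ 2 = s * (2 * lag F x v + K * `|h| ^+ 2) by ring.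
  rewrite -mulrDr ler_wpM2l //.
  have : C * (`|d| ^+ 2 + `|k| ^+ 2) <= C * (`|h| ^+ 2 + (t^-1 * `|h|) ^+ 2).
    by rewrite ler_wpM2l ?(ltW C0) // kE lerD2r lerXn2r ?nnegrE.
  move: i5 i6; rewrite /K exprMn.
  move: (t^-1 ^+ 2) (`|h| ^+ 2) (C * (`|d| ^+ 2 + `|k| ^+ 2)) => a b c.
  by rewrite !mulrDr !mulrDl; clra.
move: i1 i2 i3 i4 i7; rewrite !mulrDr !mulrDl; clra.
Qed.

(** The velocities v1 and v2 optimal at x + h and x - h are unrelated, and their mean w competes at
    x. The displacement becomes h - s k with k their half difference, and the cross term 2 a s |h|
    |k| is absorbed by the gain 2 c s |k|^2 that strict convexity of L in v provides. The resulting
    rate L depends on A, and L t <= 1 keeps the running constant below A + 1. *)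
Lemma semiconvex_keep (R : realType) (n : nat) (F : 'rV[R]_n -> 'rV[R]_n -> R) Fx Fp (N : 'rV[R]_n -> R) W (T : R) z (r Rv S A : R) :
  hamloc F Fx Fp z r -> local_value F N W T z r Rv ->
  0 <= S -> (forall v, N v <= Rv -> `|v| <= S) -> 0 <= A ->
  exists2 L : R, 0 < L & forall rho t, 0 <= t -> t <= T -> L * t <= 1 ->
    rho + 2 * S * t <= r ->
    semiconvex (W 0) A z (rho + 2 * S * t) -> semiconvex (W t) (A + L * t) z rho.
Proof.
move=> hF [lvle [C2 [s2 [C20 s20 h2]]]] S0 hN A0.
have [C1 [s1 [C10 s10 h1]]] := lvle S.
have [B B0 hB] := hamloc_argmax S hF.
have [C [c c0 [C0 hC]]] := lag_expand_ge B S0 hF.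
(* The second summand is what Young's inequality with weight 2 c leaves of the cross term, the
   running constant being at most A + 1. *)
pose L := 2 * C + (2 * (A + 1)) ^+ 2 / (4 * (2 * c)).
have Q0 : 0 <= (2 * (A + 1)) ^+ 2 / (4 * (2 * c)).
  by apply: divr_ge0; [exact: sqr_ge0|move: c0; clra].
have L0 : 0 < L by rewrite /L; move: C0 Q0; clra.
exists L => // rho t t0 tT Lt rt sc0.
(* The centre moves by at most S s and the displacement grows by at most S s: hence the factor 2. *)
pose P tau e := forall x h, `|x - z| + `|h| <= rho + 2 * S * (t - tau) ->
  - ((A + L * tau) * `|h| ^+ 2 + e) <= sd (W tau) x h.
suff lim : forall eps, 0 < eps -> exists2 e, e <= eps & P t e.
  move=> x h xh; apply: eps_le => eps /lim[e ee /(_ x h)].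
  by rewrite subrr mulr0 addr0 => /(_ xh) => H; move: H ee; clra.
have S2 : 0 <= (A + 1) * S ^+ 2 by apply: mulr_ge0; [move: A0; clra|exact: sqr_ge0].
apply: (@euler_limit R P t (2 * (C1 + C2) + (A + 1) * S ^+ 2) (Num.min s1 s2) t0).
- by rewrite lt_min s10.
- by move: C10 C20 S2; clra.
- by move=> x h; rewrite subr0 mulr0 !addr0; exact: sc0.
move=> tau s e tau0 s0; rewrite le_min => /andP[ss1 ss2] tst e0 IH x h xh.
have {}s0 := ltW s0.
have str : rho + 2 * S * (t - (tau + s)) <= r.
  apply: le_trans rt; rewrite lerD2l ler_wpM2l //; first by move: S0; clra.
  by move: tau0 s0; clra.
have [xr xpr xmr] := near_center (le_trans xh str).
have sts : s <= tau + s by move: tau0; clra.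
have tsT := le_trans tst tT.
have [v1 Nv1] := h2 _ s (x + h) s0 ss2 sts tsT xpr.
have [v2 Nv2] := h2 _ s (x - h) s0 ss2 sts tsT xmr.
have v1S := hN v1 Nv1; have v2S := hN v2 Nv2.
pose w := 2^-1 *: (v1 + v2); pose k := 2^-1 *: (v1 - v2).
have wS : `|w| <= S.
  rewrite normrZ gtr0_norm ?invr_gt0 //; have := ler_normD v1 v2; move: v1S v2S; clra.
have kS : `|k| <= S.
  rewrite normrZ gtr0_norm ?invr_gt0 //; have := ler_normB v1 v2; move: v1S v2S; clra.
have ev1 : v1 = w + k by apply/rowP => j; rewrite !mxE; clra.
have ev2 : v2 = w - k by apply/rowP => j; rewrite !mxE; clra.
have i3 := h1 _ s x w s0 ss1 sts tsT xr wS.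
have e1 : x + h - s *: v1 = x - s *: w + (h - s *: k).
  by rewrite ev1 scalerDr opprD addrACA.
have e2 : x - h - s *: v2 = x - s *: w - (h - s *: k).
  by rewrite ev2 scalerBr !opprB addrACA [RHS]addrACA; congr (_ + _); rewrite addrC.
rewrite e1 e2 addrK => i2 i1; rewrite addrK in i3.
have nhk : `|h - s *: k| <= `|h| + s * `|k|.
  by apply: (le_trans (ler_normB _ _)); rewrite normrZ ger0_norm.
have xsh : `|x - s *: w - z| + `|h - s *: k| <= rho + 2 * S * (t - tau).
  have := @moved_center R n x w z s S `|x - z| s0 wS (lexx _).
  have : s * `|k| <= s * S by rewrite ler_wpM2l.
  by move: xh nhk; rewrite opprD !mulrDr !mulrN [s * S]mulrC; clra.
have i4 := IH (x - s *: w) (h - s *: k) xsh; rewrite /sd in i4 *.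
have [p pB ev] := hB x w xr wS.
have := hC x (x + h) p v1 xr xpr pB v1S; have := hC x (x - h) p v2 xr xmr pB v2S.
rewrite -ev ev1 ev2 ![_ + _ - x]addrC ![_ + _ - w]addrC !addKr !pairingNr !normrN => i5 i6.
have i7 : 2 * (s * lag F x w) + s * (2 * c * `|k| ^+ 2) - s * (2 * C * `|h| ^+ 2)
   <= s * lag F (x + h) v1 + s * lag F (x - h) v2.
  rewrite -mulrDr [2 * _]mulrCA -mulrDr -mulrBr ler_wpM2l //.
  by move: i5 i6; rewrite -ev1 -ev2; clra.
pose a := A + L * tau.
have a1 : a <= A + 1.
  have : L * tau <= L * t by rewrite ler_pM2l //; move: tst s0; clra.
  by rewrite /a; move: Lt; clra.
have a0 : 0 <= a by rewrite /a addr_ge0 // mulr_ge0 // ltW.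
have c20 : 0 < 2 * c by move: c0; clra.
have i8 := @young R (2 * c) (2 * (A + 1) * `|h|) `|k| c20.
have i9 : a * `|h - s *: k| ^+ 2 <= a * `|h| ^+ 2 + s * (2 * (A + 1) * `|h| * `|k|)
    + (A + 1) * S ^+ 2 * s ^+ 2.
  apply: (@le_trans _ _ (a * (`|h| + s * `|k|) ^+ 2)).
    apply: ler_wpM2l => //; rewrite lerXn2r ?nnegrE //.
    by rewrite addr_ge0 ?mulr_ge0.
  have -> : a * (`|h| + s * `|k|) ^+ 2 =
      a * `|h| ^+ 2 + s * (2 * a * `|h| * `|k|) + a * `|k| ^+ 2 * s ^+ 2 by ring.
  apply: lerD; [apply: lerD => //|].
    by rewrite ler_wpM2l // ler_wpM2r // ler_wpM2r // ler_wpM2l.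
  rewrite ler_wpM2r ?sqr_ge0 // ler_pM ?sqr_ge0 //.
  by rewrite lerXn2r ?nnegrE.
have i10 : s * (2 * (A + 1) * `|h| * `|k|) <=
   s * (2 * c * `|k| ^+ 2) + s * ((2 * (A + 1)) ^+ 2 / (4 * (2 * c)) * `|h| ^+ 2).
  rewrite -mulrDr ler_wpM2l //; apply: (le_trans i8).
  by rewrite lerD2l exprMn mulrAC.
have i11 : (A + L * (tau + s)) * `|h| ^+ 2 = a * `|h| ^+ 2 + s * (2 * C * `|h| ^+ 2)
   + s * ((2 * (A + 1)) ^+ 2 / (4 * (2 * c)) * `|h| ^+ 2).
  by rewrite /a /L; ring.
rewrite i11; move: i4; rewrite -/a.
move: (s * (2 * C * `|h| ^+ 2)) i7 => Z1 i7.
move: (s * ((2 * (A + 1)) ^+ 2 / (4 * (2 * c)) * `|h| ^+ 2)) i10 => Z2 i10.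
move: (s * (2 * (A + 1) * `|h| * `|k|)) (s * (2 * c * `|k| ^+ 2)) i9 i10 i7 => Z3 Z4 i9 i10 i7 i4.
move: (a * `|h - s *: k| ^+ 2) (a * `|h| ^+ 2) i4 i9 => Z5 Z6 i4 i9.
by move: i1 i2 i3 i4 i7 i9 i10; clra.
Qed.

(** In use, the Riemannian norm frozen at the centre of a chart ball: speeds measured by it obey
    bounds that are uniform over M, while [kappa] depends on the ball. *)
Record gauge (R : realType) (n : nat) (N : 'rV[R]_n -> R) (kappa : R) : Prop := Gauge {
  gauge_gt0 : 0 < kappa ;
  gaugeD : forall v w, N (v + w) <= N v + N w ;
  gaugeZ : forall a v, N (a *: v) = `|a| * N v ;
  gauge_lb : forall v, `|v| <= kappa * N v ;
  gauge_ub : forall v, N v <= kappa * `|v|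
}.

Lemma gaugeN (R : realType) (n : nat) (N : 'rV[R]_n -> R) kappa v : gauge N kappa -> N (- v) = N v.
Proof. by move=> gN; rewrite -scaleN1r (gaugeZ gN) normrN normr1 mul1r. Qed.

Lemma gaugeB (R : realType) (n : nat) (N : 'rV[R]_n -> R) kappa v w : gauge N kappa -> N (v - w) <= N v + N w.
Proof. by move=> gN; rewrite -[in leRHS](gaugeN w gN); exact: gaugeD gN _ _. Qed.

(* The momentum [P] of the pair [(y, v)] for [G] is moved along the flow of [G] to
   [P + rho * Gx], and Poisson commutation makes the variation of [F] along it [O(rho^2)]. *)
Lemma local_subsolution_keep (R : realType) (n : nat) (F G : 'rV[R]_n -> 'rV[R]_n -> R) Fx Fp Gx Gp (N : 'rV[R]_n -> R)
    (kappa : R) W (T : R) z (r Rv V0 Lam : R) :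
  hamloc F Fx Fp z r -> hamloc G Gx Gp z r ->
  (forall y p, `|y - z| <= r -> pairing (Fp y p) (Gx y p) = pairing (Fx y p) (Gp y p)) ->
  gauge N kappa -> 0 <= Rv -> local_value F N W T z r Rv ->
  (forall t y y', 0 <= t -> t <= T -> `|y - z| <= r -> `|y' - z| <= r ->
     W t y' - W t y <= Lam * N (y' - y)) ->
  (forall y y' P, `|y - z| <= r -> `|y' - z| <= r -> N (Gp y P) <= V0 -> N (Fp y' P) <= Rv) ->
  (forall y v, `|y - z| <= r -> V0 < N v -> Lam * N v <= lag G y v) ->
  exists2 C : R, 0 < C & forall t x0 mu E0 rho,
    0 <= t -> t <= T -> 0 <= E0 -> 0 < rho -> rho <= 1 ->
    (forall y, N (y - x0) <= mu + Rv * t -> `|y - z| <= r) ->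
    (forall y v, N (y - x0) <= mu + Rv * t -> N (y + rho *: v - x0) <= mu + Rv * t ->
       N v <= V0 -> W 0 (y + rho *: v) - W 0 y <= rho * lag G y v + E0 * rho ^+ 2) ->
    forall y v, N (y - x0) <= mu -> N (y + rho *: v - x0) <= mu -> N v <= V0 ->
      W t (y + rho *: v) - W t y <= rho * lag G y v + (E0 + C * t) * rho ^+ 2.
Proof.
move=> hF hG pois gN Rv0 [lvle [C2 [s2 [C20 s20 h2]]]] hLip hsp hbig.
have k0 := gauge_gt0 gN.
have bnd v c : N v <= c -> `|v| <= kappa * c.
  by move=> h; apply: (le_trans (gauge_lb gN v)); rewrite ler_pM2l.
have [B B0 hB] := hamloc_argmax (kappa * V0) hG.
have [D D0 hD] := hamloc_bound B hG.
have [C1 [s1 [C10 s10 h1]]] := lvle (kappa * Rv).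
have [CF CF0 hCF] := hl_reg hF (B + D).
have [CG CG0 hCG] := lag_expand_le (kappa * V0 + 2 * (kappa * Rv)) B hG.
pose C := CF * (D ^+ 2 + (kappa * V0) ^+ 2) + 1.
have C0 : 0 < C.
  apply: ltr_wpDl => //; apply: mulr_ge0; first exact: ltW.
  by apply: addr_ge0; exact: sqr_ge0.
exists C => // t x0 mu E0 rho t0 tT E00 rho0 rho1 hreg hini.
(* The size rho of the G-step is fixed while the time step s tends to 0; e collects the
   discretization errors only, apart from the term (E0 + C tau) rho^2. *)
pose P tau e := forall y v, N (y - x0) <= mu + Rv * (t - tau) ->
  N (y + rho *: v - x0) <= mu + Rv * (t - tau) -> N v <= V0 ->
  W tau (y + rho *: v) - W tau y <= rho * lag G y v + (E0 + C * tau) * rho ^+ 2 + e.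
suff lim : forall eps, 0 < eps -> exists2 e, e <= eps & P t e.
  move=> y v y1 y2 v1; apply: eps_le => eps /lim[e ee /(_ y v)].
  by rewrite subrr mulr0 addr0 => /(_ y1 y2 v1) => H; move: H ee; clra.
pose M := kappa * Rv.
(* Blows up like 1 / rho, which is harmless since rho stays fixed in the limit over time steps. *)
pose D3 := CG * (M ^+ 2 + 4 * M ^+ 2 / rho) + C1 + C2.
have D30 : 0 < D3.
  have : 0 <= CG * (M ^+ 2 + 4 * M ^+ 2 / rho).
    apply: mulr_ge0; first exact: ltW.
    apply: addr_ge0; first exact: sqr_ge0.
    by apply: divr_ge0; [apply: mulr_ge0 => //; exact: sqr_ge0|exact: ltW].
  by rewrite /D3; move: C10 C20; clra.
apply: (@euler_limit R P t D3 (Num.min rho (Num.min s1 s2)) t0) => //.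
- by rewrite !lt_min rho0 s10.
- by move=> y v; rewrite subr0 mulr0 !addr0; exact: hini.
move=> tau s e tau0 s0; rewrite !le_min => /and3P[srho ss1 ss2] tst e0 IH y v y1 y2 vV0.
have s0' := ltW s0.
have regS : mu + Rv * (t - (tau + s)) <= mu + Rv * t.
  by rewrite lerD2l ler_wpM2l //; move: tau0 s0'; clra.
set x := y + rho *: v in y2 *.
have yr : `|y - z| <= r by apply: hreg; apply: le_trans y1 regS.
have xr : `|x - z| <= r by apply: hreg; apply: le_trans y2 regS.
have [p pB ev] := hB y v yr (bnd _ _ vV0).
have [GxD GpD _] := hD y p yr pB.
have sts : s <= tau + s by move: tau0; clra.
have tsT := le_trans tst tT.
have [w0 Nw0 i2] := h2 _ s y s0' ss2 sts tsT yr.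
set w1 := Fp x p.
have Nw1 : N w1 <= Rv by apply: (hsp y) => //; rewrite -ev.
have i1 := h1 _ s x w1 s0' ss1 sts tsT xr (bnd _ _ Nw1).
rewrite addrK in i1 i2.
set v' := v - (s / rho) *: (w1 - w0).
have xE : x - s *: w1 = y - s *: w0 + rho *: v'.
  apply/rowP => j; rewrite !mxE; field; rewrite gt_eqF //.
have sr : 0 <= s / rho <= 1 by rewrite divr_ge0 ?(ltW rho0) //= ler_pdivrMr // mul1r.
have w0M : `|w0| <= M := bnd _ _ Nw0.
have w1M : `|w1| <= M := bnd _ _ Nw1.
have w10 : `|w1 - w0| <= 2 * M.
  by apply: (le_trans (ler_normB _ _)); move: w0M w1M; clra.
have dvE : `|v' - v| = s / rho * `|w1 - w0|.
  rewrite /v' addrC addKr normrN normrZ ger0_norm //; by case/andP: sr.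
have v'V : `|v'| <= kappa * V0 + 2 * (kappa * Rv).
  rewrite -(subrK v v') addrC; apply: (le_trans (ler_normD _ _)); apply: lerD; first exact: bnd.
  rewrite dvE; apply: le_trans w10; case/andP: sr => a b; by rewrite ler_piMl.
have Nmove u w : N (u - x0) <= mu + Rv * (t - (tau + s)) -> N w <= Rv ->
    N (u - s *: w - x0) <= mu + Rv * (t - tau).
  move=> a b; rewrite addrAC; apply: (le_trans (gaugeB _ _ gN)).
  have : s * N w <= s * Rv by rewrite ler_wpM2l.
  by rewrite (gaugeZ gN) ger0_norm //; move: a; rewrite opprD !mulrDr !mulrN [s * Rv]mulrC; clra.
have y1' := Nmove _ _ y1 Nw0; have x1' := Nmove _ _ y2 Nw1.
have regT : mu + Rv * (t - tau) <= mu + Rv * t.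
  by rewrite lerD2l ler_wpM2l //; move: tau0; clra.
have y1r : `|y - s *: w0 - z| <= r by apply: hreg; apply: le_trans y1' regT.
have x1r : `|x - s *: w1 - z| <= r by apply: hreg; apply: le_trans x1' regT.
have tauT : tau <= T by move: tsT s0'; clra.
have ECe : 0 <= (E0 + C * tau) * rho ^+ 2 + e.
  apply: addr_ge0 => //; apply: mulr_ge0; last exact: sqr_ge0.
  by apply: addr_ge0 => //; apply: mulr_ge0 => //; exact: ltW.
have i3 : W tau (x - s *: w1) - W tau (y - s *: w0) <=
    rho * lag G (y - s *: w0) v' + (E0 + C * tau) * rho ^+ 2 + e.
  (* A fast v' needs no induction hypothesis: the Lipschitz bound on W tau is dominated by the
     Lagrangian of G at such speeds. *)
  have [small|big] := leP (N v') V0.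
    by rewrite xE; apply: IH => //; rewrite -xE.
  have := hLip tau _ _ tau0 tauT y1r x1r.
  have := hbig _ _ y1r big; move/(ler_wpM2l (ltW rho0)).
  have -> : x - s *: w1 - (y - s *: w0) = rho *: v' by rewrite xE addrC addKr.
  rewrite (gaugeZ gN) gtr0_norm // [rho * (Lam * _)]mulrCA => a b.
  by move: (le_trans b a) ECe; clra.
have i4 : rho * lag G (y - s *: w0) v' <= rho * lag G y v - s * pairing p (w1 - w0)
    + rho * s * pairing (Gx y p) w0 + CG * (M ^+ 2 + 4 * M ^+ 2 / rho) * s ^+ 2.
  have := hCG y (y - s *: w0) p v' yr y1r pB v'V.
  have -> : y - s *: w0 - y = - (s *: w0) by rewrite addrAC subrr add0r.
  rewrite -ev pairingNr pairingZr normrN => /(ler_wpM2l (ltW rho0)) /le_trans; apply.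
  have pdv : pairing p (v' - v) = - (s / rho * pairing p (w1 - w0)).
    by rewrite /v' addrC addKr pairingNr pairingZr.
  rewrite pdv dvE normrZ (ger0_norm s0').
  have m1 : `|w0| ^+ 2 <= M ^+ 2 by rewrite lerXn2r ?nnegrE // (le_trans (normr_ge0 _) w0M).
  have m2 : `|w1 - w0| ^+ 2 <= 4 * M ^+ 2.
    have -> : 4 * M ^+ 2 = (2 * M) ^+ 2 by ring.
    by rewrite lerXn2r ?nnegrE // (le_trans (normr_ge0 _) w10).
  have -> : rho * (lag G y v + - (s / rho * pairing p (w1 - w0)) - - (s * pairing (Gx y p) w0)
      + CG * ((s * `|w0|) ^+ 2 + (s / rho * `|w1 - w0|) ^+ 2)) =
      rho * lag G y v - s * pairing p (w1 - w0) + rho * s * pairing (Gx y p) w0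
      + CG * s ^+ 2 * (rho * `|w0| ^+ 2 + `|w1 - w0| ^+ 2 / rho).
    by field; rewrite gt_eqF.
  rewrite lerD2l [leRHS]mulrAC ler_wpM2l //.
    by apply: mulr_ge0; [exact: ltW|exact: sqr_ge0].
  apply: lerD; last by rewrite ler_pM2r ?invr_gt0.
  by apply: le_trans m1; rewrite ler_piMl ?sqr_ge0.
have qB : `|p + rho *: Gx y p| <= B + D.
  apply: (le_trans (ler_normD _ _)); apply: lerD => //.
  rewrite normrZ gtr0_norm //; apply: le_trans GxD; by rewrite ler_piMl.
have pBD : `|p| <= B + D by move: pB D0; clra.
(* Fenchel's inequality for w0 is tested with p + rho Gx, that is, p moved along the flow of G while
   the base point goes from x back to y. *)
have i5 := lag_ge w0 (p + rho *: Gx y p) hF yr.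
have i6 : lag F x w1 = pairing p w1 - F x p := lag_argmax p hF xr.
have [i7 _ _ _ _] := hCF y y p (p + rho *: Gx y p) yr yr pBD qB.
have [i8 _ _ _ _] := hCF y x p p yr xr pBD pBD.
move: i7 i8; rewrite !subrr !pairing0r !normr0 !expr0n /= !addr0 add0r !subr0.
rewrite [p + _ - p]addrC addKr /x [y + _ - y]addrC addKr -/x.
rewrite !pairingZr !normrZ !(gtr0_norm rho0) ler_norml => /andP[_ i7].
rewrite ler_norml => /andP[i8 _].
(* The first-order part rho (Fp.Gx - Fx.Gp) vanishes by commutation; only the quadratic remainders
   are left. *)
have i9 : F y (p + rho *: Gx y p) - F x p <= C * rho ^+ 2.
  have q1 : CF * (rho * `|Gx y p|) ^+ 2 <= CF * (rho ^+ 2 * D ^+ 2).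
    rewrite ler_wpM2l ?(ltW CF0) // exprMn ler_wpM2l ?sqr_ge0 //.
    by rewrite lerXn2r ?nnegrE // ltW.
  have q2 : CF * (rho * `|v|) ^+ 2 <= CF * (rho ^+ 2 * (kappa * V0) ^+ 2).
    rewrite ler_wpM2l ?(ltW CF0) // exprMn ler_wpM2l ?sqr_ge0 //.
    by have vk := bnd _ _ vV0; rewrite lerXn2r ?nnegrE // (le_trans (normr_ge0 _) vk).
  have -> : C * rho ^+ 2 = CF * (rho ^+ 2 * D ^+ 2) + CF * (rho ^+ 2 * (kappa * V0) ^+ 2) + rho ^+ 2.
    by rewrite /C; ring.
  have := pois y p yr; rewrite -ev => po.
  move: i7 i8 q1 q2 (sqr_ge0 rho); rewrite po.
  move: (CF * (rho * `|Gx y p|) ^+ 2) (CF * (rho * `|v|) ^+ 2) => u1 u2.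
  by clra.
move: i5; rewrite pairingDl pairingZl => /(ler_wpM2l s0') i5.
have eqE : (E0 + C * (tau + s)) * rho ^+ 2 + (e + D3 * s ^+ 2) =
   (E0 + C * tau) * rho ^+ 2 + e + s * (C * rho ^+ 2) +
   (CG * (M ^+ 2 + 4 * M ^+ 2 / rho) * s ^+ 2 + C1 * s ^+ 2 + C2 * s ^+ 2).
  by rewrite /D3; ring.
rewrite -(addrA (rho * lag G y v)) eqE.
move: ((E0 + C * tau) * rho ^+ 2) i3 (CG * (M ^+ 2 + 4 * M ^+ 2 / rho) * s ^+ 2) i4 => X i3 Y i4.
move: i1 i2 i3 i4 i5 (ler_wpM2l s0' i9); rewrite i6 pairingBr; clra.
Qed.

(** * Differential calculus: mean value inequalities and Taylor bounds on compact sets *)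

Lemma subr_split (W : zmodType) (a b c u v : W) :
  a - b = (a - c - u) - (b - c - v) + (u - v).
Proof.
rewrite !opprD !opprK [RHS](AC (3*3*2) ((1*4)*(2*5)*(3*7)*(6*8)))%AC /=.
by rewrite addNr addNr subrr !addr0.
Qed.

Lemma subr_cancel (W : zmodType) (p q u v x : W) :
  p - u - (q - v) - (x - (u - v)) = p - q - x.
Proof.
rewrite !opprD !opprK [LHS](AC (2*2*(1*2)) ((1*3)*5*(2*6)*(4*7)))%AC /=.
by rewrite addNr subrr !addr0.
Qed.

Lemma diff_eps (R : realType) (V W : normedModType R) (f : V -> W) x :
  differentiable f x -> forall e, 0 < e -> exists2 d : R, 0 < d & forall y, `|y - x| < d ->
    `|f y - f x - 'd f x (y - x)| <= e * `|y - x|.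
Proof.
move=> /diff_locally/eqaddoP h e e0.
have /nbhs_ballP[d d0 hd] := h e e0; exists d => // y yx.
have := hd (y - x); rewrite -ball_normE /= sub0r normrN => /(_ yx).
by rewrite !fctE /= subrK opprD addrA.
Qed.

Lemma eps_diff (R : realType) (V W : normedModType R) (f : V -> W) (df : {linear V -> W}) x :
  continuous df -> (forall e, 0 < e -> exists2 d : R, 0 < d & forall y, `|y - x| < d ->
    `|f y - f x - df (y - x)| <= e * `|y - x|) ->
  differentiable f x /\ 'd f x = df :> (V -> W).
Proof.
move=> cdf h.
have E : f \o shift x = cst (f x) + df +o_ 0 id.
  apply/eqaddoP => e e0; have [d d0 hd] := h e e0.
  apply/nbhs_ballP; exists d => // y; rewrite -ball_normE /= sub0r normrN => yd.
  have := hd (y + x); rewrite addrK => /(_ yd).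
  by rewrite !fctE /= opprD addrA.
have dE := diff_unique cdf E; split => //.
by apply/diff_locallyP; rewrite dE.
Qed.

Lemma near_diff (R : realType) (V W : normedModType R) (f g : V -> W) x :
  (\forall y \near x, f y = g y) -> differentiable g x ->
  differentiable f x /\ 'd f x = 'd g x :> (V -> W).
Proof.
move=> /nbhs_ballP[r r0 fg] dg; apply: eps_diff; first exact: diff_continuous.
move=> e e0; have [d d0 hd] := diff_eps dg e0.
exists (Num.min r d); first by rewrite lt_min r0.
move=> y; rewrite lt_min => /andP[yr yd].
by rewrite !fg ?hd //; rewrite -ball_normE /= ?subrr ?normr0 // distrC.
Qed.

(** The linear estimate at s0 bounds increments over intervals that straddle s0; gluing these
    intervals avoids any integral. *)
Lemma mvt_norm_le (R : realType) (W : normedModType R) (g dg : R -> W) (a b k : R) :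
  a <= b ->
  (forall s e, a <= s <= b -> 0 < e -> exists2 d : R, 0 < d & forall s', a <= s' <= b ->
     `|s' - s| < d -> `|g s' - g s - (s' - s) *: dg s| <= e * `|s' - s|) ->
  (forall s, a <= s <= b -> `|dg s| <= k) ->
  `|g b - g a| <= k * (b - a).
Proof.
move=> ab hd hk; apply: (@eps_mul_le _ _ _ (b - a)) => e e0.
rewrite -[_ * e]mulrC -mulrDl.
apply: (@itv_glue R (fun s t => `|g t - g s| <= (k + e) * (t - s))) => //.
  move=> x y z _ xy yz _ h1 h2; have := ler_distD (g y) (g z) (g x).
  by move: h1 h2; clra.
move=> s0 s0ab; have [d d0 h] := hd s0 e s0ab e0.
exists d => // s1 s2 as1 s1s0 s0s2 s2b s1d s2d.
case/andP: (s0ab) => as0 s0b.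
have h1 : `|g s2 - g s0 - (s2 - s0) *: dg s0| <= e * (s2 - s0).
  rewrite -[X in _ <= e * X]ger0_norm; last by move: s0s2; clra.
  by apply: h; [|rewrite ger0_norm]; move: as0 s0s2 s2b s2d; clra.
have h2 : `|g s1 - g s0 - (s1 - s0) *: dg s0| <= e * (s0 - s1).
  rewrite -[X in _ <= e * X]ger0_norm; last by move: s1s0; clra.
  by rewrite [`|s0 - s1|]distrC; apply: h; [|rewrite ler0_norm]; move: s0b s1s0 as1 s1d; clra.
have h3 : `|(s2 - s1) *: dg s0| <= (s2 - s1) * k.
  by rewrite normrZ ger0_norm; [rewrite ler_wpM2l ?hk //|]; move: s1s0 s0s2; clra.
have -> : g s2 - g s1 = (g s2 - g s0 - (s2 - s0) *: dg s0) -
   (g s1 - g s0 - (s1 - s0) *: dg s0) + (s2 - s1) *: dg s0.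
  have -> : (s2 - s1) *: dg s0 = (s2 - s0) *: dg s0 - (s1 - s0) *: dg s0.
    by rewrite -scalerBl; congr (_ *: _); clra.
  by rewrite -subr_split.
apply: (le_trans (ler_normD _ _)); have := ler_normB (g s2 - g s0 - (s2 - s0) *: dg s0)
   (g s1 - g s0 - (s1 - s0) *: dg s0).
by move: h1 h2 h3; clra.
Qed.

Lemma mvt_ge (R : realType) (g dg : R -> R) (a b k : R) :
  a <= b ->
  (forall s e, a <= s <= b -> 0 < e -> exists2 d : R, 0 < d & forall s', a <= s' <= b ->
     `|s' - s| < d -> `|g s' - g s - (s' - s) * dg s| <= e * `|s' - s|) ->
  (forall s, a <= s <= b -> k <= dg s) ->
  k * (b - a) <= g b - g a.
Proof.
move=> ab hd hk; apply: (@eps_mul_le _ _ _ (b - a)) => e e0.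
suff : (k - e) * (b - a) <= g b - g a by clra.
apply: (@itv_glue R (fun s t => (k - e) * (t - s) <= g t - g s)) => //.
  by move=> x y z _ xy yz _; clra.
move=> s0 s0ab; have [d d0 h] := hd s0 e s0ab e0.
exists d => // s1 s2 as1 s1s0 s0s2 s2b s1d s2d.
case/andP: (s0ab) => as0 s0b.
have h1 : `|g s2 - g s0 - (s2 - s0) * dg s0| <= e * (s2 - s0).
  rewrite -[X in _ <= e * X]ger0_norm; last by move: s0s2; clra.
  by apply: h; [|rewrite ger0_norm]; move: as0 s0s2 s2b s2d; clra.
have h2 : `|g s1 - g s0 - (s1 - s0) * dg s0| <= e * (s0 - s1).
  rewrite -[X in _ <= e * X]ger0_norm; last by move: s1s0; clra.
  by rewrite [`|s0 - s1|]distrC; apply: h; [|rewrite ler0_norm]; move: s0b s1s0 as1 s1d; clra.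
have h3 : (s2 - s1) * k <= (s2 - s1) * dg s0.
  by rewrite ler_wpM2l ?hk //; move: s1s0 s0s2; clra.
by move: h1 h2 h3; rewrite !ler_norml => /andP[h1 _] /andP[_ h2]; move: h1 h2; clra.
Qed.

Lemma diff_line (R : realType) (V W : normedModType R) (f : V -> W) y d s :
  differentiable f (y + s *: d) -> forall e, 0 < e -> exists2 r : R, 0 < r & forall s' : R,
    `|s' - s| < r ->
    `|f (y + s' *: d) - f (y + s *: d) - (s' - s) *: 'd f (y + s *: d) d| <= e * `|s' - s|.
Proof.
move=> df e e0; have d1 : 0 < `|d| + 1 by have := normr_ge0 d; clra.
have [r r0 h] := diff_eps df (divr_gt0 e0 d1).
exists (r / (`|d| + 1)); first exact: divr_gt0.
move=> s'; rewrite ltr_pdivlMr // => ss.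
have E : y + s' *: d - (y + s *: d) = (s' - s) *: d.
  by rewrite opprD addrACA subrr add0r scalerBl.
have := h (y + s' *: d); rewrite E linearZ normrZ /=.
have b : `|s' - s| * `|d| <= `|s' - s| * (`|d| + 1) by rewrite ler_wpM2l // lerDl.
move=> /(_ (le_lt_trans b ss)) /le_trans; apply.
rewrite -mulrA ler_pM2l // mulrC ler_pdivrMr //.
Qed.

(** Bounds a linear map by its values at finitely many vectors; one notion covers both the
    coordinate space and the product that models T^*M. *)
Definition frame (R : realType) (V : normedModType R) (I : finType) (e : I -> V)
    (c : I -> V -> R) : Prop :=
  forall v, v = \sum_k c k v *: e k /\ forall k, `|c k v| <= `|v|.

Definition segment_closed (R : realType) (V : normedModType R) (K : set V) : Prop :=
  forall x y (s : R), K x -> K y -> 0 <= s <= 1 -> K (x + s *: (y - x)).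

Lemma compact_norm_bound (R : realType) (V W : normedModType R) (I : finType) (K : set V)
    (h : I -> V -> W) :
  compact K -> (forall k x, K x -> {for x, continuous (h k)}) ->
  exists2 C : R, 0 < C & forall k x, K x -> `|h k x| <= C.
Proof.
move=> cK ch.
have b k : exists C : R, 0 <= C /\ forall x, K x -> `|h k x| <= C.
  have [|C [_ hC]] := @compact_bounded R W (h k @` K) _.
    apply: continuous_compact => //; apply: continuous_in_subspaceT => x.
    by rewrite inE; exact: ch.
  exists (`|C| + 1); split; first by have := normr_ge0 C; clra.
  move=> x Kx; apply: hC; last by exists x.
  by have := ler_norm C; clra.
have [C hC] := choice b.
exists (1 + \sum_k C k).
  by apply: ltr_pwDl => //; apply: sumr_ge0 => k _; case: (hC k).
move=> k x Kx; apply: (le_trans ((hC k).2 x Kx)).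
rewrite (bigD1 k) //= addrCA lerDl addr_ge0 //; apply: sumr_ge0 => l _.
by case: (hC l).
Qed.

Lemma frame_linear (R : realType) (V W : normedModType R) (I : finType) e (c : I -> V -> R)
    (f : {linear V -> W}) (C : R) v :
  frame e c -> (forall k, `|f (e k)| <= C) -> `|f v| <= #|I|%:R * C * `|v|.
Proof.
move=> fr fC; have [vE vc] := fr v.
rewrite {1}vE linear_sum; apply: (le_trans (ler_norm_sum _ _ _)).
rewrite -mulrA -[#|I|]sum1_card natr_sum mulr_suml; apply: ler_sum => k _.
by rewrite linearZ normrZ mul1r mulrC ler_pM.
Qed.

(** [Ck_on] gives continuity for each fixed direction only. Compactness bounds the derivatives in
    the finitely many directions of the frame, linearity extends the bounds to all directions, and
    the mean value inequality on segments of [K] yields the Taylor estimates. *)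
Lemma C2_bounds (R : realType) (V W : normedModType R) (I : finType) e (c : I -> V -> R)
    (U K : set V) (f : V -> W) :
  frame e c -> compact K -> segment_closed K -> K `<=` U -> Ck_on 2 U f ->
  exists2 C : R, 0 < C & forall y y' w, K y -> K y' ->
    [/\ `|f y| <= C, `|'d f y w| <= C * `|w|,
        `|'d f y' w - 'd f y w| <= C * `|y' - y| * `|w|
      & `|f y' - f y - 'd f y (y' - y)| <= C * `|y' - y| ^+ 2].
Proof.
move=> fr cK vK KU [df0 df1].
have dw v x : U x -> differentiable (fun x => 'd f x v) x := (df1 v).1 x.
have cw v w x : U x -> {for x, continuous (fun x => 'd (fun x => 'd f x v) x w)}.
  exact: (df1 v).2 w x.
have [C0 C00 h0] := @compact_norm_bound R V W unit K (fun _ => f) cK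
  (fun _ x Kx => differentiable_continuous (df0 x (KU _ Kx))).
have [C1 C10 h1] := @compact_norm_bound R V W I K (fun k x => 'd f x (e k)) cK
  (fun k x Kx => differentiable_continuous (dw (e k) x (KU _ Kx))).
have [C2 C20 h2] := @compact_norm_bound R V W (I * I)%type K
  (fun k x => 'd (fun x => 'd f x (e k.1)) x (e k.2)) cK
  (fun k x Kx => cw (e k.1) (e k.2) x (KU _ Kx)).
pose m : R := #|I|%:R; have m0 : 0 <= m := ler0n R _.
have B1 y w : K y -> `|'d f y w| <= m * C1 * `|w|.
  by move=> Ky; apply: (frame_linear _ fr) => k; exact: h1.
have B2 k y w : K y -> `|'d (fun x => 'd f x (e k)) y w| <= m * C2 * `|w|.
  by move=> Ky; apply: (frame_linear _ fr) => l; exact: (h2 (k, l)).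
have L2k k y y' : K y -> K y' -> `|'d f y' (e k) - 'd f y (e k)| <= m * C2 * `|y' - y|.
  move=> Ky Ky'.
  have Ks s : 0 <= s <= 1 -> K (y + s *: (y' - y)) by move=> s01; exact: vK.
  have := @mvt_norm_le R W (fun s => 'd f (y + s *: (y' - y)) (e k))
    (fun s => 'd (fun x => 'd f x (e k)) (y + s *: (y' - y)) (y' - y)) 0 1 (m * C2 * `|y' - y|) ler01.
  rewrite /= scale0r scale1r addr0 (addrC y (y' - y)) subrK subr0 mulr1; apply.
    move=> s e' s01 e'0.
    have [r r0 hr] := diff_line (dw (e k) _ (KU _ (Ks s s01))) e'0.
    by exists r => // s' _; exact: hr.
  by move=> s s01; apply: B2; exact: Ks.
have L2 y y' w : K y -> K y' -> `|'d f y' w - 'd f y w| <= m * (m * C2) * `|y' - y| * `|w|.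
  move=> Ky Ky'; have [wE wc] := fr w.
  have E x : 'd f x w = \sum_k c k w *: 'd f x (e k).
    by rewrite {1}wE linear_sum; apply: eq_bigr => k _; rewrite linearZ.
  rewrite !E -sumrB; apply: (le_trans (ler_norm_sum _ _ _)).
  apply: (@le_trans _ _ (\sum_(k : I) (m * C2 * `|y' - y|) * `|w|)).
    apply: ler_sum => k _; rewrite -scalerBr normrZ mulrC.
    by apply: ler_pM => //; exact: L2k.
  by rewrite sumr_const -mulr_natl mulrA [_ * (m * C2 * _)]mulrA.
exists (C0 + m * C1 + m * (m * C2)).
  by have : 0 <= m * C1 /\ 0 <= m * (m * C2); [split; rewrite !mulr_ge0 // ltW|move=> []; move: C00; clra].
have mC1 : 0 <= m * C1 by rewrite mulr_ge0 // ltW.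
have mC2 : 0 <= m * (m * C2) by rewrite !mulr_ge0 // ltW.
move=> y y' w Ky Ky'; split.
- by have := h0 tt y Ky; move: mC1 mC2; clra.
- by apply: (le_trans (B1 y w Ky)); rewrite ler_wpM2r //; move: C00 mC2; clra.
- apply: (le_trans (L2 y y' w Ky Ky')); rewrite ler_wpM2r // ler_wpM2r //.
  by move: C00 mC1; clra.
have Ks s : 0 <= s <= 1 -> K (y + s *: (y' - y)) by move=> s01; exact: vK.
set d := y' - y.
have := @mvt_norm_le R W (fun s => f (y + s *: d) - s *: 'd f y d)
    (fun s => 'd f (y + s *: d) d - 'd f y d) 0 1 (m * (m * C2) * `|d| * `|d|) ler01.
rewrite /= !scale0r !scale1r addr0 subr0 (addrC y d) subrK subr0 mulr1 addrAC => H.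
apply: (@le_trans _ _ (m * (m * C2) * `|d| * `|d|)).
  apply: H => [s e' s01 e'0|s s01].
    have [r r0 hr] := diff_line (df0 _ (KU _ (Ks s s01))) e'0.
    exists r => // s' _ /hr; congr (`|_| <= _).
    by rewrite /= -/d (scalerBr (s' - s) ('d f (y + s *: d) d)) (scalerBl s' s ('d f y d)) subr_cancel.
  apply: (le_trans (L2 _ _ d Ky (Ks s s01))); rewrite ler_wpM2r //.
  rewrite ler_wpM2l // addrC addKr normrZ; case/andP: s01 => s0 s1.
  by rewrite ger0_norm // ler_piMl.
rewrite -mulrA -expr2 ler_wpM2r ?sqr_ge0 //; move: C00 mC1; clra.
Qed.

Lemma frame_rV (R : realType) (n : nat) : @frame R 'rV[R]_n 'I_n (fun k => delta_mx 0 k) (fun k v => v 0 k).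
Proof. by move=> v; split; [exact: row_sum_delta|move=> k; exact: norm_entry]. Qed.

Lemma norm_pair (R : realType) (V W : normedModType R) (z : V * W) :
  [/\ `|z.1| <= `|z|, `|z.2| <= `|z| & `|z| <= `|z.1| + `|z.2|].
Proof.
rewrite [`|z|]prod_normE !le_max ge_max !lexx orbT; split=> //.
by rewrite lerDl lerDr !normr_ge0.
Qed.

Lemma frame_prod (R : realType) (n : nat) : @frame R ('rV[R]_n * 'rV[R]_n)%type ('I_n + 'I_n)%type
  (fun k => match k with inl k => (delta_mx 0 k, 0) | inr k => (0, delta_mx 0 k) end)
  (fun k v => match k with inl k => v.1 0 k | inr k => v.2 0 k end).
Proof.
move=> v; have [n1 n2 _] := norm_pair v; split=> [|[k|k]]; last 2 first.
- exact: le_trans (norm_entry _ _) n1.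
- exact: le_trans (norm_entry _ _) n2.
rewrite big_sumType /=.
have e1 : \sum_k v.1 0 k *: ((delta_mx 0 k, 0) : 'rV[R]_n * 'rV[R]_n) = (v.1, 0).
  rewrite [X in (X, _)]row_sum_delta (big_morph (fun w : 'rV[R]_n => (w, 0 : 'rV[R]_n)) (id1 := 0) (op1 := +%R)) //.
    by apply: eq_bigr => k _; congr pair; rewrite scaler0.
  by move=> w w'; congr pair; rewrite addr0.
have e2 : \sum_k v.2 0 k *: ((0, delta_mx 0 k) : 'rV[R]_n * 'rV[R]_n) = (0, v.2).
  rewrite [X in (_, X)]row_sum_delta (big_morph (fun w : 'rV[R]_n => (0 : 'rV[R]_n, w)) (id1 := 0) (op1 := +%R)) //.
    by apply: eq_bigr => k _; congr pair; rewrite scaler0.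
  by move=> w w'; congr pair; rewrite addr0.
rewrite e1 e2 [LHS]surjective_pairing; congr pair; rewrite ?addr0 ?add0r //.
Qed.

Lemma closed_ball_convex (R : realType) (n : nat) (z : 'rV[R]_n) (r : R) : segment_closed [set y : 'rV[R]_n | `|y - z| <= r].
Proof.
move=> x y s /= xr yr /andP[s0 s1].
have -> : x + s *: (y - x) - z = (1 - s) *: (x - z) + s *: (y - z).
  by apply/rowP => j; rewrite !mxE; ring.
have s1' : 0 <= 1 - s by move: s1; clra.
apply: (le_trans (ler_normD _ _)); rewrite !normrZ !ger0_norm //.
have := ler_wpM2l s0 yr; have := ler_wpM2l s1' xr; clra.
Qed.

(** * Charts and changes of coordinates *)

Section ManifoldBasics.
Variables (R : realType) (n : nat) (M : c2_manifold R n).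
Implicit Types (i j k : chart M) (x : M) (y : 'rV[R]_n).

Definition chart_cod i : set 'rV[R]_n := phi i @` dom i.

Lemma codom_phi i x : dom i x -> chart_cod i (phi i x).
Proof. by exists x. Qed.

Lemma dom_phi_inv i y : chart_cod i y -> dom i (phi_inv i y).
Proof. by case=> x dx <-; rewrite phi_invK. Qed.

Lemma phi_phi_inv i y : chart_cod i y -> phi i (phi_inv i y) = y.
Proof. by case=> x dx <-; rewrite phi_invK. Qed.

Lemma chart_near i x (A : set M) : dom i x -> nbhs x A ->
  \forall y \near phi i x, chart_cod i y /\ A (phi_inv i y).
Proof.
move=> dx Ax; apply: filterI.
  by apply: open_nbhs_nbhs; split; [exact: codom_open|exact: codom_phi].
by apply: (phi_inv_continuous (codom_phi dx)); rewrite phi_invK.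
Qed.

Lemma chart_pull i x (A : set 'rV[R]_n) : dom i x -> nbhs (phi i x) A ->
  nbhs x [set x' | dom i x' /\ A (phi i x')].
Proof.
move=> dx Ax; apply: filterI; last exact: (phi_continuous dx).
by apply: open_nbhs_nbhs; split; [exact: dom_open|].
Qed.

Definition overlap i j : set 'rV[R]_n := phi i @` (dom i `&` dom j).

Lemma overlap_near i j x : dom i x -> dom j x ->
  \forall y \near phi i x, overlap i j y.
Proof.
move=> dx dx'; have dn : nbhs x (dom j) by apply: open_nbhs_nbhs; split; [exact: dom_open|].
have := chart_near dx dn.
apply: filterS => y [cy dy]; exists (phi_inv i y); last exact: phi_phi_inv.
by split=> //; exact: dom_phi_inv.
Qed.

Lemma trans_diff i j x : dom i x -> dom j x ->
  differentiable (phi j \o phi_inv i) (phi i x).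
Proof. by move=> dx dx'; apply: (transition_C2 i j).1; exists x. Qed.

Lemma jacE i j x v : v *m transition_jac i j x = 'd (phi j \o phi_inv i) (phi i x) v.
Proof. exact: mul_rV_lin1. Qed.

#[local] Opaque transition_jac.

Lemma jac_comp i j k x : dom i x -> dom j x -> dom k x ->
  transition_jac i k x = transition_jac i j x *m transition_jac j k x.
Proof.
move=> di dj dk.
have tj : (phi j \o phi_inv i) (phi i x) = phi j x by rewrite /= phi_invK.
have dij := trans_diff di dj; have djk := trans_diff dj dk; rewrite -tj in djk.
have nr : \forall y \near phi i x,
    (phi k \o phi_inv i) y = ((phi k \o phi_inv j) \o (phi j \o phi_inv i)) y.
  by apply: filterS (overlap_near di dj) => y [x' [di' dj'] <-] /=; rewrite !phi_invK.
have [_ E] := near_diff nr (differentiable_comp dij djk).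
have E' (v : 'rV[R]_n) : v *m transition_jac i k x = v *m (transition_jac i j x *m transition_jac j k x).
  rewrite mulmxA; apply: (etrans (jacE i k x v)).
  apply: (etrans (congr1 (fun f => f v) E)).
  apply: (etrans (congr1 (fun f => f v) (diff_comp dij djk))).
  apply: esym; apply: (etrans (jacE j k x _)).
  by rewrite tj; congr ('d _ _ _); exact: jacE.
by apply/row_matrixP => l; rewrite !rowE.
Qed.

Lemma jac_id i x : dom i x -> transition_jac i i x = 1%:M.
Proof.
move=> di.
have nr : \forall y \near phi i x, (phi i \o phi_inv i) y = id y.
  by apply: filterS (overlap_near di di) => y [x' [di' _] <-] /=; rewrite phi_invK.
have [_ E] := near_diff nr (@ex_diff _ _ _ _ _ _ _ (is_diff_id (phi i x))).
have E' (v : 'rV[R]_n) : v *m transition_jac i i x = v *m 1%:M.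
  rewrite mulmx1; apply: (etrans (jacE i i x v)).
  apply: (etrans (congr1 (fun f => f v) E)).
  by rewrite (@diff_val _ _ _ _ _ _ _ (is_diff_id (phi i x))).
by apply/row_matrixP => l; rewrite !rowE.
Qed.

Lemma jac_inv i j x : dom i x -> dom j x ->
  transition_jac i j x *m transition_jac j i x = 1%:M.
Proof. by move=> di dj; rewrite -jac_comp // jac_id. Qed.

Definition lh (H : cotangent M -> R) i (y p : 'rV[R]_n) : R := local_ham H i (y, p).

Lemma lh_local (H : cotangent M -> R) i y p : lh H i y p = local_ham H i (y, p).
Proof. by []. Qed.

Lemma lhE (H : cotangent M -> R) i x p : dom i x ->
  lh H i (phi i x) p = H (x, p *m (transition_jac (chart_at x) i x)^T).
Proof. by move=> di; rewrite -{2 3 4}(phi_invK di). Qed.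

#[local] Opaque lh.

Lemma lh_change (H : cotangent M -> R) i j x p : dom i x -> dom j x ->
  lh H j (phi j x) p = lh H i (phi i x) (p *m (transition_jac i j x)^T).
Proof.
move=> di dj; apply: (etrans (lhE H p dj)); apply: esym.
apply: (etrans (lhE H _ di)); apply: (congr1 (fun q => H (x, q))).
rewrite (jac_comp (dom_chart_at x) di dj) trmx_mul.
exact: esym (mulmxA _ _ _).
Qed.

(** Velocities transform by the Jacobian and momenta by its transpose, which leaves the pairing and
    hence the supremum unchanged. *)
Lemma lag_change (H : cotangent M -> R) i j x v : dom i x -> dom j x ->
  lag (lh H j) (phi j x) (v *m transition_jac i j x) = lag (lh H i) (phi i x) v.
Proof.
move=> di dj; rewrite /lag; apply: (congr1 sup); apply/seteqP; split=> [_ [p _ <-]|_ [p _ <-]].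
  exists (p *m (transition_jac i j x)^T); first by [].
  by rewrite -(lh_change H p di dj) pairing_mulmx.
exists (p *m (transition_jac j i x)^T); first by [].
rewrite -pairing_mulmx (lh_change H _ di dj) -mulmxA -trmx_mul.
by rewrite (jac_inv di dj) trmx1 mulmx1.
Qed.

Lemma lagrangianE (H : cotangent M -> R) i x v : dom i x ->
  lagrangian H (x, v *m transition_jac i (chart_at x) x) = lag (lh H i) (phi i x) v.
Proof.
move=> di; have da := dom_chart_at x.
apply: etrans (lag_change H v di da).
have E p : lh H (chart_at x) (phi (chart_at x) x) p = H (x, p).
  by rewrite (lhE H p da) (jac_id da) trmx1 mulmx1.
rewrite /lag /lagrangian; apply: (congr1 sup); apply/seteqP.
by split=> [_ [p _ <-]|_ [p _ <-]]; exists p; rewrite ?E.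
Qed.

Lemma chart_ball i x : dom i x ->
  exists2 r : R, 0 < r & forall y, `|y - phi i x| <= r -> chart_cod i y.
Proof.
move=> di; have cn : nbhs (phi i x) (chart_cod i).
  by apply: open_nbhs_nbhs; split; [exact: codom_open|exact: codom_phi].
have /nbhs_ballP[r /= r0 hr] := cn; exists (r / 2); first by move: r0; clra.
move=> y yr; suff : ball (phi i x) r y by move=> /hr.
by rewrite -ball_normE /= distrC; move: yr r0; clra.
Qed.

Lemma norm_eq_le (V : normedModType R) (a b : V) (c : R) : a = b -> `|b| <= c -> `|a| <= c.
Proof. by move=> ->. Qed.

Definition trans i j (y : 'rV[R]_n) := phi j (phi_inv i y).

Definition jac i j (y : 'rV[R]_n) : 'M[R]_n := transition_jac i j (phi_inv i y).

Lemma trans_bounds i j x : dom i x -> dom j x ->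
  exists2 r : R, 0 < r & exists2 C : R, 0 < C & forall (y y' w : 'rV[R]_n),
    `|y - phi i x| <= r -> `|y' - phi i x| <= r ->
    [/\ overlap i j y,
        `|trans i j y' - trans i j y - (y' - y) *m jac i j y| <= C * `|y' - y| ^+ 2,
        `|trans i j y' - trans i j y| <= C * `|y' - y|, `|w *m jac i j y| <= C * `|w|
      & `|w *m jac i j y' - w *m jac i j y| <= C * `|y' - y| * `|w|].
Proof.
move=> di dj; have on : nbhs (phi i x) (overlap i j) by exact: overlap_near.
have /nbhs_ballP[r /= r0 hr] := on.
have KU : [set y | `|y - phi i x| <= r / 2] `<=` overlap i j.
  by move=> y /= yr; apply: hr; rewrite -ball_normE /= distrC; move: yr r0; clra.
have [C C0 h] := C2_bounds (@frame_rV R n) (@closed_ball_compact R n (phi i x) (r / 2))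
  (@closed_ball_convex R n (phi i x) (r / 2)) KU (transition_C2 i j).
exists (r / 2); first by move: r0; clra.
have D0 : 0 < C + C * r by have := mulr_gt0 C0 r0; move: C0; clra.
exists (C + C * r); first exact: D0.
move=> y y' w yr y'r.
have [oy oy'] := (KU _ yr, KU _ y'r).
have Cy (c : R) : 0 <= c -> C * c <= (C + C * r) * c.
  by move=> c0; rewrite ler_wpM2r // lerDl mulr_ge0 // ltW.
have JE u (v : 'rV[R]_n) : overlap i j u -> v *m jac i j u = 'd (phi j \o phi_inv i) u v.
  by case=> x' [dx' _] <-; rewrite /jac phi_invK //; exact: jacE.
have [_ h1 h2 h3] := h y y' w yr y'r; have [_ h4 _ _] := h y y' (y' - y) yr y'r.
have yy : `|y' - y| <= r.
  by have := ler_distD (phi i x) y' y; rewrite [`|phi i x - y|]distrC; move: yr y'r; clra.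
have h3' : `|trans i j y' - trans i j y - (y' - y) *m jac i j y| <= C * `|y' - y| ^+ 2.
  exact: (norm_eq_le (congr1 (fun u => trans i j y' - trans i j y - u) (JE y (y' - y) oy)) h3).
have h4' : `|(y' - y) *m jac i j y| <= C * `|y' - y|.
  exact: (norm_eq_le (JE y (y' - y) oy) h4).
split; first exact: oy.
- by apply: (le_trans h3'); apply: Cy; exact: sqr_ge0.
- move: h3' h4'; move: ((y' - y) *m jac i j y) => u h3' h4'.
  rewrite -(subrK u (trans i j y' - trans i j y)); apply: (le_trans (ler_normD _ _)).
  rewrite mulrDl addrC; apply: lerD => //; apply: (le_trans h3').
  by rewrite expr2 mulrA ler_wpM2r // ler_wpM2l // ltW.
- by apply: (le_trans (norm_eq_le (JE y w oy) h1)); apply: Cy.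
- apply: (@le_trans _ _ (C * `|y' - y| * `|w|)).
    exact: (norm_eq_le (congr2 (fun u v => u - v) (JE y' w oy') (JE y w oy)) h2).
  by rewrite ler_wpM2r //; apply: Cy.
Qed.

End ManifoldBasics.

#[global] Opaque lh transition_jac lag.

(** * Quadratic forms, and the metric read in charts *)

Lemma norm_mx_entry (R : realType) (m n : nat) (A : 'M[R]_(m, n)) k l : `|A k l| <= `|A|.
Proof.
rewrite [`|A|]mx_normrE; exact: (le_bigmax _ (fun i : 'I_m * 'I_n => `|A i.1 i.2|) (k, l)).
Qed.

Lemma mulmx_bound (R : realType) (n : nat) (v : 'rV[R]_n) (A : 'M[R]_n) : `|v *m A| <= n%:R * `|A| * `|v|.
Proof.
apply: norm_le_entries => [|j]; first by rewrite !mulr_ge0.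
rewrite mxE; apply: (le_trans (ler_norm_sum _ _ _)).
rewrite -mulrA -[n in n%:R]card_ord -sum1_card natr_sum mulr_suml ler_sum // => k _.
by rewrite mul1r normrM mulrC ler_pM // ?norm_mx_entry // norm_entry.
Qed.

Lemma mulmx_continuous (R : realType) (n : nat) (A : 'M[R]_n) : continuous (fun v : 'rV[R]_n => v *m A).
Proof.
apply: (@lip_continuous _ _ _ _ (n%:R * `|A|)) => v w.
by rewrite -mulmxBl; exact: mulmx_bound.
Qed.

Section Quadratic.
Variables (R : realType) (n : nat).
Implicit Types (A : 'M[R]_n) (u v p : 'rV[R]_n).

Definition bil A u v : R := pairing (u *m A) v.

Lemma bilE A v : bil A v v = (v *m A *m v^T) 0 0.
Proof. by rewrite /bil pairing_mx. Qed.

Lemma bilC A u v : A^T = A -> bil A u v = bil A v u.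
Proof. by move=> sA; rewrite /bil -{1}sA pairing_mulmx pairingC. Qed.

Lemma bil_le A u v : `|bil A u v| <= n%:R * (n%:R * `|A|) * `|u| * `|v|.
Proof.
apply: (le_trans (pairing_le _ _)); rewrite ler_wpM2r // -mulrA ler_wpM2l //.
exact: mulmx_bound.
Qed.

Definition posdef A : Prop := A^T = A /\ forall v, v != 0 -> 0 < bil A v v.

Lemma posdef_ge0 A v : posdef A -> 0 <= bil A v v.
Proof.
move=> [_ h]; have [->|/h/ltW//] := eqVneq v 0.
by rewrite /bil pairing0r.
Qed.

Lemma posdef_unit A : posdef A -> A \in unitmx.
Proof.
move=> [_ h]; rewrite -row_free_unit -kermx_eq0; apply/eqP/row_matrixP => k.
rewrite row0; apply/eqP/contraT => /h.
by rewrite /bil -row_mul mulmx_ker row0 pairing0l ltxx.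
Qed.

Lemma bil_CS A u v : posdef A -> bil A u v ^+ 2 <= bil A u u * bil A v v.
Proof.
move=> pA; have [sA hA] := pA.
have [->|u0] := eqVneq u 0; first by rewrite /bil mul0mx !pairing0l expr0n mul0r.
have hu := hA u u0.
have := posdef_ge0 (bil A u u *: v - bil A u v *: u) pA.
have -> : bil A (bil A u u *: v - bil A u v *: u) (bil A u u *: v - bil A u v *: u) =
    bil A u u * (bil A u u * bil A v v - bil A u v ^+ 2).
  rewrite {1}/bil mulmxBl -!scalemxAl pairingBl !pairingBr !pairingZl !pairingZr.
  rewrite -!/(bil A _ _) (bilC v u sA); ring.
by rewrite pmulr_rge0 // subr_ge0.
Qed.

Definition qnorm A v : R := Num.sqrt (bil A v v).

Lemma qnorm_ge0 A v : 0 <= qnorm A v. Proof. exact: sqrtr_ge0. Qed.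

Lemma qnorm_sq A v : posdef A -> qnorm A v ^+ 2 = bil A v v.
Proof. by move=> pA; rewrite sqr_sqrtr // posdef_ge0. Qed.

Lemma bil_le_qnorm A u v : posdef A -> bil A u v <= qnorm A u * qnorm A v.
Proof.
move=> pA; apply: (le_trans (ler_norm _)).
rewrite -[leRHS]ger0_norm ?mulr_ge0 ?qnorm_ge0 // -ler_sqr ?nnegrE //.
by rewrite !real_normK ?num_real // exprMn !qnorm_sq // bil_CS.
Qed.

(** The dual norm of [qnorm A], as the norm of the vector that represents p through A. *)
Definition dnorm A p : R := qnorm A (p *m invmx A).

Lemma dnorm_CS A p v : posdef A -> pairing p v <= dnorm A p * qnorm A v.
Proof.
move=> pA; have := bil_le_qnorm (p *m invmx A) v pA.
by rewrite /bil -mulmxA mulVmx ?posdef_unit // mulmx1.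
Qed.

Lemma dnorm_dual A v : posdef A -> exists p, dnorm A p <= 1 /\ pairing p v = qnorm A v.
Proof.
move=> pA; have [q0|q0] := eqVneq (qnorm A v) 0.
  exists 0; rewrite pairing0l q0 /dnorm mul0mx /qnorm /bil mul0mx pairing0l sqrtr0.
  by split.
have q1 : 0 < qnorm A v by rewrite lt_neqAle eq_sym q0 qnorm_ge0.
have sq := qnorm_sq v pA; move: q1 sq; move: (qnorm A v) => s q1 sq.
have E : bil A (s^-1 *: v) (s^-1 *: v) = 1.
  rewrite /bil -scalemxAl pairingZl pairingZr -/(bil A v v) -sq; field.
  by rewrite gt_eqF.
exists (s^-1 *: (v *m A)); split.
  by rewrite /dnorm -scalemxAl -mulmxA mulmxV ?posdef_unit // mulmx1 /qnorm E sqrtr1.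
by rewrite pairingZl -/(bil A v v) -sq expr2 mulKf // gt_eqF.
Qed.

Lemma dnorm_attained A p : posdef A ->
  exists v, qnorm A v = dnorm A p /\ pairing p v = dnorm A p ^+ 2.
Proof.
move=> pA; exists (p *m invmx A); split=> //.
by rewrite qnorm_sq // /bil -mulmxA mulVmx ?posdef_unit // mulmx1.
Qed.

Lemma qnormZ A a v : posdef A -> qnorm A (a *: v) = `|a| * qnorm A v.
Proof.
move=> pA; rewrite /qnorm /bil -scalemxAl pairingZl pairingZr mulrA -expr2.
by rewrite sqrtrM ?sqr_ge0 // sqrtr_sqr.
Qed.

Lemma qnormD A u v : posdef A -> qnorm A (u + v) <= qnorm A u + qnorm A v.
Proof.
move=> pA; have [p [p1 <-]] := dnorm_dual (u + v) pA.
rewrite pairingDr; apply: lerD; apply: (le_trans (dnorm_CS _ _ pA));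
by rewrite ler_piMl // qnorm_ge0.
Qed.

Lemma posdef_lower A : posdef A -> exists2 c : R, 0 < c & forall v, c * `|v| ^+ 2 <= bil A v v.
Proof.
move=> pA; pose S := [set v : 'rV[R]_n | `|v| = 1].
(* For n = 0 the unit sphere is empty and every vector is 0. *)
have [[v1 S1]|S0] := pselect (S !=set0); last first.
  exists 1 => // v; suff -> : v = 0 by rewrite normr0 expr0n mulr0 /bil pairing0r.
  apply/eqP; apply: contra_notT S0 => v0; exists (`|v|^-1 *: v).
  by rewrite /S /= normrZ normfV normr_id mulVf // normr_eq0.
have cS : compact S.
  apply: bounded_closed_compact.
    by exists 1; split=> // x x1 v /= ->; exact: ltW.
  have -> : S = (fun v : 'rV[R]_n => `|v|) @^-1` [set 1] by [].
  apply: closed_comp => [v _|]; last exact: closed_eq.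
  exact: norm_continuous.
have cB : {within S, continuous (fun v => bil A v v)}.
  apply: continuous_in_subspaceT => v _; apply/eps_continuous => e e0.
  pose m := n%:R * (n%:R * `|A|) : R.
  have m0 : 0 <= m by rewrite !mulr_ge0.
  have D0 : 0 < m * (2 * `|v| + 1) + 1.
    by apply: ltr_wpDl => //; apply: mulr_ge0 => //; have := normr_ge0 v; clra.
  pose d := Num.min 1 (e / (m * (2 * `|v| + 1) + 1)).
  have d0 : 0 < d by rewrite lt_min ltr01 divr_gt0.
  exists d => // w wd.
  have d1 : d <= 1 by rewrite ge_min lexx.
  have d2 : d * (m * (2 * `|v| + 1) + 1) <= e.
    by rewrite -ler_pdivlMr // ge_min lexx orbT.
  have -> : bil A w w - bil A v v = bil A (w - v) w + bil A v (w - v).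
    by rewrite /bil mulmxBl pairingBl pairingBr subrKA.
  apply: (le_trans (ler_normD _ _)).
  apply: (le_trans (lerD (bil_le A (w - v) w) (bil_le A v (w - v)))).
  have wv : `|w| <= `|v| + 1.
    by have := ler_normD (w - v) v; rewrite subrK; move: wd d1; clra.
  rewrite -/m; apply: le_trans d2.
  move: m0 wv (normr_ge0 v) (normr_ge0 w) (ltW wd) (normr_ge0 (w - v)) (ltW d0).
  clear; move: `|w - v| `|v| `|w| => b a c m0 ca a0 c0 bd b0 d0.
  have h : m * b * c <= m * d * (a + 1) by rewrite ler_pM ?mulr_ge0 // ler_wpM2l.
  have h' : m * a * b <= m * a * d by rewrite ler_wpM2l ?mulr_ge0.
  by move: h h' d0; clear; intros; nra.
have [v0] := compact_EVT_min (ex_intro _ v1 S1) cS cB; rewrite inE => S2 vmin.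
have v00 : v0 != 0 by rewrite -normr_eq0 S2 oner_eq0.
exists (bil A v0 v0); first exact: pA.2.
move=> v; have [->|vn0] := eqVneq v 0.
  by rewrite normr0 expr0n mulr0 /bil pairing0r.
have nv : 0 < `|v| by rewrite normr_gt0.
have := vmin (`|v|^-1 *: v); rewrite inE /S /= normrZ normfV normr_id mulVf ?gt_eqF //.
move=> /(_ erefl); rewrite {2}/bil -scalemxAl pairingZl pairingZr -/(bil A v v) mulrA.
by rewrite -invfM -expr2 mulrC ler_pdivlMr ?exprn_gt0.
Qed.

End Quadratic.

Lemma le_of_sq (R : realType) (a b u w k : R) : 0 <= b -> 0 <= k ->
  a ^+ 2 = u -> b ^+ 2 = w -> u <= k ^+ 2 * w -> a <= k * b.
Proof.
move=> b0 k0 <- <-; rewrite -exprMn => h; have kb : 0 <= k * b by apply: mulr_ge0.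
rewrite leNgt; apply/negP => ba; move: h; rewrite leNgt => /negP; apply.
by rewrite ltrXn2r // (ltW (le_lt_trans kb ba)).
Qed.

Section ChartMetric.
Variables (R : realType) (n : nat) (M : c2_manifold R n) (g : riemannian_metric M).
Implicit Types (i j : chart M) (x : M) (y z v p : 'rV[R]_n).

Definition tn i y v : R := qnorm (local_gram g i y) v.

Definition cn i y p : R := dnorm (local_gram g i y) p.

Lemma local_gramE i x : dom i x -> local_gram g i (phi i x) =
  transition_jac i (chart_at x) x *m g x *m (transition_jac i (chart_at x) x)^T.
Proof. by move=> di; rewrite /local_gram (phi_invK di). Qed.

Lemma local_bilE i x v : dom i x -> bil (local_gram g i (phi i x)) v v =
  bil (g x) (v *m transition_jac i (chart_at x) x) (v *m transition_jac i (chart_at x) x).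
Proof.
move=> di; rewrite (local_gramE di); move: (transition_jac _ _ _) => J.
by rewrite /bil !mulmxA pairing_mulmx.
Qed.

Lemma jac_neq0 i j x v : dom i x -> dom j x -> v != 0 -> v *m transition_jac i j x != 0.
Proof.
move=> di dj; apply: contraNneq => h.
have : v *m (transition_jac i j x *m transition_jac j i x) = 0 by rewrite mulmxA h mul0mx.
by rewrite (jac_inv di dj) mulmx1 => ->.
Qed.

Lemma local_gram_posdef i y : chart_cod i y -> posdef (local_gram g i y).
Proof.
case=> x di <-; split.
  rewrite (local_gramE di); move: (transition_jac _ _ _) => J.
  by rewrite !trmx_mul trmxK (gram_sym g) mulmxA.
move=> v v0; rewrite (local_bilE v di) bilE; apply: gram_pos.
exact: jac_neq0 di (dom_chart_at x) v0.
Qed.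

Lemma tnormE i x v : dom i x ->
  tnorm g (x, v *m transition_jac i (chart_at x) x) = tn i (phi i x) v.
Proof. by move=> di; rewrite /tn /qnorm (local_bilE v di) bilE. Qed.

Lemma conormE i x p : dom i x ->
  conorm g (x, p *m (transition_jac (chart_at x) i x)^T) = cn i (phi i x) p.
Proof.
move=> di; have da := dom_chart_at x.
have pA := local_gram_posdef (codom_phi di).
have pg : posdef (g x).
  by split; [exact: gram_sym|move=> v /gram_pos; rewrite bilE; apply].
rewrite /cn /dnorm /qnorm /bil -(mulmxA p) (mulVmx (posdef_unit pA)) mulmx1 pairingC pairing_mx.
rewrite /conorm /=; apply: (congr1 (fun A : 'M[R]_1 => Num.sqrt (A 0 0))).
have JJ := jac_inv di da; have JJ' := jac_inv da di; move: (local_gramE di).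
move: pA; move: (local_gram g i (phi i x)) => A pA eA; move: eA JJ JJ'.
move: (transition_jac i _ x) (transition_jac _ i x) => J J' eA JJ JJ'.
rewrite trmx_mul trmxK !mulmxA; congr (_ *m _); rewrite -!mulmxA; congr (_ *m _).
have AX : A *m (J'^T *m (invmx (g x) *m J')) = 1%:M.
  rewrite eA -!mulmxA (mulmxA J^T) -trmx_mul JJ' trmx1 mul1mx (mulmxA (g x)).
  by rewrite (mulmxV (posdef_unit pg)) mul1mx JJ.
by rewrite -[LHS]mul1mx -(mulVmx (posdef_unit pA)) -mulmxA AX mulmx1.
Qed.

Lemma pairing_le_tn i y p v : chart_cod i y -> pairing p v <= cn i y p * tn i y v.
Proof. by move=> cy; apply: dnorm_CS; exact: local_gram_posdef. Qed.

Lemma tn_dual i y v : chart_cod i y -> exists p, cn i y p <= 1 /\ pairing p v = tn i y v.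
Proof. by move=> cy; apply: dnorm_dual; exact: local_gram_posdef. Qed.

Lemma tnZ i y a v : chart_cod i y -> tn i y (a *: v) = `|a| * tn i y v.
Proof. by move=> cy; apply: qnormZ; exact: local_gram_posdef. Qed.

Lemma tnD i y v w : chart_cod i y -> tn i y (v + w) <= tn i y v + tn i y w.
Proof. by move=> cy; apply: qnormD; exact: local_gram_posdef. Qed.

Lemma tn_ge0 i y v : 0 <= tn i y v. Proof. exact: qnorm_ge0. Qed.

Lemma cn_ge0 i y p : 0 <= cn i y p. Proof. exact: qnorm_ge0. Qed.

Lemma cnD i y p q : chart_cod i y -> cn i y (p + q) <= cn i y p + cn i y q.
Proof.
move=> cy; rewrite /cn /dnorm mulmxDl; apply: qnormD; exact: local_gram_posdef.
Qed.

Lemma cnZ i y a p : chart_cod i y -> cn i y (a *: p) = `|a| * cn i y p.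
Proof.
move=> cy; rewrite /cn /dnorm -scalemxAl; apply: qnormZ; exact: local_gram_posdef.
Qed.

(** Continuity of the Gram matrix makes the metric nearly constant on a small ball, where norms can
    be frozen at the centre up to a factor 2; [kappa] compares them with the sup norm of
    coordinates. *)
Lemma metric_ball i z : chart_cod i z ->
  exists r kappa : R, [/\ 0 < r, gauge (tn i z) kappa,
    forall y, `|y - z| <= r -> chart_cod i y
  & forall y v p, `|y - z| <= r ->
    [/\ tn i y v <= 2 * tn i z v, tn i z v <= 2 * tn i y v,
        `|v| <= kappa * tn i y v /\ tn i y v <= kappa * `|v|
      & `|p| <= kappa * cn i y p /\ cn i y p <= kappa * `|p|]].
Proof.
move=> cz.
have [r0 r00 hr0] : exists2 r : R, 0 < r & forall y, `|y - z| <= r -> chart_cod i y.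
  by case: cz => x di <-; exact: chart_ball.
have [A [eA pz]] : exists A, A = local_gram g i z /\ posdef A.
  by exists (local_gram g i z); split=> //; exact: local_gram_posdef.
have tz v : tn i z v = qnorm A v by rewrite eA.
have [c c0 hc] := posdef_lower pz.
have cont : {for z, continuous (local_gram g i)}.
  by apply: differentiable_continuous; exact: (gram_C1 g i).1.
pose m : R := n%:R * n%:R.
have m0 : 0 <= m by rewrite mulr_ge0.
(* With 3/4 the form at y lies between 1/4 and 7/4 of the form at z, so that the norms differ by a
   factor at most 2 in both directions. *)
pose e := 3 / 4 * c / (m + 1).
have m1 : 0 < m + 1 by move: m0; clra.
have e0 : 0 < e by rewrite /e !mulr_gt0 ?invr_gt0.
have [d d0 hd] := (eps_continuous (local_gram g i) z).2 cont e e0.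
have near y v : `|y - z| < d -> `|bil (local_gram g i y) v v - bil A v v| <= 3 / 4 * bil A v v.
  move=> /hd; rewrite -eA; move: (local_gram g i y) => B BA.
  have -> : bil B v v - bil A v v = bil (B - A) v v by rewrite /bil mulmxBr pairingBl.
  apply: (le_trans (bil_le _ _ _)).
  have h1 : n%:R * (n%:R * `|B - A|) * `|v| * `|v| <= m * e * `|v| ^+ 2.
    rewrite -mulrA -expr2 ler_wpM2r ?sqr_ge0 // mulrA -/m.
    by rewrite ler_wpM2l.
  apply: (le_trans h1); have h2 : m * e <= 3 / 4 * c.
    rewrite /e mulrA ler_pdivrMr // mulrC ler_wpM2l //; last by clra.
    by rewrite !mulr_ge0 // ltW.
  apply: (@le_trans _ _ (3 / 4 * c * `|v| ^+ 2)); first by rewrite ler_wpM2r ?sqr_ge0.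
  by rewrite -mulrA ler_wpM2l //; exact: hc.
pose r := Num.min r0 (d / 2).
have rd : r < d.
  by have : r <= d / 2 by [rewrite ge_min lexx orbT]; move: d0; clra.
have cod y : `|y - z| <= r -> chart_cod i y.
  by move=> yr; apply: hr0; apply: (le_trans yr); rewrite ge_min lexx.
pose k0 := 1 + c^-1 + m * `|A|.
have ci0 : 0 < c^-1 by rewrite invr_gt0.
have mA0 : 0 <= m * `|A| by rewrite mulr_ge0.
have k00 : 0 < k0 by rewrite /k0; move: ci0 mA0; clra.
have lb v : `|v| <= k0 * tn i z v.
  rewrite tz; apply: (le_of_sq (qnorm_ge0 A v) (ltW k00) erefl (qnorm_sq v pz)).
  apply: (@le_trans _ _ (c^-1 * bil A v v)).
    by rewrite mulrC ler_pdivlMr // mulrC.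
  rewrite ler_wpM2r ?posdef_ge0 // /k0; move: ci0 mA0; move: (c^-1) (m * `|A|).
  by clear; intros; nra.
have ub v : tn i z v <= k0 * `|v|.
  rewrite tz; apply: (le_of_sq (normr_ge0 v) (ltW k00) (qnorm_sq v pz) erefl).
  apply: (le_trans (ler_norm _)).
  apply: (le_trans (bil_le _ _ _)); rewrite -mulrA -expr2 ler_wpM2r ?sqr_ge0 // mulrA -/m.
  by rewrite /k0; move: ci0 mA0; move: (c^-1) (m * `|A|); clear; intros; nra.
have two : 0 <= 2 :> R := ler0n R 2.
have up y v : `|y - z| <= r -> tn i y v <= 2 * tn i z v.
  move=> yr; have := near y v (le_lt_trans yr rd); rewrite ler_norml => /andP[h1 h2].
  rewrite tz; apply: (le_of_sq (qnorm_ge0 A v) two (qnorm_sq v (local_gram_posdef (cod y yr))) (qnorm_sq v pz)).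
  move: (posdef_ge0 v pz) h2; move: (bil A v v) (bil (local_gram g i y) v v) => a b; clra.
have lo y v : `|y - z| <= r -> tn i z v <= 2 * tn i y v.
  move=> yr; have := near y v (le_lt_trans yr rd); rewrite ler_norml => /andP[h1 h2].
  rewrite tz; apply: (le_of_sq (tn_ge0 i y v) two (qnorm_sq v pz) (qnorm_sq v (local_gram_posdef (cod y yr)))).
  move: (posdef_ge0 v pz) h1; move: (bil A v v) (bil (local_gram g i y) v v) => a b; clra.
have kap1 : k0 <= 2 * k0 * (n%:R + 1).
  have : 0 <= k0 * n%:R by rewrite mulr_ge0 // ltW.
  by move: k00; clra.
have kap2 : 2 * k0 <= 2 * k0 * (n%:R + 1).
  have : 0 <= k0 * n%:R by rewrite mulr_ge0 // ltW.
  by move: k00; clra.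
have kap3 : 2 * k0 * n%:R <= 2 * k0 * (n%:R + 1) by move: k00; clra.
exists r, (2 * k0 * (n%:R + 1)); split.
- by rewrite lt_min r00 divr_gt0.
- split.
  + by move: kap1 k00; clra.
  + by move=> v w; exact: tnD.
  + by move=> a v; exact: tnZ.
  + by move=> v; apply: (le_trans (lb v)); rewrite ler_wpM2r ?tn_ge0.
  + by move=> v; apply: (le_trans (ub v)); rewrite ler_wpM2r.
- exact: cod.
move=> y v p yr.
have lby w : `|w| <= 2 * k0 * tn i y w.
  apply: (le_trans (lb w)); rewrite mulrAC (mulrC _ k0) ler_pM2l //.
  by rewrite mulrC; apply: le_trans (lo y w yr) _; rewrite mulrC.
have uby w : tn i y w <= 2 * k0 * `|w|.
  by apply: (le_trans (up y w yr)); rewrite -mulrA ler_pM2l.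
split; [exact: up|exact: lo| |].
  split; first by apply: (le_trans (lby v)); rewrite ler_wpM2r ?tn_ge0.
  by apply: (le_trans (uby v)); rewrite ler_wpM2r.
have cy := cod y yr; split.
  apply: (@le_trans _ _ (2 * k0 * cn i y p)); last by rewrite ler_wpM2r ?cn_ge0.
  apply: norm_le_entries => [|l]; first by rewrite mulr_ge0 ?cn_ge0 // mulr_ge0 // ltW.
  have nd : `|delta_mx 0 l : 'rV[R]_n| <= 1.
    apply: norm_le_entries => // l'; rewrite mxE; case: (_ && _); by rewrite ?normr1 ?normr0.
  have td : tn i y (delta_mx 0 l) <= 2 * k0.
    apply: (le_trans (uby _)); by rewrite ler_piMr // mulr_ge0 // ltW.
  have td' : tn i y (- delta_mx 0 l) <= 2 * k0.
    apply: (le_trans (uby _)); by rewrite normrN ler_piMr // mulr_ge0 // ltW.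
  have h1 := le_trans (pairing_le_tn p (delta_mx 0 l) cy) (ler_wpM2l (cn_ge0 i y p) td).
  have h2 := le_trans (pairing_le_tn p (- delta_mx 0 l) cy) (ler_wpM2l (cn_ge0 i y p) td').
  by move: h1 h2; rewrite pairingNr pairing_delta ler_norml; clra.
apply: (@le_trans _ _ (2 * k0 * n%:R * `|p|)); last by rewrite ler_wpM2r.
have [v' [e1 e2]] := dnorm_attained p (local_gram_posdef cy).
have [c00|c0'] := eqVneq (cn i y p) 0.
  by rewrite c00 !mulr_ge0 // ltW.
have cp : 0 < cn i y p by rewrite lt_neqAle eq_sym c0' cn_ge0.
rewrite -(ler_pM2l cp) -expr2 /cn -e2; apply: (le_trans (ler_norm _)).
apply: (le_trans (pairing_le _ _)); rewrite -e1.
have := lby v'; rewrite /tn => h.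
apply: (le_trans (ler_wpM2l (mulr_ge0 (ler0n R n) (normr_ge0 p)) h)).
move: (qnorm (local_gram g i y) v') => q; rewrite le_eqVlt; apply/orP; left; apply/eqP; ring.
Qed.

End ChartMetric.

#[global] Opaque tn cn.

(** * Tonelli Hamiltonians read in charts *)

Lemma diff_snd (R : realType) (U V W : normedModType R) (f : U * V -> W) y q :
  differentiable f (y, q) -> differentiable (fun q => f (y, q)) q /\
  forall v, 'd (fun q => f (y, q)) q v = 'd f (y, q) (0, v).
Proof.
move=> df.
have dc : differentiable (fun _ : V => y) q by exact: differentiable_cst.
have di : differentiable (fun q : V => q) q by exact: (@ex_diff _ _ _ _ _ _ _ (is_diff_id q)).
have dp : differentiable (fun q : V => (y, q)) q by exact: differentiable_pair.
split; first exact: (differentiable_comp dp df).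
move=> v; apply: (etrans (congr1 (fun h => h v) (diff_comp dp df))) => /=.
congr ('d f _ _); apply: (etrans (congr1 (fun h => h v) (diff_pair dc di))) => /=.
congr pair; first by rewrite (diff_cst y q).
by rewrite (@diff_val _ _ _ _ _ _ _ (is_diff_id q)).
Qed.

Lemma diff_mulmx (R : realType) (n : nat) (W : normedModType R) (f : 'rV[R]_n -> W)
    (A : 'M[R]_n) (q : 'rV[R]_n) :
  differentiable f (q *m A) -> differentiable (fun q => f (q *m A)) q /\
  forall v, 'd (fun q => f (q *m A)) q v = 'd f (q *m A) (v *m A).
Proof.
move=> df; have cA : continuous (mulmxr A : {linear 'rV[R]_n -> 'rV[R]_n}).
  exact: mulmx_continuous.
have dA : differentiable (mulmxr A : {linear 'rV[R]_n -> 'rV[R]_n}) q.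
  exact: linear_differentiable.
split; first exact: (differentiable_comp dA df).
move=> v; apply: (etrans (congr1 (fun h => h v) (diff_comp dA df))) => /=.
by congr ('d f _ _); rewrite diff_lin.
Qed.

Section TonelliGood.
Variables (R : realType) (n : nat) (M : c2_manifold R n).
Implicit Types (i j : chart M) (x : M) (y z v w p q : 'rV[R]_n) (H : cotangent M -> R).

Definition grad_x H i y p : 'rV[R]_n := \row_k ('d (local_ham H i) (y, p) (delta_mx 0 k, 0) : R).

Definition grad_p H i y p : 'rV[R]_n := \row_k ('d (local_ham H i) (y, p) (0, delta_mx 0 k) : R).

Lemma local_diffE H i y p v w : 'd (local_ham H i) (y, p) (v, w) =
  pairing (grad_x H i y p) v + pairing (grad_p H i y p) w.
Proof.
have [-> _] := @frame_prod R n (v, w); rewrite linear_sum big_sumType /=; congr (_ + _).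
  by apply: eq_bigr => k _; rewrite linearZ mxE mulrC.
by apply: eq_bigr => k _; rewrite linearZ mxE mulrC.
Qed.

(** Positivity is assumed in the preferred chart at x only; the passage to the chart i is a linear
    substitution in the fiber, which turns the direction w into w B, again nonzero. *)
Lemma hess_pos (g : riemannian_metric M) H i y p w : tonelli g H -> chart_cod i y -> w != 0 ->
  0 < 'd (fun u => 'd (local_ham H i) u (0, w)) (y, p) (0, w).
Proof.
move=> [HC _ _ Hpos] cy w0; have dx := dom_phi_inv cy; set x := phi_inv i y in dx.
have yx : y = phi i x by rewrite /x phi_phi_inv.
pose a := chart_at x; have da : dom a x := dom_chart_at x.
have ca : chart_cod a (phi a x) := codom_phi da.
pose B := (transition_jac a i x)^T.
have wB : w *m B != 0.
  apply: contra_neq w0 => h; have : w *m (B *m (transition_jac i a x)^T) = 0.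
    by rewrite mulmxA h mul0mx.
  by rewrite /B -trmx_mul (jac_inv dx da) trmx1 mulmx1.
pose h : 'rV[R]_n -> R^o := fun q => H (x, q).
have hE : h = fun q => local_ham H a (phi a x, q).
  by apply/funext => q; rewrite -lh_local (lhE H q da) (jac_id da) trmx1 mulmx1.
have in_cod j (u : 'rV[R]_n) q : chart_cod j u -> (chart_cod j `*` setT) (u, q) by move=> cu; split.
have dH j (u : 'rV[R]_n) q : chart_cod j u -> differentiable (local_ham H j) (u, q).
  by move=> cu; apply: (HC j).1; exact: in_cod.
have dH2 j (y0 : 'rV[R]_n) q (v : 'rV[R]_n * 'rV[R]_n) : chart_cod j y0 -> differentiable (fun u => 'd (local_ham H j) u v) (y0, q).
  by move=> cu; apply: ((HC j).2 v).1; exact: in_cod.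
have dh q : differentiable h q by rewrite hE; exact: (diff_snd (dH a _ q ca)).1.
have dhE q v : 'd h q v = 'd (local_ham H a) (phi a x, q) (0, v).
  by rewrite hE; exact: (diff_snd (dH a _ q ca)).2.
pose k : 'rV[R]_n -> R^o := fun q => 'd h q (w *m B).
have kE : k = fun q => 'd (local_ham H a) (phi a x, q) (0, w *m B).
  by apply/funext => q; exact: dhE.
have dk q : differentiable k q by rewrite kE; exact: (diff_snd (dH2 a _ q _ ca)).1.
have e1 q : 'd (local_ham H i) (y, q) (0, w) = k (q *m B).
  have := (diff_snd (dH i _ q cy)).2 w => <-.
  have E : (fun q => local_ham H i (y, q)) = (fun q => h (q *m B)).
    by apply/funext => q'; rewrite -lh_local {1}yx (lhE H q' dx).
  by rewrite E; exact: (diff_mulmx (dh (q *m B))).2.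
have e2 : 'd (fun u => 'd (local_ham H i) u (0, w)) (y, p) (0, w) = 'd k (p *m B) (w *m B).
  have := (diff_snd (dH2 i _ p (0, w) cy)).2 w => <-.
  have -> : (fun q => 'd (local_ham H i) (y, q) (0, w)) = (fun q => k (q *m B)).
    by apply/funext => q; exact: e1.
  exact: (diff_mulmx (dk (p *m B))).2.
by rewrite e2; exact: (Hpos x (p *m B) (w *m B) wB).
Qed.

End TonelliGood.

Lemma continuous_big_sum (R : realType) (T : topologicalType) (I : finType) (f : I -> T -> R) x :
  (forall k, {for x, continuous (f k)}) -> {for x, continuous (fun y => \sum_k f k y)}.
Proof.
move=> cf; have h (s : seq I) : {for x, continuous (fun y => \sum_(k <- s) f k y : R^o)}.
  elim: s => [|k s IH].
    have -> : (fun y => \sum_(k <- [::]) f k y) = (fun _ => 0 : R^o) by apply/funext => y; rewrite big_nil.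
    exact: cst_continuous.
  have -> : (fun y => \sum_(k0 <- k :: s) f k0 y : R^o) =
      (f k : T -> R^o) + (fun y => \sum_(k <- s) f k y : R^o).
    by apply/funext => y; rewrite big_cons.
  apply: (@continuousD R R^o T) => //; exact: cf.
exact: (h (index_enum I)).
Qed.

Lemma continuous_mul_fun (R : realType) (T : topologicalType) (f g : T -> R) x :
  {for x, continuous f} -> {for x, continuous g} -> {for x, continuous (fun y => f y * g y)}.
Proof. by move=> cf cg; have := @continuousM R T f g x cf cg. Qed.

Lemma is_diff_big_sum (R : realType) (V W : normedModType R) (I : finType) (a : I -> R)
    (f : I -> V -> W) x :
  (forall k, differentiable (f k) x) -> forall v,
  'd (fun y => \sum_k a k *: f k y) x v = \sum_k a k *: 'd (f k) x v.
Proof.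
move=> df v; have h (s : seq I) : is_diff x (fun y => \sum_(k <- s) a k *: f k y)
    (fun v => \sum_(k <- s) a k *: 'd (f k) x v).
  elim: s => [|k s IH].
    have -> : (fun y => \sum_(k <- [::]) a k *: f k y) = cst 0 by apply/funext => y; rewrite big_nil.
    have -> : (fun v => \sum_(k <- [::]) a k *: 'd (f k) x v) = 0 by apply/funext => y; rewrite big_nil.
    exact: is_diff_cst.
  have -> : (fun y => \sum_(k <- k :: s) a k *: f k y) =
      (a k *: f k) + (fun y => \sum_(k <- s) a k *: f k y).
    by apply/funext => y; rewrite big_cons.
  have -> : (fun v => \sum_(k <- k :: s) a k *: 'd (f k) x v) =
      (a k *: ('d (f k) x : V -> W)) + (fun v => \sum_(k <- s) a k *: 'd (f k) x v).
    by apply/funext => y; rewrite big_cons.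
  by apply: is_diffD; apply: is_diffZ; exact: differentiableP.
by have [_ ->] := h (index_enum I).
Qed.

Section TonelliHamloc.
Variables (R : realType) (n : nat) (M : c2_manifold R n) (g : riemannian_metric M).
Variables (H : cotangent M -> R) (i : chart M) (z : 'rV[R]_n) (r : R).
Local Notation E := 'rV[R]_n.
Let f : E * E -> R^o := local_ham H i.

(** Expanding in coordinates turns continuity for each fixed direction into joint continuity in the
    point and in w, as needed to minimize over a compact set. *)
Lemma hess_expand (u : E * E) (w : E) :
  (forall v, differentiable (fun u => 'd f u v) u) ->
  'd (fun u => 'd f u (0, w)) u (0, w) =
  \sum_k w 0 k * \sum_l w 0 l * 'd (fun u => 'd f u (0, delta_mx 0 k)) u (0, delta_mx 0 l) :> R.
Proof.
move=> df.
have expw (h : {linear (E * E)%type -> R^o}) : h (0, w) = \sum_k w 0 k *: h (0, delta_mx 0 k).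
  have [ew _] := @frame_prod R n (0, w); apply: (etrans (congr1 h ew)).
  rewrite linear_sum big_sumType /=.
  rewrite big1 ?add0r; last by move=> k _; rewrite mxE scale0r linear0.
  by apply: eq_bigr => k _; rewrite linearZ.
have E1 : (fun u => 'd f u (0, w)) = fun u => \sum_k w 0 k *: 'd f u (0, delta_mx 0 k).
  by apply/funext => u'; exact: expw.
apply: (etrans (congr1 (fun h : E * E -> R^o => 'd h u (0, w)) E1)).
apply: (etrans (@is_diff_big_sum R _ R^o _ (fun k => w 0 k)
  (fun k u => 'd f u (0, delta_mx 0 k)) u (fun k => df _) (0, w))).
by apply: eq_bigr => k _; apply: (congr1 (fun t => w 0 k * t)); exact: expw.
Qed.

Lemma tonelli_convex P : tonelli g H -> (forall y, `|y - z| <= r -> chart_cod i y) ->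
  exists2 a : R, 0 < a & forall y p p', `|y - z| <= r -> `|p| <= P -> `|p'| <= P ->
    lh H i y p + pairing (grad_p H i y p) (p' - p) + a * `|p' - p| ^+ 2 <= lh H i y p'.
Proof.
move=> TH cod; have [/(_ i) [df0 df1] _ _ _] := TH.
have inc y (p : E) : `|y - z| <= r -> (chart_cod i `*` setT) (y, p) by move=> /cod; split.
have dd v y (p : E) : `|y - z| <= r -> differentiable (fun u => 'd f u v) (y, p).
  by move=> yr; apply: (df1 v).1; exact: inc.
pose S := [set v : E | `|v| = 1].
have [[v1 S1]|S0] := pselect (S !=set0); last first.
  have z0 v : v = 0 :> E.
    apply/eqP; apply: contra_notT S0 => v0; exists (`|v|^-1 *: v).
    by rewrite /S /= normrZ normfV normr_id mulVf // normr_eq0.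
  exists 1 => // y p p' _ _ _; rewrite [p' - p]z0 [p]z0 [p']z0.
  by rewrite pairing0r normr0 expr0n mulr0 !addr0.
have [[[y1 p1] [yr1 pP1]]|K0] := pselect (([set y : E | `|y - z| <= r] `*` [set p : E | `|p - 0| <= P]) !=set0); last first.
  exists 1 => // y p p' yr pP _; exfalso; apply: K0; exists (y, p); split => //=.
  by rewrite subr0.
pose K := ([set y : E | `|y - z| <= r] `*` [set p : E | `|p - 0| <= P]) `*` S.
have cS : compact S.
  apply: bounded_closed_compact.
    by exists 1; split=> // x x1 v /= ->; exact: ltW.
  have -> : S = (fun v : E => `|v|) @^-1` [set 1] by [].
  apply: closed_comp => [v _|]; last exact: closed_eq.
  exact: norm_continuous.
have cK : compact K.
  by apply: compact_setX => //; apply: compact_setX; exact: closed_ball_compact.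
pose D2 k l (u : E * E) : R := 'd (fun u => 'd f u (0, delta_mx 0 k)) u (0, delta_mx 0 l).
pose Phi (t : (E * E) * E) : R := \sum_k t.2 0 k * \sum_l t.2 0 l * D2 k l t.1.
have cPhi : {within K, continuous Phi}.
  apply: continuous_in_subspaceT => -[[y p] w]; rewrite inE => -[[/= yr pP] Sw].
  have c2 : continuous (fun t : (E * E) * E => t.2) by move=> t; exact: cvg_snd.
  have c1 : continuous (fun t : (E * E) * E => t.1) by move=> t; exact: cvg_fst.
  have cw k : continuous (fun t : (E * E) * E => t.2 0 k).
    move=> t; apply: (@continuous_comp _ _ _ (fun t : (E * E) * E => t.2) (fun w : E => w 0 k)).
      exact: c2.
    exact: coord_continuous.
  apply: continuous_big_sum => k; apply: continuous_mul_fun; first exact: cw.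
  apply: continuous_big_sum => l; apply: continuous_mul_fun; first exact: cw.
  apply: (@continuous_comp _ _ _ (fun t : (E * E) * E => t.1) (D2 k l)); first exact: c1.
  have [_ cD] := df1 (0, delta_mx 0 k).
  have yp := inc y p yr; have := cD (0, delta_mx 0 l) _ yp; exact.
have KN : K !=set0 by exists ((y1, p1), v1).
have [[[y0 p0] w0]] := compact_EVT_min KN cK cPhi; rewrite inE => -[[/= yr0 pP0] Sw0] Pmin.
have hessPhi y p w : `|y - z| <= r -> 'd (fun u => 'd f u (0, w)) (y, p) (0, w) = Phi (y, p, w).
  by move=> yr; apply: hess_expand => v; exact: dd.
have a0 : 0 < Phi (y0, p0, w0).
  rewrite -hessPhi //; apply: (hess_pos _ TH (cod _ yr0)).
  by rewrite -normr_eq0 Sw0 oner_eq0.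
move: Pmin a0; move: (Phi (y0, p0, w0)) => a Pmin a0.
have low y p d : `|y - z| <= r -> `|p| <= P -> a * `|d| ^+ 2 <= Phi (y, p, d).
  move=> yr pP; have [->|dn0] := eqVneq d 0.
    by rewrite normr0 expr0n mulr0 /Phi big1 // => k _; rewrite mxE mul0r.
  have nd : 0 < `|d| by rewrite normr_gt0.
  have := Pmin (y, p, `|d|^-1 *: d); rewrite inE => h.
  have {}h : a <= Phi (y, p, `|d|^-1 *: d).
    apply: h; split; first by split => //=; rewrite subr0.
    by rewrite /S /= normrZ normfV normr_id mulVf ?gt_eqF.
  have e : Phi (y, p, `|d|^-1 *: d) = `|d|^-1 ^+ 2 * Phi (y, p, d).
    rewrite /Phi /= mulr_sumr; apply: eq_bigr => k _; rewrite mxE expr2 -!mulrA; congr (_ * _).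
    rewrite mulrCA; congr (_ * _); rewrite mulr_sumr; apply: eq_bigr => l _.
    by rewrite mxE mulrA.
  by move: h; rewrite e exprVn mulrC ler_pdivlMr ?exprn_gt0.
(* The derivative along the segment from p to p' grows at rate at least a |d|^2. On the second half
   it exceeds its initial value by a |d|^2 / 2, over a length 1/2: hence a / 4. *)
exists (a / 4); first by rewrite divr_gt0.
move=> y p p' yr pP p'P; set d := p' - p.
pose g1 s := 'd f (y, p + s *: d) (0, d).
have lineE s : (y, p + s *: d) = (y, p) + s *: (0, d) :> E * E.
  by congr pair; rewrite /= scaler0 addr0.
have ps s : 0 <= s <= 1 -> `|p + s *: d| <= P.
  move=> s01; have := @closed_ball_convex R n 0 P p p' s; rewrite /= !subr0; exact.
have h1 s : 0 <= s <= 1 -> a * `|d| ^+ 2 * (s - 0) <= g1 s - g1 0.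
  move=> /andP[s0 s1].
  apply: (@mvt_ge R g1 (fun s => 'd (fun u => 'd f u (0, d)) (y, p + s *: d) (0, d))) => //.
    move=> t e /andP[t0 ts] e0; have t01 : 0 <= t <= 1 by rewrite t0 (le_trans ts s1).
    have := @diff_line R _ R^o (fun u => 'd f u (0, d)) (y, p) (0, d) t.
    rewrite -lineE => /(_ (dd (0, d) y _ yr) e e0)[rho rho0 hrho].
    by exists rho => // s' _ /hrho; rewrite -lineE.
  move=> t /andP[t0 ts]; have t01 : 0 <= t <= 1 by rewrite t0 (le_trans ts s1).
  by rewrite hessPhi //; apply: low => //; exact: ps.
have h2 s t k : 0 <= s -> s <= t -> t <= 1 -> (forall w, s <= w <= t -> k <= g1 w) ->
    k * (t - s) <= f (y, p + t *: d) - f (y, p + s *: d).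
  move=> s0 st t1 hk; apply: (@mvt_ge R (fun w => f (y, p + w *: d)) g1) => //.
  move=> w e _ e0.
  have dfw : differentiable f ((y, p) + w *: (0, d)) by rewrite -lineE; exact/df0/inc.
  have [rho rho0 hrho] := diff_line dfw e0.
  by exists rho => // s' _ /hrho; rewrite -!lineE.
have ad0 : 0 <= a * `|d| ^+ 2 by rewrite mulr_ge0 ?sqr_ge0 // ltW.
have half01 : 0 <= (2^-1 : R) /\ (2^-1 : R) <= 1 by split; [rewrite invr_ge0|rewrite invf_le1 ?ler1n].
have [hf0 hf1] := half01.
have k1 := h2 0 2^-1 (g1 0) (lexx _) hf0 hf1.
have k2 := h2 2^-1 1 (g1 0 + a * `|d| ^+ 2 / 2) hf0 hf1 (lexx _).
have {}k1 : g1 0 * (2^-1 - 0) <= f (y, p + 2^-1 *: d) - f (y, p + 0 *: d).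
  apply: k1 => w /andP[w0' w1]; have w01 : 0 <= w <= 1 by rewrite w0' (le_trans w1).
  have := h1 w w01; have : 0 <= a * `|d| ^+ 2 * (w - 0) by rewrite mulr_ge0 ?subr0.
  by move=> A B; have := le_trans A B; rewrite subr_ge0.
have {}k2 : (g1 0 + a * `|d| ^+ 2 / 2) * (1 - 2^-1) <= f (y, p + 1 *: d) - f (y, p + 2^-1 *: d).
  apply: k2 => w /andP[w0' w1]; have w01 : 0 <= w <= 1 by rewrite (le_trans hf0 w0').
  have := h1 w w01; have : a * `|d| ^+ 2 * 2^-1 <= a * `|d| ^+ 2 * (w - 0).
    by rewrite ler_wpM2l ?subr0.
  by move=> A B; have := le_trans A B; rewrite lerBrDr addrC.
have e0 : p + 0 *: d = p by rewrite scale0r addr0.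
have e1 : p + 1 *: d = p' by rewrite scale1r /d addrC subrK.
have eg : g1 0 = pairing (grad_p H i y p) d.
  by rewrite /g1 e0; apply: (etrans (local_diffE _ _ _ _ _ _)); rewrite pairing0r add0r.
move: k1 k2; rewrite e0 e1 eg !lh_local.
move: (pairing _ d) => a4; rewrite -/f; move: (f (y, p + _)) (f (y, p)) (f (y, p')) => a1 a2 a3.
move: (`|d| ^+ 2) => a5; clear; intros; lra.
Qed.

End TonelliHamloc.

(* What the proof uses of a Tonelli Hamiltonian: the properties are stable
   under [H - alpha] and under [p |-> - p]. *)
Record good (R : realType) (n : nat) (M : c2_manifold R n) (g : riemannian_metric M) (H : cotangent M -> R)
    (Hx Hp : chart M -> 'rV[R]_n -> 'rV[R]_n -> 'rV[R]_n) : Prop := Good {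
  good_loc : forall i z, chart_cod i z -> exists r kappa : R, [/\ 0 < r,
    gauge (tn g i z) kappa, forall y, `|y - z| <= r -> chart_cod i y,
    forall y v p, `|y - z| <= r ->
      [/\ tn g i y v <= 2 * tn g i z v, tn g i z v <= 2 * tn g i y v,
        `|v| <= kappa * tn g i y v /\ tn g i y v <= kappa * `|v|
      & `|p| <= kappa * cn g i y p /\ cn g i y p <= kappa * `|p|]
    & hamloc (lh H i) (Hx i) (Hp i) z r] ;
  good_coercive : forall K : R, exists C : R, forall i y p, chart_cod i y ->
    K * cn g i y p - C <= lh H i y p ;
  good_bounded : forall K : R, exists C : R, forall i y p, chart_cod i y ->
    cn g i y p <= K -> lh H i y p <= C
}.

Lemma tonelli_hamloc (R : realType) (n : nat) (M : c2_manifold R n) (g : riemannian_metric M) (H : cotangent M -> R) i z (r kappa : R) :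
  tonelli g H -> (forall y, `|y - z| <= r -> chart_cod i y) ->
  (forall y p, `|y - z| <= r -> `|p| <= kappa * cn g i y p) -> 0 <= kappa ->
  (forall K : R, exists C : R, forall i y p, chart_cod i y -> K * cn g i y p - C <= lh H i y p) ->
  hamloc (lh H i) (grad_x H i) (grad_p H i) z r.
Proof.
move=> TH cod kap kap0 coer; split.
- move=> P; have [/(_ i) HC _ _ _] := TH.
  pose K := [set y : 'rV[R]_n | `|y - z| <= r] `*` [set p : 'rV[R]_n | `|p - 0| <= P].
  have cK : compact K by apply: compact_setX; exact: closed_ball_compact.
  have sK : segment_closed K.
    move=> [y1 p1] [y2 p2] s [/= a1 b1] [/= a2 b2] s01; split => /=.
      exact: (@closed_ball_convex R n z r y1 y2 s a1 a2 s01).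
    exact: (@closed_ball_convex R n 0 P p1 p2 s b1 b2 s01).
  have KU : K `<=` (chart_cod i `*` setT) by move=> [y p] [/= a b]; split => //=; exact: cod.
  have [C C0 hC] := C2_bounds (@frame_prod R n) cK sK KU HC.
  have dn1 k : `|delta_mx 0 k : 'rV[R]_n| <= 1.
    apply: norm_le_entries => // l; rewrite mxE; case: (_ && _); by rewrite ?normr1 ?normr0.
  have np (a b : 'rV[R]_n) : `|(a, b)| <= `|a| + `|b| by have [] := norm_pair (a, b).
  exists (2 * C); first by rewrite mulr_gt0.
  move=> y y' p p' yr y'r pP p'P.
  have Ky : K (y, p) by split => //=; rewrite subr0.
  have Ky' : K (y', p') by split => //=; rewrite subr0.
  have Ky2 : K (y', p) by split => //=; rewrite subr0.
  have C2 : C <= 2 * C by move: C0; clra.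
  have [h1 _ _ h2] := hC (y, p) (y', p') 0 Ky Ky'.
  have hd (w : 'rV[R]_n * 'rV[R]_n) : `|w| <= 1 -> `|'d (local_ham H i) (y, p) w| <= 2 * C.
    move=> w1; have [_ h _ _] := hC (y, p) (y, p) w Ky Ky; apply: (le_trans h).
    by apply: le_trans C2; rewrite ler_piMr // ltW.
  split.
  + rewrite !lh_local; move: h2.
    have E : (y', p') - (y, p) = (y' - y, p' - p) :> 'rV[R]_n * 'rV[R]_n by [].
    rewrite E => h2; have := local_diffE H i y p (y' - y) (p' - p) => E2.
    rewrite -addrA -opprD -E2; apply: (le_trans h2).
    have := np (y' - y) (p' - p); move: `|(y' - y, p' - p)| (normr_ge0 (y' - y, p' - p)) => N N0 NN.
    move: NN (normr_ge0 (y' - y)) (normr_ge0 (p' - p)) => NN a0 b0.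
    rewrite [2 * C]mulrC -mulrA ler_pM2l //.
    apply: (@le_trans _ _ ((`|y' - y| + `|p' - p|) ^+ 2)).
      by rewrite lerXn2r ?nnegrE ?addr_ge0.
    by have := sqr_ge0 (`|y' - y| - `|p' - p|); rewrite !expr2; clra.
  + apply: norm_le_entries => [|k]; first by rewrite mulr_ge0 // ltW.
    rewrite mxE; apply: hd; apply: (le_trans (np _ _)); rewrite normr0 addr0; exact: dn1.
  + apply: norm_le_entries => [|k]; first by rewrite mulr_ge0 // ltW.
    rewrite mxE; apply: hd; apply: (le_trans (np _ _)); rewrite normr0 add0r; exact: dn1.
  + by rewrite lh_local; apply: le_trans C2.
  + apply: norm_le_entries => [|k]; first by rewrite mulr_ge0 // mulr_ge0 // ltW.
    rewrite !mxE; have [_ _ h _] := hC (y, p) (y', p) (0, delta_mx 0 k) Ky Ky2.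
    apply: (le_trans h).
    have a1 : `|(y', p) - (y, p) : 'rV[R]_n * 'rV[R]_n| <= `|y' - y|.
      have -> : (y', p) - (y, p) = (y' - y, 0) :> 'rV[R]_n * 'rV[R]_n by congr pair; rewrite /= subrr.
      by apply: (le_trans (np _ _)); rewrite normr0 addr0.
    have a2 : `|(0 : 'rV[R]_n, delta_mx 0 k : 'rV[R]_n)| <= 1.
      by apply: (le_trans (np _ _)); rewrite normr0 add0r.
    apply: (@le_trans _ _ (C * `|y' - y| * 1)).
      by apply: ler_pM => //; rewrite ?mulr_ge0 ?(ltW C0) // ler_wpM2l // ltW.
    by rewrite mulr1 ler_wpM2r.
- by move=> P; exact: (tonelli_convex P TH cod).
- move=> K; have [C hC] := coer (`|K| * kappa); exists C => y p yr.
  have := hC i y p (cod y yr); have h1 := ler_wpM2l (normr_ge0 K) (kap y p yr).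
  have h2 : K * `|p| <= `|K| * `|p| by rewrite ler_wpM2r // ler_norm.
  by rewrite -mulrA; move: h1 h2; move: (lh H i y p) (cn g i y p) => u u'; clra.
Qed.

Lemma lh_conorm (R : realType) (n : nat) (M : c2_manifold R n) (g : riemannian_metric M) (H : cotangent M -> R) i y p : chart_cod i y ->
  exists q, lh H i y p = H q /\ cn g i y p = conorm g q.
Proof.
case=> x di <-; exists (x, p *m (transition_jac (chart_at x) i x)^T).
by rewrite (lhE H p di) (conormE g p di).
Qed.

Lemma tonelli_good (R : realType) (n : nat) (M : c2_manifold R n) (g : riemannian_metric M) (H : cotangent M -> R) :
  tonelli g H -> good g H (grad_x H) (grad_p H).
Proof.
move=> TH; have [_ Hc Hb _] := TH.
have coer (K : R) : exists C : R, forall i y p, chart_cod i y -> K * cn g i y p - C <= lh H i y p.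
  have K0 : 0 < `|K| + 1 by have := normr_ge0 K; clra.
  have [C hC] := Hc _ K0; exists C => i y p cy.
  have [q [-> ->]] := lh_conorm g H p cy; apply: le_trans (hC q).
  have q0 : 0 <= conorm g q by exact: sqrtr_ge0.
  have : K * conorm g q <= (`|K| + 1) * conorm g q.
    by rewrite ler_wpM2r //; have := ler_norm K; clra.
  by clra.
split=> //.
- move=> i z cz; have [r [kappa [r0 gg cod h]]] := metric_ball g cz.
  exists r, kappa; split=> //.
  apply: (tonelli_hamloc TH cod _ (ltW (gauge_gt0 gg)) coer).
  by move=> y p yr; have [_ _ _ []] := h y 0 p yr.
- move=> K; have K0 : 0 <= `|K| by [].
  have := Hb _ K0; set A := ereal_sup _ => Afin.
  have ubA q : conorm g q <= `|K| -> ((H q)%:E <= A)%E.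
    by move=> hq; apply: ereal_sup_ubound; exists q.
  case: A Afin ubA => [C| |] // _ ubA.
    exists C => i y p cy cp; have [q [e1 e2]] := lh_conorm g H p cy.
    by rewrite e1 -lee_fin; apply: ubA; rewrite -e2 (le_trans cp) // ler_norm.
  exists 0 => i y p cy cp; have [q [e1 e2]] := lh_conorm g H p cy.
  have := ubA q; rewrite -e2 (le_trans cp (ler_norm K)) => /(_ isT).
  by rewrite leeNy_eq.
Qed.

(** Absorbs the constant: the Lagrangian of H - alpha is L_H + alpha, so that (alpha,
    H)-subsolutions become subsolutions with constant 0. *)
Definition shift_ham (R : realType) (n : nat) (M : c2_manifold R n) (H : cotangent M -> R) (alpha : R) : cotangent M -> R :=
  fun w => H w - alpha.

(** Reversing time turns L(x, v) into L(x, - v) and subsolutions u into - u. Minus the [lax] of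
    [rev_ham H] applied to - u is therefore T^+_t u, and what is proved of T^- for all good
    Hamiltonians applies to T^+. *)
Definition rev_ham (R : realType) (n : nat) (M : c2_manifold R n) (H : cotangent M -> R) : cotangent M -> R := fun w => H (w.1, - w.2).

Lemma lh_shift (R : realType) (n : nat) (M : c2_manifold R n) (H : cotangent M -> R) alpha i :
  lh (shift_ham H alpha) i = fun y p => lh H i y p - alpha.
Proof. by apply/funext => y; apply/funext => p; rewrite !lh_local. Qed.

Lemma lh_rev (R : realType) (n : nat) (M : c2_manifold R n) (H : cotangent M -> R) i : lh (rev_ham H) i = fun y p => lh H i y (- p).
Proof.
by apply/funext => y; apply/funext => p; rewrite !lh_local /local_ham /rev_ham /= mulNmx.
Qed.

Lemma cnN (R : realType) (n : nat) (M : c2_manifold R n) (g : riemannian_metric M) i y p : chart_cod i y -> cn g i y (- p) = cn g i y p.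
Proof. by move=> cy; rewrite -scaleN1r cnZ // normrN normr1 mul1r. Qed.

Lemma good_shift (R : realType) (n : nat) (M : c2_manifold R n) (g : riemannian_metric M) (H : cotangent M -> R) Hx Hp alpha :
  good g H Hx Hp -> good g (shift_ham H alpha) Hx Hp.
Proof.
move=> [h1 h2 h3]; split.
- move=> i z /h1[r [kappa [r0 gg cod hm [a1 a2 a3]]]]; exists r, kappa; split=> //.
  rewrite lh_shift; split.
  + move=> P; have [C C0 hC] := a1 P; exists (C + `|alpha|); first by rewrite ltr_pwDl.
    have CC : C <= C + `|alpha| by rewrite lerDl.
    move=> y y' p p' yr y'r pP p'P; have [b1 b2 b3 b4 b5] := hC y y' p p' yr y'r pP p'P.
    have mono (c : R) : 0 <= c -> C * c <= (C + `|alpha|) * c by move=> c0; exact: ler_wpM2r.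
    split; try by [apply: le_trans CC|apply: (le_trans b5); exact: mono].
      rewrite opprB subrKA.
      by apply: (le_trans b1); apply: mono; rewrite addr_ge0 ?sqr_ge0.
    by apply: (le_trans (ler_normB _ _)); apply: lerD.
  + move=> P; have [a a0 ha] := a2 P; exists a => // y p p' yr pP p'P.
    by have := ha y p p' yr pP p'P; move: (lh H i y p) (lh H i y p') => u u'; clra.
  + move=> K; have [C hC] := a3 K; exists (C + alpha) => y p yr.
    by have := hC y p yr; move: (lh H i y p) => u; clra.
- move=> K; have [C hC] := h2 K; exists (C + alpha) => i y p cy; rewrite lh_shift.
  by have := hC i y p cy; move: (lh H i y p) => u; clra.
- move=> K; have [C hC] := h3 K; exists (C - alpha) => i y p cy cp; rewrite lh_shift.
  by have := hC i y p cy cp; move: (lh H i y p) => u; clra.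
Qed.

Lemma good_rev (R : realType) (n : nat) (M : c2_manifold R n) (g : riemannian_metric M) (H : cotangent M -> R) Hx Hp :
  good g H Hx Hp ->
  good g (rev_ham H) (fun i y p => Hx i y (- p)) (fun i y p => - Hp i y (- p)).
Proof.
move=> [h1 h2 h3]; split.
- move=> i z /h1[r [kappa [r0 gg cod hm [a1 a2 a3]]]]; exists r, kappa; split=> //.
  rewrite lh_rev; split.
  + move=> P; have [C C0 hC] := a1 P; exists C => // y y' p p' yr y'r pP p'P.
    rewrite -normrN in pP; rewrite -normrN in p'P.
    have [b1 b2 b3 b4 b5] := hC y y' (- p) (- p') yr y'r pP p'P.
    have E : - p' - - p = - (p' - p) by rewrite opprB opprK addrC.
    move: b1; rewrite E pairingNr normrN pairingNl => b1.
    by split=> //; rewrite ?normrN // -opprD normrN -opprB normrN in b5 * => //; rewrite opprK addrC distrC.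
  + move=> P; have [a a0 ha] := a2 P; exists a => // y p p' yr pP p'P.
    rewrite -normrN in pP; rewrite -normrN in p'P.
    have := ha y (- p) (- p') yr pP p'P.
    have E : - p' - - p = - (p' - p) by rewrite opprB opprK addrC.
    by rewrite E pairingNr normrN pairingNl.
  + move=> K; have [C hC] := a3 K; exists C => y p yr; rewrite -normrN; exact: hC.
- move=> K; have [C hC] := h2 K; exists C => i y p cy; rewrite lh_rev -cnN //; exact: hC.
- move=> K; have [C hC] := h3 K; exists C => i y p cy cp; rewrite lh_rev; apply: hC => //.
  by rewrite cnN.
Qed.

Definition commute_grad (R : realType) (n : nat) (M : c2_manifold R n) (Gx Gp Hx Hp : chart M -> 'rV[R]_n -> 'rV[R]_n -> 'rV[R]_n) : Prop :=
  forall i y p, chart_cod i y -> pairing (Hp i y p) (Gx i y p) = pairing (Hx i y p) (Gp i y p).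

Lemma OmegaE (R : realType) (n : nat) (z X Y : 'rV[R]_n * 'rV[R]_n) : Omega z X Y = pairing Y.2 X.1 - pairing X.2 Y.1.
Proof.
have dl (A B : 'rV[R]_n * 'rV[R]_n) : 'd (fun z' : 'rV[R]_n * 'rV[R]_n => liouville z' A) z B = pairing B.2 A.1 :> R.
  pose l : 'rV[R]_n * 'rV[R]_n -> R^o := fun z' => liouville z' A.
  have lin : linear l by move=> a u v; rewrite /l /liouville /= pairingDl pairingZl.
  pose L : {linear ('rV[R]_n * 'rV[R]_n)%type -> R^o} := HB.pack l (GRing.isLinear.Build R ('rV[R]_n * 'rV[R]_n)%type R^o *:%R l lin).
  have cL : continuous L.
    apply: (@lip_continuous _ _ R^o _ (n%:R * `|A.1|)) => u v.
    rewrite -[L u - L v](linearB L) /= /l /liouville; apply: (le_trans (pairing_le _ _)).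
    have [_ h _] := norm_pair (u - v).
    by rewrite mulrAC ler_wpM2l ?mulr_ge0.
  by have := diff_lin z cL => E; rewrite -[LHS]/('d L z B) E.
apply: (etrans (congr1 -%R (congr2 (fun a b : R => a - b) (dl Y X) (dl X Y)))).
exact: opprB.
Qed.

(** The Hamiltonian vector of F has coordinates (grad_p F, - grad_x F), so Omega evaluates to the
    classical bracket. *)
Lemma poisson_grad (R : realType) (n : nat) (M : c2_manifold R n) (G H : cotangent M -> R) : poisson_commute G H ->
  commute_grad (grad_x G) (grad_p G) (grad_x H) (grad_p H).
Proof.
move=> pc i y p cy.
have hv (F : cotangent M -> R) : is_ham_vector F i (y, p) (grad_p F i y p, - grad_x F i y p).
  move=> [v w]; rewrite OmegaE /= (local_diffE F i y p v w) pairingNl opprK addrC.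
  by rewrite [pairing w _]pairingC.
have E : pairing (- grad_x H i y p) (grad_p G i y p) - pairing (- grad_x G i y p) (grad_p H i y p) = 0.
  exact: (etrans (esym (OmegaE (y, p) (grad_p G i y p, - grad_x G i y p)
    (grad_p H i y p, - grad_x H i y p))) (pc i (y, p) _ _ cy (hv G) (hv H))).
move: (grad_x H i y p) (grad_p G i y p) (grad_x G i y p) (grad_p H i y p) E => a b c d.
by rewrite !pairingNl opprK addrC => /eqP; rewrite subr_eq0 [pairing d c]pairingC => /eqP.
Qed.

(** Lets the preservation theorem be applied with G = H: the semigroup of H preserves the
    subsolutions of H. *)
Lemma commute_refl (R : realType) (n : nat) (M : c2_manifold R n) (Gx Gp : chart M -> 'rV[R]_n -> 'rV[R]_n -> 'rV[R]_n) : commute_grad Gx Gp Gx Gp.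
Proof. by move=> i y p cy; rewrite pairingC. Qed.

Lemma commute_rev (R : realType) (n : nat) (M : c2_manifold R n) (Gx Gp Hx Hp : chart M -> 'rV[R]_n -> 'rV[R]_n -> 'rV[R]_n) :
  commute_grad Gx Gp Hx Hp -> commute_grad (fun i y p => Gx i y (- p))
    (fun i y p => - Gp i y (- p)) (fun i y p => Hx i y (- p)) (fun i y p => - Hp i y (- p)).
Proof. by move=> h i y p cy; rewrite pairingNl pairingNr h. Qed.

Lemma le_of_eq (R : realType) (a b : R) : a = b -> a <= b.
Proof. by move=> ->. Qed.

(** * Infinitesimal subsolutions *)

Definition loclip (R : realType) (n : nat) (M : c2_manifold R n) (u : M -> R) : Prop :=
  forall i z, chart_cod i z -> exists r L : R, 0 < r /\ forall y y',
    `|y - z| <= r -> `|y' - z| <= r -> `|u (phi_inv i y') - u (phi_inv i y)| <= L * `|y' - y|.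

Definition dini_at (R : realType) (n : nat) (M : c2_manifold R n) (H : cotangent M -> R) (u : M -> R) (i : chart M) (y : 'rV[R]_n) : Prop :=
  forall (v : 'rV[R]_n) (e : R), 0 < e -> exists2 rho : R, 0 < rho & forall s, 0 < s -> s < rho ->
    u (phi_inv i (y + s *: v)) - u (phi_inv i y) <= s * (lag (lh H i) y v + e).

(* By [subsolution_subsol] and [subsol_subsolution] below, this infinitesimal
   notion is [subsolution] with [alpha = 0]. *)
Definition subsol (R : realType) (n : nat) (M : c2_manifold R n) (H : cotangent M -> R) (u : M -> R) : Prop :=
  loclip u /\ forall i y, chart_cod i y -> dini_at H u i y.

(** A line of the chart j becomes in the chart i a curve at distance O(s^2) from its tangent line,
    because transitions are C^2; the local Lipschitz bound turns this into an error o(s) on u. *)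
Lemma loclip_dini_chart (R : realType) (n : nat) (M : c2_manifold R n) (H : cotangent M -> R) (u : M -> R) i j x :
  loclip u -> dom i x -> dom j x -> dini_at H u i (phi i x) -> dini_at H u j (phi j x).
Proof.
move=> lu di dj Di v e e0.
have [r [L [r0 hL]]] := lu i (phi i x) (codom_phi di).
have [rt rt0 [C C0 hC]] := trans_bounds dj di.
have [w ew] : exists w, w = v *m transition_jac j i x by exists (v *m transition_jac j i x).
have e2 : 0 < e / 2 by rewrite divr_gt0.
have [rho rho0 hrho] := Di w _ e2.
have L0 : 0 <= `|L| by []. have nv := normr_ge0 v. have nw := normr_ge0 w.
pose K := `|L| * (C * `|v| ^+ 2).
have K0 : 0 <= K by rewrite !mulr_ge0 // ltW.
have eK : K = `|L| * (C * `|v| ^+ 2) by [].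
clearbody K.
have pos (a c : R) : 0 < a -> 0 <= c -> 0 < a / (c + 1) by move=> a0 c0; rewrite divr_gt0 // ltr_pwDr.
pose d := Num.min rho (Num.min (rt / (`|v| + 1)) (Num.min (r / (`|w| + 1))
  (Num.min (r / (C * `|v| + 1)) (e / 2 / (K + 1))))).
have d0 : 0 < d.
  by rewrite !lt_min rho0 !pos //= ?andbT ?mulr_ge0 // ltW.
exists d => // s s0; rewrite !lt_min => /and5P[s1 s2 s3 s4 s5].
move: s2 s3 s4 s5; rewrite !ltr_pdivlMr; [|by move: nv nw K0 (mulr_ge0 (ltW C0) nv); clra..].
move=> s2 s3 s4 s5.
have sv : `|s *: v| <= rt by rewrite normrZ gtr0_norm //; move: s2 s0; clra.
have sw : `|s *: w| <= r by rewrite normrZ gtr0_norm //; move: s3 s0; clra.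
have y1 : `|phi j x - phi j x| <= rt by rewrite subrr normr0 ltW.
have y2 : `|phi j x + s *: v - phi j x| <= rt by rewrite addrC addKr.
have [_ h1 h3 _ _] := hC (phi j x) (phi j x + s *: v) 0 y1 y2.
have [ ov _ _ _ _] := hC (phi j x + s *: v) (phi j x) 0 y2 y1.
have exx : phi_inv j (phi j x) = x by rewrite phi_invK.
have tx : trans j i (phi j x) = phi i x by rewrite /trans exx.
have jx : jac j i (phi j x) = transition_jac j i x by rewrite /jac exx.
have dsv : phi j x + s *: v - phi j x = s *: v by rewrite addrC addKr.
pose a := trans j i (phi j x + s *: v).
have E1 : (phi j x + s *: v - phi j x) *m jac j i (phi j x) = s *: w.
  by apply: (etrans (congr2 (fun b A => b *m A) dsv jx)); rewrite ew; exact: esym (scalemxAl _ _ _).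
have E2 : a - phi i x = a - trans j i (phi j x) by apply: (congr1 (fun b => a - b)); exact: esym.
have nsv : `|phi j x + s *: v - phi j x| = s * `|v|.
  by apply: (etrans (congr1 (fun b : 'rV[R]_n => `|b|) dsv)); rewrite normrZ gtr0_norm.
have {}h1 : `|a - phi i x - s *: w| <= C * (s * `|v|) ^+ 2.
  have := norm_eq_le (congr2 (fun b c => b - c) E2 (esym E1)) h1.
  by rewrite nsv.
have {}h3 : `|a - phi i x| <= C * (s * `|v|).
  by have := norm_eq_le E2 h3; rewrite nsv.
have ea : a = trans j i (phi j x + s *: v) by [].
clearbody a.
have ar : `|a - phi i x| <= r.
  by apply: (le_trans h3); move: s4 s0; rewrite mulrCA; move: (C * `|v|) => c; clra.
have wr : `|phi i x + s *: w - phi i x| <= r by rewrite addrC addKr.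
have ua : u (phi_inv i a) = u (phi_inv j (phi j x + s *: v)).
  by rewrite ea; case: ov => x' [dj' di'] E; rewrite /trans -E !phi_invK.
have h4 := hL _ _ wr ar; rewrite ua in h4.
have aw : a - (phi i x + s *: w) = a - phi i x - s *: w by rewrite opprD addrA.
rewrite aw in h4.
have h5 : `|L| * `|a - phi i x - s *: w| <= K * s ^+ 2.
  rewrite eK; have -> : `|L| * (C * `|v| ^+ 2) * s ^+ 2 = `|L| * (C * (s * `|v|) ^+ 2) by ring.
  by rewrite ler_wpM2l.
have h6 : L * `|a - phi i x - s *: w| <= `|L| * `|a - phi i x - s *: w|.
  exact: (ler_wpM2r (normr_ge0 _) (ler_norm L)).
have h7 := hrho s s0 s1.
have lc : lag (lh H i) (phi i x) w = lag (lh H j) (phi j x) v.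
  by rewrite ew; exact: (lag_change H v dj di).
have {}h4 := le_trans (ler_norm _) h4.
have uu : u (phi_inv i (phi i x)) = u (phi_inv j (phi j x)) by rewrite !phi_invK.
have h8 : K * s ^+ 2 <= s * (e / 2).
  have := ler_wpM2l (ltW s0) (ltW s5); have := sqr_ge0 s.
  by rewrite expr2; clra.
have fin (U1 U2 U3 l N nL : R) : U1 - U2 <= L * N -> nL * N <= K * s ^+ 2 ->
    L * N <= nL * N -> U2 - U3 <= s * (l + e / 2) -> K * s ^+ 2 <= s * (e / 2) ->
    U1 - U3 <= s * (l + e).
  by clear; intros; lra.
apply: (fin _ _ _ _ _ _ h4 h5 h6 _ h8).
have E3 := congr1 (fun t => u (phi_inv i (phi i x + s *: w)) - t) uu.
have E4 := congr1 (fun t => s * (t + e / 2)) lc.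
exact: (le_trans (le_of_eq (esym E3)) (le_trans h7 (le_of_eq E4))).
Qed.

(** [C] depends neither on [f] nor on [L]: the Lipschitz hypothesis serves as continuity only. This
    uniformity is what makes subsolutions stable under limits. *)
Lemma dini_segment (R : realType) (n : nat) (F : 'rV[R]_n -> 'rV[R]_n -> R) Fx Fp (z : 'rV[R]_n) (r V : R) :
  hamloc F Fx Fp z r -> 0 <= V -> exists2 C : R, 0 < C & forall (f : 'rV[R]_n -> R) y v t L,
    0 <= t -> `|v| <= V -> (forall s, 0 <= s -> s <= t -> `|y + s *: v - z| <= r) ->
    (forall s s', 0 <= s -> s <= t -> 0 <= s' -> s' <= t ->
       `|f (y + s' *: v) - f (y + s *: v)| <= L * `|s' - s|) ->
    (forall s e, 0 <= s -> s < t -> 0 < e -> exists2 rho : R, 0 < rho & forall h, 0 < h -> h < rho ->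
       f (y + (s + h) *: v) - f (y + s *: v) <= h * (lag F (y + s *: v) v + e)) ->
    f (y + t *: v) - f y <= t * lag F y v + C * t ^+ 2.
Proof.
move=> hF V0; have [C C0 hC] := lag_lip V hF.
exists (C * (V + 1)); first by rewrite mulr_gt0 // ltr_pwDr.
move=> f y v t L t0 vV seg lip dini.
have y0 : y + 0 *: v = y by rewrite scale0r addr0.
have := @right_dini_le R (fun s => f (y + s *: v)) (lag F y v + C * (V + 1) * t) 0 t t0.
rewrite y0 subr0 => h; apply: le_trans (h _ _) _.
- move=> s e /andP[s0 st] e0; have L1 : 0 < `|L| + 1 by have := normr_ge0 L; clra.
  exists (e / (`|L| + 1)); first by rewrite divr_gt0.
  move=> s' /andP[s'0 s't]; rewrite ltr_pdivlMr // => ss.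
  apply: (le_trans (lip s s' s0 st s'0 s't)); apply: le_trans (ltW ss).
  by rewrite mulrC ler_wpM2l //; have := ler_norm L; clra.
- move=> s e /andP[s0 st] e0; have [rho rho0 hrho] := dini s e s0 st e0.
  exists rho => // k /andP[k0 kr]; apply: (le_trans (hrho k k0 kr)).
  rewrite ler_pM2l // lerD2r.
  have st' := ltW st; have sy := seg s s0 st'; have yr := seg 0 (lexx _) t0; rewrite y0 in yr.
  apply: (le_trans (hC y _ v v yr sy vV vV)).
  have -> : y + s *: v - y = s *: v by rewrite addrC addKr.
  rewrite subrr normr0 addr0 lerD2l normrZ ger0_norm // -mulrA ler_pM2l // mulrC.
  by apply: ler_pM => //; move: vV; clra.
- by rewrite mulrDl expr2 mulrA [_ * t in leLHS]mulrC.
Qed.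

Lemma dual_sup (R : realType) (n : nat) (v : 'rV[R]_n) : exists p : 'rV[R]_n, `|p| <= 1 /\ pairing p v = `|v|.
Proof.
have [->|[k ->]] := norm_attained v.
  by exists 0; rewrite pairing0l !normr0.
exists (Num.sg (v 0 k) *: delta_mx 0 k); split.
  apply: norm_le_entries => // l; rewrite !mxE normrM.
  by case: (_ && _); rewrite ?normr0 ?mulr0 ?ler01 // normr1 mulr1 normr_sg lern1 leq_b1.
by rewrite pairingZl pairingC pairing_delta -normrEsg.
Qed.

Lemma loclip_segment (R : realType) (n : nat) (f : 'rV[R]_n -> R) (z : 'rV[R]_n) (r L : R) y v t :
  (forall y y', `|y - z| <= r -> `|y' - z| <= r -> `|f y' - f y| <= L * `|y' - y|) ->
  (forall s, 0 <= s -> s <= t -> `|y + s *: v - z| <= r) ->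
  forall s s', 0 <= s -> s <= t -> 0 <= s' -> s' <= t ->
    `|f (y + s' *: v) - f (y + s *: v)| <= L * `|v| * `|s' - s|.
Proof.
move=> h seg s s' s0 st s'0 s't.
apply: (le_trans (h _ _ (seg s s0 st) (seg s' s'0 s't))).
by rewrite opprD addrACA subrr add0r -scalerBl normrZ mulrAC mulrA.
Qed.

Lemma segment_in_ball (R : realType) (n : nat) (y y' z : 'rV[R]_n) (r t s : R) : 0 < t -> 0 <= s -> s <= t ->
  `|y - z| <= r -> `|y' - z| <= r -> `|y + s *: (t^-1 *: (y' - y)) - z| <= r.
Proof.
move=> t0 s0 st yr y'r; rewrite scalerA; apply: (@closed_ball_convex R n z r y y') => //.
by rewrite divr_ge0 ?(ltW t0) //= ler_pdivrMr // mul1r.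
Qed.

Lemma pairing_split (R : realType) (n : nat) (p x y z : 'rV[R]_n) :
  pairing p (x - z) = pairing p (x - y) + pairing p (y - z).
Proof. by rewrite -pairingDr subrKA. Qed.

(* A curve [c] on [[a, b]] together with a cost function whose increments
   dominate [\int p.c' - H(c, p)] for all covectors [p], hence the Lagrangian
   action: this encodes action-bounded curves without integrating. *)
Record adm (R : realType) (n : nat) (M : c2_manifold R n) (H : cotangent M -> R) (a b : R) (c : R -> M) (cost : R -> R) : Prop := Adm {
  adm_le : a <= b ;
  adm_cont : forall s0 (A : set M), a <= s0 -> s0 <= b -> nbhs (c s0) A ->
    exists2 rho : R, 0 < rho & forall s, a <= s -> s <= b -> `|s - s0| < rho -> A (c s) ;
  adm_ineq : forall s0 i (B e : R), a <= s0 -> s0 <= b -> dom i (c s0) -> 0 < e ->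
    exists2 rho : R, 0 < rho & forall s1 s2 p, a <= s1 -> s1 <= s0 -> s0 <= s2 -> s2 <= b ->
      s0 - rho < s1 -> s2 < s0 + rho -> `|p| <= B ->
      pairing p (phi i (c s2) - phi i (c s1)) - (s2 - s1) * (lh H i (phi i (c s0)) p + e)
        <= cost s2 - cost s1
}.

Lemma adm_restrict (R : realType) (n : nat) (M : c2_manifold R n) (H : cotangent M -> R) a b c cost a' b' :
  adm H a b c cost -> a <= a' -> a' <= b' -> b' <= b -> adm H a' b' c cost.
Proof.
move=> [ab h1 h2] aa a'b' bb; split=> //.
- move=> s0 A as0 s0b nA; have [rho r0 h] := h1 s0 A (le_trans aa as0) (le_trans s0b bb) nA.
  by exists rho => // s as_ sb; apply: h; [exact: le_trans as_|exact: le_trans bb].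
- move=> s0 i B e as0 s0b di e0.
  have [rho r0 h] := h2 s0 i B e (le_trans aa as0) (le_trans s0b bb) di e0.
  exists rho => // s1 s2 p x1 x2 x3 x4; apply: h => //; [exact: le_trans x1|exact: le_trans bb].
Qed.

Lemma adm_shift (R : realType) (n : nat) (M : c2_manifold R n) (H : cotangent M -> R) a b c cost tau :
  adm H a b c cost -> adm H (a - tau) (b - tau) (fun s => c (s + tau)) (fun s => cost (s + tau)).
Proof.
move=> [ab h1 h2]; split; first by rewrite lerD2r.
- move=> s0 A; rewrite lerBlDr lerBrDr => as0 s0b nA.
  have [rho r0 h] := h1 _ A as0 s0b nA.
  exists rho => // s; rewrite lerBlDr lerBrDr => as_ sb ss; apply: h => //.
  by rewrite opprD addrACA subrr addr0.
- move=> s0 i B e; rewrite lerBlDr lerBrDr => as0 s0b di e0.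
  have [rho r0 h] := h2 _ i B e as0 s0b di e0.
  exists rho => // s1 s2 p; rewrite lerBlDr lerBrDr => x1 x2 x3 x4 x5 x6 x7.
  have := h (s1 + tau) (s2 + tau) p x1; rewrite !lerD2r => /(_ x2 x3 x4).
  have z5 : s0 + tau - rho < s1 + tau by move: x5; clra.
  have z6 : s2 + tau < s0 + tau + rho by move: x6; clra.
  have E : s2 + tau - (s1 + tau) = s2 - s1 by clra.
  by move=> /(_ z5 z6 x7); rewrite E.
Qed.

(** The second cost is translated to match the first at b. At the junction the inequality over
    [s1, s2] is the sum of those over [s1, b] and [b, s2], taken with the same covector. *)
Lemma adm_cat (R : realType) (n : nat) (M : c2_manifold R n) (H : cotangent M -> R) a b d c1 k1 c2 k2 :
  adm H a b c1 k1 -> adm H b d c2 k2 -> c1 b = c2 b ->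
  adm H a d (fun s => if s <= b then c1 s else c2 s)
    (fun s => if s <= b then k1 s else k2 s - k2 b + k1 b).
Proof.
move=> [ab h1 h2] [bd h3 h4] cb; split; first exact: le_trans bd.
- move=> s0 A as0 s0d; case: (leP s0 b) => s0b nA.
    have [rho1 r1 g1] := h1 s0 A as0 s0b nA.
    have [s0b'|s0b'] := ltP s0 b.
      exists (Num.min rho1 (b - s0)); first by rewrite lt_min r1 subr_gt0.
      move=> s as_ sd; rewrite lt_min => /andP[x1 x2].
      have sb : s <= b by move: x2; rewrite ltr_norml; clra.
      by rewrite sb; exact: g1.
    have E : s0 = b by apply/eqP; rewrite eq_le s0b s0b'.
    rewrite E in nA g1; have nA2 := nA; rewrite cb in nA2.
    have [rho2 r2 g2] := h3 b A (lexx _) bd nA2.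
    exists (Num.min rho1 rho2); first by rewrite lt_min r1.
    rewrite E => s as_ sd; rewrite lt_min => /andP[x1 x2]; case: (leP s b) => sb.
      exact: g1.
    by apply: g2 => //; exact: ltW.
  have [rho2 r2 g2] := h3 s0 A (ltW s0b) s0d nA.
  exists (Num.min rho2 (s0 - b)); first by rewrite lt_min r2 subr_gt0.
  move=> s as_ sd; rewrite lt_min => /andP[x1 x2].
  have sb : b < s by move: x2; rewrite ltr_norml; clra.
  by rewrite leNgt sb /=; apply: g2 => //; exact: ltW.
- move=> s0 i B e as0 s0d; case: (leP s0 b) => s0b di e0; last first.
    have [rho2 r2 g2] := h4 s0 i B e (ltW s0b) s0d di e0.
    exists (Num.min rho2 (s0 - b)); first by rewrite lt_min r2 subr_gt0.
    move=> s1 s2 p x1 x2 x3 x4 x5 x6 pB.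
    have m1 : Num.min rho2 (s0 - b) <= rho2 by rewrite ge_min lexx.
    have m2 : Num.min rho2 (s0 - b) <= s0 - b by rewrite ge_min lexx orbT.
    have s1b : b < s1 by move: x5 m2; clra.
    have s2b : b < s2 by exact: lt_le_trans (lt_le_trans s1b x2) x3.
    rewrite (leNgt s1 b) s1b (leNgt s2 b) s2b /=.
    have := g2 s1 s2 p (ltW s1b) x2 x3 x4 _ _ pB.
    move=> g; have {}g := g _ _; apply: (le_trans (g _ _)).
    + by move: x5 m1; clra.
    + by move: x6 m1; clra.
    + by move: (k2 s1) (k2 s2) (k2 b) (k1 b); clra.
  have [rho1 r1 g1] := h2 s0 i B e as0 s0b di e0.
  have [s0b'|s0b'] := ltP s0 b.
    exists (Num.min rho1 (b - s0)); first by rewrite lt_min r1 subr_gt0.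
    move=> s1 s2 p x1 x2 x3 x4 x5 x6 pB.
    have m1 : Num.min rho1 (b - s0) <= rho1 by rewrite ge_min lexx.
    have m2 : Num.min rho1 (b - s0) <= b - s0 by rewrite ge_min lexx orbT.
    have s2b : s2 <= b by move: x6 m2; clra.
    rewrite s2b (le_trans x2 s0b).
    by apply: g1 => //; [move: x5 m1; clra|move: x6 m1; clra].
  have E : s0 = b by apply/eqP; rewrite eq_le s0b s0b'.
  rewrite E in di g1 *; have di2 := di; rewrite cb in di2.
  have [rho2 r2 g2] := h4 b i B e (lexx _) bd di2 e0.
  exists (Num.min rho1 rho2); first by rewrite lt_min r1.
  move=> s1 s2 p x1 x2 x3 x4 x5 x6 pB.
  have m1 : Num.min rho1 rho2 <= rho1 by rewrite ge_min lexx.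
  have m2 : Num.min rho1 rho2 <= rho2 by rewrite ge_min lexx orbT.
  have y1 := g1 s1 b p x1 x2 (lexx _) (lexx _).
  have y2 := g2 b s2 p (lexx _) (lexx _) x3 x4.
  have z1 : b - rho1 < s1 by move: x5 m1; clra.
  have z2 : b < b + rho1 by rewrite ltrDl.
  have z3 : b - rho2 < b by rewrite gtrDl oppr_lt0.
  have z4 : s2 < b + rho2 by move: x6 m2; clra.
  move: (y1 z1 z2 (le_trans pB (lexx _))) (y2 z3 z4 pB); rewrite -cb.
  rewrite x2; case: (leP s2 b) => s2b; last first.
    rewrite (pairing_split p (phi i (c2 s2)) (phi i (c1 b)) (phi i (c1 s1))).
    move: (pairing p _) (pairing p _) (lh _ _ _ _) (k1 s1) (k1 b) (k2 b) (k2 s2).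
    by clear; intros; lra.
  have -> : s2 = b by apply/eqP; rewrite eq_le s2b x3.
  by move=> Y _.
Qed.

(** Integrates [adm_ineq] against a constant covector of one chart; a suitable p then converts a
    bound on the cost into a bound on the displacement. *)
Lemma adm_dual (R : realType) (n : nat) (M : c2_manifold R n) (H : cotangent M -> R) a b c cost i p (h : R) :
  adm H a b c cost -> (forall s, a <= s -> s <= b -> dom i (c s) /\ lh H i (phi i (c s)) p <= h) ->
  pairing p (phi i (c b) - phi i (c a)) <= cost b - cost a + (b - a) * h.
Proof.
move=> [ab h1 h2] hs; apply: (@eps_mul_le _ _ _ (b - a)) => e e0.
apply: (@itv_glue R (fun s t => pairing p (phi i (c t) - phi i (c s)) <=
  cost t - cost s + (t - s) * h + (t - s) * e)) => //.
  move=> x y z _ xy yz _; rewrite (pairing_split p (phi i (c z)) (phi i (c y)) (phi i (c x))).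
  move: (pairing p _) (pairing p _) (cost x) (cost y) (cost z).
  by clear; intros; lra.
move=> s0 /andP[as0 s0b]; have [di lhh] := hs s0 as0 s0b.
have [rho r0 g] := h2 s0 i `|p| e as0 s0b di e0.
exists rho => // s1 s2 x1 x2 x3 x4 x5 x6; have := g s1 s2 p x1 x2 x3 x4 x5 x6 (lexx _).
have s12 : 0 <= s2 - s1 by rewrite subr_ge0; exact: le_trans x3.
move: (ler_wpM2l s12 lhh); rewrite mulrDr.
move: (pairing p _) (lh _ _ _ _) (cost s1) (cost s2).
by clear; intros; lra.
Qed.

Lemma line_ineq (R : realType) (n : nat) (p D w0 w1 : 'rV[R]_n) (tau rho nv C B hh k e : R) :
  0 <= tau -> tau <= 2 * rho -> 0 <= rho -> 0 < C -> 0 <= nv ->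
  `|D - tau *: w1| <= C * (tau * nv) ^+ 2 -> `|w1 - w0| <= C * (rho * nv) * nv ->
  `|p| <= B -> pairing p w0 - hh <= k -> rho * (n%:R * `|B| * (3 * C * nv ^+ 2)) <= e ->
  pairing p D - tau * (hh + e) <= k * tau.
Proof.
move=> s12 s12r rho0 C0 nv0 h1 h2 pB lgp re.
have DE : pairing p D = tau * pairing p w0 + (pairing p (D - tau *: w1) + tau * pairing p (w1 - w0)).
  by rewrite !pairingBr pairingZr; ring.
have pB' : n%:R * `|p| <= n%:R * `|B| by rewrite ler_wpM2l // (le_trans pB) // ler_norm.
have b1 : pairing p (D - tau *: w1) <= n%:R * `|B| * (C * (2 * rho * tau * nv ^+ 2)).
  apply: (le_trans (ler_norm _)); apply: (le_trans (pairing_le _ _)).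
  apply: ler_pM => //; apply: (le_trans h1).
  rewrite ler_wpM2l ?(ltW C0) // exprMn ler_wpM2r ?sqr_ge0 //.
  by rewrite expr2 ler_wpM2r.
have b2 : pairing p (w1 - w0) <= n%:R * `|B| * (C * (rho * nv ^+ 2)).
  apply: (le_trans (ler_norm _)); apply: (le_trans (pairing_le _ _)).
  by apply: ler_pM => //; apply: (le_trans h2); rewrite expr2 !mulrA.
have {}b2 := ler_wpM2l s12 b2.
have b3 := ler_wpM2l s12 re.
have b4 := ler_wpM2l s12 lgp.
rewrite DE; move: b1 b2 b3 b4.
move: (pairing p w0) (pairing p (w1 - w0)) (pairing p _) => P1 P2 P3.
by clear; intros; lra.
Qed.

(** The defining inequality has to hold in every chart j met by the line, where the line is curved:
    its displacement differs from the one along a fixed velocity by quadratic terms ([line_ineq]),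
    absorbed by e. *)
Lemma adm_line (R : realType) (n : nat) (M : c2_manifold R n) (g : riemannian_metric M) (H : cotangent M -> R) Hx Hp i y v (t k : R) :
  good g H Hx Hp -> 0 <= t -> (forall s, 0 <= s -> s <= t -> chart_cod i (y + s *: v)) ->
  (forall s, 0 <= s -> s <= t -> lag (lh H i) (y + s *: v) v <= k) ->
  adm H 0 t (fun s => phi_inv i (y + s *: v)) (fun s => k * s).
Proof.
move=> gH t0 cod lagk; have nv := normr_ge0 v.
have v1 : 0 < `|v| + 1 by rewrite ltr_pwDr.
have dist s s' : `|y + s *: v - (y + s' *: v)| = `|s - s'| * `|v|.
  by rewrite opprD addrACA subrr add0r -scalerBl normrZ.
split=> //.
- move=> s0 A s00 s0t nA.
  have := phi_inv_continuous (cod s0 s00 s0t) nA => /nbhs_ballP[d /= d0 hd].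
  exists (d / (`|v| + 1)); first by rewrite divr_gt0.
  move=> s s0' st; rewrite ltr_pdivlMr // => ss; apply: hd.
  rewrite -ball_normE /= distrC dist; apply: le_lt_trans ss.
  by rewrite ler_wpM2l // lerDl.
move=> s0 j B e s00 s0t dj e0.
have cy0 := cod s0 s00 s0t; have di := dom_phi_inv cy0.
have y0E := phi_phi_inv cy0; move: (dj) => dj'.
have [r r0 [C C0 hC]] := trans_bounds di dj.
rewrite y0E in hC.
have lg p : pairing p (v *m jac i j (y + s0 *: v)) - lh H j (phi j (phi_inv i (y + s0 *: v))) p <= k.
  have [rj [kj [rj0 _ _ _ hl]]] := good_loc gH (codom_phi dj).
  have z0 : `|phi j (phi_inv i (y + s0 *: v)) - phi j (phi_inv i (y + s0 *: v))| <= rj.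
    by rewrite subrr normr0 ltW.
  apply: (le_trans (lag_ge _ p hl z0)).
  have E := lag_change H v di dj; rewrite y0E in E.
  exact: (le_trans (le_of_eq E) (lagk s0 s00 s0t)).
pose Q := n%:R * `|B| * (3 * C * `|v| ^+ 2) : R.
have Q0 : 0 <= Q by rewrite !mulr_ge0 ?sqr_ge0 // ltW.
have eQ : Q = n%:R * `|B| * (3 * C * `|v| ^+ 2) by [].
clearbody Q.
have Q1 : 0 < Q + 1 by rewrite ltr_pwDr.
exists (Num.min (r / (`|v| + 1)) (e / (Q + 1))).
  by rewrite lt_min !divr_gt0.
move=> s1 s2 p x1 x2 x3 x4 x5 x6 pB.
set rho := Num.min _ _ in x5 x6.
have rr : rho * (`|v| + 1) <= r by rewrite -ler_pdivlMr // ge_min lexx.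
have re : rho * (Q + 1) <= e by rewrite -ler_pdivlMr // ge_min lexx orbT.
have rho0 : 0 <= rho by rewrite /rho le_min !divr_ge0 // ltW.
clearbody rho.
have near s : `|s - s0| <= rho -> `|y + s *: v - (y + s0 *: v)| <= r.
  move=> ss; rewrite dist; apply: le_trans rr; apply: ler_pM => //.
  by rewrite lerDl.
have s1r : `|s1 - s0| <= rho by rewrite ler_norml; move: x5 x2 rho0; clra.
have s2r : `|s2 - s0| <= rho by rewrite ler_norml; move: x6 x3 rho0; clra.
have s0r : `|s0 - s0| <= rho by rewrite subrr normr0.
have [_ h1 _ _ _] := hC _ _ 0 (near s1 s1r) (near s2 s2r).
have [_ _ _ _ h2] := hC _ _ v (near s0 s0r) (near s1 s1r).
rewrite !dist in h1 h2.
have s12 : 0 <= s2 - s1 by rewrite subr_ge0; exact: le_trans x3.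
have s12r : s2 - s1 <= 2 * rho by move: x5 x6; clra.
have E21 : y + s2 *: v - (y + s1 *: v) = (s2 - s1) *: v.
  by rewrite opprD addrACA subrr add0r -scalerBl.
have E3 : (y + s2 *: v - (y + s1 *: v)) *m jac i j (y + s1 *: v) =
    (s2 - s1) *: (v *m jac i j (y + s1 *: v)).
  by apply: (etrans (congr1 (fun b => b *m jac i j (y + s1 *: v)) E21)); exact: esym (scalemxAl _ _ _).
have {}h1 := norm_eq_le (congr1 (fun b => trans i j (y + s2 *: v) - trans i j (y + s1 *: v) - b) (esym E3)) h1.
have eT : phi j (phi_inv i (y + s2 *: v)) - phi j (phi_inv i (y + s1 *: v)) =
   trans i j (y + s2 *: v) - trans i j (y + s1 *: v) by [].
rewrite -mulrBr; apply: (line_ineq (w0 := v *m jac i j (y + s0 *: v))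
  (w1 := v *m jac i j (y + s1 *: v)) s12 s12r rho0 C0 nv _ _ pB (lg p)).
- by have := h1; rewrite (ger0_norm s12).
- apply: (le_trans h2); rewrite ler_wpM2r // ler_wpM2l ?(ltW C0) // ler_wpM2r //.
- by move: re rho0; rewrite -eQ; clra.
Qed.

(** On a short interval the curve is compared with its chord. A slow chord is tested with its own
    Legendre momentum, which gives back the Lagrangian. A fast chord is tested with a covector of
    size |L| + 1, where L is the local Lipschitz constant of u: the cost then exceeds the possible
    growth of u. *)
Lemma adm_subsol (R : realType) (n : nat) (M : c2_manifold R n) (g : riemannian_metric M) (H : cotangent M -> R) Hx Hp u a b c cost :
  good g H Hx Hp -> subsol H u -> adm H a b c cost -> u (c b) - u (c a) <= cost b - cost a.
Proof.
move=> gH [lu du] [ab hc hi]; apply: (@eps_mul_le _ _ _ (b - a)) => e e0.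
wlog e1 : e e0 / e <= 1.
  move=> W; have [e1|e1] := leP e 1; first exact: W.
  apply: (le_trans (W 1 ltr01 (lexx _))).
  by rewrite lerD2l ler_wpM2l ?subr_ge0 // ltW.
apply: (@itv_glue R (fun s t => u (c t) - u (c s) <= cost t - cost s + (t - s) * e)) => //.
  move=> x y z _ xy yz _; move: (u (c x)) (u (c y)) (u (c z)) (cost x) (cost y) (cost z).
  by clear; intros; lra.
move=> s0 /andP[as0 s0b].
set i := chart_at (c s0); have di : dom i (c s0) := dom_chart_at _.
set z := phi i (c s0).
have [r [kp [r0 _ cod _ hl]]] := good_loc gH (codom_phi di).
have [r' [L [r'0 hL]]] := lu i z (codom_phi di).
pose rr := Num.min r r'.
have rr0 : 0 < rr by rewrite lt_min r0.
have rrr y : `|y - z| <= rr -> `|y - z| <= r by move=> h; apply: (le_trans h); rewrite ge_min lexx.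
have rrr' y : `|y - z| <= rr -> `|y - z| <= r' by move=> h; apply: (le_trans h); rewrite ge_min lexx orbT.
have zr : `|z - z| <= r by rewrite subrr normr0 ltW.
have [C0 C00 hC0] := hamloc_bound (`|L| + 1) hl.
(* [C0] bounds H at momenta of size |L| + 1; for chords faster than [V] the extra unit of momentum
   outweighs [C0] and the error e <= 1. *)
pose V := C0 + 1.
have V0 : 0 <= V by rewrite /V; move: C00; clra.
have [C1 C10 hC1] := dini_segment hl V0.
have [B B0 hB] := hamloc_argmax V hl.
have [C2 C20 hC2] := lag_lip V hl.
have e3 : 0 < e / 3 by rewrite divr_gt0.
have [rho1 rho10 h1] := hi s0 i (Num.max B (`|L| + 1)) (e / 3) as0 s0b di e3.
pose d := Num.min rr (e / 3 / C2).
have d0 : 0 < d by rewrite lt_min rr0 divr_gt0.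
have nA : nbhs (c s0) [set x | dom i x /\ ball z d (phi i x)].
  by apply: chart_pull => //; exact: nbhsx_ballx.
have [rho2 rho20 h2] := hc s0 _ as0 s0b nA.
pose rho := Num.min rho1 (Num.min rho2 (e / 3 / (2 * C1))).
have rhoC : rho * (2 * C1) <= e / 3.
  by rewrite -ler_pdivlMr ?mulr_gt0 // /rho !ge_min lexx !orbT.
have rho_1 : rho <= rho1 by rewrite ge_min lexx.
have rho_2 : rho <= rho2 by rewrite /rho !ge_min lexx !orbT.
exists rho; first by rewrite !lt_min rho10 rho20 !divr_gt0 // mulr_gt0.
clearbody rho.
move=> s1 s2 x1 x2 x3 x4 x5 x6.
have [ds1 b1] : dom i (c s1) /\ ball z d (phi i (c s1)).
  by apply: h2 => //; [exact: le_trans x2 s0b|rewrite ltr_norml; move: x5 x2 x3 x4 rho_2 rho20; clra].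
have [ds2 b2] : dom i (c s2) /\ ball z d (phi i (c s2)).
  by apply: h2 => //; [exact: le_trans as0 x3|rewrite ltr_norml; move: x6 x2 x3 x4 rho_2 rho20; clra].
move: b1 b2; rewrite -!ball_normE /= ![`|z - _|]distrC => /ltW b1 /ltW b2.
have u1 : u (c s1) = u (phi_inv i (phi i (c s1))) by rewrite phi_invK.
have u2 : u (c s2) = u (phi_inv i (phi i (c s2))) by rewrite phi_invK.
have dini_p p : `|p| <= Num.max B (`|L| + 1) ->
    pairing p (phi i (c s2) - phi i (c s1)) - (s2 - s1) * (lh H i z p + e / 3) <= cost s2 - cost s1.
  by move=> pB; apply: h1 => //; [move: x5 rho_1; clra|move: x6 rho_1; clra].
have [ts|ts] := leP s2 s1.
  have E : s2 = s1 by apply/eqP; rewrite eq_le ts (le_trans x2 x3).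
  by rewrite E !subrr mul0r addr0.
rewrite u1 u2; move: (phi i (c s1)) (phi i (c s2)) b1 b2 dini_p => y1 y2 b1 b2 dini_p.
have dr : d <= rr by rewrite ge_min lexx.
have dC : d * C2 <= e / 3 by rewrite -ler_pdivlMr // ge_min lexx orbT.
clear u1 u2.
pose tau := s2 - s1.
have tau0 : 0 < tau by rewrite subr_gt0.
have taur : tau <= 2 * rho by rewrite /tau; move: x5 x6 x2 x3; clra.
pose v := tau^-1 *: (y2 - y1).
have y2E : y1 + tau *: v = y2 by rewrite /v scalerA divff ?gt_eqF // scale1r addrC subrK.
have dE : y2 - y1 = tau *: v by rewrite /v scalerA divff ?gt_eqF // scale1r.
have b1r := le_trans b1 dr; have b2r := le_trans b2 dr.
have [vV|Vv] := leP `|v| V.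
  have seg s : 0 <= s -> s <= tau -> `|y1 + s *: v - z| <= rr.
    by move=> s_0 st; exact: segment_in_ball.
  have lip := loclip_segment hL (fun s a b => rrr' _ (seg s a b)).
  have := hC1 (fun y => u (phi_inv i y)) y1 v tau _ (ltW tau0) vV (fun s a b => rrr _ (seg s a b)) lip.
  rewrite y2E => H1; have {}H1 : u (phi_inv i y2) - u (phi_inv i y1) <= tau * lag (lh H i) y1 v + C1 * tau ^+ 2.
    apply: H1 => s e' s_0 st e'0.
    have cy := cod _ (rrr _ (seg s s_0 (ltW st))).
    have [rho' rho'0 h'] := du i _ cy v e' e'0.
    by exists rho' => // h h0 hr; rewrite scalerDl addrA; exact: h'.
  have [P PB vP] := hB z v zr vV.
  have PB' : `|P| <= Num.max B (`|L| + 1) by rewrite le_max PB.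
  have H2 := dini_p P PB'.
  have H3 := hC2 z y1 v v zr (rrr _ b1r) vV vV.
  have H4 : lag (lh H i) z v = pairing P v - lh H i z P.
    by rewrite vP; exact: (lag_argmax P hl zr).
  rewrite subrr normr0 addr0 H4 in H3; rewrite dE pairingZr -/tau in H2 *.
  have H5 : tau * lag (lh H i) y1 v <= tau * (pairing P v - lh H i z P + e / 3).
    rewrite ler_pM2l //; apply: (le_trans H3); rewrite lerD2l.
    by apply: le_trans dC; rewrite mulrC ler_pM2r.
  have H6 : C1 * tau ^+ 2 <= tau * (e / 3).
    rewrite expr2 mulrCA; apply: (ler_wpM2l (ltW tau0)).
    by have := ler_wpM2l (ltW C10) taur; move: rhoC; clra.
  move: H1 H2 H5 H6; rewrite -/tau.
  move: (u _) (u _) (lag _ _ _) (pairing _ _) (lh _ _ _ _) (cost s2) (cost s1).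
  by clear; intros; lra.
have [q [q1 qE]] := dual_sup (y2 - y1).
have H2 := dini_p ((`|L| + 1) *: q).
have Lq : `|(`|L| + 1) *: q| <= `|L| + 1.
  by rewrite normrZ ger0_norm ?addr_ge0 // ler_piMr // addr_ge0.
have {}H2 := H2 (le_trans Lq (_ : _ <= Num.max B (`|L| + 1))).
have {}H2 := H2 ltac:(by rewrite le_max lexx orbT).
have [_ _ H3] := hC0 z _ zr Lq; have {}H3 := le_trans (ler_norm _) H3.
have H4 := le_trans (ler_norm _) (hL _ _ (rrr' _ b1r) (rrr' _ b2r)).
have H5 : L * `|y2 - y1| <= `|L| * `|y2 - y1| := ler_wpM2r (normr_ge0 _) (ler_norm L).
rewrite pairingZl qE in H2.
have H6 : tau * V <= `|y2 - y1|.
  by rewrite dE normrZ gtr0_norm // ler_pM2l // ltW.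
have H7 := ler_wpM2l (ltW tau0) H3.
have H8 : tau * (e / 3) <= tau by rewrite -[leRHS]mulr1 ler_pM2l //; move: e1; clra.
have H9 : 0 <= tau * e by rewrite mulr_ge0 // ltW.
move: H2 H4 H5 H6 H7 H8 H9; rewrite -/tau /V.
by move: (u _) (u _) (lh _ _ _ _) (cost s2) (cost s1); clear; intros; lra.
Qed.

(** * The Lax-Oleinik semigroup *)

Definition nice (R : realType) (n : nat) (M : c2_manifold R n) (g : riemannian_metric M) (H : cotangent M -> R)
    (Hx Hp : chart M -> 'rV[R]_n -> 'rV[R]_n -> 'rV[R]_n) i (z : 'rV[R]_n) (r kappa : R) : Prop :=
  [/\ 0 < r, gauge (tn g i z) kappa, forall y, `|y - z| <= r -> chart_cod i y,
    forall y v p, `|y - z| <= r ->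
      [/\ tn g i y v <= 2 * tn g i z v, tn g i z v <= 2 * tn g i y v,
        `|v| <= kappa * tn g i y v /\ tn g i y v <= kappa * `|v|
      & `|p| <= kappa * cn g i y p /\ cn g i y p <= kappa * `|p|]
    & hamloc (lh H i) (Hx i) (Hp i) z r].

Lemma lag_upper (R : realType) (n : nat) (M : c2_manifold R n) (g : riemannian_metric M) (H : cotangent M -> R) Hx Hp (V : R) :
  good g H Hx Hp -> exists2 C : R, 0 <= C & forall i y v, chart_cod i y ->
  tn g i y v <= V -> lag (lh H i) y v <= C.
Proof.
move=> gH; have [C hC] := good_coercive gH `|V|; exists `|C| => // i y v cy tv.
have [r [k [r0 _ _ _ hl]]] := good_loc gH cy.
have yr : `|y - y| <= r by rewrite subrr normr0 ltW.
have [B _ hB] := hamloc_argmax `|v| hl.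
have [p _ vE] := hB y v yr (lexx _).
have E : lag (lh H i) y v = pairing p v - lh H i y p by rewrite vE; exact: (lag_argmax p hl yr).
have h1 := pairing_le_tn g p v cy; have h2 := hC i y p cy.
have h3 : cn g i y p * tn g i y v <= cn g i y p * `|V|.
  by rewrite ler_wpM2l ?cn_ge0 // (le_trans tv) // ler_norm.
apply: (le_trans (le_of_eq E)); have := ler_norm C.
move: h1 h2 h3; move: (pairing p v) (lh _ _ _ _) (cn g i y p) (tn g i y v) `|C| `|V|.
by clear; intros; lra.
Qed.

Lemma lag_lower (R : realType) (n : nat) (M : c2_manifold R n) (g : riemannian_metric M) (H : cotangent M -> R) Hx Hp (K : R) :
  0 <= K -> good g H Hx Hp -> exists2 C : R, 0 <= C & forall i y v, chart_cod i y ->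
  K * tn g i y v - C <= lag (lh H i) y v.
Proof.
move=> K0 gH; have [C hC] := good_bounded gH K; exists `|C| => // i y v cy.
have [r [k [r0 _ _ _ hl]]] := good_loc gH cy.
have yr : `|y - y| <= r by rewrite subrr normr0 ltW.
have [p [p1 pE]] := tn_dual g v cy.
have cK : cn g i y (K *: p) <= K by rewrite cnZ // ger0_norm // ler_piMr.
have h1 := hC i y (K *: p) cy cK; have h2 := lag_ge v (K *: p) hl yr.
have := ler_norm C; move: h1 h2; rewrite pairingZl pE.
move: (lh _ _ _ _) (lag _ _ _) (tn g i y v) `|C|.
by clear; intros; lra.
Qed.

Definition paths (R : realType) (n : nat) (M : c2_manifold R n) (H : cotangent M -> R) (u : M -> R) (t : R) (x : M) : set R :=
  [set w | exists c cost, [/\ adm H 0 t c cost, c t = x & w = u (c 0) + cost t - cost 0]].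

(* The Lax-Oleinik semigroup [T^-_t u (x)]. *)
Definition lax (R : realType) (n : nat) (M : c2_manifold R n) (H : cotangent M -> R) (u : M -> R) (t : R) (x : M) : R := inf (paths H u t x).

Definition setting (R : realType) (n : nat) (M : c2_manifold R n) (g : riemannian_metric M) (H : cotangent M -> R) Hx Hp u : Prop :=
  good g H Hx Hp /\ subsol H u.

Lemma paths_lb (R : realType) (n : nat) (M : c2_manifold R n) (g : riemannian_metric M) (H : cotangent M -> R) Hx Hp u t x w :
  setting g H Hx Hp u -> paths H u t x w -> u x <= w.
Proof.
move=> [gH su] [c [k [ak <- ->]]]; have := adm_subsol gH su ak.
by move: (u _) (u _) (k t) (k 0); clear; intros; lra.
Qed.

Lemma paths_const (R : realType) (n : nat) (M : c2_manifold R n) (g : riemannian_metric M) (H : cotangent M -> R) Hx Hp :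
  good g H Hx Hp -> exists2 C : R, 0 <= C & forall t x, 0 <= t ->
    exists c k, [/\ adm H 0 t c k, c 0 = x, c t = x & k t - k 0 = C * t].
Proof.
move=> gH; have [C C0 hC] := lag_upper 0 gH; exists C => // t x t0.
have di := dom_chart_at x; set i := chart_at x in di.
have cx := codom_phi di.
have E s : phi i x + s *: 0 = phi i x by rewrite scaler0 addr0.
exists (fun s => phi_inv i (phi i x + s *: 0)), (fun s => C * s); split.
- apply: (adm_line gH t0) => s s0 st; rewrite E //.
  by apply: hC => //; rewrite -(scale0r 0) tnZ // normr0 mul0r.
- by rewrite E phi_invK.
- by rewrite E phi_invK.
- by rewrite mulr0 subr0.
Qed.

Lemma lax_le_path (R : realType) (n : nat) (M : c2_manifold R n) (g : riemannian_metric M) (H : cotangent M -> R) Hx Hp u t x w :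
  setting g H Hx Hp u -> paths H u t x w -> lax H u t x <= w.
Proof.
by move=> st pw; apply: ge_inf => //; exists (u x) => w' /(paths_lb st).
Qed.

Lemma lax_le (R : realType) (n : nat) (M : c2_manifold R n) (g : riemannian_metric M) (H : cotangent M -> R) Hx Hp u :
  setting g H Hx Hp u -> exists2 C : R, 0 <= C & forall t x, 0 <= t -> lax H u t x <= u x + C * t.
Proof.
move=> st; have [C C0 hC] := paths_const st.1; exists C => // t x t0.
have [c [k [ak c0 ct kt]]] := hC t x t0; apply: (lax_le_path st).
by exists c, k; split=> //; rewrite c0 -kt addrA.
Qed.

Lemma paths_has_inf (R : realType) (n : nat) (M : c2_manifold R n) (g : riemannian_metric M) (H : cotangent M -> R) Hx Hp u t x :
  setting g H Hx Hp u -> 0 <= t -> has_inf (paths H u t x).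
Proof.
move=> st t0; have [C C0 hC] := paths_const st.1; split; last first.
  by exists (u x) => w' /(paths_lb st).
have [c [k [ak c0 ct kt]]] := hC t x t0.
by exists (u (c 0) + k t - k 0), c, k.
Qed.

Lemma lax_ge (R : realType) (n : nat) (M : c2_manifold R n) (g : riemannian_metric M) (H : cotangent M -> R) Hx Hp u t x :
  setting g H Hx Hp u -> 0 <= t -> u x <= lax H u t x.
Proof.
move=> st t0; apply: lb_le_inf; first by have [] := paths_has_inf x st t0.
by move=> w /(paths_lb st).
Qed.

Lemma lax0 (R : realType) (n : nat) (M : c2_manifold R n) (g : riemannian_metric M) (H : cotangent M -> R) Hx Hp u x :
  setting g H Hx Hp u -> lax H u 0 x = u x.
Proof.
move=> st; apply/eqP; rewrite eq_le (lax_ge x st (lexx 0)) andbT.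
by have [C C0 hC] := lax_le st; have := hC 0 x (lexx _); rewrite mulr0 addr0.
Qed.

Lemma lax_near (R : realType) (n : nat) (M : c2_manifold R n) (g : riemannian_metric M) (H : cotangent M -> R) Hx Hp u t x e :
  setting g H Hx Hp u -> 0 <= t -> 0 < e -> exists c k, [/\ adm H 0 t c k, c t = x &
    u (c 0) + k t - k 0 <= lax H u t x + e].
Proof.
move=> st t0 e0; have [w [c [k [ak ct ->]]] wl] := inf_adherent e0 (paths_has_inf x st t0).
by exists c, k; split=> //; exact: ltW.
Qed.

Lemma lax_cat (R : realType) (n : nat) (M : c2_manifold R n) (g : riemannian_metric M) (H : cotangent M -> R) Hx Hp u t s c k :
  setting g H Hx Hp u -> 0 <= t -> adm H 0 s c k ->
  lax H u (t + s) (c s) <= lax H u t (c 0) + k s - k 0.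
Proof.
move=> st t0 ak; apply: eps_le => e e0.
have [c1 [k1 [ak1 c1t h]]] := lax_near (c 0) st t0 e0.
have := adm_shift (- t) ak; rewrite !opprK add0r [s + t]addrC => ak2.
have c12 : c1 t = (fun s => c (s + - t)) t by rewrite subrr.
have := adm_cat ak1 ak2 c12; set c3 := fun s => _; set k3 := fun s => _ => ak3.
have s0 := adm_le ak.
have tst : t + s - t = s by clra.
have cts : c3 (t + s) = c s.
  rewrite /c3; case: leP => ts; last by rewrite tst.
  have s00 : s = 0 by apply/eqP; rewrite eq_le s0 andbT; move: ts; rewrite gerDl.
  by rewrite s00 addr0 c1t.
have c30 : c3 0 = c1 0 by rewrite /c3 t0.
have k30 : k3 0 = k1 0 by rewrite /k3 t0.
have kts : k3 (t + s) = k s - k 0 + k1 t.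
  rewrite /k3; case: leP => ts; last by rewrite tst subrr.
  have s00 : s = 0 by apply/eqP; rewrite eq_le s0 andbT; move: ts; rewrite gerDl.
  by rewrite s00 addr0 subrr add0r.
have := lax_le_path st (ex_intro _ c3 (ex_intro _ k3 (And3 ak3 cts erefl))).
rewrite c30 k30 kts => h2; apply: (le_trans h2).
by move: h; move: (u _) (lax _ _ _ _) (k1 t) (k1 0) (k s) (k 0); clear; intros; lra.
Qed.

Lemma lax_time (R : realType) (n : nat) (M : c2_manifold R n) (g : riemannian_metric M) (H : cotangent M -> R) Hx Hp u t s c k :
  setting g H Hx Hp u -> adm H 0 t c k -> 0 <= s -> s <= t ->
  lax H u s (c s) <= u (c 0) + k s - k 0.
Proof.
move=> st ak s0 s_t; apply: (lax_le_path st); exists c, k; split=> //.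
exact: (adm_restrict ak).
Qed.

(** Dropping the first t - s of a nearly optimal curve cannot raise its value, since the subsolution
    u grows along that part by at most the cost. *)
Lemma lax_mono (R : realType) (n : nat) (M : c2_manifold R n) (g : riemannian_metric M) (H : cotangent M -> R) Hx Hp u s t x :
  setting g H Hx Hp u -> 0 <= s -> s <= t -> lax H u s x <= lax H u t x.
Proof.
move=> st s0 s_t; have t0 := le_trans s0 s_t.
apply: eps_le => e e0; have [c [k [ak ct h]]] := lax_near x st t0 e0.
have ts0 : 0 <= t - s by rewrite subr_ge0.
have tst : t - s <= t by rewrite gerBl.
have ak1 := adm_restrict ak (lexx 0) ts0 tst.
have ak2 := adm_shift (t - s) (adm_restrict ak ts0 tst (lexx t)).
have E : t - (t - s) = s by clra.
rewrite subrr E in ak2.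
have := adm_subsol st.1 st.2 ak1.
have := lax_le_path st (ex_intro _ _ (ex_intro _ _ (And3 ak2 _ erefl))).
rewrite !add0r [s + _]addrC subrK => /(_ x ct) h1 h2; move: h h1 h2.
by move: (u _) (u _) (lax _ _ _ _) (lax _ _ _ _) (k t) (k (t - s)) (k 0); clear; intros; lra.
Qed.

Lemma nice_line (R : realType) (n : nat) (M : c2_manifold R n) (g : riemannian_metric M) (H : cotangent M -> R) Hx Hp :
  good g H Hx Hp -> exists2 C : R, 0 <= C & forall i z r kappa y y',
    nice g H Hx Hp i z r kappa -> `|y - z| <= r -> `|y' - z| <= r -> y' != y ->
    exists c k, let d := 2 * tn g i z (y' - y) in [/\ 0 < d, adm H 0 d c k,
      c 0 = phi_inv i y, c d = phi_inv i y' & k d - k 0 <= C * d].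
Proof.
move=> gH; have [C C0 hC] := lag_upper 1 gH; exists C => // i z r kappa y y' [r0 gg cod cmp hl] yr y'r yy.
set d := 2 * tn g i z (y' - y).
have d0 : 0 < d.
  rewrite mulr_gt0 // lt_neqAle tn_ge0 andbT eq_sym; apply: contra_neq yy => t0.
  have := gauge_lb gg (y' - y); rewrite t0 mulr0 normr_le0 subr_eq0 => /eqP.
  by [].
pose v := d^-1 *: (y' - y).
have seg s : 0 <= s -> s <= d -> `|y + s *: v - z| <= r.
  by move=> s0 sd; apply: segment_in_ball.
have yE : y + d *: v = y' by rewrite /v scalerA divff ?gt_eqF // scale1r addrC subrK.
exists (fun s => phi_inv i (y + s *: v)), (fun s => C * s); split=> //.
- apply: (adm_line gH (ltW d0)) => s s0 sd; first exact/cod/seg.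
  apply: hC; first exact/cod/seg.
  have [h _ _ _] := cmp _ v 0 (seg s s0 sd); apply: (le_trans h).
  rewrite (gaugeZ gg) ger0_norm ?invr_ge0 ?(ltW d0) // mulrCA.
  by rewrite -/d mulVf // gt_eqF.
- by rewrite scale0r addr0.
- by rewrite yE.
- by rewrite mulr0 subr0.
Qed.

(** The constant depends on H alone, not on u, t or the ball, and this is the source of the global
    speed bound. If the time d needed to run along the segment is at most t, monotonicity in t pays
    for it; otherwise t is small and values of u are compared instead. *)
Lemma lax_lip (R : realType) (n : nat) (M : c2_manifold R n) (g : riemannian_metric M) (H : cotangent M -> R) Hx Hp :
  good g H Hx Hp -> exists2 C : R, 0 <= C & forall u, subsol H u ->
  forall i z r kappa t y y',
    nice g H Hx Hp i z r kappa -> `|y - z| <= r -> `|y' - z| <= r -> 0 <= t ->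
    lax H u t (phi_inv i y') - lax H u t (phi_inv i y) <= C * tn g i z (y' - y).
Proof.
move=> gH; have [C1 C10 hl] := nice_line gH.
have [C2 C20 hc] := paths_const gH.
exists (2 * (C1 + C2)) => [|u su i z r kappa t y y' ni yr y'r t0]; first by rewrite mulr_ge0 ?addr_ge0.
have st : setting g H Hx Hp u by [].
have [->|yy] := eqVneq y' y; first by rewrite subrr mulr_ge0 ?tn_ge0 // mulr_ge0 ?addr_ge0.
have [c [k [d0 ak c0 cd kd]]] := hl i z r kappa y y' ni yr y'r yy.
move: d0 ak cd kd; have -> : 2 * (C1 + C2) * tn g i z (y' - y) = (C1 + C2) * (2 * tn g i z (y' - y)) by ring.
move: (2 * tn _ _ _ _) => d d0 ak cd kd.
have C2d : 0 <= C2 * d by rewrite mulr_ge0 // ltW.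
have [dt|td] := leP d t.
  have td0 : 0 <= t - d by rewrite subr_ge0.
  have := lax_cat st td0 ak; rewrite subrK cd c0.
  have := @lax_mono _ _ _ _ _ _ _ _ (t - d) t (phi_inv i y) st td0 (_ : _ <= t).
  rewrite gerBl (ltW d0) => /(_ isT).
  by move: kd C2d; move: (lax _ _ _ _) (lax _ _ _ _) (lax _ _ _ _) (k d) (k 0); clear; intros; lra.
have h1 := lax_ge (phi_inv i y) st t0.
have h2 := adm_subsol gH su ak; rewrite cd c0 in h2.
have [c' [k' [ak' c'0 c't k't]]] := hc t (phi_inv i y') t0.
have := lax_le_path st (ex_intro _ c' (ex_intro _ k' (And3 ak' c't erefl))).
rewrite c'0; have : C2 * t <= C2 * d by rewrite ler_wpM2l // ltW.
move: h1 h2 kd k't; move: (lax _ _ _ _) (lax _ _ _ _) (u _) (u _) (k d) (k 0) (k' t) (k' 0).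
by clear; intros; lra.
Qed.

Lemma hamloc_lipx (R : realType) (n : nat) (F : 'rV[R]_n -> 'rV[R]_n -> R) Fx Fp (z : 'rV[R]_n) (r P : R) :
  hamloc F Fx Fp z r -> exists2 C : R, 0 < C & forall x y p,
  `|x - z| <= r -> `|y - z| <= r -> `|p| <= P -> F y p <= F x p + C * `|y - x|.
Proof.
move=> hF; have [C C0 hC] := hl_reg hF P; have m0 := ler0n R n.
exists (n%:R * C + C * (2 * `|r|) + 1).
  by apply: ltr_wpDl => //; rewrite addr_ge0 // mulr_ge0 ?mulr_ge0 // ltW.
move=> x y p xr yr pP; have [h1 h2 _ _ _] := hC x y p p xr yr pP pP.
move: h1; rewrite subrr pairing0r normr0 expr0n /= addr0 subr0 => h1.
have {}h1 := le_trans (ler_norm _) h1.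
have h3 := le_trans (ler_norm _) (pairing_le (Fx x p) (y - x)).
have h4 : n%:R * `|Fx x p| * `|y - x| <= n%:R * C * `|y - x| by rewrite ler_wpM2r // ler_wpM2l.
have h5 : `|y - x| <= 2 * `|r|.
  by have := ler_distD z y x; rewrite [`|z - x|]distrC; move: xr yr (ler_norm r); clra.
have h6 : C * `|y - x| ^+ 2 <= C * (2 * `|r|) * `|y - x|.
  by rewrite expr2 mulrA ler_wpM2r // ler_wpM2l // ltW.
by have := normr_ge0 (y - x); move: h1 h3 h4 h6; clra.
Qed.

Lemma chart_ball_closed (R : realType) (n : nat) (M : c2_manifold R n) i (z : 'rV[R]_n) (r : R) :
  (forall y, `|y - z| <= r -> chart_cod i y) ->
  closed [set x : M | dom i x /\ `|phi i x - z| <= r].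
Proof.
move=> cod; have E : [set x : M | dom i x /\ `|phi i x - z| <= r] =
    phi_inv i @` [set y | `|y - z| <= r].
  apply/seteqP; split=> [x [dx xr]|_ [y yr <-]].
    by exists (phi i x) => //; rewrite phi_invK.
  by have cy := cod y yr; split; [exact: dom_phi_inv|rewrite phi_phi_inv].
rewrite E; apply: compact_closed; first exact: carrier_hausdorff.
apply: continuous_compact; last exact: closed_ball_compact.
apply: continuous_in_subspaceT => y; rewrite inE => yr.
exact: phi_inv_continuous (cod y yr).
Qed.

(** A bootstrap run backwards from b: while the curve stays in the large ball, [step] confines it to
    the small one, from which continuity lets it go further back. As M is Hausdorff, a closed
    coordinate ball is closed in M, so the curve cannot escape at a limit time. *)
Lemma stay_in (R : realType) (n : nat) (M : c2_manifold R n) i (z : 'rV[R]_n) (r r1 a b : R) (c : R -> M) :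
  (forall y, `|y - z| <= r -> chart_cod i y) -> r1 < r -> a <= b ->
  (forall s0 (A : set M), a <= s0 -> s0 <= b -> nbhs (c s0) A ->
    exists2 rho : R, 0 < rho & forall s, a <= s -> s <= b -> `|s - s0| < rho -> A (c s)) ->
  dom i (c b) -> `|phi i (c b) - z| <= r1 ->
  (forall s, a <= s -> s <= b ->
    (forall s', s <= s' -> s' <= b -> dom i (c s') /\ `|phi i (c s') - z| <= r) ->
    `|phi i (c s) - z| <= r1) ->
  forall s, a <= s -> s <= b -> dom i (c s) /\ `|phi i (c s) - z| <= r1.
Proof.
move=> cod r1r ab cc db br1 step.
pose S := [set s | [/\ a <= s, s <= b & forall s', s <= s' -> s' <= b ->
  dom i (c s') /\ `|phi i (c s') - z| <= r1]].
have Sb : S b by split=> // s' h1 h2; have -> : s' = b by apply/eqP; rewrite eq_le h1 h2.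
have hS : has_inf S by split; [exists b|exists a => x []].
pose m := inf S.
have ma : a <= m by apply: lb_le_inf; [exists b|move=> x []].
have mS s : S s -> m <= s by move=> Ss; apply: ge_inf => //; exists a => x [].
have mb : m <= b := mS b Sb.
have after s' : m < s' -> s' <= b -> dom i (c s') /\ `|phi i (c s') - z| <= r1.
  move=> ms s'b; have sm : 0 < s' - m by rewrite subr_gt0.
  have [s [as_ sb Ss] sm'] := inf_adherent sm hS.
  by apply: Ss => //; apply: ltW; move: sm'; rewrite -/m addrC subrK.
have cod1 y : `|y - z| <= r1 -> chart_cod i y.
  by move=> h; apply: cod; apply: (le_trans h); exact: ltW.
have atm : dom i (c m) /\ `|phi i (c m) - z| <= r1.
  have [->|mb'] := eqVneq m b; first by [].
  have mlb : m < b by rewrite lt_neqAle mb'.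
  apply: contrapT => nm.
  have oA : open (~` [set x : M | dom i x /\ `|phi i x - z| <= r1]).
    by apply: closed_openC; exact: chart_ball_closed cod1.
  have nA : nbhs (c m) (~` [set x : M | dom i x /\ `|phi i x - z| <= r1]).
    by apply: open_nbhs_nbhs; split.
  have [rho rho0 h] := cc m _ ma mb nA.
  pose s := Num.min b (m + rho / 2).
  have sm : m < s by rewrite lt_min mlb /=; move: rho0; clra.
  have sb : s <= b by rewrite ge_min lexx.
  have sr : s <= m + rho / 2 by rewrite ge_min lexx orbT.
  have := h s (le_trans ma (ltW sm)) sb; apply.
    by rewrite gtr0_norm ?subr_gt0 //; move: sr rho0; clra.
  exact: after.
have Sm : S m.
  split=> // s' ms s'b; have [->//|ms'] := eqVneq s' m.
  by apply: after => //; rewrite lt_neqAle eq_sym ms'.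
suff -> : a = m by move=> s ms sb; have [_ _] := Sm; apply.
apply/eqP; rewrite eq_le ma leNgt; apply/negP => am.
have nA : nbhs (c m) [set x | dom i x /\ [set y | `|y - z| < r] (phi i x)].
  case: atm => dm mr; apply: chart_pull => //.
  apply/nbhs_ballP; exists (r - `|phi i (c m) - z|) => /=.
    by rewrite subr_gt0; exact: le_lt_trans r1r.
  move=> y; rewrite -ball_normE /= => h.
  by have := ler_distD (phi i (c m)) y z; rewrite [`|y - phi i (c m)|]distrC; move: h; clra.
have [rho rho0 h] := cc m _ ma mb nA.
pose s := Num.max a (m - rho / 2).
have sa : a <= s by rewrite le_max lexx.
have sm : s < m by rewrite gt_max am /=; move: rho0; clra.
have sr : m - rho / 2 <= s by rewrite le_max lexx orbT.
suff Ss : S s by have := mS s Ss; rewrite leNgt sm.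
have inr s' : s <= s' -> s' <= b -> dom i (c s') /\ `|phi i (c s') - z| <= r.
  move=> ss s'b; have [ms|sm'] := leP m s'.
    have [_ _ hm] := Sm; have [d1 d2] := hm s' ms s'b; split=> //.
    by apply: (le_trans d2); exact: ltW.
  have [] := h s' (le_trans sa ss) s'b _; last by move=> d1 d2; split=> //; exact: ltW.
  by rewrite ler0_norm ?subr_le0 ?(ltW sm') //; move: sr ss rho0; clra.
have sb : s <= b by apply: le_trans mb; exact: ltW.
split=> // s' ss s'b; have [d1 d2] := inr s' ss s'b; split=> //.
apply: step => //; first exact: le_trans ss.
by move=> s2 s's2 s2b; apply: inr => //; exact: le_trans s's2.
Qed.

Lemma cn_cmp (R : realType) (n : nat) (M : c2_manifold R n) (g : riemannian_metric M) i (y z p : 'rV[R]_n) : chart_cod i y -> chart_cod i z ->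
  (forall v, tn g i z v <= 2 * tn g i y v) -> cn g i y p <= 2 * cn g i z p.
Proof.
move=> cy cz h; have [v [ev pv]] := dnorm_attained p (local_gram_posdef g cy).
have [c0|c0] := eqVneq (cn g i y p) 0; first by rewrite c0 mulr_ge0 ?cn_ge0.
have cp : 0 < cn g i y p by rewrite lt_neqAle eq_sym c0 cn_ge0.
have e1 : tn g i y v = cn g i y p := ev.
have e2 : pairing p v = cn g i y p ^+ 2 := pv.
have h1 := pairing_le_tn g p v cz; have h2 := ler_wpM2l (cn_ge0 g i z p) (h v).
rewrite e1 in h2; rewrite e2 in h1.
rewrite -(ler_pM2r cp) -expr2; apply: (le_trans h1); apply: (le_trans h2).
by rewrite mulrCA mulrA.
Qed.

(** The upper inequality appends a straight segment to a curve. For the lower one a nearly optimal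
    curve is followed back for a time s. Its speed is bounded in terms of H only, because [lax] is
    Lipschitz with the uniform constant [Lam] while L grows at least like (Lam + 1) |v|. *)
Lemma lax_value (R : realType) (n : nat) (M : c2_manifold R n) (g : riemannian_metric M) (H : cotangent M -> R) Hx Hp :
  good g H Hx Hp -> exists2 Rv : R, 0 <= Rv & forall u, subsol H u ->
  forall i z r kappa t0 T, nice g H Hx Hp i z r kappa -> 0 <= t0 ->
    local_value (lh H i) (tn g i z) (fun t y => lax H u (t0 + t) (phi_inv i y)) T z (r / 2) Rv.
Proof.
move=> gH; have [Lam Lam0 hLam] := lax_lip gH.
have [C2 C20 hc2] := paths_const gH.
have [hB hhB] := good_bounded gH (2 * (Lam + 1)).
(* [C2] bounds the growth of [lax] in time and [hB] bounds H at covectors of norm 2 (Lam + 1); the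
   last 1 pays for the defect s^2 of the nearly optimal curve, as s <= 1. *)
pose Rv := C2 + `|hB| + 1.
have Rv0 : 0 <= Rv by rewrite !addr_ge0.
exists Rv => // u su i z r kappa t0 T ni t00.
have st : setting g H Hx Hp u by [].
have [r0 gg cod cmp hl] := ni.
have zz : `|z - z| <= r by rewrite subrr normr0 ltW.
have k0 := gauge_gt0 gg.
have r2 : r / 2 <= r by move: r0; clra.
split.
- move=> V; have [C C0 hC] := lag_lip `|V| hl.
  have V1 : 0 < 2 * (`|V| + 1) by rewrite mulr_gt0 // ltr_pwDr.
  exists (C * (`|V| + 1)), (r / (2 * (`|V| + 1))); split.
  + by rewrite mulr_gt0 // ltr_pwDr.
  + by rewrite divr_gt0.
  move=> t s x v s0; rewrite ler_pdivlMr // => ss s_t tT xr vV.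
  have vV' : `|v| <= `|V| by apply: (le_trans vV); exact: ler_norm.
  have sV : s * `|V| <= r / 2 by move: ss s0; clra.
  pose y := x - s *: v.
  have yE sg : y + sg *: v - x = (sg - s) *: v by rewrite /y; apply/rowP => l; rewrite !mxE; ring.
  have dy sg : 0 <= sg -> sg <= s -> `|y + sg *: v - x| <= s * `|V|.
    move=> g0 gs; rewrite yE normrZ; apply: ler_pM => //.
    by rewrite ler_norml; move: g0 gs; clra.
  have seg sg : 0 <= sg -> sg <= s -> `|y + sg *: v - z| <= r.
    move=> g0 gs; have := ler_distD x (y + sg *: v) z; have := dy sg g0 gs.
    by move: xr sV; clra.
  pose k := lag (lh H i) x v + C * (s * `|V|).
  have ak : adm H 0 s (fun sg => phi_inv i (y + sg *: v)) (fun sg => k * sg).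
    apply: (adm_line gH s0) => sg g0 gs; first exact/cod/seg.
    apply: (le_trans (hC x _ v v (le_trans xr r2) (seg sg g0 gs) vV' vV')).
    by rewrite subrr normr0 addr0 lerD2l ler_pM2l //; exact: dy.
  have ts0 : 0 <= t0 + (t - s) by rewrite addr_ge0 // subr_ge0.
  have := lax_cat st ts0 ak.
  have -> : t0 + (t - s) + s = t0 + t by clra.
  have -> : y + s *: v = x by rewrite /y subrK.
  have -> : y + 0 *: v = x - s *: v by rewrite scale0r addr0.
  have h : k * s - k * 0 <= s * lag (lh H i) x v + C * (`|V| + 1) * s ^+ 2.
    rewrite /k; have := mulr_ge0 (ltW C0) (sqr_ge0 s).
    move: (lag _ _ _) `|V| => l nV; clra.
  move: h; move: (lax _ _ _ _) (lax _ _ _ _) (lag _ _ _) (k * s) (k * 0).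
  by clear; intros; lra.
have [B B0 hBm] := hamloc_argmax (kappa * Rv) hl.
have [C C0 hC] := hamloc_lipx B hl.
pose C4 := C * (kappa * Rv).
have kR : 0 <= kappa * Rv by rewrite mulr_ge0 // ltW.
have C40 : 0 <= C4.
  by rewrite mulr_ge0 // ltW.
have kR1 : 0 < 4 * (kappa * Rv + 1) by rewrite mulr_gt0 // ltr_pwDr.
exists (C4 + 1), (Num.min 1 (r / (4 * (kappa * Rv + 1)))); split.
- by rewrite ltr_pwDr.
- by rewrite lt_min ltr01 divr_gt0.
move=> t s x s0; rewrite le_min ler_pdivlMr // => /andP[s1 ss] s_t tT xr2.
have xr := le_trans xr2 r2.
have [s00|sn0] := eqVneq s 0.
  exists 0; first by rewrite -(scale0r 0) (gaugeZ gg) normr0 mul0r.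
  by rewrite s00 subr0 scaler0 subr0 mul0r expr0n mulr0 !addr0.
have sp : 0 < s by rewrite lt_neqAle eq_sym sn0.
pose b := t0 + t; pose a := t0 + (t - s).
have a0 : 0 <= a by rewrite addr_ge0 // subr_ge0.
have ab : a <= b by rewrite /a /b; move: s0; clra.
have bas : b - a = s by rewrite /a /b; clra.
have b0 : 0 <= b := le_trans a0 ab.
have s20 : 0 < s ^+ 2 by rewrite exprn_gt0.
(* A defect of s^2 is of the order that [local_value] tolerates anyway. *)
have [c [k [ak cb near]]] := lax_near (phi_inv i x) st b0 s20.
have cx := cod x xr.
have db : dom i (c b) by rewrite cb; exact: dom_phi_inv.
have pb : phi i (c b) = x by rewrite cb phi_phi_inv.
have dk sg : 0 <= sg -> sg <= b ->
    k b - k sg <= lax H u b (phi_inv i x) - lax H u sg (c sg) + s ^+ 2.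
  move=> g0 gb; have := lax_time st ak g0 gb; move: near.
  by move: (u _) (lax _ _ _ _) (lax _ _ _ _) (k b) (k 0) (k sg); clear; intros; lra.
(* Calibration by Lam + 1 times a unit covector dual to the displacement w: the cost controls (Lam +
   1) |w|, the Lipschitz bound gives back Lam |w|, and |w| <= Rv s is left. *)
have speed sg : a <= sg -> sg <= b ->
    (forall s', sg <= s' -> s' <= b -> dom i (c s') /\ `|phi i (c s') - z| <= r) ->
    tn g i z (x - phi i (c sg)) <= Rv * s.
  move=> ag gb inr; have g0 := le_trans a0 ag; have [dsg rsg] := inr sg (lexx _) gb.
  set w := x - phi i (c sg).
  have [p [p1 pw]] := tn_dual g w (cod z zz).
  have cK y : `|y - z| <= r -> lh H i y ((Lam + 1) *: p) <= `|hB|.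
    move=> yr; apply: le_trans (ler_norm hB); apply: hhB; first exact: cod.
    have cz := cod z zz; have cy := cod y yr.
    apply: (le_trans (cn_cmp _ cy cz _)) => [v|]; first by have [_ ? _ _] := cmp y v 0 yr.
    by rewrite ler_pM2l // (cnZ g _ _ cz) ger0_norm ?addr_ge0 // ler_piMr // addr_ge0.
  have akr := adm_restrict ak g0 gb (lexx b).
  have h1 := @adm_dual _ _ _ _ _ _ _ _ i ((Lam + 1) *: p) `|hB| akr.
  have {}h1 := h1 (fun s' x1 x2 => conj (inr s' x1 x2).1 (cK _ (inr s' x1 x2).2)).
  rewrite pb -/w pairingZl pw in h1.
  have h2 := dk sg g0 gb.
  have h3 : lax H u b (phi_inv i x) <= lax H u sg (phi_inv i x) + C2 * (b - sg).
    have bg : 0 <= b - sg by rewrite subr_ge0.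
    have [c' [k' [ak' c'0 c't k't]]] := hc2 (b - sg) (phi_inv i x) bg.
    have := lax_cat st g0 ak'; have -> : sg + (b - sg) = b by clra.
    by rewrite c'0 c't -addrA k't.
  have h4 := hLam u su i z r kappa sg _ _ ni rsg xr g0; rewrite phi_invK // in h4.
  have gs : b - sg <= s by rewrite -bas lerD2l lerN2.
  have h5 : (C2 + `|hB|) * (b - sg) <= (C2 + `|hB|) * s by rewrite ler_wpM2l // addr_ge0.
  have h6 : s ^+ 2 <= s by rewrite expr2 ler_piMr.
  move: h1 h2 h3 h4 h5 h6; rewrite -/w /Rv.
  move: (lax _ _ _ _) (lax _ _ _ _) (lax _ _ _ _) (tn g i z w) (k b) (k sg).
  by clear; intros; lra.
have kRs : kappa * Rv * s <= r / 4 by move: ss s0; clra.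
have inball sg : a <= sg -> sg <= b ->
    dom i (c sg) /\ `|phi i (c sg) - z| <= r / 2 + r / 4.
  have r34 : r / 2 + r / 4 < r by move: r0; clra.
  apply: (stay_in cod r34 ab _ db).
  - move=> s' A x1 x2 nA; have [rho rho0 h] := adm_cont ak (le_trans a0 x1) x2 nA.
    by exists rho => // s2 y1 y2; apply: h => //; exact: le_trans y1.
  - by rewrite pb; move: xr2 r0; clra.
  move=> s' x1 x2 inr; have h := speed s' x1 x2 inr.
  have := gauge_lb gg (x - phi i (c s')); have := ler_distD x (phi i (c s')) z.
  rewrite [`|phi i (c s') - x|]distrC; have := ler_wpM2l (ltW k0) h; move: kRs xr2.
  move: (tn _ _ _ _) => q; clra.
have inr sg : a <= sg -> sg <= b -> dom i (c sg) /\ `|phi i (c sg) - z| <= r.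
  by move=> x1 x2; have [d1 d2] := inball sg x1 x2; split=> //; move: d2 r0; clra.
have tube sg : a <= sg -> sg <= b -> tn g i z (x - phi i (c sg)) <= Rv * s.
  by move=> x1 x2; apply: speed => // s' y1 y2; apply: inr => //; exact: le_trans y1.
pose v := s^-1 *: (x - phi i (c a)).
have svE : s *: v = x - phi i (c a) by rewrite /v scalerA divff ?scale1r // gt_eqF.
have Nv : tn g i z v <= Rv.
  rewrite /v (gaugeZ gg) gtr0_norm ?invr_gt0 // mulrC ler_pdivrMr //.
  exact: tube.
exists v => //.
have xv : x - s *: v = phi i (c a) by rewrite svE opprB addrC subrK.
have vV : `|v| <= kappa * Rv by apply: (le_trans (gauge_lb gg v)); rewrite ler_pM2l.
(* The momentum of the mean velocity v, kept constant along the piece of curve; H varies there by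
   O(s), which costs O(s^2). *)
have [P PB vP] := hBm x v xr vV.
have lE : lag (lh H i) x v = pairing P v - lh H i x P by rewrite vP; exact: (lag_argmax P hl xr).
have lhb sg : a <= sg -> sg <= b -> lh H i (phi i (c sg)) P <= lh H i x P + C4 * s.
  move=> x1 x2; have [d1 d2] := inr sg x1 x2; have := tube sg x1 x2.
  move: (phi i (c sg)) d2 => y yr ty.
  have yx : `|y - x| <= kappa * Rv * s.
    rewrite distrC; apply: (le_trans (gauge_lb gg _)); rewrite -mulrA ler_pM2l //.
  apply: (le_trans (hC x y P xr yr PB)); rewrite lerD2l /C4 -mulrA.
  exact: (ler_wpM2l (ltW C0) yx).
have akr := adm_restrict ak a0 ab (lexx b).
have := @adm_dual _ _ _ _ _ _ _ _ i P (lh H i x P + C4 * s) akr.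
move=> /(_ (fun sg x1 x2 => conj (inr sg x1 x2).1 (lhb sg x1 x2))).
rewrite pb -svE pairingZr bas => h1.
have h2 := lax_time st ak a0 ab.
have ca : phi_inv i (x - s *: v) = c a by rewrite xv phi_invK //; case: (inr a (lexx _) ab).
have h3 : lax H u (t0 + (t - s)) (phi_inv i (x - s *: v)) <= u (c 0) + k a - k 0.
  by rewrite ca.
move: h1 h3 near; rewrite lE -/b.
move: (lax _ _ _ _) (lax _ _ _ _) (u _) (k b) (k a) (k 0) (lh _ _ _ _) (pairing _ _).
by clear; intros; lra.
Qed.

Lemma sq_le_lin (R : realType) (C q m : R) : 0 <= C -> 0 <= q -> q <= m -> C * q ^+ 2 <= C * m * q.
Proof.
by move=> C0 q0 qm; rewrite expr2 -[C * m * q]mulrA ler_wpM2l // ler_wpM2r.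
Qed.

(** * Curves and the Riemannian distance *)

(* C^{1,1} regularity of the curve [c] at [s0], with speed at most [V]. *)
Definition c11 (R : realType) (n : nat) (M : c2_manifold R n) (g : riemannian_metric M) (c : R -> M) (s0 V : R) : Prop :=
  exists i (rho C : R) (gam dgam : R -> 'rV[R]_n), [/\ 0 < rho, 0 <= C & forall s s',
    `|s - s0| < rho -> `|s' - s0| < rho ->
    [/\ chart_cod i (gam s), c s = phi_inv i (gam s),
        `|gam s' - gam s - (s' - s) *: dgam s| <= C * `|s' - s| ^+ 2,
        `|dgam s' - dgam s| <= C * `|s' - s| & tn g i (gam s) (dgam s) <= V]].

Lemma tn_change (R : realType) (n : nat) (M : c2_manifold R n) (g : riemannian_metric M) i j x v : dom i x -> dom j x ->
  tn g j (phi j x) (v *m transition_jac i j x) = tn g i (phi i x) v.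
Proof.
move=> di dj; rewrite -(tnormE g _ dj) -(tnormE g _ di).
apply: (congr1 (fun w => tnorm g (x, w))).
by rewrite (jac_comp di dj (dom_chart_at x)) mulmxA.
Qed.

Lemma c11_affine (R : realType) (n : nat) (M : c2_manifold R n) (g : riemannian_metric M) c s0 V (a b : R) :
  c11 g c (a * s0 + b) V -> c11 g (fun s => c (a * s + b)) s0 (`|a| * V).
Proof.
move=> [i [rho [C [gam [dgam [rho0 C0 h]]]]]].
have a1 : 0 < `|a| + 1 by rewrite ltr_pwDr.
exists i, (rho / (`|a| + 1)), (C * a ^+ 2), (fun s => gam (a * s + b)), (fun s => a *: dgam (a * s + b)).
split; [by rewrite divr_gt0|by rewrite mulr_ge0 ?sqr_ge0|].
have near s : `|s - s0| < rho / (`|a| + 1) -> `|a * s + b - (a * s0 + b)| < rho.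
  rewrite ltr_pdivlMr // => ss; have -> : a * s + b - (a * s0 + b) = a * (s - s0) by ring.
  rewrite normrM mulrC; apply: le_lt_trans ss.
  by rewrite ler_wpM2l // lerDl.
move=> s s' /near ss /near ss'; have [h1 h2 h3 h4 h5] := h _ _ ss ss'.
have E : a * s' + b - (a * s + b) = a * (s' - s) by ring.
rewrite E normrM in h3 h4; split=> //.
- rewrite scalerA [(s' - s) * a]mulrC; apply: (le_trans h3).
  by rewrite exprMn real_normK ?num_real // mulrA.
- rewrite -scalerBr normrZ; apply: (le_trans (ler_wpM2l (normr_ge0 a) h4)).
  by rewrite -(real_normK (num_real a)); apply: le_of_eq; ring.
- by rewrite tnZ // ler_wpM2l.
Qed.

Lemma c11_near (R : realType) (n : nat) (M : c2_manifold R n) (g : riemannian_metric M) c c' s0 V (d : R) : 0 < d ->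
  (forall s, `|s - s0| < d -> c s = c' s) -> c11 g c' s0 V -> c11 g c s0 V.
Proof.
move=> d0 cc [i [rho [C [gam [dgam [rho0 C0 h]]]]]].
exists i, (Num.min d rho), C, gam, dgam; split=> //; first by rewrite lt_min d0.
move=> s s'; rewrite !lt_min => /andP[sd sr] /andP[sd' sr'].
by have [h1 h2 h3 h4 h5] := h _ _ sr sr'; split=> //; rewrite cc.
Qed.

Lemma c11_const (R : realType) (n : nat) (M : c2_manifold R n) (g : riemannian_metric M) x s0 V : 0 <= V -> c11 g (fun=> x) s0 V.
Proof.
move=> V0; have di := dom_chart_at x; have cx := codom_phi di.
exists (chart_at x), 1, 0, (fun=> phi (chart_at x) x), (fun=> 0); split=> // s s' _ _; split=> //.
- by rewrite phi_invK.
- by rewrite subrr scaler0 subrr normr0 mul0r.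
- by rewrite subrr normr0 mul0r.
- by rewrite -(scale0r 0) tnZ // normr0 mul0r.
Qed.

(** As transitions are C^2, the Taylor estimate and the Lipschitz bound on the velocity pass to any
    chart around the point; the speed is intrinsic. *)
Lemma c11_chart (R : realType) (n : nat) (M : c2_manifold R n) (g : riemannian_metric M) c s0 V j : c11 g c s0 V -> dom j (c s0) ->
  exists (rho C : R) (dgam : R -> 'rV[R]_n), [/\ 0 < rho, 0 <= C & forall s s',
    `|s - s0| < rho -> `|s' - s0| < rho ->
    [/\ dom j (c s), `|phi j (c s') - phi j (c s) - (s' - s) *: dgam s| <= C * `|s' - s| ^+ 2,
        `|dgam s' - dgam s| <= C * `|s' - s| & tn g j (phi j (c s)) (dgam s) <= V]].
Proof.
move=> [i [rho [C [gam [dgam [rho0 C0 h]]]]]] dj.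
have s00 : `|s0 - s0| < rho by rewrite subrr normr0.
have [cg0 c0E _ _ _] := h _ _ s00 s00.
have di : dom i (c s0) by rewrite c0E; exact: dom_phi_inv.
have g0E : phi i (c s0) = gam s0 by rewrite c0E phi_phi_inv.
have [r r0 [Ct Ct0 hT]] := trans_bounds di dj; rewrite g0E in hT.
pose B := `|dgam s0| + C * rho; pose K := B + C * (2 * rho).
have Cr : 0 <= C * rho by rewrite mulr_ge0 // ltW.
have B0 : 0 <= B by rewrite addr_ge0.
have K0 : 0 <= K by rewrite addr_ge0 // mulrCA mulr_ge0.
have dB s : `|s - s0| < rho -> `|dgam s| <= B.
  move=> ss; have [_ _ _ h1 _] := h _ _ s00 ss.
  have := ler_normD (dgam s - dgam s0) (dgam s0); rewrite subrK.
  have := ler_wpM2l C0 (ltW ss); move: h1; rewrite /B; clra.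
have ss2 s s' : `|s - s0| < rho -> `|s' - s0| < rho -> `|s' - s| <= 2 * rho.
  by move=> a b; have := ler_distD s0 s' s; rewrite [`|s0 - s|]distrC; move: a b; clra.
have lip s s' : `|s - s0| < rho -> `|s' - s0| < rho -> `|gam s' - gam s| <= K * `|s' - s|.
  move=> ss ss'; have [_ _ h1 _ _] := h _ _ ss ss'.
  rewrite -(subrK ((s' - s) *: dgam s) (gam s' - gam s)); apply: (le_trans (ler_normD _ _)).
  rewrite normrZ; have h2 := ler_wpM2l (normr_ge0 (s' - s)) (dB s ss).
  have h3 : C * `|s' - s| ^+ 2 <= C * (2 * rho) * `|s' - s|.
    by apply: sq_le_lin => //; exact: ss2.
  by move: h1 h2 h3; rewrite /K; clra.
have K1 : 0 < K + 1 by rewrite ltr_pwDr.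
exists (Num.min rho (r / (K + 1))), (Ct * K ^+ 2 + Ct * C + Ct * K * B), (fun s => dgam s *m jac i j (gam s)).
split; first by rewrite lt_min rho0 divr_gt0.
  by rewrite !addr_ge0 ?mulr_ge0 ?sqr_ge0 // ltW.
have ball s : `|s - s0| < Num.min rho (r / (K + 1)) -> `|s - s0| < rho /\ `|gam s - gam s0| <= r.
  rewrite lt_min ltr_pdivlMr // => /andP[x1 x2]; split=> //.
  apply: (le_trans (lip _ _ s00 x1)); apply: le_trans (ltW x2).
  by rewrite mulrC ler_wpM2l // lerDl.
move=> s s' /ball[ss sr] /ball[ss' sr'].
have [cg cE h1 h2 h3] := h _ _ ss ss'; have [_ cE' _ _ _] := h _ _ ss' ss.
have [ov t1 _ _ _] := hT (gam s) (gam s') 0 sr sr'.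
have [_ _ _ t2 _] := hT (gam s) (gam s') (gam s' - gam s - (s' - s) *: dgam s) sr sr'.
have [_ _ _ t3 _] := hT (gam s') (gam s') (dgam s' - dgam s) sr' sr'.
have [_ _ _ _ t4] := hT (gam s) (gam s') (dgam s) sr sr'.
have dis : dom i (c s) by rewrite cE; exact: dom_phi_inv.
have djs : dom j (c s).
  by rewrite cE; case: ov => x' [dx' dy'] <-; rewrite phi_invK.
have pE : phi i (c s) = gam s by rewrite cE phi_phi_inv.
have l1 := lip _ _ ss ss'.
have q0 : 0 <= `|s' - s| ^+ 2 by exact: sqr_ge0.
split=> //.
- have E : phi j (c s') - phi j (c s) - (s' - s) *: (dgam s *m jac i j (gam s)) =
    (trans i j (gam s') - trans i j (gam s) - (gam s' - gam s) *m jac i j (gam s)) +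
    (gam s' - gam s - (s' - s) *: dgam s) *m jac i j (gam s).
    rewrite cE cE' (mulmxBl (gam s' - gam s) ((s' - s) *: dgam s)) scalemxAl.
    by rewrite -/(trans i j (gam s)) -/(trans i j (gam s')) addrA subrK.
  rewrite E; apply: (le_trans (ler_normD _ _)).
  have b1 : Ct * `|gam s' - gam s| ^+ 2 <= Ct * K ^+ 2 * `|s' - s| ^+ 2.
    by rewrite -mulrA -exprMn ler_wpM2l ?(ltW Ct0) // lerXn2r ?nnegrE // mulr_ge0.
  have b2 := ler_wpM2l (ltW Ct0) h1.
  have b3 : 0 <= Ct * K * B * `|s' - s| ^+ 2 by rewrite !mulr_ge0 // ltW.
  apply: (le_trans (lerD (le_trans t1 b1) (le_trans t2 b2))).
  by move: b3; clra.
- have E : dgam s' *m jac i j (gam s') - dgam s *m jac i j (gam s) =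
    (dgam s' - dgam s) *m jac i j (gam s') + (dgam s *m jac i j (gam s') - dgam s *m jac i j (gam s)).
    by rewrite mulmxBl addrA subrK.
  rewrite E; apply: (le_trans (ler_normD _ _)).
  have b1 := ler_wpM2l (ltW Ct0) h2.
  have b2 : Ct * `|gam s' - gam s| * `|dgam s| <= Ct * (K * `|s' - s|) * B.
    by apply: ler_pM => //; [rewrite mulr_ge0 // ltW|rewrite ler_wpM2l // ltW|exact: dB].
  have b3 : 0 <= Ct * K ^+ 2 * `|s' - s| by rewrite !mulr_ge0 ?sqr_ge0 // ltW.
  apply: (le_trans (lerD (le_trans t3 b1) (le_trans t4 b2))).
  by move: b3; clra.
- have -> : jac i j (gam s) = transition_jac i j (c s) by rewrite /jac -cE.
  by rewrite (tn_change g _ dis djs) pE.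
Qed.

Lemma scalel_diff (R : realType) (V : normedModType R) (f : R -> V) (w : V) s (C rho : R) :
  0 < rho -> 0 <= C -> (forall s', `|s' - s| < rho -> `|f s' - f s - (s' - s) *: w| <= C * `|s' - s| ^+ 2) ->
  @differentiable_def _ R^o V f _ (Phantom _ (nbhs (s : R^o))) /\
  forall v : R^o, @diff _ R^o V _ (Phantom _ (nbhs (s : R^o))) f v = v *: w.
Proof.
move=> rho0 C0 h.
pose l : R^o -> V := fun t => t *: w.
have lin : linear l by move=> a u v; rewrite /l scalerDl scalerA.
pose L : {linear R^o -> V} := HB.pack l (GRing.isLinear.Build R R^o V *:%R l lin).
have cL : continuous L.
  by apply: (@lip_continuous R R^o V L `|w|) => x y; rewrite /= /l -scalerBl normrZ mulrC.
have [|d1 d2] := @eps_diff R R^o V f L s cL; last by split=> // v; rewrite d2.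
move=> e e0; have C1 : 0 < C + 1 by rewrite ltr_pwDr.
exists (Num.min rho (e / (C + 1))); first by rewrite lt_min rho0 divr_gt0.
move=> y; rewrite lt_min ltr_pdivlMr // => /andP[y1 y2].
apply: (le_trans (h y y1)); rewrite expr2 mulrA ler_wpM2r // mulrC.
by apply: le_trans (ltW y2); rewrite ler_wpM2l // lerDl.
Qed.

Lemma c11_C1_curve (R : realType) (n : nat) (M : c2_manifold R n) (g : riemannian_metric M) c V : (forall s0, c11 g c s0 V) -> C1_curve c.
Proof.
move=> hc; split.
  move=> s0 A nA; have [i [rho [C [gam [dgam [rho0 C0 h]]]]]] := hc s0.
  have s00 : `|s0 - s0| < rho by rewrite subrr normr0.
  have [cg0 c0E _ _ _] := h _ _ s00 s00; rewrite c0E in nA.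
  have := phi_inv_continuous cg0 nA => /nbhs_ballP[d /= d0 hd].
  pose K := `|dgam s0| + C * rho.
  have K0 : 0 <= K by rewrite addr_ge0 // mulr_ge0 // ltW.
  have K1 : 0 < K + 1 by rewrite ltr_pwDr.
  apply/nbhs_ballP; exists (Num.min rho (d / (K + 1))); first by rewrite /= lt_min rho0 divr_gt0.
  move=> s; rewrite -ball_normE /= distrC lt_min ltr_pdivlMr // => /andP[s1 s2].
  have [_ cE _ _ _] := h _ _ s1 s00; rewrite cE; apply: hd.
  rewrite -ball_normE /= distrC; have [_ _ h1 _ _] := h _ _ s00 s1.
  apply: le_lt_trans s2; rewrite -(subrK ((s - s0) *: dgam s0) (gam s - gam s0)).
  apply: (le_trans (ler_normD _ _)); rewrite normrZ.
  have h3 : C * `|s - s0| ^+ 2 <= C * rho * `|s - s0|.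
    by apply: sq_le_lin => //; exact: ltW.
  by have := normr_ge0 (s - s0); move: h1 h3; rewrite /K; clra.
move=> j; split=> [s dj|v s dj].
  have [rho [C [dgam [rho0 C0 h]]]] := c11_chart (hc s) dj.
  have s00 : `|s - s| < rho by rewrite subrr normr0.
  have [] := @scalel_diff R _ (phi j \o c) (dgam s) s C rho rho0 C0 _ => // s' ss'.
  by have [] := h s s' s00 ss'.
have [rho [C [dgam [rho0 C0 h]]]] := c11_chart (hc s) dj.
have dE s1 : `|s1 - s| < rho -> @diff _ R^o _ _ (Phantom _ (nbhs (s1 : R^o))) (phi j \o c) v = v *: dgam s1.
  move=> ss1; have r1 : 0 < rho - `|s1 - s| by rewrite subr_gt0.
  have [] := @scalel_diff R _ (phi j \o c) (dgam s1) s1 C _ r1 C0 _ => // s' ss'.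
  have [|_ a1 _ _] := h s1 s' ss1; last exact: a1.
  by have := ler_distD s1 s' s; move: ss'; clra.
apply/(@eps_continuous R R^o) => e e0.
have D1 : 0 < C * `|v| + 1 by rewrite ltr_pwDr // mulr_ge0.
exists (Num.min rho (e / (C * `|v| + 1))); first by rewrite lt_min rho0 divr_gt0.
move=> y; rewrite lt_min ltr_pdivlMr // => /andP[y1 y2].
have s00 : `|s - s| < rho by rewrite subrr normr0.
apply: (le_trans (le_of_eq (congr1 (fun a => `|a|) (congr2 (fun a b => a - b) (dE y y1) (dE s s00))))).
rewrite -scalerBr normrZ; have [_ _ a1 _] := h s y s00 y1.
apply: (le_trans (ler_wpM2l (normr_ge0 v) a1)); apply: le_trans (ltW y2).
have := normr_ge0 (y - s); clra.
Qed.

Lemma c11_speed (R : realType) (n : nat) (M : c2_manifold R n) (g : riemannian_metric M) c s V : c11 g c s V ->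
  tnorm g (c s, velocity c s) <= V.
Proof.
move=> hc; have da := dom_chart_at (c s).
have [rho [C [dgam [rho0 C0 h]]]] := c11_chart hc da.
have s00 : `|s - s| < rho by rewrite subrr normr0.
have [_ _ _ hV] := h s s s00 s00.
have [d1 d2] := @scalel_diff R _ (phi (chart_at (c s)) \o c) (dgam s) s C rho rho0 C0
  (fun s' ss' => let: And4 _ a _ _ := h s s' s00 ss' in a).
have vE : velocity c s = dgam s.
  by rewrite /velocity (derive1E' d1) d2 scale1r.
rewrite vE; have := tnormE g (dgam s) da; rewrite (jac_id da) mulmx1 => E.
exact: (le_trans (le_of_eq E) hV).
Qed.

(* The integral is defined by suprema over simple functions, so it is monotone
   without any measurability assumption. *)
Lemma int_mono (d : measure_display) (T : measurableType d) (R : realType)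
  (mu : set T -> \bar R) (D E : set T) (f g : T -> \bar R) :
  (forall x, ((f \_ D) x <= (g \_ E) x)%E) -> (integral mu D f <= integral mu E g)%E.
Proof.
move=> fg; rewrite /integral; apply: leeB; apply: ereal_sup_le => _ [h hf <-]; exists h => // x;
  apply: (le_trans (hf x)); rewrite ?funeposE ?funenegE ge_max !le_max lexx orbT andbT.
  by rewrite fg.
by rewrite leeN2 fg.
Qed.

Lemma derive1_eps (R : realType) (V : normedModType R) (f : R -> V) (s : R) (w : V) :
  (forall e : R, 0 < e -> exists2 d : R, 0 < d & forall y, `|y - s| < d ->
    `|f y - f s - (y - s) *: w| <= e * `|y - s|) <->
  @differentiable_def _ R^o V f _ (Phantom _ (nbhs (s : R^o))) /\ derive1 f s = w.
Proof.
split=> [h|[df <-] e e0].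
  pose l : R^o -> V := fun t => t *: w.
  have lin : linear l by move=> a u v; rewrite /l scalerDl scalerA.
  pose L : {linear R^o -> V} := HB.pack l (GRing.isLinear.Build R R^o V *:%R l lin).
  have cL : continuous L.
    by apply: (@lip_continuous R R^o V L `|w|) => x y; rewrite /= /l -scalerBl normrZ mulrC.
  have [d1 d2] := @eps_diff R R^o V f L s cL h; split=> //.
  by rewrite (derive1E' d1) d2 /= /l scale1r.
have [d d0 hd] := @diff_eps R R^o V f s df e e0.
exists d => // y ys; have := hd y ys; rewrite (derive1E' df).
by rewrite -linearZ /= [(y - s) *: _]mulr1.
Qed.

Lemma vel_change (R : realType) (n : nat) (M : c2_manifold R n) (c : R -> M) (s : R) i j :
  {for s, continuous c} -> dom i (c s) -> dom j (c s) ->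
  @differentiable_def _ R^o 'rV[R]_n (phi i \o c) _ (Phantom _ (nbhs (s : R^o))) ->
  @differentiable_def _ R^o 'rV[R]_n (phi j \o c) _ (Phantom _ (nbhs (s : R^o))) /\
  derive1 (phi j \o c) s = derive1 (phi i \o c) s *m transition_jac i j (c s).
Proof.
move=> cc di dj df; have dt := trans_diff di dj.
have nr : \forall y \near (s : R^o), (phi j \o c) y = ((phi j \o phi_inv i) \o (phi i \o c)) y.
  have ni : nbhs (c s) (dom i) by apply: open_nbhs_nbhs; split; [exact: dom_open|].
  have H y : dom i (c y) -> (phi j \o c) y = ((phi j \o phi_inv i) \o (phi i \o c)) y.
    by move=> dy /=; rewrite phi_invK.
  exact: (filterS H (cc _ ni)).
have dg : @differentiable_def _ R^o 'rV[R]_n ((phi j \o phi_inv i) \o (phi i \o c)) _ (Phantom _ (nbhs (s : R^o))).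
  exact: (@differentiable_comp _ R^o _ _ (phi i \o c) (phi j \o phi_inv i) s df dt).
have [d1 d2] := @near_diff R R^o _ _ _ s nr dg; split; first exact: d1.
etransitivity; first exact: (derive1E' d1).
etransitivity; first exact: (congr1 (fun h => h (1 : R)) d2).
etransitivity; first exact: (congr1 (fun h => h (1 : R)) (@diff_comp _ R^o _ _ (phi i \o c) (phi j \o phi_inv i) s df dt)).
exact: esym (etrans (jacE i j (c s) _) (congr1 ('d (phi j \o phi_inv i) (phi i (c s))) (derive1E' df))).
Qed.

Lemma vel_tnorm (R : realType) (n : nat) (M : c2_manifold R n) (g : riemannian_metric M) (c : R -> M) (s : R) i :
  {for s, continuous c} -> dom i (c s) ->
  @differentiable_def _ R^o 'rV[R]_n (phi i \o c) _ (Phantom _ (nbhs (s : R^o))) ->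
  tnorm g (c s, velocity c s) = tn g i (phi i (c s)) (derive1 (phi i \o c) s).
Proof.
move=> cc di df; have [_ E] := vel_change cc di (dom_chart_at (c s)) df.
by rewrite /velocity E (tnormE g _ di).
Qed.

(** The metric half of [nice], enough to compare the distance with coordinates. *)
Definition mball (R : realType) (n : nat) (M : c2_manifold R n) (g : riemannian_metric M) i (z : 'rV[R]_n) (r kappa : R) : Prop :=
  [/\ 0 < r, gauge (tn g i z) kappa, forall y, `|y - z| <= r -> chart_cod i y
  & forall y v p, `|y - z| <= r ->
      [/\ tn g i y v <= 2 * tn g i z v, tn g i z v <= 2 * tn g i y v,
        `|v| <= kappa * tn g i y v /\ tn g i y v <= kappa * `|v|
      & `|p| <= kappa * cn g i y p /\ cn g i y p <= kappa * `|p|]].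

Lemma nice_mball (R : realType) (n : nat) (M : c2_manifold R n) (g : riemannian_metric M) (H : cotangent M -> R) Hx Hp i z r kappa :
  nice g H Hx Hp i z r kappa -> mball g i z r kappa.
Proof. by case=> r0 gg cod cmp _; split. Qed.

(** The linear function given by p is a calibration: on the ball its derivative along the curve is
    at most twice the speed, so its increment is at most twice the length. *)
Lemma length_segment (R : realType) (n : nat) (M : c2_manifold R n) (g : riemannian_metric M) i z (r kappa : R) (c : R -> M) (l a b : R) (p : 'rV[R]_n) :
  mball g i z r kappa -> C1_curve c -> (curve_length g c <= l%:E)%E -> 0 <= a -> a < b -> b <= 1 ->
  (forall s, a <= s -> s <= b -> dom i (c s) /\ `|phi i (c s) - z| <= r) -> cn g i z p <= 1 ->
  pairing p (phi i (c b) - phi i (c a)) <= 2 * l.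
Proof.
move=> [r0 gg cod cmp] [cc hc] lc a0 ab b1 inb cp.
have hl (x y : R) : x <= 2 * y -> y <= 1 -> 1 / 2 * x <= 1 by clra.
(* The metric varies by a factor 2 at most over the ball, so half of p has conorm at most 1 at each
   of its points. *)
have cz : chart_cod i z by apply: cod; rewrite subrr normr0 ltW.
pose p' := (1 / 2) *: p.
have df (t : R) : a <= t -> t <= b -> @differentiable_def _ R^o 'rV[R]_n (phi i \o c) _ (Phantom _ (nbhs (t : R^o))).
  by move=> st t1; have [dt _] := inb t st t1; exact: (hc i).1.
pose V t := derive1 (phi i \o c) t.
pose F t : R := pairing p' (phi i (c t)).
pose f t : R := pairing p' (V t).
have np : 0 < n%:R * `|p'| + 1 by rewrite ltr_pwDr // mulr_ge0 ?ler0n.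
have dF (t : R) : a <= t -> t <= b -> @differentiable_def _ R^o R^o F _ (Phantom _ (nbhs (t : R^o))) /\ derive1 F t = f t.
  move=> st t1; apply/(@derive1_eps R R^o) => e e0.
  have [d d0 hd] := (@derive1_eps _ _ (phi i \o c) t (V t)).2 (conj (df t st t1) erefl) _ (divr_gt0 e0 np).
  exists d => // y /hd h.
  have -> : F y - F t - (y - t) *: f t = pairing p' (phi i (c y) - phi i (c t) - (y - t) *: V t).
    by rewrite !pairingBr pairingZr.
  apply: (le_trans (pairing_le _ _)).
  have npE : (n%:R * `|p'| + 1) * (e / (n%:R * `|p'| + 1) * `|y - t|) = e * `|y - t|.
    by field; rewrite gt_eqF.
  have := ler_wpM2l (ltW np) h; rewrite npE; apply: le_trans.
  by apply: ler_wpM2r => //; rewrite lerDl.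
have cf : {within `[a, b], continuous f}.
  apply: continuous_in_subspaceT => t; rewrite inE /= in_itv /= => /andP[st t1].
  have [dt _] := inb t st t1.
  have nd : nbhs (t : R^o) (c @^-1` dom i).
    by apply: cc; apply: open_nbhs_nbhs; split; [exact: dom_open|].
  have c2 := (hc i).2 (1 : R^o) t dt; rewrite /= in c2.
  have c3 : {for t, continuous (fun t : R^o => pairing p' ('d (phi i \o c) t (1 : R^o)))}.
    apply: (@continuous_comp _ _ _ (fun t : R^o => 'd (phi i \o c) t (1 : R^o)) (pairing p')) => //.
    have -> : pairing p' = (fun v => pairing v p') by apply/funext => v; exact: pairingC.
    exact: pairing_continuousl.
  have E : \forall t' \near (t : R^o), pairing p' ('d (phi i \o c) t' (1 : R^o)) = f t'.
    by apply: filterS nd => t' dt'; rewrite /f /V (derive1E' ((hc i).1 _ dt')).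
  apply: cvg_trans; last first.
    rewrite /f /V (derive1E' (df t st t1)); exact: c3.
  by apply: near_eq_cvg; apply: filterS E.
have FTC : (\int[lebesgue_measure]_(x in `[a, b]) (f x)%:E = (F b)%:E - (F a)%:E)%E.
  apply: continuous_FTC2 => //; last by move=> t; rewrite in_itv /= => /andP[/ltW st /ltW t1]; case: (dF t st t1).
  have cF (t : R) : a <= t -> t <= b -> {for (t : R^o), continuous (F : R^o -> R^o)}.
    by move=> st t1; have [dt _] := dF t st t1; exact: (@differentiable_continuous R R^o R^o t F dt).
  split; first by move=> t; rewrite in_itv /= => /andP[/ltW st /ltW t1]; have [dt _] := dF t st t1; exact: (@diff_derivable R R^o R^o F t 1 dt).
    by apply: cvg_at_right_filter; exact: (cF a (lexx a) (ltW ab)).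
  by apply: cvg_at_left_filter; exact: (cF b (ltW ab) (lexx b)).
have : ((F b)%:E - (F a)%:E <= curve_length g c)%E.
  rewrite -FTC; apply: int_mono => t; rewrite !patchE.
  case: ifPn => [|_].
    rewrite inE /= in_itv /= => /andP[st t1]; have [dt bt] := inb t st t1.
    rewrite mem_set ?lee_fin /=; last by rewrite in_itv /= (le_trans a0 st) (le_trans t1 b1).
    rewrite (vel_tnorm g (cc t) dt (df t st t1)) /f -/(V t).
    have cyt : chart_cod i (phi i (c t)) by exact: codom_phi.
    apply: (le_trans (pairing_le_tn g _ _ cyt)).
    have c1' : cn g i (phi i (c t)) p' <= 1.
      rewrite /p' (cnZ g _ _ cyt) ger0_norm ?divr_ge0 //.
      have c2 : cn g i (phi i (c t)) p <= 2 * cn g i z p.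
        by apply: (cn_cmp _ cyt cz) => v; have [] := cmp (phi i (c t)) v 0 bt.
      exact: hl c2 cp.
    by rewrite -[leRHS]mul1r ler_wpM2r ?tn_ge0.
  by case: ifP => // _; rewrite lee_fin sqrtr_ge0.
move=> /le_trans/(_ lc); rewrite -EFinB lee_fin /F -pairingBr /p' pairingZl; lra.
Qed.

(** The length estimate enters as a hypothesis on increments, so that the argument also applies to
    the reversed curve, whose length need not be computed. *)
Lemma lower_core (R : realType) (n : nat) (M : c2_manifold R n) (g : riemannian_metric M) i z (r kappa : R) (c : R -> M) y1 (l : R) :
  mball g i z r kappa -> continuous c -> c 1 = phi_inv i y1 -> `|y1 - z| <= r / 2 ->
  0 <= l -> 4 * kappa * l < r ->
  (forall s p, 0 <= s -> s < 1 ->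
    (forall s', s <= s' -> s' <= 1 -> dom i (c s') /\ `|phi i (c s') - z| <= r) -> cn g i z p <= 1 ->
    pairing p (phi i (c 1) - phi i (c s)) <= 2 * l) ->
  dom i (c 0) /\ tn g i z (y1 - phi i (c 0)) <= 2 * l.
Proof.
move=> [r0 gg cod cmp] cc c1 y1z l0 lr seg.
have k0 := gauge_gt0 gg.
have cz : chart_cod i z by apply: cod; rewrite subrr normr0 ltW.
have cy1 : chart_cod i y1 by apply: cod; apply: (le_trans y1z); lra.
have pc1 : phi i (c 1) = y1 by rewrite c1 phi_phi_inv.
have step (s : R) : 0 <= s -> s <= 1 ->
    (forall s', s <= s' -> s' <= 1 -> dom i (c s') /\ `|phi i (c s') - z| <= r) ->
    tn g i z (y1 - phi i (c s)) <= 2 * l.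
  move=> s0; rewrite le_eqVlt => /orP[/eqP -> _|s1 inb].
    by rewrite pc1 subrr -(scale0r 0) (tnZ g _ _ cz) normr0 mul0r mulr_ge0.
  have [p [cp pv]] := tn_dual g (y1 - phi i (c s)) cz.
  by have := seg s p s0 s1 inb cp; rewrite pc1 pv.
have bnd (s : R) : tn g i z (y1 - phi i (c s)) <= 2 * l -> `|phi i (c s) - z| <= r / 2 + 2 * kappa * l.
  move=> h; have h1 := gauge_lb gg (y1 - phi i (c s)).
  have h2 := ler_wpM2l (ltW k0) h; have := ler_distD y1 (phi i (c s)) z.
  by rewrite [`|phi i (c s) - y1|]distrC; move: h1 h2 y1z; clra.
have r1 : r / 2 + 2 * kappa * l < r by move: lr; clra.
have dc1 : dom i (c 1) by rewrite c1; exact: dom_phi_inv.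
have kl : 0 <= 2 * kappa * l by rewrite !mulr_ge0 // ltW.
have st := @stay_in _ _ _ i z r _ 0 1 c cod r1 ler01 _ dc1 _ _.
have all : forall s, 0 <= s -> s <= 1 -> dom i (c s) /\ `|phi i (c s) - z| <= r / 2 + 2 * kappa * l.
  apply: st => [s0 A _ _ nA||s s0 s1 inb].
  - have := cc s0 A nA => /nbhs_ballP[d /= d0 hd]; exists d => // s _ _ ss.
    by apply: hd; rewrite -ball_normE /= distrC.
  - by rewrite pc1; move: kl y1z; clra.
  - by apply: bnd; apply: step.
split; first by have [] := all 0 (lexx 0) ler01.
apply: step => // s s0 s1; have [h1 h2] := all s s0 s1; split=> //.
exact: (le_trans h2 (ltW r1)).
Qed.

Lemma curve_length_ge0 (R : realType) (n : nat) (M : c2_manifold R n) (g : riemannian_metric M) (c : R -> M) (l : R) :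
  (curve_length g c <= l%:E)%E -> 0 <= l.
Proof.
move=> lc; rewrite -lee_fin; apply: le_trans lc.
by apply: integral_ge0 => s _; rewrite lee_fin sqrtr_ge0.
Qed.

Lemma riem_lower (R : realType) (n : nat) (M : c2_manifold R n) (g : riemannian_metric M) i z (r kappa : R) (c : R -> M) y1 (l : R) :
  mball g i z r kappa -> C1_curve c -> c 1 = phi_inv i y1 -> `|y1 - z| <= r / 2 ->
  (curve_length g c <= l%:E)%E -> 4 * kappa * l < r ->
  dom i (c 0) /\ tn g i z (y1 - phi i (c 0)) <= 2 * l.
Proof.
move=> mb hc c1 y1z lc lr; have [cc _] := hc.
apply: (lower_core mb cc c1 y1z (curve_length_ge0 lc) lr) => s p s0 s1 inb cp.
exact: (length_segment mb hc lc s0 s1 (lexx 1) inb cp).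
Qed.

Lemma riem_lower_start (R : realType) (n : nat) (M : c2_manifold R n) (g : riemannian_metric M) i z (r kappa : R) (c : R -> M) y1 (l : R) :
  mball g i z r kappa -> C1_curve c -> c 0 = phi_inv i y1 -> `|y1 - z| <= r / 2 ->
  (curve_length g c <= l%:E)%E -> 4 * kappa * l < r ->
  dom i (c 1) /\ tn g i z (y1 - phi i (c 1)) <= 2 * l.
Proof.
move=> mb hc c0 y1z lc lr; have [cc _] := hc.
pose c' s := c (1 - s).
have cc' : continuous c'.
  move=> s; apply: (@continuous_comp _ _ _ (fun s : R => 1 - s) c); last exact: cc.
  by apply: cvgB; [exact: cvg_cst|exact: cvg_id].
have c'1 : c' 1 = phi_inv i y1 by rewrite /c' subrr.
have c'0 : c' 0 = c 1 by rewrite /c' subr0.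
rewrite -c'0; apply: (lower_core mb cc' c'1 y1z (curve_length_ge0 lc) lr) => s p s0 s1 inb cp.
have s1' : 0 < 1 - s by rewrite subr_gt0.
have s2' : 1 - s <= 1 by rewrite gerBl.
have [_ gg cod cmp] := mb.
have cz : chart_cod i z by apply: cod; rewrite subrr normr0; case: mb => /ltW.
have cpN : cn g i z (- p) <= 1 by rewrite -scaleN1r (cnZ g _ _ cz) normrN1 mul1r.
have := @length_segment _ _ _ g i z r kappa c l 0 (1 - s) (- p) mb hc lc (lexx 0) s1' s2' _ cpN.
rewrite pairingNl -pairingNr opprB /c' subrr; apply=> t t0 ts.
have E : 1 - (1 - t) = t by ring.
by have := inb (1 - t); rewrite /c' E; apply; move: t0 ts; clra.
Qed.

(* [conn g x y T]: a C^{1,1} curve of speed at most 1 goes from x to y in time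
   T and is constant near its ends, so that such curves can be concatenated. *)
Definition conn (R : realType) (n : nat) (M : c2_manifold R n) (g : riemannian_metric M) (x y : M) (T : R) : Prop :=
  0 <= T /\ exists (c : R -> M) (d : R), [/\ 0 < d, forall s, c11 g c s 1,
    forall s, s <= d -> c s = x & forall s, T - d <= s -> c s = y].

Lemma conn_refl (R : realType) (n : nat) (M : c2_manifold R n) (g : riemannian_metric M) x : conn g x x 0.
Proof. by split=> //; exists (fun=> x), 1; split=> // s; exact: c11_const. Qed.

Lemma conn_sym (R : realType) (n : nat) (M : c2_manifold R n) (g : riemannian_metric M) x y T : conn g x y T -> conn g y x T.
Proof.
move=> [T0 [c [d [d0 hc cx cy]]]]; split=> //; exists (fun s => c (-1 * s + T)), d; split=> // s.
- by have := c11_affine (hc (-1 * s + T)); rewrite normrN1 mul1r.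
- by move=> sd; apply: cy; move: sd; clra.
- by move=> sd; apply: cx; move: sd; clra.
Qed.

Lemma conn_cat (R : realType) (n : nat) (M : c2_manifold R n) (g : riemannian_metric M) x y z T1 T2 :
  conn g x y T1 -> conn g y z T2 -> conn g x z (T1 + T2).
Proof.
move=> [T10 [c1 [d1 [d10 h1 c1x c1y]]]] [T20 [c2 [d2 [d20 h2 c2y c2z]]]].
split; first exact: addr_ge0.
pose d := Num.min d1 d2.
have d0 : 0 < d by rewrite lt_min d10.
have dd1 : d <= d1 by rewrite ge_min lexx.
have dd2 : d <= d2 by rewrite ge_min lexx orbT.
exists (fun s => if s <= T1 then c1 s else c2 (s - T1)), d; split=> // [s|s sd|s sd].
- have [sT|sT] := ltP s T1.
    apply: (@c11_near _ _ _ g _ c1 s 1 (T1 - s)); [by rewrite subr_gt0| |exact: h1].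
    move=> s' ss; rewrite ifT //; have := ler_norm (s' - s); move: ss; clra.
  apply: (@c11_near _ _ _ g _ (fun s => c2 (1 * s + - T1)) s 1 d1) => //.
    move=> s' ss; have := ler_norm (s - s'); rewrite distrC => ss'.
    case: leP => h; last by rewrite mul1r.
    rewrite c1y; last by move: ss ss' sT; clra.
    by rewrite c2y //; move: h d20; clra.
  by have := c11_affine (h2 (1 * s + - T1)); rewrite normr1 mul1r.
- case: leP => h; first by apply: c1x; exact: le_trans sd dd1.
  rewrite c2y; last by move: sd dd2 T10; clra.
  rewrite -(c1y T1); last by move: d10; clra.
  by apply: c1x; move: h sd dd1; clra.
- case: leP => h; last by apply: c2z; move: sd dd2; clra.
  rewrite c1y; last by move: sd dd1 T20; clra.
  rewrite -(c2y T2); last by move: sd dd2 h; clra.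
  by apply: c2z; move: d20; clra.
Qed.

Section SmoothStep.
Variable R : realType.
Implicit Types h : R.

Definition clamp h : R := Num.max 0 (Num.min 1 h).
(** The cubic 3 x^2 - 2 x^3 has slope 0 at 0 and at 1, so its extension by constants is C^{1,1}. It
    reparametrizes segments so that they rest at both ends. *)
Definition step h : R := 3 * clamp h ^+ 2 - 2 * clamp h ^+ 3.
Definition dstep h : R := 6 * clamp h * (1 - clamp h).

Lemma clampP h : [\/ h <= 0 /\ clamp h = 0, [/\ 0 <= h, h <= 1 & clamp h = h] | 1 <= h /\ clamp h = 1].
Proof.
rewrite /clamp; have [h0|h0] := leP h 0.
  by apply: Or31; split=> //; rewrite min_r ?max_l // (le_trans h0).
have [h1|h1] := leP h 1; last by apply: Or33; split; [exact: ltW|rewrite max_r].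
by apply: Or32; split; [exact: ltW|done|rewrite max_r // ltW].
Qed.

Lemma clamp_itv h : 0 <= clamp h <= 1.
Proof. by case: (clampP h) => [[_ ->]|[h0 h1 ->]|[_ ->]]; rewrite ?lexx ?ler01 ?h0 ?h1. Qed.

Lemma clamp_lip h h' : `|clamp h' - clamp h| <= `|h' - h|.
Proof.
have b1 := ler_norm (h' - h); have b2 := ler_norm (h - h'); rewrite distrC in b2.
by rewrite ler_norml; move: b1 b2; move: (`|h' - h|) => q b1 b2; apply/andP; split;
  case: (clampP h) => [[a0 ->]|[a0 a1 ->]|[a1 ->]]; case: (clampP h') => [[e0 ->]|[e0 e1 ->]|[e1 ->]]; lra.
Qed.

Lemma dstep_bound h : `|dstep h| <= 2.
Proof.
rewrite /dstep; have /andP[a b] := clamp_itv h; rewrite ger0_norm; first by nra.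
by rewrite !mulr_ge0 // subr_ge0.
Qed.

Lemma dstep_lip h h' : `|dstep h' - dstep h| <= 6 * `|h' - h|.
Proof.
have := clamp_lip h h'; have /andP[a b] := clamp_itv h; have /andP[a' b'] := clamp_itv h'.
have -> : dstep h' - dstep h = 6 * (1 - clamp h - clamp h') * (clamp h' - clamp h) by rewrite /dstep; ring.
move=> l; rewrite normrM; apply: ler_pM => //.
by rewrite normrM ger0_norm // -[leRHS]mulr1 ler_wpM2l // ler_norml; apply/andP; split; lra.
Qed.

Lemma step_itv h : 0 <= step h <= 1.
Proof.
have /andP[a b] := clamp_itv h; rewrite /step; move: (clamp h) a b => k a b.
have k2 : 0 <= k ^+ 2 by exact: sqr_ge0.
have E : 1 - (3 * k ^+ 2 - 2 * k ^+ 3) = (1 - k) ^+ 2 * (1 + 2 * k) by ring.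
have E' : 3 * k ^+ 2 - 2 * k ^+ 3 = k ^+ 2 * (3 - 2 * k) by ring.
apply/andP; split; first by rewrite E' mulr_ge0 //; lra.
by rewrite -subr_ge0 E mulr_ge0 ?sqr_ge0 //; lra.
Qed.

Lemma step_taylor_aux (a b : R) : 0 <= a -> 0 <= b -> b <= 1 ->
  `|a * (b * (1 - b))| <= (a + b) ^+ 2.
Proof.
move=> a0 b0 b1; have b1' : 0 <= 1 - b by rewrite subr_ge0.
rewrite ger0_norm ?mulr_ge0 //; have p1 := mulr_ge0 a0 b0; have p2 := mulr_ge0 p1 b0.
have p3 := sqr_ge0 a; have p4 := sqr_ge0 b.
have -> : (a + b) ^+ 2 = a ^+ 2 + 2 * (a * b) + b ^+ 2 by ring.
have -> : a * (b * (1 - b)) = a * b - a * b * b by ring.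
lra.
Qed.

Lemma step_taylor h h' : `|step h' - step h - (h' - h) * dstep h| <= 9 * `|h' - h| ^+ 2.
Proof.
have l := clamp_lip h h'; have /andP[a b] := clamp_itv h; have /andP[a' b'] := clamp_itv h'.
have -> : step h' - step h - (h' - h) * dstep h =
  (3 - 4 * clamp h - 2 * clamp h') * (clamp h' - clamp h) ^+ 2 +
  6 * (((clamp h' - clamp h) - (h' - h)) * (clamp h * (1 - clamp h))) by rewrite /step /dstep; ring.
have l2 : (clamp h' - clamp h) ^+ 2 <= `|h' - h| ^+ 2.
  by rewrite -(real_normK (num_real (clamp h' - clamp h))) lerXn2r ?nnegrE.
apply: (le_trans (ler_normD _ _)).
have b1 : `|(3 - 4 * clamp h - 2 * clamp h') * (clamp h' - clamp h) ^+ 2| <= 3 * `|h' - h| ^+ 2.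
  rewrite normrM; apply: ler_pM => //; last by rewrite ger0_norm ?sqr_ge0.
  by rewrite ler_norml; apply/andP; split; lra.
have b2 : `|((clamp h' - clamp h) - (h' - h)) * (clamp h * (1 - clamp h))| <= `|h' - h| ^+ 2.
  rewrite real_normK ?num_real //.
  case: (clampP h) => [[a0 ->]|[a0 a1 ->]|[a1 ->]];
    rewrite ?subrr ?subr0 ?(mulr0, mul0r) ?normr0 ?sqr_ge0 //.
  case: (clampP h') => [[e0 ->]|[e0 e1 ->]|[e1 ->]]; last 2 first.
  - by rewrite subrr mul0r normr0 sqr_ge0.
  - have -> : (1 - h - (h' - h)) * (h * (1 - h)) = - ((h' - 1) * ((1 - h) * (1 - (1 - h)))) by ring.
    have -> : h' - h = (h' - 1) + (1 - h) by ring.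
    rewrite normrN; apply: step_taylor_aux; lra.
  have -> : 0 - h - (h' - h) = - h' by ring.
  have -> : (h' - h) ^+ 2 = (- h' + h) ^+ 2 by ring.
  by apply: step_taylor_aux; lra.
rewrite [X in _ + X]normrM [X in _ + X * _]ger0_norm //; lra.
Qed.

End SmoothStep.

Lemma conn_segment (R : realType) (n : nat) (M : c2_manifold R n) (g : riemannian_metric M) i z (r kappa : R) (y y' : 'rV[R]_n) (T : R) :
  mball g i z r kappa -> `|y - z| <= r -> `|y' - z| <= r ->
  0 < T -> 8 * tn g i z (y' - y) <= T -> conn g (phi_inv i y) (phi_inv i y') T.
Proof.
move=> [r0 gg cod cmp] yr y'r T0 hT; split; first exact: ltW.
have T2 : 0 <= 2 / T by rewrite divr_ge0 // ltW.
(* h crosses [0, 1] while s runs through [T/4, 3T/4], so the curve is constant near both ends. The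
   slope 2 / T, the bound 2 on [dstep] and the factor 2 between norms make up the 8 of the
   hypothesis. *)
pose h (s : R) : R := 2 / T * s - 2^-1.
pose gam (s : R) := y + step (h s) *: (y' - y).
pose dgam (s : R) := (2 / T * dstep (h s)) *: (y' - y).
have inb s : `|gam s - z| <= r.
  have /andP[a b] := step_itv (h s).
  have b' : 0 <= 1 - step (h s) by rewrite subr_ge0.
  have -> : gam s - z = (1 - step (h s)) *: (y - z) + step (h s) *: (y' - z).
    rewrite /gam !scalerBl !scalerBr !scale1r.
    by apply/rowP => k; rewrite !mxE; ring.
  apply: (le_trans (ler_normD _ _)); rewrite !normrZ (ger0_norm a) (ger0_norm b').
  have b1 : (1 - step (h s)) * `|y - z| <= (1 - step (h s)) * r by rewrite ler_wpM2l.
  have b2 := ler_wpM2l a y'r.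
  by move: b1 b2; clra.
exists (fun s => phi_inv i (gam s)), (T / 4); split.
- by rewrite divr_gt0.
- move=> s0; exists i, 1, (9 * (2 / T) ^+ 2 * `|y' - y|), gam, dgam.
  split; [exact: ltr01|by apply: mulr_ge0 => //; apply: mulr_ge0 => //; exact: sqr_ge0|move=> s s' _ _].
  have hh : h s' - h s = 2 / T * (s' - s) by rewrite /h; ring.
  have nT : `|2 / T| = 2 / T by rewrite ger0_norm // divr_ge0 // ltW.
  split=> //; first exact: cod.
  + have -> : gam s' - gam s - (s' - s) *: dgam s =
      (step (h s') - step (h s) - (h s' - h s) * dstep (h s)) *: (y' - y).
      by rewrite hh /gam /dgam; apply/rowP => k; rewrite !mxE; ring.
    rewrite normrZ; apply: (le_trans (ler_wpM2r (normr_ge0 _) (step_taylor _ _))).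
    by rewrite hh normrM nT exprMn; apply: le_of_eq; ring.
  + have -> : dgam s' - dgam s = (2 / T * (dstep (h s') - dstep (h s))) *: (y' - y).
      by rewrite /dgam -scalerBl mulrBr.
    rewrite normrZ normrM nT; have := dstep_lip (h s) (h s'); rewrite hh normrM nT => b.
    have b1 := ler_wpM2r (normr_ge0 (y' - y)) (ler_wpM2l T2 b).
    apply: (le_trans b1); rewrite -subr_ge0.
    have -> : 9 * (2 / T) ^+ 2 * `|y' - y| * `|s' - s| - 2 / T * (6 * (2 / T * `|s' - s|)) * `|y' - y|
      = 3 * (2 / T) ^+ 2 * `|y' - y| * `|s' - s| by ring.
    apply: mulr_ge0 => //; apply: mulr_ge0 => //; apply: mulr_ge0 => //; exact: sqr_ge0.
  + have cg : chart_cod i (gam s) by exact: cod.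
    rewrite /dgam (tnZ g _ _ cg) normrM nT.
    have [c1 _ _ _] := cmp (gam s) (y' - y) 0 (inb s).
    have c2 : 2 / T * `|dstep (h s)| * tn g i (gam s) (y' - y) <= 2 / T * 2 * (2 * tn g i z (y' - y)).
      apply: ler_pM => //; [|exact: tn_ge0|].
        by rewrite mulr_ge0 // divr_ge0 // ltW.
      by rewrite ler_wpM2l ?dstep_bound // divr_ge0 // ltW.
    apply: (le_trans c2); have -> : 2 / T * 2 * (2 * tn g i z (y' - y)) = 8 * tn g i z (y' - y) / T by ring.
    by rewrite ler_pdivrMr // mul1r.
- move=> s sd; congr (phi_inv i _); rewrite /gam.
  have h0 : h s <= 0.
    have : 2 / T * s <= 2 / T * (T / 4) by rewrite ler_wpM2l // divr_ge0 // ltW.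
    have -> : 2 / T * (T / 4) = 2^-1 :> R by field; rewrite gt_eqF.
    by rewrite /h subr_le0.
  have -> : step (h s) = 0.
    rewrite /step; case: (clampP (h s)) => [[_ ->]|[h1 _ ->]|[h1 _]]; first by ring.
      have -> : h s = 0 by apply/eqP; rewrite eq_le h0 h1.
      by ring.
    by have := le_trans h1 h0; rewrite ler10.
  by rewrite scale0r addr0.
- move=> s sd; congr (phi_inv i _); rewrite /gam.
  have h0 : 1 <= h s.
    have : 2 / T * (T - T / 4) <= 2 / T * s by rewrite ler_wpM2l // divr_ge0 // ltW.
    have -> : 2 / T * (T - T / 4) = 1 + 2^-1 :> R by field; rewrite gt_eqF.
    by rewrite /h; clra.
  have -> : step (h s) = 1.
    rewrite /step; case: (clampP (h s)) => [[h1 _]|[_ h1 ->]|[h1 ->]]; last by ring.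
      by have := le_trans h0 h1; rewrite ler10.
    have -> : h s = 1 by apply/eqP; rewrite eq_le h0 h1.
    by ring.
  by rewrite scale1r addrC subrK.
Qed.

Lemma conn_dist (R : realType) (n : nat) (M : c2_manifold R n) (g : riemannian_metric M) x y T : conn g x y T -> (riem_dist g x y <= T%:E)%E.
Proof.
move=> [T0 [c [d [d0 hc cx cy]]]].
have ht s : c11 g (fun s => c (T * s + 0)) s T.
  by have := c11_affine (hc (T * s + 0)); rewrite mulr1 ger0_norm.
apply: (le_trans (ereal_inf_lbound _)).
  exists (fun s => c (T * s + 0)); last by [].
  split; first exact: (c11_C1_curve ht).
    by apply: cx; rewrite mulr0 addr0 ltW.
  by apply: cy; move: d0; clra.
rewrite /curve_length; apply: (@le_trans _ _ (\int[lebesgue_measure]_(s in `[0%R, 1%R]) T%:E)%E).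
  apply: int_mono => s; rewrite !patchE; case: ifP => // _.
  by rewrite lee_fin; exact: c11_speed.
rewrite integral_cst //= lebesgue_measure_itv /= lte_fin ltr01 oppr0 adde0 mule1; exact: lexx.
Qed.

(** * Preservation of common subsolutions *)

Lemma nice_sub (R : realType) (n : nat) (M : c2_manifold R n) (g : riemannian_metric M) (H : cotangent M -> R) Hx Hp i z r r' kappa :
  nice g H Hx Hp i z r kappa -> 0 < r' -> r' <= r -> nice g H Hx Hp i z r' kappa.
Proof.
move=> [r0 gg cod cmp hl] r'0 rr; split=> //.
- by move=> y yr; apply: cod; exact: le_trans yr rr.
- by move=> y v p yr; apply: cmp; exact: le_trans yr rr.
- by apply: (hamloc_sub hl); rewrite subrr normr0 add0r.
Qed.

Lemma local_value_mono (R : realType) (n : nat) (F : 'rV[R]_n -> 'rV[R]_n -> R) (N : 'rV[R]_n -> R) W (T : R) z (r Rv Rv' : R) :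
  local_value F N W T z r Rv -> Rv <= Rv' -> local_value F N W T z r Rv'.
Proof.
move=> [h1 [C [s0 [C0 s00 h2]]]] RR; split=> //; exists C, s0; split=> // t s x a1 a2 a3 a4 a5.
by have [v v1 v2] := h2 t s x a1 a2 a3 a4 a5; exists v => //; exact: le_trans v1 RR.
Qed.

(** A bounded G-velocity forces a bounded momentum by coercivity of G, and at a bounded momentum the
    H-velocity is bounded by convexity of H. All bounds are in the metric norms, hence uniform over
    M. *)
Lemma speed_transfer (R : realType) (n : nat) (M : c2_manifold R n) (g : riemannian_metric M) (G H : cotangent M -> R) Gx Gp Hx Hp (V : R) :
  good g G Gx Gp -> good g H Hx Hp -> 0 <= V -> exists2 Rv : R, 0 <= Rv &
  forall i z r kappa y y' P, nice g H Hx Hp i z r kappa -> hamloc (lh G i) (Gx i) (Gp i) z r ->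
    `|y - z| <= r -> `|y' - z| <= r -> tn g i z (Gp i y P) <= V -> tn g i z (Hp i y' P) <= Rv.
Proof.
move=> gG gH V0; have [C0 hC0] := good_bounded gG 0.
have [C1 hC1] := good_coercive gG (2 * V + 1).
pose B := 4 * (C0 + C1) + 1.
have [C2 hC2] := good_bounded gH B; have [C3 hC3] := good_coercive gH 0.
exists (2 * `|C2 + C3|); first by rewrite mulr_ge0.
move=> i z r kappa y y' P [r0 gg cod cmp hl] hG yr y'r hV.
have zr : `|z - z| <= r by rewrite subrr normr0 ltW.
have [cy cy' cz] : [/\ chart_cod i y, chart_cod i y' & chart_cod i z] by split; exact: cod.
have cP : cn g i y P <= C0 + C1.
  have a0 : lh G i y 0 <= C0.
    by apply: hC0 => //; rewrite -(scale0r 0) (cnZ g _ _ cy) normr0 mul0r.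
  have a1 := hC1 i y P cy; have a2 := lag_ge (Gp i y P) 0 hG yr.
  rewrite (lag_argmax P hG yr) pairing0l in a2.
  have a3 := pairing_le_tn g P (Gp i y P) cy.
  have [b1 _ _ _] := cmp y (Gp i y P) 0 yr.
  have a4 : cn g i y P * tn g i y (Gp i y P) <= cn g i y P * (2 * V).
    by rewrite ler_wpM2l ?cn_ge0 //; apply: (le_trans b1); rewrite ler_pM2l.
  move: a0 a1 a2 a3 a4; move: (lh G i y 0) (lh G i y P) (pairing _ _) (tn g i y _) (cn g i y P).
  by clear; intros; lra.
have cP' : cn g i y' P <= 4 * (C0 + C1).
  have b1 : cn g i y' P <= 2 * cn g i z P.
    by apply: (cn_cmp _ cy' cz) => v; have [] := cmp y' v 0 y'r.
  have b2 : cn g i z P <= 2 * cn g i y P.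
    by apply: (cn_cmp _ cz cy) => v; have [] := cmp y v 0 yr.
  by move: cP b1 b2; move: (cn _ _ _ _) (cn _ _ _ _) (cn _ _ _ _); clear; intros; lra.
have [q [cq qv]] := tn_dual g (Hp i y' P) cy'.
have h1 := hamloc_global_convex P (P + q) hl y'r.
have PqE : P + q - P = q by rewrite addrAC subrr add0r.
rewrite PqE pairingC qv in h1.
have cPq : cn g i y' (P + q) <= B.
  apply: (le_trans (cnD g _ _ cy')); apply: lerD => //.
have h2 := hC2 i y' (P + q) cy' cPq; have h3 := hC3 i y' P cy'.
rewrite mul0r sub0r in h3.
have [_ b2 _ _] := cmp y' (Hp i y' P) 0 y'r.
have h4 := ler_norm (C2 + C3).
move: h1 h2 h3 b2 h4; move: (lh H i y' P) (lh H i y' _) (tn g i y' _) (tn g i z _) `|C2 + C3|.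
by clear; intros; lra.
Qed.

(** A finite domain of dependence: the inequality for T^-_t u at y follows from the one for
    T^-_{t-s} u on a ball of radius Rv s around y. The ball and [s1] do not depend on t, as the
    global argument requires. *)
Lemma dini_step (R : realType) (n : nat) (M : c2_manifold R n) (g : riemannian_metric M) (G H : cotangent M -> R) Gx Gp Hx Hp :
  good g G Gx Gp -> good g H Hx Hp -> commute_grad Gx Gp Hx Hp -> exists2 Rv : R, 0 < Rv &
  forall u, subsol H u -> forall i z, chart_cod i z -> exists r kappa s1 : R, [/\ mball g i z r kappa, 0 < s1 &
  forall t s y, 0 < s -> s <= s1 -> s <= t -> `|y - z| <= r / 4 ->
    (forall y', tn g i z (y' - y) <= Rv * s -> `|y' - z| <= r) /\
    ((forall y', tn g i z (y' - y) <= Rv * s -> dini_at G (lax H u (t - s)) i y') ->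
      dini_at G (lax H u t) i y)].
Proof.
move=> gG gH cGH.
have [Lam Lam0 hLam] := lax_lip gH; have [Rv1 Rv10 hRv1] := lax_value gH.
have K0 : 0 <= 2 * (Lam + 1) by rewrite mulr_ge0 // addr_ge0.
(* At frozen speed |v| > V0 this gives L_G >= (Lam + 1) |v| - V0 >= Lam |v|, so that fast directions
   are covered by the Lipschitz bound; the factor 2 in [K0] pays for freezing the norm at z. *)
have [V0 V00 hV0] := lag_lower K0 gG.
have [Rv2 Rv20 hRv2] := speed_transfer gG gH V00.
pose Rv := Num.max Rv1 Rv2.
have Rv0 : 0 <= Rv by rewrite le_max Rv10.
have [RR1 RR2] : Rv1 <= Rv /\ Rv2 <= Rv by rewrite !le_max !lexx orbT.
clearbody Rv.
(* The extra unit of speed makes room for the G-segment, of length rho V0 <= s. *)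
exists (Rv + 1) => [|u su i z cz]; first by rewrite ltr_pwDr.
have [rH [kappa niH]] := good_loc gH cz; have [rG [kG niG]] := good_loc gG cz.
have [rH0 rG0] : 0 < rH /\ 0 < rG by case: niH => ?; case: niG => ?.
pose r := Num.min rH rG.
have r0 : 0 < r by rewrite lt_min rH0.
have ni : nice g H Hx Hp i z r kappa by apply: (nice_sub niH) => //; rewrite ge_min lexx.
have hG : hamloc (lh G i) (Gx i) (Gp i) z r.
  by case: niG => _ _ _ _ hG; apply: (hamloc_sub hG); rewrite subrr normr0 add0r ge_min lexx orbT.
have [_ gg cod cmp hH] := ni; have k0 := gauge_gt0 gg.
have r2 : r / 2 <= r by move: r0; clra.
have z0 : `|z - z| + r / 2 <= r by rewrite subrr normr0 add0r.
have D0 : 0 < 4 * kappa * (Rv + 1 + V0 + 1) by rewrite !mulr_gt0 // !ltr_pwDr // !addr_ge0.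
pose s1 := r / (4 * kappa * (Rv + 1 + V0 + 1)).
have s10 : 0 < s1 by rewrite divr_gt0.
have s1E : kappa * ((Rv + 1 + V0 + 1) * s1) = r / 4.
  by rewrite /s1; field; rewrite !gt_eqF // !ltr_pwDr // !addr_ge0.
exists r, kappa, s1; split; [exact: nice_mball ni|exact: s10|].
move=> t s y s0 ss1 st yz.
have inb y' (m : R) : tn g i z (y' - y) <= m -> m <= (Rv + 1 + V0 + 1) * s1 -> `|y' - z| <= r / 2.
  move=> h1 h2; have := gauge_lb gg (y' - y); have := ler_distD y y' z.
  have := ler_wpM2l (ltW k0) (le_trans h1 h2); rewrite s1E; move: yz.
  by move: (`|y' - y|) (`|y' - z|) (`|y - z|) (kappa * tn _ _ _ _); clear; intros; lra.
have m1 : (Rv + 1) * s <= (Rv + 1 + V0 + 1) * s1.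
  by apply: ler_pM => //; [rewrite addr_ge0|exact: ltW|by rewrite -addrA lerDl addr_ge0].
split=> [y' /inb/(_ m1) h|hini]; first exact: le_trans h r2.
pose W tau y' := lax H u (t - s + tau) (phi_inv i y').
have ts0 : 0 <= t - s by rewrite subr_ge0.
have lv : local_value (lh H i) (tn g i z) W s z (r / 2) Rv.
  apply: (local_value_mono (hRv1 u su i z r kappa (t - s) s ni ts0)).
  exact: RR1.
have hLip tau y1 y2 : 0 <= tau -> tau <= s -> `|y1 - z| <= r / 2 -> `|y2 - z| <= r / 2 ->
    W tau y2 - W tau y1 <= Lam * tn g i z (y2 - y1).
  move=> t0 _ y1r y2r; apply: (hLam u su i z r kappa _ y1 y2 ni).
  - exact: le_trans y1r r2.
  - exact: le_trans y2r r2.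
  - exact: addr_ge0.
have hbig y1 v : `|y1 - z| <= r / 2 -> V0 < tn g i z v -> Lam * tn g i z v <= lag (lh G i) y1 v.
  move=> y1r Vv; have y1r' := le_trans y1r r2.
  have [_ b _ _] := cmp y1 v 0 y1r'; have h := hV0 i y1 v (cod y1 y1r').
  have h2 := ler_wpM2l (_ : 0 <= Lam + 1) b; move: h2; rewrite addr_ge0 // => /(_ isT).
  by move: Vv h; move: (tn g i z v) (tn g i y1 v) (lag _ _ _); clear; intros; lra.
have [C C0 keep] := @local_subsolution_keep R n (lh H i) (lh G i) (Hx i) (Hp i) (Gx i) (Gp i)
  (tn g i z) kappa W s z (r / 2) Rv V0 Lam (hamloc_sub hH z0) (hamloc_sub hG z0)
  (fun y p yr => cGH i y p (cod y (le_trans yr r2))) gg Rv0 lv hLip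
  (fun y1 y2 P y1r y2r h => le_trans (hRv2 i z r kappa y1 y2 P ni hG (le_trans y1r r2) (le_trans y2r r2) h)
     RR2) hbig.
have kV : 0 <= kappa * V0 by rewrite mulr_ge0 // ltW.
have [E0 E00 seg] := dini_segment hG kV.
move=> v e e0.
have Ws : W s = (fun y' => lax H u t (phi_inv i y')) by rewrite /W subrK.
have W0 : W 0 = (fun y' => lax H u (t - s) (phi_inv i y')) by rewrite /W addr0.
have yr2 : `|y - z| <= r / 2 by apply: (le_trans yz); move: r0; clra.
have [vV|Vv] := leP (tn g i z v) V0; last first.
  have v0 : 0 < `|v| + 1 by rewrite ltr_pwDr.
  exists (r / 4 / (`|v| + 1)) => [|rho rho0]; first by rewrite !divr_gt0.
  rewrite ltr_pdivlMr // => rr.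
  have yv : `|y + rho *: v - z| <= r / 2.
    rewrite addrAC; apply: (le_trans (ler_normD _ _)); rewrite normrZ gtr0_norm //.
    by move: rr yz rho0; move: `|v| `|y - z| => a b; clra.
  have := hLip s y (y + rho *: v) (ltW s0) (lexx s) yr2 yv; rewrite Ws.
  have -> : y + rho *: v - y = rho *: v by rewrite addrAC subrr add0r.
  rewrite (gaugeZ gg) gtr0_norm // => h; apply: (le_trans h).
  rewrite mulrCA ler_pM2l //; apply: (le_trans (hbig y v yr2 Vv)).
  by rewrite lerDl ltW.
have Ce : 0 < E0 + C * s + 1 by rewrite ltr_pwDr // addr_ge0 ?mulr_ge0 // ltW.
have V1 : 0 < V0 + 1 by rewrite ltr_pwDr.
(* The second bound keeps the segment in the domain of dependence; the third makes the error (E0 + C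
   s) rho^2 at most rho e. *)
exists (Num.min 1 (Num.min (s / (V0 + 1)) (e / (E0 + C * s + 1)))).
  by rewrite !lt_min ltr01 !divr_gt0.
move=> rho rho0; rewrite !lt_min => /and3P[rho1 rhos rhoe].
rewrite ltr_pdivlMr // in rhos; rewrite ltr_pdivlMr // in rhoe.
have rV : rho * V0 <= s by move: rhos rho0; clra.
have mu0 : 0 <= rho * V0 by rewrite mulr_ge0 // ltW.
have mus : rho * V0 + Rv * s <= (Rv + 1) * s by move: rV; clra.
have ball y' : tn g i z (y' - y) <= rho * V0 + Rv * s -> `|y' - z| <= r / 2.
  by move=> h; apply: (inb _ _ h); exact: le_trans mus m1.
have ini y1 w : tn g i z (y1 - y) <= rho * V0 + Rv * s ->
    tn g i z (y1 + rho *: w - y) <= rho * V0 + Rv * s -> tn g i z w <= V0 ->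
    W 0 (y1 + rho *: w) - W 0 y1 <= rho * lag (lh G i) y1 w + E0 * rho ^+ 2.
  move=> h1 h2 wV.
  have nw : `|w| <= kappa * V0.
    by apply: (le_trans (gauge_lb gg w)); rewrite ler_pM2l.
  have conv sg : 0 <= sg -> sg <= rho -> tn g i z (y1 + sg *: w - y) <= rho * V0 + Rv * s.
    move=> g0 gr; have rn : rho != 0 by rewrite gt_eqF.
    have -> : y1 + sg *: w - y = (1 - sg / rho) *: (y1 - y) + (sg / rho) *: (y1 + rho *: w - y).
      by apply/rowP => l; rewrite !mxE; field.
    have q0 : 0 <= sg / rho by rewrite divr_ge0 // ltW.
    have q1 : 0 <= 1 - sg / rho by rewrite subr_ge0 ler_pdivrMr // mul1r.
    apply: (le_trans (gaugeD gg _ _)); rewrite !(gaugeZ gg) (ger0_norm q0) (ger0_norm q1).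
    have b1 := ler_wpM2l q0 h2; have b2 := ler_wpM2l q1 h1.
    by apply: (le_trans (lerD b2 b1)); apply: le_of_eq; ring.
  rewrite W0; apply: (seg (fun y' => lax H u (t - s) (phi_inv i y')) y1 w rho (Lam * V0)) => //.
  - exact: ltW.
  - by move=> sg g0 gr; apply: (le_trans _ r2); apply: ball; exact: conv.
  - move=> sg sg' g0 gr g0' gr'.
    have a1 := ball _ (conv sg g0 gr); have a2 := ball _ (conv sg' g0' gr').
    have l1 := hLip 0 _ _ (lexx 0) (ltW s0) a1 a2; have l2 := hLip 0 _ _ (lexx 0) (ltW s0) a2 a1.
    have d1 : y1 + sg' *: w - (y1 + sg *: w) = (sg' - sg) *: w.
      by apply/rowP => l; rewrite !mxE; ring.
    have d2 : y1 + sg *: w - (y1 + sg' *: w) = (sg - sg') *: w.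
      by apply/rowP => l; rewrite !mxE; ring.
    rewrite W0 d1 (gaugeZ gg) in l1; rewrite W0 d2 (gaugeZ gg) [`|sg - sg'|]distrC in l2.
    have b : Lam * (`|sg' - sg| * tn g i z w) <= Lam * V0 * `|sg' - sg|.
      by rewrite -mulrA ler_wpM2l // mulrC ler_wpM2r.
    rewrite ler_norml; apply/andP; split; last exact: le_trans l1 b.
    by rewrite lerNl opprB; exact: le_trans l2 b.
  - move=> sg e' g0 gr e'0; have [rho' rho'0 hr] := hini (y1 + sg *: w) (le_trans (conv sg g0 (ltW gr)) mus) w e' e'0.
    exists rho' => // h h0 hh; rewrite scalerDl addrA; exact: hr.
have y0 : tn g i z (y - y) = 0 by rewrite subrr -(scale0r 0) (gaugeZ gg) normr0 mul0r.
have yv : tn g i z (y + rho *: v - y) <= rho * V0.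
  by rewrite addrAC subrr add0r (gaugeZ gg) gtr0_norm // ler_pM2l.
have y0' : tn g i z (y - y) <= rho * V0 by rewrite y0.
have := keep s y (rho * V0) E0 rho (ltW s0) (lexx s) (ltW E00) rho0 (ltW rho1) ball ini y v y0' yv vV.
rewrite Ws => h; apply: (le_trans h).
have : (E0 + C * s) * rho ^+ 2 <= rho * e.
  rewrite expr2 mulrA mulrC; apply: ler_wpM2l; first exact: ltW.
  by apply: le_trans (ltW rhoe); rewrite mulrC; apply: ler_wpM2l; [exact: ltW|rewrite lerDl].
by move: (lag _ _ _) ((E0 + C * s) * rho ^+ 2) => a b; clear; intros; lra.
Qed.

Lemma loclip_lax (R : realType) (n : nat) (M : c2_manifold R n) (g : riemannian_metric M) (H : cotangent M -> R) Hx Hp u t :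
  good g H Hx Hp -> subsol H u -> 0 <= t -> loclip (lax H u t).
Proof.
move=> gH su t0 i z cz; have [Lam Lam0 hLam] := lax_lip gH.
have [r [kappa ni]] := good_loc gH cz; have [r0 gg _ _ _] := ni.
exists r, (Lam * kappa); split=> // y y' yr y'r.
have b w : Lam * tn g i z w <= Lam * kappa * `|w|.
  by rewrite -mulrA ler_wpM2l //; exact: (gauge_ub gg).
rewrite ler_norml; apply/andP; split.
  by rewrite lerNl opprB distrC; exact: (le_trans (hLam u su i z r kappa t y' y ni y'r yr t0) (b _)).
exact: (le_trans (hLam u su i z r kappa t y y' ni yr y'r t0) (b _)).
Qed.

(* If the inequality fails at (t, x), it already fails at an earlier time at a
   point reached from x with bounded speed. Going back as far as possible (up
   to a factor 2) gives a Cauchy sequence; near its limit one can always go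
   back by a fixed amount of time. *)
Lemma lax_keep (R : realType) (n : nat) (M : c2_manifold R n) (g : riemannian_metric M) (G H : cotangent M -> R) Gx Gp Hx Hp u t :
  good g G Gx Gp -> good g H Hx Hp -> commute_grad Gx Gp Hx Hp -> riem_complete g ->
  subsol G u -> subsol H u -> 0 <= t -> subsol G (lax H u t).
Proof.
move=> gG gH cGH cg sG sH t0.
have [Rv Rv0 hstep] := dini_step gG gH cGH.
pose bad t x := exists i, dom i x /\ ~ dini_at G (lax H u t) i (phi i x).
suff nobad : forall t x, 0 <= t -> ~ bad t x.
  split; first exact: (loclip_lax gH).
  move=> i y cy; apply: contrapT => nd; apply: (nobad t (phi_inv i y) t0).
  by exists i; rewrite phi_phi_inv //; split=> //; exact: dom_phi_inv.
have bad_chart s x i : 0 <= s -> bad s x -> dom i x -> ~ dini_at G (lax H u s) i (phi i x).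
  move=> s0 [j [dj nj]] di Di; apply: nj.
  exact: (loclip_dini_chart (loclip_lax gH sH s0) di dj Di).
have bad0 x : ~ bad 0 x.
  have E : lax H u 0 = u by apply/funext => x'; exact: (@lax0 _ _ _ g H Hx Hp).
  by move=> [i [di]]; apply; rewrite E; apply: sG.2; exact: codom_phi.
move=> {t0} t1 x1 t10 b1.
(* Amounts of time by which one can go back from p to a bad point; a displacement Rv s in the chart
   takes a time 8 Rv s in [conn_segment]. *)
pose S (p : R * M) := [set s | [/\ 0 <= s, s <= p.1 & exists2 x', bad (p.1 - s) x' & conn g p.2 x' (8 * Rv * s)]].
pose ok (p : R * M) := 0 <= p.1 /\ bad p.1 p.2.
have nxt p : exists q : R * M, ok p -> [/\ ok q, q.1 <= p.1, conn g p.2 q.2 (8 * Rv * (p.1 - q.1)) &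
    forall s, S p s -> s <= 2 * (p.1 - q.1)].
  have [okp|nok] := pselect (ok p); last by exists p.
  have [p0 bp] := okp.
  have S0 : S p 0.
    by split=> //; exists p.2; [rewrite subr0|rewrite mulr0; exact: conn_refl].
  have hS : has_sup (S p) by split; [exists 0|exists p.1 => s []].
  have sup0 : 0 <= sup (S p) by apply: ub_le_sup S0; exact: hS.2.
  (* The supremum need not be attained, but half of it is exceeded or reached, also when it is 0. *)
  have [s [s0 sp [x' bx' cx']] hs] : exists2 s, S p s & sup (S p) <= 2 * s.
    have [E|ne] := eqVneq (sup (S p)) 0; first by exists 0 => //; rewrite E mulr0.
    have h0 : 0 < sup (S p) / 2 by rewrite divr_gt0 // lt_neqAle eq_sym ne.
    have [s Ss hs] := sup_adherent h0 hS; exists s => //.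
    by move: hs; clra.
  exists (p.1 - s, x') => _ /=; split.
  - by split=> //=; rewrite subr_ge0.
  - by rewrite gerBl.
  - by rewrite opprB addrC subrK.
  - move=> s' Ss'; rewrite opprB [p.1 + _]addrC subrK; apply: le_trans hs.
    by apply: ub_le_sup => //; exact: hS.2.
have [next hnext] := choice nxt.
pose a k := iter k next (t1, x1).
have oka k : ok (a k) by elim: k => [|k IH]; [split|have [] := hnext _ IH].
have dec k : (a k.+1).1 <= (a k).1 by have [] := hnext _ (oka k).
have chain k m : conn g (a k).2 (a (m + k)%N).2 (8 * Rv * ((a k).1 - (a (m + k)%N).1)).
  elim: m => [|m IH]; first by (rewrite add0n subrr mulr0; exact: conn_refl).
  have [_ _ c _] := hnext _ (oka (m + k)%N); have := conn_cat IH c.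
  by rewrite -mulrDr addrA subrK.
have decm k m : (a (m + k)%N).1 <= (a k).1.
  by elim: m => [|m IH]; [exact: lexx|apply: le_trans IH; exact: dec].
pose tm := inf (range (fun k => (a k).1)).
have tmlb : has_inf (range (fun k => (a k).1)).
  by split; [exists (a 0%N).1; exists 0%N|exists 0 => _ [k _ <-]; case: (oka k)].
have tml k : tm <= (a k).1 by apply: ge_inf; [exact: tmlb.2|exists k].
have tmc e : 0 < e -> exists N, forall m, (a (m + N)%N).1 <= tm + e.
  move=> e0; have [_ [N _ <-] hN] := inf_adherent e0 tmlb; exists N => m.
  exact: (le_trans (decm N m) (ltW hN)).
have cau (e : R) : 0 < e -> exists N, forall k l, (N <= k)%N -> (N <= l)%N ->
    (riem_dist g (a k).2 (a l).2 < e%:E)%E.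
  move=> e0; have R8 : 0 < 8 * Rv by rewrite mulr_gt0.
  have e1 : 0 < e / 2 / (8 * Rv) by rewrite !divr_gt0.
  have [N hN] := tmc _ e1.
  have key k l : (N <= k)%N -> (k <= l)%N -> conn g (a k).2 (a l).2 (8 * Rv * ((a k).1 - (a l).1)) /\
      8 * Rv * ((a k).1 - (a l).1) < e.
    move=> Nk kl; split; first by have := chain k (l - k)%N; rewrite subnK.
    have h1 := hN (k - N)%N; rewrite subnK // in h1; have h2 := tml l.
    have h3 : (a k).1 - (a l).1 <= e / 2 / (8 * Rv) by move: h1 h2; clra.
    have := ler_wpM2l (ltW R8) h3; rewrite [_ * (e / 2 / _)]mulrC divfK ?gt_eqF //.
    by move: e0; clra.
  exists N => k l Nk Nl; have [kl|lk] := leqP k l.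
    by have [c ce] := key k l Nk kl; apply: (le_lt_trans (conn_dist c)); rewrite lte_fin.
  have [c ce] := key l k Nl (ltnW lk).
  by apply: (le_lt_trans (conn_dist (conn_sym c))); rewrite lte_fin.
have [xs hxs] := cg _ cau.
have di := dom_chart_at xs; set i := chart_at xs in di.
have cz := codom_phi di; set z := phi i xs in cz.
have [r [kappa [s1 [mb s10 hs]]]] := hstep u sH i z cz.
have [r0 gg cod cmp] := mb; have k0 := gauge_gt0 gg.
(* Points at distance less than l from the limit [xs] lie in the chart within r / 4 of z, where
   [dini_step] applies. *)
pose l := r / (16 * (kappa + 1)).
have k1 : 0 < 16 * (kappa + 1) by rewrite mulr_gt0 // ltr_wpDr // ltW.
have l0 : 0 < l by rewrite divr_gt0.
have kl : 16 * kappa * l <= r.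
  have : 16 * (kappa + 1) * l = r by rewrite /l mulrC divfK ?gt_eqF.
  by move: l0; clra.
have kl0 : 0 < kappa * l by rewrite mulr_gt0.
have [N hN] := hxs _ l0.
have near k : (N <= k)%N -> dom i (a k).2 /\ `|phi i (a k).2 - z| <= r / 4.
  move=> Nk; have /ereal_inf_lt[_ [c [cc c0 c1] <-] lc] := hN k Nk.
  have zz : `|z - z| <= r / 2 by rewrite subrr normr0 divr_ge0 // ltW.
  have c1' : c 1 = phi_inv i z by rewrite c1 /z phi_invK.
  have l4 : 4 * kappa * l < r by move: kl kl0; clra.
  have [d0 h0] := riem_lower mb cc c1' zz (ltW lc) l4; rewrite c0 in d0 h0.
  split=> //; have h1 := gauge_lb gg (z - phi i (a k).2); rewrite distrC.
  have h2 := ler_wpM2l (ltW k0) h0; apply: (le_trans h1); apply: (le_trans h2).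
  by move: kl kl0; clra.
have back k s : (N <= k)%N -> 0 < s -> s <= s1 -> s <= (a k).1 -> S (a k) s.
  move=> Nk s0 ss st; have [dk zk] := near k Nk; have [ak0 bk] := oka k.
  have [inb hd] := hs (a k).1 s (phi i (a k).2) s0 ss st zk.
  have ak1 : 0 <= (a k).1 - s by rewrite subr_ge0.
  have [y' ly' ny'] : exists2 y', tn g i z (y' - phi i (a k).2) <= Rv * s &
      ~ dini_at G (lax H u ((a k).1 - s)) i y'.
    apply: contrapT => no; apply: (bad_chart _ _ i ak0 bk dk); apply: hd => y' ly'.
    by apply: contrapT => nd; apply: no; exists y'.
  have yr := inb y' ly'.
  split=> //; first exact: ltW.
  exists (phi_inv i y').
    have cy' := cod y' yr; exists i; split; first exact: dom_phi_inv.
    by rewrite phi_phi_inv.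
  rewrite -{1}(phi_invK dk); apply: (conn_segment mb _ yr).
  - by apply: (le_trans zk); move: r0; clra.
  - by rewrite !mulr_gt0.
  - by rewrite -mulrA ler_pM2l.
have big k : (N <= k)%N -> s1 < (a k).1.
  move=> Nk; rewrite ltNge; apply/negP => ks.
  have ap : 0 < (a k).1.
    rewrite lt_neqAle (oka k).1 andbT; apply/eqP => E; apply: (@bad0 (a k).2).
    by rewrite E; exact: (oka k).2.
  have [_ _ [x' bx' _]] := back k _ Nk ap ks (lexx _).
  by apply: (@bad0 x'); rewrite subrr in bx'.
(* From every late term one can go back by s1, so the chosen step is at least s1 / 2; infinitely
   many such steps would make time negative. *)
have drop m : (a (m + N)%N).1 <= (a N).1 - m%:R * (s1 / 2).
  elim: m => [|m IH]; first by rewrite mul0r subr0.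
  have Nm : (N <= m + N)%N by exact: leq_addl.
  have [_ _ _ h] := hnext _ (oka (m + N)%N).
  have h1 := h s1 (back _ _ Nm s10 (lexx _) (ltW (big _ Nm))).
  change (a (m.+1 + N)%N) with (next (a (m + N)%N)); rewrite -natr1 mulrDl mul1r.
  by move: IH h1; move: ((next (a (m + N)%N)).1) ((a (m + N)%N).1) => b c; clra.
have s2 : 0 < s1 / 2 by rewrite divr_gt0.
have := truncnS_gt ((a N).1 / (s1 / 2)).
set m := (Num.truncn _).+1; rewrite ltr_pdivrMr // => hm.
have := drop m; have := (oka (m + N)%N).1; move: hm.
by move: ((a (m + N)%N).1) ((a N).1) => b c; clra.
Qed.

(** * Absolutely continuous real functions *)

Section Families.
Variable R : realType.
Implicit Types (f : R -> R) (p q : R * R) (s : seq (R * R)) (x y : R).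

Definition dj p q := (p.2 <= q.1) || (q.2 <= p.1).
(** Finite families of nonoverlapping intervals, listed in any order, as in the definition of
    absolute continuity; common end points are allowed. *)
Definition fam s := all (fun p => p.1 <= p.2) s && pairwise dj s.
Definition var f s := \sum_(p <- s) `|f p.2 - f p.1|.
Definition len s := \sum_(p <- s) (p.2 - p.1).
Definition within x y s := all (fun p => (x <= p.1) && (p.2 <= y)) s.

(* [gac] and [lac] stand for absolute continuity on the whole line and on [[a, b]]. *)
Definition gac f := forall e : R, 0 < e -> exists2 d : R, 0 < d &
  forall s, fam s -> len s < d -> var f s <= e.

Lemma fam_map (m : R -> R) s : {homo m : x y / x <= y} -> fam s ->
  fam [seq (m p.1, m p.2) | p <- s].
Proof.
move=> mm /andP[a b]; apply/andP; split.
  by rewrite all_map; apply: sub_all a => p /= /mm.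
rewrite pairwise_map; apply: sub_pairwise b => p q /orP[] /mm h; apply/orP; [left|right] => //.
Qed.

Lemma len_le x y s : x <= y -> fam s -> within x y s -> len s <= y - x.
Proof.
have [k] := ubnP (size s); elim: k s x y => // k IH [|p s] x y sk xy.
  by rewrite /len big_nil subr_ge0.
move=> /andP[/= /andP[pp ps] /andP[dp ds]] /andP[/andP[xp py] ws].
rewrite /len big_cons -/(len s).
have mn c : {homo (fun z : R => Num.min z c) : z z' / z <= z'}.
  by move=> z z' zz; rewrite le_min !ge_min lexx zz orbT.
have mx c : {homo (fun z : R => Num.max z c) : z z' / z <= z'}.
  by move=> z z' zz; rewrite ge_max !le_max lexx zz orbT.
have fs : fam s by rewrite /fam ps.
have E : len s = len [seq (Num.min q.1 p.1, Num.min q.2 p.1) | q <- s] +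
    len [seq (Num.max q.1 p.2, Num.max q.2 p.2) | q <- s].
  rewrite /len !big_map -big_split; apply: eq_big_seq => q qs /=.
  have qq := allP ps q qs; case/orP: (allP dp q qs) => h.
    have h1 := le_trans pp h; have h2 := le_trans h qq; have h3 := le_trans h1 qq.
    by rewrite !min_r // !max_l // subrr add0r.
  have h1 := le_trans h pp; have h2 := le_trans qq h; have h3 := le_trans qq h1.
  by rewrite !min_l // !max_r // subrr addr0.
have l1 := IH _ x p.1 _ xp (fam_map (mn p.1) fs).
have l2 := IH _ p.2 y _ py (fam_map (mx p.2) fs).
rewrite !size_map in l1 l2.
have b1 : len [seq (Num.min q.1 p.1, Num.min q.2 p.1) | q <- s] <= p.1 - x.
  apply: l1 => //; rewrite /within all_map; apply: sub_all ws => q /= /andP[a b].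
  by rewrite le_min a xp ge_min lexx orbT.
have b2 : len [seq (Num.max q.1 p.2, Num.max q.2 p.2) | q <- s] <= y - p.2.
  apply: l2 => //; rewrite /within all_map; apply: sub_all ws => q /= /andP[a b].
  by rewrite ge_max b py le_max lexx orbT.
by rewrite E; move: b1 b2; clra.
Qed.

Lemma var_cut f x s : fam s ->
  var f s <= var f [seq (Num.min p.1 x, Num.min p.2 x) | p <- s] +
             var f [seq (Num.max p.1 x, Num.max p.2 x) | p <- s].
Proof.
move=> /andP[a _]; rewrite /var !big_map -big_split /= !big_seq; apply: ler_sum => p ps.
have pp := allP a p ps; case/orP: (le_total p.2 x) => h.
  have h' := le_trans pp h.
  by rewrite (min_l h') (max_r h') (min_l h) (max_r h) subrr normr0 addr0.
case/orP: (le_total x p.1) => h'.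
  by rewrite (min_r h') (max_l h') (min_r h) (max_l h) subrr normr0 add0r.
rewrite (min_l h') (max_r h') (min_r h) (max_l h).
have -> : f p.2 - f p.1 = (f x - f p.1) + (f p.2 - f x) by ring.
exact: ler_normD.
Qed.

(** Total variation on the half line up to x; it is applied to functions that are constant outside
    an interval. *)
Definition tv f x := sup [set w | exists s, [/\ fam s, all (fun p => p.2 <= x) s & w = var f s]].

Section TotalVariation.
Variables (f : R -> R) (B : R).
Hypothesis bv : forall s, fam s -> var f s <= B.

Lemma tv_has_sup x : has_sup [set w | exists s, [/\ fam s, all (fun p => p.2 <= x) s & w = var f s]].
Proof.
split; first by exists (var f [::]), [::].
by exists B => _ [s [fs _ ->]]; exact: bv.
Qed.

Lemma tv_ge x y : x <= y -> `|f y - f x| <= tv f y - tv f x.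
Proof.
move=> xy; rewrite lerBrDr addrC -lerBrDr; apply: ge_sup; first by case: (tv_has_sup x).
move=> _ [s [fs sx ->]]; rewrite lerBrDr; apply: ub_le_sup; first by case: (tv_has_sup y).
exists ((x, y) :: s); split; last by rewrite /var big_cons addrC.
- move: fs => /andP[a b]; rewrite /fam /= xy a b /= andbT.
  by apply: sub_all sx => p px; rewrite /dj /= px orbT.
- by rewrite /= lexx /=; apply: sub_all sx => p px; exact: le_trans px xy.
Qed.

Lemma tv_homo : {homo tv f : x y / x <= y}.
Proof. by move=> x y xy; rewrite -subr_ge0; apply: le_trans (tv_ge xy). Qed.

Lemma tv_approx x y e : x <= y -> 0 < e -> exists s, [/\ fam s, within x y s & tv f y - tv f x <= var f s + e].
Proof.
move=> xy e0; have [_ [s [fs sy ->]] hs] := sup_adherent e0 (tv_has_sup y).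
have mn : {homo (fun z : R => Num.min z x) : z z' / z <= z'}.
  by move=> z z' zz; rewrite le_min !ge_min lexx zz orbT.
have mx : {homo (fun z : R => Num.max z x) : z z' / z <= z'}.
  by move=> z z' zz; rewrite ge_max !le_max lexx zz orbT.
exists [seq (Num.max p.1 x, Num.max p.2 x) | p <- s]; split; first exact: (fam_map mx).
  by rewrite /within all_map; apply: sub_all sy => p /= py; rewrite ge_max py xy le_max lexx orbT.
have h1 := var_cut f x fs.
have h2 : var f [seq (Num.min p.1 x, Num.min p.2 x) | p <- s] <= tv f x.
  apply: ub_le_sup; first by case: (tv_has_sup x).
  exists [seq (Num.min p.1 x, Num.min p.2 x) | p <- s]; split=> //; first exact: (fam_map mn).
  by rewrite all_map; apply/allP => p _ /=; rewrite ge_min lexx orbT.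
by rewrite -/(tv f y) in hs; move: hs h1 h2; clra.
Qed.

(** Each interval is replaced by a family inside it that nearly realizes its total variation. The
    total length does not grow, so absolute continuity of f passes to [tv f]. *)
Lemma tv_refine s e : fam s -> 0 < e -> exists t, [/\ fam t, len t <= len s,
  forall q, q \in t -> exists2 p, p \in s & (p.1 <= q.1) && (q.2 <= p.2) &
  var (tv f) s <= var f t + e * (size s)%:R].
Proof.
move=> + e0; elim: s => [|p s IH].
  by exists [::]; split=> //; rewrite /var !big_nil mulr0 addr0.
move=> /andP[/= /andP[pp ps] /andP[dp ds]].
have [|t [ft lt it vt]] := IH; first by rewrite /fam ps.
have [u [fu wu vu]] := tv_approx pp e0.
have := fu; have := ft; rewrite /fam => /andP[t1 t2] /andP[u1 u2].
exists (u ++ t); split.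
- rewrite /fam all_cat u1 t1 pairwise_cat u2 t2 !andbT /=.
  apply/allrelP => q q' qu qt; have /andP[a b] := allP wu q qu.
  have [p' p's /andP[a' b']] := it q' qt; case/orP: (allP dp p' p's) => h; apply/orP; [left|right].
    exact: (le_trans b (le_trans h a')).
  exact: (le_trans b' (le_trans h a)).
- by rewrite /len big_cat big_cons; apply: lerD => //; exact: len_le.
- move=> q; rewrite mem_cat => /orP[/(allP wu) qu|/it[p' p's h]]; first by exists p; rewrite ?mem_head.
  by exists p' => //; rewrite in_cons p's orbT.
- have -> : var f (u ++ t) = var f u + var f t by rewrite /var big_cat.
  have -> : var (tv f) (p :: s) = tv f p.2 - tv f p.1 + var (tv f) s.
    by rewrite /var big_cons ger0_norm // subr_ge0 tv_homo.
  rewrite [size _]/= -natr1 mulrDr mulr1.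
  by move: vu vt; clra.
Qed.

Lemma tv_gac : gac f -> gac (tv f).
Proof.
move=> af e e0; have e2 : 0 < e / 2 by rewrite divr_gt0.
have [d d0 hd] := af _ e2; exists d => // s fs ls.
have s1 : 0 < (size s).+1%:R :> R by rewrite ltr0Sn.
have [t [ft lt _ vt]] := tv_refine fs (divr_gt0 e2 s1).
have h := hd t ft (le_lt_trans lt ls).
have h2 : e / 2 / (size s).+1%:R * (size s)%:R <= e / 2.
  by rewrite mulrAC ler_pdivrMr // ler_wpM2l ?ler_nat // ltW.
by apply: (le_trans vt); apply: (le_trans (lerD h h2)); rewrite -splitr.
Qed.

End TotalVariation.

Lemma gac_continuous f : gac f -> continuous f.
Proof.
move=> af x; apply/(@eps_continuous R R^o R^o) => e e0.
have [d d0 hd] := af e e0; exists d => // y yx.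
have [xy|yx'] := leP x y.
  have := hd [:: (x, y)]; rewrite /fam /len /var !big_seq1 /= xy; apply=> //.
  by move: yx; rewrite ger0_norm ?subr_ge0.
have := hd [:: (y, x)]; rewrite /fam /len /var !big_seq1 /= (ltW yx') [`|f x - _|]distrC; apply=> //.
by move: yx; rewrite ltr0_norm ?subr_lt0 // opprB.
Qed.

(** Composition with it extends a function on [a, b] by constants, which turns absolute continuity
    on [a, b] into absolute continuity on the line. *)
Definition clampi (a b x : R) := Num.max a (Num.min b x).

Lemma clampi_homo a b : {homo clampi a b : x y / x <= y}.
Proof. by move=> x y xy; rewrite /clampi ge_max !le_max lexx /= le_min !ge_min lexx xy !orbT. Qed.

Lemma clampi_in a b x : a <= x -> x <= b -> clampi a b x = x.
Proof. by move=> ax xb; rewrite /clampi min_r // max_r. Qed.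

Lemma clampi_le a b x : x <= a -> a <= b -> clampi a b x = a.
Proof. by move=> xa ab; rewrite /clampi max_l // ge_min xa orbT. Qed.

Lemma clampi_ge a b x : b <= x -> a <= b -> clampi a b x = b.
Proof. by move=> bx ab; rewrite /clampi min_l // max_r. Qed.

Lemma clampi_itv a b x : a <= b -> a <= clampi a b x <= b.
Proof. by move=> ab; rewrite /clampi le_max lexx ge_max ab ge_min lexx. Qed.

Lemma clampi_dist a b x y : a <= b -> x <= y -> clampi a b y - clampi a b x <= y - x.
Proof.
move=> ab xy; have [ya|ay] := leP y a.
  by rewrite !clampi_le ?subrr ?subr_ge0 // (le_trans xy).
have [bx|xb] := leP b x.
  by rewrite !clampi_ge ?subrr ?subr_ge0 // (le_trans bx).
have h1 : clampi a b y <= y by rewrite /clampi ge_max (ltW ay) ge_min lexx orbT.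
have h2 : x <= clampi a b x by rewrite /clampi le_max le_min lexx (ltW xb) orbT.
exact: lerB.
Qed.

Definition lac a b f := forall e : R, 0 < e -> exists2 d : R, 0 < d &
  forall s, fam s -> within a b s -> len s < d -> var f s <= e.

Lemma clampi_fam a b s : a <= b -> fam s ->
  let t := [seq (clampi a b p.1, clampi a b p.2) | p <- s] in
  [/\ fam t, within a b t, len t <= len s & forall f, var (f \o clampi a b) s = var f t].
Proof.
move=> ab fs t; split; first exact: (fam_map (@clampi_homo a b)).
- rewrite /within all_map; apply/allP => p _ /=.
  by have /andP[-> _] := clampi_itv p.1 ab; have /andP[_ ->] := clampi_itv p.2 ab.
- rewrite /len big_map !big_seq; apply: ler_sum => p ps; apply: clampi_dist => //.
  by move: fs => /andP[/allP/(_ p ps)].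
- by move=> f; rewrite /var big_map.
Qed.

Lemma lac_gac a b f : a <= b -> lac a b f -> gac (f \o clampi a b).
Proof.
move=> ab lf e /lf[d d0 hd]; exists d => // s fs ls.
have [ft wt lt ->] := clampi_fam ab fs; apply: hd => //; exact: le_lt_trans lt ls.
Qed.

End Families.

Lemma measure_mono (R : realType) (mu : {measure set (measurableTypeR R) -> \bar R}) (A B : set R) :
  measurable A -> measurable B -> A `<=` B -> (mu A <= mu B)%E.
Proof. by move=> mA mB AB; apply: le_measure; rewrite ?inE. Qed.

Lemma itv_ends (R : realType) (I : set R) (d : R) : open I -> is_interval I -> I !=set0 ->
  (lebesgue_measure I < d%:E)%E -> [/\ has_inf I, has_sup I,
    ((sup I - inf I)%:E <= lebesgue_measure I)%E & I `<=` `]inf I, sup I]].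
Proof.
move=> oI iI [w Iw] Id.
have mI : measurable I by exact: open_measurable.
have dist u v : I u -> I v -> u <= v -> ((v - u)%:E <= lebesgue_measure I)%E.
  move=> Iu Iv uv; have <- : lebesgue_measure (`[u, v]%classic : set R) = (v - u)%:E.
    rewrite lebesgue_measure_itv /= lte_fin; case: ltP => // vu.
    by have -> : u = v by [apply/eqP; rewrite eq_le uv]; rewrite subrr.
  apply: measure_mono => //.
  by move=> z /=; rewrite in_itv /= => uzv; exact: (iI u v Iu Iv z uzv).
have dist' u v : I u -> I v -> v - u <= d.
  move=> Iu Iv; have [uv|vu] := leP u v.
    by have := le_lt_trans (dist u v Iu Iv uv) Id; rewrite lte_fin => /ltW.
  have h0 : 0 <= d by have := le_lt_trans (measure_ge0 lebesgue_measure I) Id; rewrite lte_fin => /ltW.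
  by move: vu h0; clra.
have hi : has_inf I by split; [exists w|exists (w - d) => v Iv; rewrite lerBlDr -lerBlDl; exact: dist'].
have hs : has_sup I by split; [exists w|exists (w + d) => v Iv; rewrite -lerBlDl; exact: dist'].
split=> //.
  apply/lee_addgt0Pr => e e0; have e2 : 0 < e / 2 by rewrite divr_gt0.
  have [u Iu hu] := inf_adherent e2 hi; have [v Iv hv] := sup_adherent e2 hs.
  have [uv|vu] := leP u v.
    apply: (@le_trans _ _ ((v - u)%:E + e%:E)%E); last by apply: leeD => //; exact: dist.
    by rewrite -EFinD lee_fin; move: hu hv; clra.
  apply: (@le_trans _ _ (0 + e%:E)%E); last by apply: leeD.
  by rewrite add0e lee_fin; move: hu hv vu; clra.
move=> v Iv /=; rewrite in_itv /=; apply/andP; split; last by apply: ub_le_sup => //; exact: hs.2.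
have := oI; rewrite openE => /(_ v Iv)/nbhs_ballP[r /= r0 hr].
have : I (v - r / 2).
  apply: hr; rewrite -ball_normE /= opprB addrC subrK gtr0_norm ?divr_gt0 //.
  by move: r0; clra.
move=> /(ge_inf hi.2) h; apply: (le_lt_trans h); by move: r0; clra.
Qed.

Lemma itv_disj (R : realType) (I J : set R) : is_interval I -> is_interval J ->
  I !=set0 -> J !=set0 -> has_inf I -> has_sup I -> has_inf J -> has_sup J -> I `&` J = set0 ->
  dj (inf I, sup I) (inf J, sup J).
Proof.
suff key (A B : set R) a b : is_interval A -> is_interval B -> A a -> B b -> a < b ->
    has_sup A -> has_inf B -> A `&` B = set0 -> sup A <= inf B.
  move=> iI iJ [a Ia] [b Jb] hi hs hi' hs' IJ; rewrite /dj /=.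
  have [ab|ba|E] := ltgtP a b.
  - by rewrite (key I J a b).
  - by rewrite (key J I b a) ?orbT // setIC.
  - by have : (I `&` J) a by [split=> //; rewrite E]; rewrite IJ.
move=> iA iB Aa Bb ab hs hi AB; rewrite leNgt; apply/negP => lt.
have e0 : 0 < (sup A - inf B) / 2 by rewrite divr_gt0 // subr_gt0.
have [v Av hv] := sup_adherent e0 hs; have [u Bu hu] := inf_adherent e0 hi.
have uv : u < v by move: hv hu; clra.
have [bv|vb] := leP b v.
  have : (A `&` B) b by split=> //; apply: (iA a v Aa Av); rewrite bv ltW.
  by rewrite AB.
have : (A `&` B) v by split=> //; apply: (iB u b Bu Bb); rewrite !ltW.
by rewrite AB.
Qed.

(** A null set lies in an open set of measure less than d. Finitely many components of that set form
    a family of total length less than d, to which absolute continuity applies; sigma-additivity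
    passes to all components. *)
Lemma gac_dominated (R : realType) (nu : {measure set (measurableTypeR R) -> \bar R}) (F : R -> R) :
  {homo F : x y / x <= y} -> gac F ->
  (forall x y : R, x <= y -> nu `]x, y]%classic = (F y - F x)%:E) ->
  forall N, measurable N -> lebesgue_measure N = 0%E -> nu N = 0%E.
Proof.
move=> nF aF nuE N mN N0; apply/eqP; rewrite eq_le measure_ge0 andbT.
apply/lee_addgt0Pr => e e0; rewrite add0e.
have [d d0 hd] := aF e e0.
have Nlt : (lebesgue_measure N < +oo)%E by rewrite N0.
have [U [oU NU UN]] := lebesgue_regularity_outer mN Nlt d0.
have mU : measurable U by exact: open_measurable.
have Ud : (lebesgue_measure U < d%:E)%E.
  apply: le_lt_trans UN; have {1}-> : U = (U `\` N) `|` N by rewrite setDE setUIl setUCl setIT setUidl.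
  apply: (le_trans (measureU2 _ _ _)) => //; first exact: measurableD.
  by rewrite [X in (_ + X)%E](_ : _ = 0%E) ?adde0 //; exact: N0.
apply: (@le_trans _ _ (nu U)); first by apply: measure_mono.
pose I := open_disjoint_itv oU.
have UI : U = \bigcup_q I q := open_disjoint_itv_bigcup oU.
have oI q : open (I q) by exact: open_disjoint_itv_open.
have mI q : measurable (I q) by exact: open_measurable.
have iI q : is_interval (I q) by exact: open_disjoint_itv_is_interval.
have tI : trivIset setT I := open_disjoint_itv_trivIset (oU := oU).
have Iq q : (lebesgue_measure (I q) < d%:E)%E.
  by apply: le_lt_trans Ud; apply: measure_mono => //; rewrite UI => z Iz; exists q.
have ends q : I q != set0 -> [/\ has_inf (I q), has_sup (I q),
    ((sup (I q) - inf (I q))%:E <= lebesgue_measure (I q))%E & I q `<=` `]inf (I q), sup (I q)]].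
  by move=> /set0P ne; exact: (itv_ends (oI q) (iI q) ne (Iq q)).
have le_ends q : I q != set0 -> inf (I q) <= sup (I q).
  move=> ne; have [hi hs _ sub] := ends q ne; have [w Iw] := hi.1.
  by have := sub w Iw; rewrite /= in_itv /= => /andP[/ltW a b]; exact: le_trans a b.
pose s m := [seq (inf (I q), sup (I q)) | q <- iota 0 m & I q != set0].
have fs m : fam (s m).
  apply/andP; split.
    by rewrite all_map; apply/allP => q; rewrite mem_filter => /andP[/le_ends h _].
  rewrite pairwise_map.
  apply: (@sub_in_pairwise _ (fun q => I q != set0) (fun q q' => q != q')).
  - move=> q q' /= Hq Hq' qq.
    have [hi hs _ _] := ends q Hq; have [hi' hs' _ _] := ends q' Hq'.
    apply: itv_disj => //; [exact: hi.1|exact: hi'.1|].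
    by move/trivIsetP: tI; apply.
  - exact: filter_all.
  - by rewrite -uniq_pairwise filter_uniq // iota_uniq.
have ls m : len (s m) < d.
  rewrite -lte_fin; apply: le_lt_trans Ud.
  have c1 := measure_sigma_additive (mu := lebesgue_measure) mI tI.
  rewrite -UI in c1; rewrite -(cvg_lim _ c1) //.
  apply: le_trans (nneseries_lim_ge m _); last by move=> q _ _; exact: measure_ge0.
  rewrite /len big_map big_filter -sumEFin big_mkcond /= /index_iota subn0.
  by apply: lee_sum => q _; case: ifP => [/ends[]|_] //; exact: measure_ge0.
have vs m : (\sum_(0 <= q < m) nu (I q) <= e%:E)%E.
  apply: (@le_trans _ _ (var F (s m))%:E); last by rewrite lee_fin; exact: hd.
  rewrite /var big_map big_filter -sumEFin [leRHS]big_mkcond /= /index_iota subn0.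
  apply: lee_sum => q _; case: ifPn => [ne|/negPn/eqP ->]; last by rewrite measure0.
  have [_ _ _ sub] := ends q ne.
  apply: (@le_trans _ _ (nu `]inf (I q), sup (I q)]%classic)).
    by apply: measure_mono => //; exact: measurable_itv.
  by rewrite (nuE _ _ (le_ends q ne)) lee_fin ler_norm.
have c2 := measure_sigma_additive (mu := nu) mI tI.
rewrite -UI in c2; rewrite -(cvg_lim _ c2) //.
apply: lime_le; first by apply/cvg_ex; exists (nu U).
exact: nearW.
Qed.

(** Normalized to run from 0 to 1, g is the distribution function of a Stieltjes measure dominated
    by Lebesgue measure; up to the normalizing factor, h is its Radon-Nikodym density. *)
Lemma mono_ftc (R : realType) (g : R -> R) (a b : R) : g a < g b ->
  {homo g : x y / x <= y} -> gac g -> (forall x, x <= a -> g x = g a) -> (forall x, b <= x -> g x = g b) ->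
  exists h : R -> R, lebesgue_measure.-integrable setT (EFin \o h) /\
    forall x, a <= x -> (\int[lebesgue_measure]_(t in `]a, x]) (h t)%:E)%E = (g x - g a)%:E.
Proof.
move=> gab gm ga gla glb; pose c := g b - g a; have c0 : 0 < c by rewrite subr_gt0.
pose F x := (g x - g a) / c.
have Fm : {homo F : x y / x <= y}.
  by move=> x y xy; rewrite ler_pM2r ?invr_gt0 // lerB // gm.
have FE x y : F y - F x = (g y - g x) / c by rewrite /F -mulrBl opprB addrA subrK.
have Fa : gac F.
  move=> e e0; have [d d0 hd] := ga _ (mulr_gt0 e0 c0); exists d => // s fs ls.
  rewrite -(ler_pM2r c0); apply: le_trans (hd s fs ls); rewrite /var mulr_suml ler_sum // => p _.
  by rewrite FE normrM normfV (gtr0_norm c0) divfK ?gt_eqF.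
have rc : right_continuous F by apply: right_continuousW; exact: gac_continuous.
have l0 : F @ -oo --> (0 : R).
  apply: cvg_near_cst; exists a; split; first exact: num_real.
  by move=> x /ltW xa; rewrite /F gla // subrr mul0r.
have l1 : F @ +oo --> (1 : R).
  apply: cvg_near_cst; exists b; split; first exact: num_real.
  by move=> x /ltW xb; rewrite /F glb // divff // gt_eqF.
pose G : cumulativeBounded (0 : R) (1 : R) :=
  HB.pack F (isCumulative.Build R _ R F Fm rc) (isCumulativeBounded.Build R 0 1 F l0 l1).
pose nu := lebesgue_stieltjes_measure G.
have nuE (x y : R) : x <= y -> nu `]x, y]%classic = (F y - F x)%:E.
  move=> xy; rewrite /nu /lebesgue_stieltjes_measure /measure_extension measurable_mu_extE /=; last exact: is_ocitv.
  by rewrite wlength_itv_bnd.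
have dom : nu `<< lebesgue_measure.
  by apply/null_content_dominatesP => N; exact: (gac_dominated Fm Fa nuE).
have [f [f0 ffin fint fE]] := radon_nikodym_sigma_finite dom.
exists (fun x => c * fine (f x)); split.
  have -> : EFin \o (fun x => c * fine (f x)) = (fun x => c%:E * f x)%E.
    by apply/funext => x /=; rewrite EFinM fineK.
  by apply: integrableZl.
move=> x ax; have mi : measurable (`]a, x]%classic : set (measurableTypeR R)) by exact: measurable_itv.
transitivity (\int[lebesgue_measure]_(t in `]a, x]) (c%:E * f t))%E.
  by apply: eq_integral => t _; rewrite EFinM fineK.
have fi := integrableS measurableT mi (@subsetT _ _) fint.
rewrite integralZl //.
by rewrite (etrans (esym (fE _ mi)) (nuE a x ax)) FE -EFinM mulrC divfK ?gt_eqF.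
Qed.

Definition has_der (R : realType) (V : normedModType R) (f : R -> V) (s : R) (w : V) :=
  forall e : R, 0 < e -> exists2 d : R, 0 < d & forall y, `|y - s| < d ->
    `|f y - f s - (y - s) *: w| <= e * `|y - s|.

Lemma has_der_near (R : realType) (V : normedModType R) (f g : R -> V) (s : R) (w k : V) (r : R) :
  0 < r -> (forall y, `|y - s| < r -> f y = g y + k) -> has_der g s w -> has_der f s w.
Proof.
move=> r0 fg h e /h[d d0 hd]; exists (Num.min r d); first by rewrite lt_min r0.
move=> y; rewrite lt_min => /andP[yr yd]; rewrite !fg ?subrr ?normr0 //.
by rewrite opprD addrACA subrr addr0; exact: hd.
Qed.

Lemma ac_ftc (R : realType) (f : R -> R) (a b B : R) : a < b -> lac a b f ->
  (forall s, fam s -> within a b s -> var f s <= B) ->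
  exists h : R -> R, [/\ lebesgue_measure.-integrable setT (EFin \o h),
    forall x, a <= x -> x <= b -> (\int[lebesgue_measure]_(t in `]a, x]) (h t)%:E)%E = (f x - f a)%:E
  & {ae lebesgue_measure, forall x : R, a < x -> x < b -> has_der (f : R -> R^o) x (h x)}].
Proof.
move=> ab lf bv; have ab' := ltW ab; pose c := clampi a b; pose f1 := f \o c.
have f1a : gac f1 by exact: lac_gac.
have bv1 s : fam s -> var f1 s <= B.
  by move=> fs; have [ft wt _ ->] := clampi_fam ab' fs; exact: bv.
pose V := tv f1; have Va : gac V := tv_gac bv1 f1a.
have cm : {homo c : x y / x <= y} := @clampi_homo R a b.
have ca x : x <= a -> c x = a by move=> h; exact: clampi_le.
have cb x : b <= x -> c x = b by move=> h; exact: clampi_ge.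
have caa : c a = a by exact: ca. have cbb : c b = b by exact: cb.
have lenE s : fam s -> var c s <= len s.
  move=> /andP[h _]; rewrite /var /len !big_seq ler_sum // => p ps.
  have pp := allP h p ps; rewrite ger0_norm ?subr_ge0 ?cm //; exact: clampi_dist.
have Vconst x y : x <= y -> (forall z, x <= z -> z <= y -> f1 z = f1 x) -> V y = V x.
  move=> xy hz; apply/eqP; rewrite eq_le (tv_homo bv1 xy) andbT; apply: eps_le => e e0.
  have [s [fs ws vs]] := tv_approx bv1 xy e0.
  have : var f1 s = 0.
    rewrite /var big_seq big1 // => p ps; have /andP[p1 p2] := allP ws p ps.
    have pp : p.1 <= p.2 by move: fs => /andP[/allP/(_ p ps)].
    by rewrite !hz ?subrr ?normr0 // ?(le_trans p1) // (le_trans pp).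
  by move: vs => + E; rewrite E add0r lerBlDl.
have Vla x : x <= a -> V x = V a.
  by move=> xa; apply/esym/Vconst => // z xz za; rewrite /f1 /= !ca.
have Vlb x : b <= x -> V x = V b.
  by move=> bx; apply: Vconst => // z bz zx; rewrite /f1 /= !cb.
have e3 (e : R) : 0 < e -> 0 < e / 3 by move=> e0; rewrite divr_gt0.
(* f1 is the difference of V + c and V - f1 + c, the cases sg = 0 and sg = -1. The clamped identity
   c is added because [mono_ftc] needs a strict increase from a to b. *)
have main (sg : R) : `|sg| <= 1 -> exists h : R -> R, lebesgue_measure.-integrable setT (EFin \o h) /\
    forall x, a <= x -> (\int[lebesgue_measure]_(t in `]a, x]) (h t)%:E)%E =
      ((V x + sg * f1 x + c x) - (V a + sg * f1 a + c a))%:E.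
  move=> sg1; have key x y : x <= y -> V x + sg * f1 x <= V y + sg * f1 y.
    move=> xy; have := tv_ge bv1 xy; rewrite -/V => h.
    have h2 : `|sg * (f1 y - f1 x)| <= 1 * `|f1 y - f1 x| by rewrite normrM ler_wpM2r.
    by move: h2; rewrite ler_norml => /andP[h3 _]; move: h h3; clra.
  apply: (@mono_ftc R (fun x => V x + sg * f1 x + c x) a b).
  - have := key a b ab'; rewrite caa cbb; move: ab; clra.
  - by move=> x y xy; apply: lerD; [exact: key|exact: cm].
  - move=> e /e3 e0; have [d1 d10 h1] := Va _ e0; have [d2 d20 h2] := f1a _ e0.
    exists (Num.min (e / 3) (Num.min d1 d2)); first by rewrite !lt_min e0 d10.
    move=> s fs; rewrite !lt_min => /and3P[l1 l2 l3].
    have b1 := h1 s fs l2; have b2 := h2 s fs l3; have b3 := le_trans (lenE s fs) (ltW l1).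
    apply: (@le_trans _ _ (var V s + var f1 s + var c s)); last by move: b1 b2 b3; clra.
    rewrite /var -!big_split /=; apply: ler_sum => p _.
    have -> : V p.2 + sg * f1 p.2 + c p.2 - (V p.1 + sg * f1 p.1 + c p.1) =
      (V p.2 - V p.1) + sg * (f1 p.2 - f1 p.1) + (c p.2 - c p.1) by ring.
    apply: (le_trans (ler_normD _ _)); rewrite lerD2r; apply: (le_trans (ler_normD _ _)).
    by rewrite lerD2l normrM ler_piMl.
  - by move=> x xa; rewrite (Vla x xa) /f1 /= !ca.
  - by move=> x xb; rewrite (Vlb x xb) /f1 /= !cb.
have [|h1 [i1 e1]] := main 0; first by rewrite normr0.
have [|h2 [i2 e2]] := main (-1); first by rewrite normrN1.
have fE x : a <= x -> x <= b -> f1 x = f x by move=> ax xb; rewrite /f1 /= /c clampi_in.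
pose h x := h1 x - h2 x.
have ih : lebesgue_measure.-integrable setT (EFin \o h).
  exact: (integrableB measurableT i1 i2).
have hE x : a <= x -> x <= b -> (\int[lebesgue_measure]_(t in `]a, x]) (h t)%:E)%E = (f x - f a)%:E.
  move=> ax xb; have mi : measurable (`]a, x]%classic : set (measurableTypeR R)) by exact: measurable_itv.
  transitivity (\int[lebesgue_measure]_(t in `]a, x]) ((h1 t)%:E - (h2 t)%:E))%E.
    by apply: eq_integral => t _; rewrite EFinB.
  rewrite integralB_EFin //; [|exact: integrableS i1|exact: integrableS i2].
  rewrite e1 // e2 // -EFinB -!fE //; congr (_%:E); ring.
exists h; split=> //.
have loc : locally_integrable [set: R] h.
  by apply: open_integrable_locally => //; exact: openT.
have int y : lebesgue_measure.-integrable [set` Interval (BRight a) (BRight y)] (EFin \o h).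
  exact: (integrableS measurableT _ (@subsetT _ _) ih).
have := FTC1 int loc; apply: filterS; first exact: (ae_filter_ringOfSetsType lebesgue_measure).
move=> x hx ax xb.
have [|d1 d2] := hx; first exact: ax.
have hd := (@derive1_eps R R^o _ x (h x)).2 (conj ((derivable1_diffP _ _).1 d1) d2).
apply: (@has_der_near _ _ _ _ x _ (f a) (Num.min (x - a) (b - x))) hd.
  by rewrite lt_min !subr_gt0 ax.
move=> y; rewrite lt_min => /andP[y1 y2].
have ay : a <= y by have := ler_norm (x - y); rewrite distrC; move: y1; clra.
have yb : y <= b by have := ler_norm (y - x); move: y2; clra.
by rewrite /Rintegral hE //= subrK.
Qed.

(** * Infinitesimal subsolutions are subsolutions *)

Lemma ae_all (R : realType) (I : finType) (P : I -> R -> Prop) :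
  (forall k, {ae (@lebesgue_measure R), forall x, P k x}) ->
  {ae (@lebesgue_measure R), forall x, forall k, P k x}.
Proof.
move=> h; have F := ae_filter_ringOfSetsType (@lebesgue_measure R).
suff H (s : seq I) : {ae (@lebesgue_measure R), forall x, forall k, k \in s -> P k x}.
  by apply: filterS (H (enum I)) => x hx k; apply: hx; rewrite mem_enum.
elim: s => [|k s IH]; first exact: filterE.
apply: filterS2 (h k) IH => x pk hs l; rewrite in_cons => /orP[/eqP ->|/hs] //.
Qed.

Lemma int_ae_le (R : realType) (a b : R) (h L : R -> R) :
  measurable_fun [set: measurableTypeR R] (EFin \o h) ->
  {ae lebesgue_measure, forall x : R, a < x -> x < b -> h x <= L x} ->
  (\int[lebesgue_measure]_(x in `]a, b]) (h x)%:E <= \int[lebesgue_measure]_(x in `[a, b]) (L x)%:E)%E.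
Proof.
move=> mh [N [mN N0 sN]].
pose N' : set (measurableTypeR R) := N `|` ([set a] `|` [set b]).
have m1 (c : R) : measurable ([set c] : set (measurableTypeR R)) by exact: measurable_set1.
have mN' : measurable N' by apply: measurableU => //; apply: measurableU.
have l1 (c : R) : lebesgue_measure ([set c] : set (measurableTypeR R)) = 0%E.
  by rewrite -(set_itv1 c) lebesgue_measure_itv /= ltxx.
have N'0 : lebesgue_measure N' = 0%E.
  apply/eqP; rewrite eq_le measure_ge0 andbT.
  apply: (le_trans (measureU2 _ _ _)) => //; first exact: measurableU.
  rewrite [X in (X + _)%E]N0 add0e.
  apply: (le_trans (measureU2 _ _ _)) => //.
  by rewrite [X in (X + _)%E]l1 [X in (_ + X)%E]l1 add0e.
have mC : measurable (~` N') := measurableC mN'.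
pose hE : measurableTypeR R -> \bar R := EFin \o h.
(* With the value [-oo] on a null set, [int_mono] applies although [L] need not be measurable. *)
pose k : measurableTypeR R -> \bar R := hE \_ (~` N') \+ (cst -oo%E) \_ N'.
have mk : measurable_fun [set: measurableTypeR R] k.
  apply: emeasurable_funD.
    by apply/(measurable_restrictT hE mC); exact: measurable_funS mh.
  by apply/(measurable_restrictT _ mN'); exact: measurable_cst.
have kE x : k x = if x \in N' then -oo%E else (h x)%:E.
  by rewrite /k /hE /= !patchE in_setC; case: (x \in N') => /=; rewrite ?add0e ?adde0.
rewrite integral_itv_obnd_cbnd; last exact: measurable_funS mh.
have -> : (\int[lebesgue_measure]_(x in `[a, b]) (h x)%:E = \int[lebesgue_measure]_(x in `[a, b]) k x)%E.
  apply: ae_eq_integral; [exact: measurable_itv|exact: measurable_funS mh|exact: measurable_funS mk|].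
  exists N'; split=> // x /= hx; apply: contrapT => nx; apply: hx => _.
  by rewrite kE memNset.
apply: int_mono => x; rewrite !patchE; case: ifP => // /[!inE]/= xab; rewrite kE.
case: ifPn => [_|/negP xN]; first exact: leNye.
rewrite lee_fin; apply: contrapT => hL; apply: xN; rewrite inE.
move: xab; rewrite in_itv /= => /andP[ax xb].
have [xa|xa] := eqVneq x a; first by right; left.
have [xb'|xb'] := eqVneq x b; first by right; right.
left; apply: sN => /= H; apply: hL; apply: H.
  by rewrite lt_neqAle eq_sym xa.
by rewrite lt_neqAle xb'.
Qed.

Lemma riem_dist_ge0 (R : realType) (n : nat) (M : c2_manifold R n) (g : riemannian_metric M) x y : (0 <= riem_dist g x y)%E.
Proof.
apply: le_ereal_inf_tmp => _ [c _ <-]; apply: integral_ge0 => s _; rewrite lee_fin; exact: sqrtr_ge0.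
Qed.

(** The distance w need not be attained by a curve; curves of length below w + e are used and the
    margin e tends to 0. *)
Lemma riem_lower_fine (R : realType) (n : nat) (M : c2_manifold R n) (g : riemannian_metric M) i z (r kappa : R) x y1 (w : R) :
  mball g i z r kappa -> `|y1 - z| <= r / 2 -> (riem_dist g x (phi_inv i y1) <= w%:E)%E ->
  4 * kappa * w < r -> dom i x /\ `|y1 - phi i x| <= 2 * kappa * w.
Proof.
move=> mb y1z xw wr; have [r0 gg cod cmp] := mb; have k0 := gauge_gt0 gg.
have key e : 0 < e -> 4 * kappa * (w + e) < r -> dom i x /\ `|y1 - phi i x| <= 2 * kappa * (w + e).
  move=> e0 we; have lt : (riem_dist g x (phi_inv i y1) < (w + e)%:E)%E.
    by apply: le_lt_trans xw _; rewrite lte_fin ltrDl.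
  have /ereal_inf_lt[_ [c [cc c0 c1] <-] lc] := lt.
  have [d0 h0] := riem_lower mb cc c1 y1z (ltW lc) we; rewrite c0 in d0 h0.
  split=> //; apply: (le_trans (gauge_lb gg _)).
  by rewrite [2 * kappa]mulrC -mulrA ler_pM2l.
have e1 : 0 < (r - 4 * kappa * w) / (8 * kappa) by rewrite divr_gt0 ?subr_gt0 ?mulr_gt0.
have keyE e : e <= (r - 4 * kappa * w) / (8 * kappa) -> 4 * kappa * (w + e) < r.
  rewrite ler_pdivlMr ?mulr_gt0 //; move: wr.
  have -> : 4 * kappa * (w + e) = 4 * kappa * w + (e * (8 * kappa)) / 2 by field.
  by clra.
split; first by have [] := key _ e1 (keyE _ (lexx _)).
apply: (@eps_mul_le R _ _ (2 * kappa)) => e e0; pose e' := Num.min e ((r - 4 * kappa * w) / (8 * kappa)).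
have e'0 : 0 < e' by rewrite lt_min e0.
have e'k : e' <= (r - 4 * kappa * w) / (8 * kappa) by rewrite ge_min lexx orbT.
have [_ h] := key e' e'0 (keyE e' e'k).
apply: (le_trans h); rewrite mulrDr lerD2l ler_pM2l ?mulr_gt0 //.
by rewrite ge_min lexx.
Qed.

Lemma riem_lower_fine_start (R : realType) (n : nat) (M : c2_manifold R n) (g : riemannian_metric M) i z (r kappa : R) x y1 (w : R) :
  mball g i z r kappa -> `|y1 - z| <= r / 2 -> (riem_dist g (phi_inv i y1) x <= w%:E)%E ->
  4 * kappa * w < r -> dom i x /\ `|y1 - phi i x| <= 2 * kappa * w.
Proof.
move=> mb y1z xw wr; have [r0 gg cod cmp] := mb; have k0 := gauge_gt0 gg.
have key e : 0 < e -> 4 * kappa * (w + e) < r -> dom i x /\ `|y1 - phi i x| <= 2 * kappa * (w + e).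
  move=> e0 we; have lt : (riem_dist g (phi_inv i y1) x < (w + e)%:E)%E.
    by apply: le_lt_trans xw _; rewrite lte_fin ltrDl.
  have /ereal_inf_lt[_ [c [cc c0 c1] <-] lc] := lt.
  have [d0 h0] := riem_lower_start mb cc c0 y1z (ltW lc) we; rewrite c1 in d0 h0.
  split=> //; apply: (le_trans (gauge_lb gg _)).
  by rewrite [2 * kappa]mulrC -mulrA ler_pM2l.
have e1 : 0 < (r - 4 * kappa * w) / (8 * kappa) by rewrite divr_gt0 ?subr_gt0 ?mulr_gt0.
have keyE e : e <= (r - 4 * kappa * w) / (8 * kappa) -> 4 * kappa * (w + e) < r.
  rewrite ler_pdivlMr ?mulr_gt0 //; move: wr.
  have -> : 4 * kappa * (w + e) = 4 * kappa * w + (e * (8 * kappa)) / 2 by field.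
  by clra.
split; first by have [] := key _ e1 (keyE _ (lexx _)).
apply: (@eps_mul_le R _ _ (2 * kappa)) => e e0; pose e' := Num.min e ((r - 4 * kappa * w) / (8 * kappa)).
have e'0 : 0 < e' by rewrite lt_min e0.
have e'k : e' <= (r - 4 * kappa * w) / (8 * kappa) by rewrite ge_min lexx orbT.
have [_ h] := key e' e'0 (keyE e' e'k).
apply: (le_trans h); rewrite mulrDr lerD2l ler_pM2l ?mulr_gt0 //.
by rewrite ge_min lexx.
Qed.

Lemma ac_families (R : realType) (n : nat) (M : c2_manifold R n) (g : riemannian_metric M) t (c : R -> M) : abs_continuous_curve g t c ->
  forall e : R, 0 < e -> exists2 d : R, 0 < d & forall s, fam s -> within 0 t s -> len s < d ->
    (\sum_(p <- s) riem_dist g (c p.1) (c p.2) < e%:E)%E.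
Proof.
move=> ac e e0; have [d d0 hd] := ac e e0; exists d => // s /andP[s1 s2] ws ls.
have := hd (size s) (fun k => (tnth (in_tuple s) k).1) (fun k => (tnth (in_tuple s) k).2).
rewrite -(big_tnth _ _ s xpredT (fun p => riem_dist g (c p.1) (c p.2))).
rewrite -(big_tnth _ _ s xpredT (fun p => p.2 - p.1)); apply=> //.
- move=> k; have ks : tnth (in_tuple s) k \in s by exact: mem_tnth.
  by have /andP[a b] := allP ws _ ks; split=> //; exact: (allP s1).
- move=> k l kl; pose x0 := tnth (in_tuple s) k.
  rewrite !(tnth_nth x0) /=; have := pairwiseP x0 s2 => h.
  have [klt|lkt|E] := ltngtP (nat_of_ord k) l.
  + by case/orP: (h k l (ltn_ord k) (ltn_ord l) klt) => ?; [left|right].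
  + by case/orP: (h l k (ltn_ord l) (ltn_ord k) lkt) => ?; [right|left].
  + by move/eqP: kl; case; exact: val_inj.
Qed.

(** Near s0 small distances keep the curve in one chart, where increments of coordinates are at most
    2 kappa times the distance: absolute continuity passes from the distance to the coordinates. *)
Lemma ac_chart (R : realType) (n : nat) (M : c2_manifold R n) (g : riemannian_metric M) t (c : R -> M) i z (r kappa : R) s0 :
  abs_continuous_curve g t c -> mball g i z r kappa -> 0 <= s0 -> s0 <= t -> c s0 = phi_inv i z ->
  exists2 rho : R, 0 < rho &
   (forall s, 0 <= s -> s <= t -> `|s - s0| < rho -> dom i (c s) /\ `|phi i (c s) - z| <= r / 2) /\
   forall a b, 0 <= a -> b <= t -> s0 - rho < a -> b < s0 + rho -> a <= b ->
    (forall e : R, 0 < e -> exists2 d : R, 0 < d & forall s, fam s -> within a b s -> len s < d ->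
      \sum_(p <- s) `|phi i (c p.2) - phi i (c p.1)| <= e) /\
    (forall s, fam s -> within a b s -> \sum_(p <- s) `|phi i (c p.2) - phi i (c p.1)| <= 1).
Proof.
move=> ac mb s00 s0t cs0; have [r0 gg cod cmp] := mb; have k0 := gauge_gt0 gg.
(* A distance below w0 keeps the coordinates within r / 4 of z and satisfies the smallness condition
   4 kappa w0 < r. *)
have k8 : 0 < 8 * kappa by rewrite mulr_gt0.
pose w0 := r / (8 * kappa); have w00 : 0 < w0 by rewrite divr_gt0.
have w0E : 8 * kappa * w0 = r by rewrite /w0 mulrC divfK // gt_eqF.
have [d0 d00 hd0] := ac_families ac w00.
have zz : `|z - z| <= r / 2 by rewrite subrr normr0 divr_ge0 // ltW.
have A s : 0 <= s -> s <= t -> `|s - s0| < d0 -> dom i (c s) /\ `|phi i (c s) - z| <= r / 2.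
  move=> s_0 st sd.
  have w4 : 4 * kappa * w0 < r by move: w0E r0; clra.
  suff [h1 h2] : dom i (c s) /\ `|z - phi i (c s)| <= 2 * kappa * w0.
    by split=> //; rewrite distrC; apply: (le_trans h2); move: w0E r0; clra.
  have [ss|ss] := leP s s0.
    have := hd0 [:: (s, s0)]; rewrite /fam /within /len /= !big_seq1 /= ss s_0 s0t cs0 => h.
    apply: (riem_lower_fine mb zz _ w4); apply/ltW; apply: h => //.
    by apply: le_lt_trans sd; rewrite distrC; exact: ler_norm.
  have := hd0 [:: (s0, s)]; rewrite /fam /within /len /= !big_seq1 /= (ltW ss) s00 st cs0 => h.
  apply: (riem_lower_fine_start mb zz _ w4); apply/ltW; apply: h => //.
  by apply: le_lt_trans sd; exact: ler_norm.
have sums a b (e : R) s : 0 <= a -> b <= t -> s0 - d0 < a -> b < s0 + d0 -> fam s -> within a b s ->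
    0 < e -> e <= w0 -> (\sum_(p <- s) riem_dist g (c p.1) (c p.2) < e%:E)%E ->
    \sum_(p <- s) `|phi i (c p.2) - phi i (c p.1)| <= 2 * kappa * e.
  move=> a0 bt sa bs /andP[fs _] ws e0 ew lt.
  have fin p : p \in s -> riem_dist g (c p.1) (c p.2) = (fine (riem_dist g (c p.1) (c p.2)))%:E.
    move=> ps; rewrite fineK // ge0_fin_numE ?riem_dist_ge0 //.
    apply: le_lt_trans (lt_trans lt (ltry e)).
    rewrite (big_rem p ps) /= leeDl // sume_ge0 // => q _; exact: riem_dist_ge0.
  have f0 p : 0 <= fine (riem_dist g (c p.1) (c p.2)) by rewrite fine_ge0 // riem_dist_ge0.
  have sE : \sum_(p <- s) fine (riem_dist g (c p.1) (c p.2)) <= e.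
    rewrite -lee_fin -sumEFin; apply: le_trans (ltW lt).
    by rewrite !big_seq; apply: lee_sum => p ps; rewrite -fin.
  apply: (@le_trans _ _ (\sum_(p <- s) 2 * kappa * fine (riem_dist g (c p.1) (c p.2)))).
    rewrite !big_seq; apply: ler_sum => p ps.
    have /andP[ap pb] := allP ws p ps; have pp := allP fs p ps.
    have near q : a <= q -> q <= b -> [/\ 0 <= q, q <= t & `|q - s0| < d0].
      move=> aq qb; split; [exact: le_trans a0 aq|exact: le_trans qb bt|].
      by rewrite ltr_norml; move: aq qb sa bs; clra.
    have [p20 p2t p2d] := near p.2 (le_trans ap pp) pb.
    have [d2 z2] := A p.2 p20 p2t p2d.
    have le : (riem_dist g (c p.1) (phi_inv i (phi i (c p.2))) <= (fine (riem_dist g (c p.1) (c p.2)))%:E)%E.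
      by rewrite phi_invK // -fin.
    have w4 : 4 * kappa * fine (riem_dist g (c p.1) (c p.2)) < r.
      have : fine (riem_dist g (c p.1) (c p.2)) <= w0.
        apply: le_trans ew; apply: le_trans sE; rewrite (big_rem p ps) /= lerDl.
        by apply: sumr_ge0 => q _; exact: f0.
      move=> /(ler_wpM2l (ltW k8)); rewrite w0E; have := f0 p; move: k0 r0.
      move: (fine _) => q; clear; intros; nra.
    by have [] := riem_lower_fine mb z2 le w4.
  by rewrite -mulr_sumr ler_pM2l // mulr_gt0.
pose e1 := Num.min w0 (1 / (2 * kappa)).
have e10 : 0 < e1 by rewrite lt_min w00 divr_gt0 // mulr_gt0.
have [d1 d10 hd1] := ac_families ac e10.
exists (Num.min d0 (d1 / 2)) => [|]; first by rewrite lt_min d00 divr_gt0.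
split=> [s s_0 st|a b a0 bt]; first by rewrite lt_min => /andP[ss _]; exact: A.
move=> sa bs ab.
have m0 : Num.min d0 (d1 / 2) <= d0 by rewrite ge_min lexx.
have m1 : Num.min d0 (d1 / 2) <= d1 / 2 by rewrite ge_min lexx orbT.
have sa' : s0 - d0 < a by move: sa m0; clra.
have bs' : b < s0 + d0 by move: bs m0; clra.
have win s : within a b s -> within 0 t s.
  by apply: sub_all => p /andP[ap pb]; rewrite (le_trans a0 ap) (le_trans pb bt).
have k2 : 0 < 2 * kappa by rewrite mulr_gt0.
split=> [e e0|s fs ws].
  pose e2 := Num.min w0 (e / (2 * kappa)).
  have e20 : 0 < e2 by rewrite lt_min w00 divr_gt0.
  have [d d_0 hd] := ac_families ac e20; exists d => // s fs ws ls.
  apply: (le_trans (sums a b e2 s a0 bt sa' bs' fs ws e20 _ (hd s fs (win s ws) ls))).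
    by rewrite ge_min lexx.
  by rewrite -ler_pdivlMl // mulrC ge_min lexx orbT.
have ls : len s < d1.
  by apply: (le_lt_trans (len_le ab fs ws)); move: sa bs m1; clra.
apply: (le_trans (sums a b e1 s a0 bt sa' bs' fs ws e10 _ (hd1 s fs (win s ws) ls))).
  by rewrite ge_min lexx.
by rewrite -ler_pdivlMl // mulrC ge_min lexx orbT.
Qed.

Lemma ae_imp (R : realType) (P Q : R -> Prop) : (forall x, P x -> Q x) ->
  {ae @lebesgue_measure R, forall x, P x} -> {ae @lebesgue_measure R, forall x, Q x}.
Proof. by move=> PQ; apply: (@filterS _ _ (ae_filter_ringOfSetsType (@lebesgue_measure R)) _ _ PQ). Qed.

Lemma ae_and (R : realType) (P Q : R -> Prop) : {ae @lebesgue_measure R, forall x, P x} ->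
  {ae @lebesgue_measure R, forall x, Q x} -> {ae @lebesgue_measure R, forall x, P x /\ Q x}.
Proof. exact: (@filterI _ _ (ae_filter_ringOfSetsType (@lebesgue_measure R))). Qed.

Lemma ae_true (R : realType) (P : R -> Prop) : (forall x, P x) -> {ae @lebesgue_measure R, forall x, P x}.
Proof. by move=> h; apply: (@filterE _ _ (ae_filter_ringOfSetsType (@lebesgue_measure R))). Qed.

Lemma has_der_row (R : realType) (n : nat) (f : R -> 'rV[R]_n) (s : R) (w : 'rV[R]_n) :
  (forall k, has_der (fun s => f s 0 k : R^o) s (w 0 k : R^o)) -> has_der f s w.
Proof.
move=> h e e0.
have H (l : seq 'I_n) : exists2 d : R, 0 < d & forall y, `|y - s| < d -> forall k, k \in l ->
    `|f y 0 k - f s 0 k - (y - s) * w 0 k| <= e * `|y - s|.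
  elim: l => [|k l [d d0 hd]]; first by exists 1.
  have [d' d'0 hd'] := h k e e0; exists (Num.min d d'); first by rewrite lt_min d0.
  move=> y; rewrite lt_min => /andP[y1 y2] j; rewrite in_cons => /orP[/eqP ->|jl].
    exact: hd'.
  exact: hd.
have [d d0 hd] := H (enum 'I_n); exists d => // y yd.
apply: norm_le_entries => [|k]; first by rewrite mulr_ge0 // ltW.
by rewrite !mxE; apply: hd => //; rewrite mem_enum.
Qed.

Lemma has_der_bound (R : realType) (V : normedModType R) (f : R -> V) s w : has_der f s w ->
  exists2 d : R, 0 < d & forall y, `|y - s| < d -> `|f y - f s| <= (`|w| + 1) * `|y - s|.
Proof.
move=> /(_ 1 ltr01)[d d0 hd]; exists d => // y /hd h.
rewrite -(subrK ((y - s) *: w) (f y - f s)); apply: (le_trans (ler_normD _ _)).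
by move: h; rewrite normrZ mul1r; clra.
Qed.

Lemma chart_curve_continuous (R : realType) (n : nat) (M : c2_manifold R n) (c : R -> M) (s rho : R) i (w : 'rV[R]_n) : 0 < rho ->
  (forall s', `|s' - s| < rho -> dom i (c s')) -> has_der (phi i \o c) s w -> {for s, continuous c}.
Proof.
move=> rho0 hd hw A nA; have ds : dom i (c s) by apply: hd; rewrite subrr normr0.
have /nbhs_ballP[e /= e0 he] := chart_near ds nA.
have [d d0 hb] := has_der_bound hw; have w0 : 0 < `|w| + 1 by rewrite ltr_pwDr.
apply/nbhs_ballP; exists (Num.min rho (Num.min d (e / (`|w| + 1)))).
  by rewrite /= !lt_min rho0 d0 divr_gt0.
move=> s'; rewrite -ball_normE /= distrC !lt_min ltr_pdivlMr // => /and3P[s1 s2 s3].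
have [|_] := he (phi i (c s')); last by rewrite (phi_invK (hd s' s1)).
rewrite -ball_normE /= distrC; apply: le_lt_trans (hb s' s2) _.
by rewrite mulrC.
Qed.

(** Replacing the curve by its tangent line at s costs o(h), since u is locally Lipschitz; the
    derivative of u along c then obeys the Dini bound in the direction of the velocity. *)
Lemma dini_velocity (R : realType) (n : nat) (M : c2_manifold R n) (H : cotangent M -> R) (u : M -> R) (c : R -> M) (s rho : R) i (w : 'rV[R]_n) (w' : R) :
  loclip u -> 0 < rho -> (forall s', `|s' - s| < rho -> dom i (c s')) ->
  dini_at H u i (phi i (c s)) ->
  has_der (phi i \o c) s w -> has_der (u \o c : R -> R^o) s (w' : R^o) ->
  w' <= lagrangian H (c s, velocity c s).
Proof.
move=> lu rho0 hd di hw hw'.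
have ds : dom i (c s) by apply: hd; rewrite subrr normr0.
have cc := chart_curve_continuous rho0 hd hw.
have [df dE] := (derive1_eps _ _ _).1 hw.
have [_ vE] := vel_change cc ds (dom_chart_at (c s)) df.
have -> : lagrangian H (c s, velocity c s) = lag (lh H i) (phi i (c s)) w.
  by rewrite /velocity vE dE; exact: lagrangianE.
set y := phi i (c s) in di *.
have [r [L [r0 hL]]] := lu i y (codom_phi ds).
apply: (@eps_mul_le R _ _ (2 + `|L|)) => e e0.
have [d1 d10 h1] := di w e e0; have [d2 d20 h2] := hw e e0; have [d3 d30 h3] := hw' e e0.
have k0 : 0 < `|w| + e + 1 by rewrite ltr_pwDr // addr_ge0 // ltW.
pose m := Num.min rho (Num.min d1 (Num.min d2 (Num.min d3 (r / (`|w| + e + 1))))).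
have m0 : 0 < m by rewrite !lt_min rho0 d10 d20 d30 divr_gt0.
pose h := m / 2; have h0 : 0 < h by rewrite divr_gt0.
have : h < m by rewrite /h; move: m0; clra.
rewrite /m !lt_min ltr_pdivlMr // => /and5P[hr hd1 hd2 hd3 hk].
have shs : s + h - s = h by rewrite addrAC subrr add0r.
have nh : `|s + h - s| = h by rewrite shs gtr0_norm.
have [a2 a3] := (h2 (s + h), h3 (s + h)); rewrite nh in a2 a3.
have {a2} b2 := a2 hd2; have {a3} b3 := a3 hd3; have b1 := h1 h h0 hd1.
have dsh : dom i (c (s + h)) by apply: hd; rewrite nh.
rewrite /= shs in b2 b3; set y' := phi i (c (s + h)) in b2.
have E1 : c (s + h) = phi_inv i y' by rewrite /y' phi_invK.
have E2 : c s = phi_inv i y by rewrite /y phi_invK.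
rewrite E1 E2 in b3.
have n1 : `|y + h *: w - y| <= r.
  rewrite addrAC subrr add0r normrZ gtr0_norm //; move: hk h0 e0; have := normr_ge0 w.
  by move: `|w| => q; clear; intros; nra.
have yy : y' - (y + h *: w) = y' - y - h *: w by rewrite opprD addrA.
have n2 : `|y' - y| <= r.
  have := ler_normD (y' - y - h *: w) (h *: w); rewrite subrK normrZ gtr0_norm // => q1.
  apply: (le_trans q1); move: b2 hk h0; rewrite -/y; move: `|_ - _ - _| `|w| => q2 q3.
  by clear; intros; nra.
have b4 := hL _ _ n1 n2; rewrite yy in b4.
have b5 : `|u (phi_inv i y') - u (phi_inv i (y + h *: w))| <= `|L| * (e * h).
  apply: (le_trans b4); apply: (le_trans (ler_wpM2r (normr_ge0 _) (ler_norm L))).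
  by rewrite ler_wpM2l.
have b6 := ler_norm (u (phi_inv i y') - u (phi_inv i (y + h *: w))).
have b7 : h * w' - (u (phi_inv i y') - u (phi_inv i y)) <= e * h.
  by apply: le_trans b3; rewrite distrC; exact: ler_norm.
rewrite -(ler_pM2l h0).
have -> : h * (lag (lh H i) y w + (2 + `|L|) * e) = h * (lag (lh H i) y w + e) + `|L| * (e * h) + e * h by ring.
have fin (A B C X Y Z W : R) : A - C <= X -> B - A <= Y -> Z - (B - C) <= W -> Z <= X + Y + W by clra.
exact: fin b1 (le_trans b6 b5) b7.
Qed.

Lemma mball_sub (R : realType) (n : nat) (M : c2_manifold R n) (g : riemannian_metric M) i z r r' kappa :
  mball g i z r kappa -> 0 < r' -> r' <= r -> mball g i z r' kappa.
Proof.
move=> [r0 gg cod cmp] r'0 rr; split=> //.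
- by move=> y yr; apply: cod; exact: le_trans yr rr.
- by move=> y v p yr; apply: cmp; exact: le_trans yr rr.
Qed.

Lemma fam_cut (R : realType) (a b y : R) s : a <= y -> y <= b -> fam s -> within a b s ->
  exists l r, [/\ fam l /\ fam r, within a y l, within y b r, len l <= len s /\ len r <= len s &
    forall f, var f s <= var f l + var f r].
Proof.
move=> ay yb fs ws.
have mn : {homo (fun z : R => Num.min z y) : z z' / z <= z'}.
  by move=> z z' zz; rewrite le_min !ge_min lexx zz orbT.
have mx : {homo (fun z : R => Num.max z y) : z z' / z <= z'}.
  by move=> z z' zz; rewrite ge_max !le_max lexx zz orbT.
exists [seq (Num.min p.1 y, Num.min p.2 y) | p <- s], [seq (Num.max p.1 y, Num.max p.2 y) | p <- s].
split; [by split; [exact: (fam_map mn)|exact: (fam_map mx)]| | | |by move=> f; exact: var_cut].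
- rewrite /within all_map; apply: sub_all ws => p /= /andP[p1 p2].
  by rewrite le_min p1 ay ge_min lexx orbT.
- rewrite /within all_map; apply: sub_all ws => p /= /andP[p1 p2].
  by rewrite ge_max p2 yb le_max lexx orbT.
- have /andP[/allP fs' _] := fs; rewrite /len !big_map !big_seq; split; apply: ler_sum => p /fs' pp /=.
    rewrite /Num.min; case: ltP => a1; case: ltP => a2; move: pp a1 a2; clra.
  rewrite /Num.max; case: ltP => a1; case: ltP => a2; move: pp a1 a2; clra.
Qed.

Lemma lag_shift (R : realType) (n : nat) (M : c2_manifold R n) (g : riemannian_metric M) (H : cotangent M -> R) Hx Hp alpha i y v :
  good g H Hx Hp -> chart_cod i y ->
  lag (lh (shift_ham H alpha) i) y v = lag (lh H i) y v + alpha.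
Proof.
move=> gH cy; have [r [k [r0 _ _ _ hl]]] := good_loc gH cy.
have [r' [k' [r'0 _ _ _ hl']]] := good_loc (good_shift alpha gH) cy.
have y0 : `|y - y| <= r by rewrite subrr normr0 ltW.
have y0' : `|y - y| <= r' by rewrite subrr normr0 ltW.
apply/eqP; rewrite eq_le; apply/andP; split.
  apply: ge_sup; first by exists (pairing 0 v - lh (shift_ham H alpha) i y 0); exists 0.
  move=> _ [p _ <-]; rewrite lh_shift opprB addrCA [alpha + _]addrC lerD2r.
  exact: (lag_ge v p hl y0).
rewrite -lerBrDr; apply: ge_sup; first by exists (pairing 0 v - lh H i y 0); exists 0.
move=> _ [p _ <-]; have := lag_ge v p hl' y0'; rewrite lh_shift.
by move: (lag _ _ _) (lh H i y p) (pairing p v); clear; intros; lra.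
Qed.

Lemma lagrangian_shift (R : realType) (n : nat) (M : c2_manifold R n) (g : riemannian_metric M) (H : cotangent M -> R) Hx Hp alpha x (v : 'rV[R]_n) :
  good g H Hx Hp -> lagrangian (shift_ham H alpha) (x, v) = lagrangian H (x, v) + alpha.
Proof.
move=> gH; have da := dom_chart_at x.
have E (F : cotangent M -> R) : lagrangian F (x, v) = lag (lh F (chart_at x)) (phi (chart_at x) x) v.
  by rewrite -(lagrangianE F v da) jac_id // mulmx1.
by rewrite !E (lag_shift alpha v gH) //; exact: codom_phi.
Qed.

(** Along an absolutely continuous curve u is absolutely continuous, hence the integral of its
    derivative, which the Lagrangian bounds almost everywhere. Charts give this only locally in
    time, so the three properties in [P] are chosen to be stable under concatenation. *)
Lemma subsol_subsolution (R : realType) (n : nat) (M : c2_manifold R n) (g : riemannian_metric M) (H : cotangent M -> R) Hx Hp alpha (u : M -> R) :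
  good g H Hx Hp -> subsol (shift_ham H alpha) u -> subsolution g H alpha u.
Proof.
move=> gH [lu du] x y t t0; rewrite -leeBlDr // -EFinB.
apply: le_ereal_inf_tmp => _ [c [ac c0 ct] <-].
pose f s := u (c s); pose L s := lagrangian (shift_ham H alpha) (c s, velocity c s).
(* The bound concerns any derivative w that may exist; existence almost everywhere comes from
   [ac_ftc], after gluing. *)
pose P a b := [/\ lac a b f, exists B : R, forall s, fam s -> within a b s -> var f s <= B &
  {ae lebesgue_measure, forall s : R, a < s -> s < b -> forall w : R, has_der (f : R -> R^o) s (w : R^o) -> w <= L s}].
have : P 0 t.
  apply: itv_glue t0 => [a b d a0 ab bd dt [l1 [B1 v1] e1] [l2 [B2 v2] e2]|s0 /andP[s00 s0t]].
    split.
    - move=> e e0; have e2' : 0 < e / 2 by rewrite divr_gt0.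
      have [d1 d10 h1] := l1 _ e2'; have [d2 d20 h2] := l2 _ e2'.
      exists (Num.min d1 d2); first by rewrite lt_min d10.
      move=> s fs ws; rewrite lt_min => /andP[s1 s2].
      have [l [r [[fl fr] wl wr [ll lr] v]]] := fam_cut ab bd fs ws.
      have := h1 l fl wl (le_lt_trans ll s1); have := h2 r fr wr (le_lt_trans lr s2).
      by have := v f; clra.
    - exists (B1 + B2) => s fs ws; have [l [r [[fl fr] wl wr _ v]]] := fam_cut ab bd fs ws.
      by apply: (le_trans (v f)); apply: lerD; [exact: v1|exact: v2].
    - have e3 : {ae lebesgue_measure, forall s : R, s <> b}.
        exists [set b]; split; [exact: measurable_set1|exact: lebesgue_measure_set1|].
        by move=> s /= /contrapT.
      have e12 := ae_and (ae_and e1 e2) e3.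
      apply: ae_imp e12 => s [[h1 h2] sb] as_ sd w hw.
      have [sb'|bs|E] := ltgtP s b; [exact: h1 hw|exact: h2 hw|by []].
  pose i := chart_at (c s0); have di := dom_chart_at (c s0) : dom i (c s0).
  pose z := phi i (c s0); have cz : chart_cod i z := codom_phi di.
  have [r [kappa ni]] := good_loc gH cz; have mb0 := @nice_mball _ _ _ g H Hx Hp _ _ _ _ ni.
  have [rL [Lc [rL0 hL]]] := lu i z cz.
  have r0 : 0 < r by case: ni.
  have m0 : 0 < Num.min r rL by rewrite lt_min r0.
  have m1 : Num.min r rL <= r by rewrite ge_min lexx.
  have m2 : Num.min r rL <= rL by rewrite ge_min lexx orbT.
  have mb := mball_sub mb0 m0 m1.
  have cs0 : c s0 = phi_inv i z by rewrite /z phi_invK.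
  have [rho rho0 [near loc]] := ac_chart ac mb s00 s0t cs0.
  exists rho => // s1 s2 s10 s1s0 s0s2 s2t sr1 sr2.
  have s12 := le_trans s1s0 s0s2.
  have [la bv] := loc s1 s2 s10 s2t sr1 sr2 s12.
  have nearp q : s1 <= q -> q <= s2 -> dom i (c q) /\ `|phi i (c q) - z| <= rL.
    move=> q1 q2; have [|||d1 d2] := near q.
    - exact: le_trans s10 q1.
    - exact: le_trans q2 s2t.
    - by rewrite ltr_norml; move: q1 q2 sr1 sr2; clra.
    by split=> //; apply: (le_trans d2); move: m0 m2; clra.
  have L1 : 0 < `|Lc| + 1 by rewrite ltr_pwDr.
  have vf s : fam s -> within s1 s2 s -> var f s <= (`|Lc| + 1) * \sum_(p <- s) `|phi i (c p.2) - phi i (c p.1)|.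
    move=> /andP[fs _] ws; rewrite mulr_sumr /var !big_seq; apply: ler_sum => p ps.
    have pp := allP fs p ps; have /andP[p1 p2] := allP ws p ps.
    have [d1 b1] := nearp p.1 p1 (le_trans pp p2); have [d2 b2] := nearp p.2 (le_trans p1 pp) p2.
    have := hL _ _ b1 b2; rewrite !phi_invK // => h; apply: (le_trans h).
    by apply: ler_wpM2r => //; apply: (le_trans (ler_norm Lc)); rewrite lerDl.
  split.
  - move=> e e0; have [d d0 hd] := la _ (divr_gt0 e0 L1); exists d => // s fs ws ls.
    apply: (le_trans (vf s fs ws)); have := ler_wpM2l (ltW L1) (hd s fs ws ls).
    by rewrite [X in _ <= X -> _]mulrC divfK ?gt_eqF.
  - exists (`|Lc| + 1) => s fs ws; apply: (le_trans (vf s fs ws)).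
    by rewrite -[leRHS]mulr1 ler_wpM2l ?(ltW L1) // bv.
  have [s12'|s21] := ltP s1 s2; last first.
    apply: ae_true => s a1 a2; have := lt_trans a1 a2.
    by rewrite ltNge s21.
  have coord (k : 'I_n) : exists h : R -> R, {ae lebesgue_measure, forall s : R, s1 < s -> s < s2 ->
      has_der (fun s => phi i (c s) 0 k : R^o) s (h s : R^o)}.
    have ent p : `|phi i (c p.2) 0 k - phi i (c p.1) 0 k| <= `|phi i (c p.2) - phi i (c p.1)|.
      by have := norm_entry (phi i (c p.2) - phi i (c p.1)) k; rewrite !mxE.
    have [||h [_ _ hh]] := @ac_ftc R (fun s => phi i (c s) 0 k) s1 s2 1 s12'; last by exists h.
    - move=> e /la[d d0 hd]; exists d => // s fs ws ls; apply: le_trans (hd s fs ws ls).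
      by apply: ler_sum => p _; exact: ent.
    - move=> s fs ws; apply: le_trans (bv s fs ws).
      by apply: ler_sum => p _; exact: ent.
  have [h hh] := choice coord.
  apply: ae_imp (ae_all hh) => s hs a1 a2 w hw.
  have rr : 0 < Num.min (s - s1) (s2 - s) by rewrite lt_min !subr_gt0 a1.
  have dn s' : `|s' - s| < Num.min (s - s1) (s2 - s) -> dom i (c s').
    rewrite lt_min !ltr_norml => /andP[/andP[q1 q2] /andP[q3 q4]].
    by have [] := nearp s' _ _ => //; move: q1 q2 q3 q4; clra.
  have ds : dom i (c s) by apply: dn; rewrite subrr normr0.
  apply: (dini_velocity lu rr dn (du i _ (codom_phi ds)) _ hw).
  apply: (@has_der_row _ _ _ _ (\row_k h k s)) => k; rewrite mxE; exact: (hs k a1 a2).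
(* For t = 0 the action is an integral over a single point, and only its sign matters. *)
move=> [lf [B bf] hf]; have [t00|tn0] := eqVneq t 0.
  have yx : y = x by rewrite -c0 -ct t00.
  rewrite yx subrr t00 mul0r subr0.
  have m0 : measurable_fun [set: measurableTypeR R] (EFin \o cst (0 : R)).
    exact: (measurable_cst (0%E : \bar R)).
  have := @int_ae_le R 0 0 (cst 0) (fun s => lagrangian H (c s, velocity c s)) m0.
  rewrite integral0; apply.
  by apply: ae_true => s a1 a2; have := lt_trans a1 a2; rewrite ltxx.
have tp : 0 < t by rewrite lt_neqAle eq_sym tn0.
have [h [ih hE hd]] := ac_ftc tp lf bf.
have ff : f t - f 0 = u y - u x by rewrite /f c0 ct.
have mi : measurable (`]0, t]%classic : set (measurableTypeR R)) by exact: measurable_itv.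
have ic : lebesgue_measure.-integrable (`]0, t]%classic : set (measurableTypeR R)) (EFin \o cst alpha).
  apply/integrableP; split; first exact: (measurable_cst (alpha%:E)).
  have -> : (fun s : measurableTypeR R => `|(EFin \o cst alpha) s|%E) = cst `|alpha|%:E by [].
  by rewrite integral_cst //= lebesgue_measure_itv /= lte_fin tp -EFinB -EFinM ltry.
have Ic : (\int[lebesgue_measure]_(s in `]0%R, t]) (cst alpha s)%:E)%E = (t * alpha)%:E.
  have lt : lebesgue_measure (`]0, t]%classic : set (measurableTypeR R)) = t%:E.
    by rewrite lebesgue_measure_itv /= lte_fin tp -EFinB subr0.
  apply: (etrans (integral_cst lebesgue_measure mi alpha%:E)).
  by rewrite [X in (_ * X)%E](_ : _ = t%:E) // -EFinM mulrC.
have ih' := integrableS measurableT mi (@subsetT _ _) ih.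
have -> : (u y - u x - t * alpha)%:E = (\int[lebesgue_measure]_(s in `]0%R, t]) (h s - alpha)%:E)%E.
  transitivity (\int[lebesgue_measure]_(s in `]0%R, t]) ((h s)%:E - (cst alpha s)%:E))%E.
    by rewrite integralB_EFin // (hE t (ltW tp) (lexx t)) ff Ic -EFinB.
  by apply: eq_integral => s _; rewrite EFinB.
apply: int_ae_le.
  have mh : measurable_fun [set: measurableTypeR R] (EFin \o h) by case/integrableP: ih.
  have -> : EFin \o (fun s => h s - alpha) = (EFin \o h) \+ cst (- alpha)%:E by apply/funext => s /=; rewrite -EFinD.
  exact: emeasurable_funD mh (measurable_cst _).
apply: ae_imp (ae_and hd hf) => s [{}hd {}hf] s0 st.
have := hf s0 st (h s) (hd s0 st); rewrite /L (lagrangian_shift alpha _ _ gH).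
by rewrite lerBlDr.
Qed.

(** * Time reversal *)

Lemma lag_rev (R : realType) (n : nat) (M : c2_manifold R n) (g : riemannian_metric M) (H : cotangent M -> R) Hx Hp i y (v : 'rV[R]_n) :
  good g H Hx Hp -> chart_cod i y -> lag (lh (rev_ham H) i) y v = lag (lh H i) y (- v).
Proof.
move=> gH cy; have [r [k [r0 _ _ _ hl]]] := good_loc gH cy.
have [r' [k' [r'0 _ _ _ hl']]] := good_loc (good_rev gH) cy.
have y0 : `|y - y| <= r by rewrite subrr normr0 ltW.
have y0' : `|y - y| <= r' by rewrite subrr normr0 ltW.
have sup_le (F : 'rV[R]_n -> 'rV[R]_n -> R) w c : (forall p, pairing p w - F y p <= c) -> lag F y w <= c.
  move=> h; apply: ge_sup; first by exists (pairing 0 w - F y 0); exists 0.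
  by move=> _ [p _ <-].
apply/eqP; rewrite eq_le; apply/andP; split; apply: sup_le => // p.
  rewrite lh_rev; have := lag_ge (- v) (- p) hl y0.
  by rewrite pairingNl pairingNr opprK.
have := lag_ge v (- p) hl' y0'; rewrite lh_rev opprK.
by rewrite pairingNl -pairingNr.
Qed.

Lemma rev_hamK (R : realType) (n : nat) (M : c2_manifold R n) (H : cotangent M -> R) : rev_ham (rev_ham H) = H.
Proof. by apply/funext => -[x p]; rewrite /rev_ham /= opprK. Qed.

(** For - u the segment is run backwards, from y + s v to y, and the Dini bound of u at y alone says
    nothing about it. The bounds at all points of the segment are integrated by [dini_segment], and
    L at y + s v is replaced by L at y up to O(s). *)
Lemma subsol_rev (R : realType) (n : nat) (M : c2_manifold R n) (g : riemannian_metric M) (H : cotangent M -> R) Hx Hp u :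
  good g H Hx Hp -> subsol H u -> subsol (rev_ham H) (fun x => - u x).
Proof.
move=> gH [lu du]; split.
  move=> i z cz; have [r [L [r0 hL]]] := lu i z cz; exists r, L; split=> // y y' yr y'r.
  have -> : - u (phi_inv i y') - - u (phi_inv i y) = - (u (phi_inv i y') - u (phi_inv i y)) by ring.
  by rewrite normrN; exact: hL.
move=> i y cy v e e0; rewrite (lag_rev v gH cy).
have [r [k [r0 gg cod cmp hl]]] := good_loc gH cy.
have [rL [L [rL0 hL]]] := lu i y cy.
have [C1 C10 seg] := dini_segment hl (normr_ge0 (- v)).
have [C2 C20 hC] := lag_lip `|- v| hl.
pose m := Num.min r rL; have m0 : 0 < m by rewrite lt_min r0.
have v1 : 0 < `|v| + 1 by rewrite ltr_pwDr.
have K0 : 0 < C1 + C2 * `|v| + 1 by rewrite ltr_pwDr // addr_ge0 // ?mulr_ge0 // ltW.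
exists (Num.min (m / (`|v| + 1)) (e / (C1 + C2 * `|v| + 1))); first by rewrite lt_min !divr_gt0.
move=> s s0; rewrite lt_min !ltr_pdivlMr // => /andP[sm se].
have near q : 0 <= q -> q <= s -> `|y + s *: v + q *: - v - y| <= m.
  move=> q0 qs; have -> : y + s *: v + q *: - v - y = (s - q) *: v.
    by apply/rowP => l; rewrite !mxE; ring.
  rewrite normrZ ger0_norm ?subr_ge0 //; have := normr_ge0 v; move: q0 qs sm.
  by move: `|v| => a; clear; intros; nra.
have mr : m <= r by rewrite ge_min lexx.
have mL : m <= rL by rewrite ge_min lexx orbT.
have E : y + s *: v + s *: - v = y by rewrite scalerN addrK.
have E0 : y + s *: v + 0 *: - v = y + s *: v by rewrite scale0r addr0.
have h2 q q' : 0 <= q -> q <= s -> 0 <= q' -> q' <= s ->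
    `|u (phi_inv i (y + s *: v + q' *: - v)) - u (phi_inv i (y + s *: v + q *: - v))| <= `|L| * `|v| * `|q' - q|.
  move=> q0 qs q'0 q's.
  apply: (le_trans (hL _ _ (le_trans (near q q0 qs) mL) (le_trans (near q' q'0 q's) mL))).
  have -> : y + s *: v + q' *: - v - (y + s *: v + q *: - v) = (q - q') *: v.
    by apply/rowP => l; rewrite !mxE; ring.
  rewrite normrZ [`|q - q'|]distrC [`|q' - q| * _]mulrC mulrA.
  by apply: ler_wpM2r => //; apply: ler_wpM2r => //; exact: ler_norm.
have h3 q e' : 0 <= q -> q < s -> 0 < e' -> exists2 rho : R, 0 < rho & forall h, 0 < h -> h < rho ->
    u (phi_inv i (y + s *: v + (q + h) *: - v)) - u (phi_inv i (y + s *: v + q *: - v)) <=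
    h * (lag (lh H i) (y + s *: v + q *: - v) (- v) + e').
  move=> q0 qs e'0; have cq := cod _ (le_trans (near q q0 (ltW qs)) mr).
  have [rho rho0 hr] := du i _ cq (- v) e' e'0; exists rho => // h h0 hh.
  by rewrite scalerDl addrA; exact: hr.
have h1 := seg (fun y => u (phi_inv i y)) (y + s *: v) (- v) s (`|L| * `|v|) (ltW s0) (lexx _)
  (fun q q0 qs => le_trans (near q q0 qs) mr) h2 h3.
rewrite E in h1.
have b := near 0 (lexx 0) (ltW s0); rewrite E0 in b.
have yy : `|y - y| <= r by rewrite subrr normr0 ltW.
have h4 := hC y (y + s *: v) (- v) (- v) yy (le_trans b mr) (lexx _) (lexx _).
have E1 : y + s *: v - y = s *: v by rewrite addrAC subrr add0r.
rewrite subrr normr0 addr0 E1 normrZ gtr0_norm // in h4.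
have h5 := ler_wpM2l (ltW s0) h4.
have h6 : s * (C2 * (s * `|v|)) + C1 * s ^+ 2 <= s * e.
  have -> : s * (C2 * (s * `|v|)) + C1 * s ^+ 2 = s * (s * (C1 + C2 * `|v|)) by ring.
  rewrite ler_pM2l //; apply: le_trans (ltW se); rewrite ler_pM2l //; by rewrite lerDl.
have fin (a0 b0 c d X Y Z : R) : a0 - b0 <= c + d -> c <= s * (X + Y) -> s * Y + d <= s * Z ->
  - b0 - - a0 <= s * (X + Z) by clear; intros; lra.
exact: fin h1 h5 h6.
Qed.

(** The chart line is a competitor curve. The strict inequalities leave room to prolong it beyond
    both ends, where [velocity] is a two-sided derivative. *)
Lemma subsolution_line (R : realType) (n : nat) (M : c2_manifold R n) (g : riemannian_metric M) (H : cotangent M -> R) Hx Hp alpha u i z r kappa y v t K :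
  subsolution g H alpha u -> nice g H Hx Hp i z r kappa -> 0 < t ->
  `|y - z| < r -> `|y + t *: v - z| < r ->
  (forall s, 0 <= s -> s <= t -> lag (lh H i) (y + s *: v) v <= K) ->
  u (phi_inv i (y + t *: v)) - u (phi_inv i y) <= t * (K + alpha).
Proof.
move=> hs ni t0 yr ytr hK; have mb := nice_mball ni; have [r0 gg cod cmp] := mb.
pose c s := phi_inv i (y + s *: v).
pose r' := Num.max `|y - z| `|y + t *: v - z|.
have r'r : r' < r by rewrite gt_max yr.
have inb s : 0 <= s -> s <= t -> `|y + s *: v - z| <= r'.
  move=> s0 st; have := @segment_in_ball R n y (y + t *: v) z r' t s t0 s0 st.
  have -> : t^-1 *: (y + t *: v - y) = v.
    by rewrite addrAC subrr add0r scalerA mulVf ?gt_eqF // scale1r.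
  by apply; rewrite le_max lexx ?orbT.
have v1 : 0 < `|v| + 1 by rewrite ltr_pwDr.
pose d := (r - r') / (`|v| + 1); have d0 : 0 < d by rewrite divr_gt0 // subr_gt0.
have nearb s s' : 0 <= s -> s <= t -> `|s' - s| < d -> `|y + s' *: v - z| <= r.
  move=> s0 st; rewrite ltr_pdivlMr // => h.
  have -> : y + s' *: v - z = (y + s *: v - z) + (s' - s) *: v.
    by apply/rowP => l; rewrite !mxE; ring.
  apply: (le_trans (ler_normD _ _)); rewrite normrZ.
  have := inb s s0 st; have := normr_ge0 (s' - s); move: h; rewrite mulrDr mulr1; clra.
have vel s : 0 <= s -> s <= t -> lagrangian H (c s, velocity c s) = lag (lh H i) (y + s *: v) v.
  move=> s0 st; have dn s' : `|s' - s| < d -> dom i (c s').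
    by move=> h; apply: dom_phi_inv; apply: cod; exact: nearb h.
  have pE s' : `|s' - s| < d -> phi i (c s') = y + s' *: v.
    by move=> h; apply: phi_phi_inv; apply: cod; exact: nearb h.
  have ss : `|s - s| < d by rewrite subrr normr0.
  have hd : has_der (phi i \o c) s v.
    move=> e e0; exists d => // s' h; rewrite /= pE // pE //.
    have -> : y + s' *: v - (y + s *: v) - (s' - s) *: v = 0.
      by apply/rowP => l; rewrite !mxE; ring.
    by rewrite normr0 mulr_ge0 // ltW.
  have cc := chart_curve_continuous d0 dn hd; have ds := dn s ss.
  have [df dE] := (derive1_eps _ _ _).1 hd.
  have [_ vE] := vel_change cc ds (dom_chart_at (c s)) df.
  by rewrite /velocity vE dE (lagrangianE H v ds) pE.
pose T := 8 * tn g i z v + 1.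
have T0 : 0 < T by rewrite ltr_pwDr // mulr_ge0 // tn_ge0.
have dist s s' : 0 <= s -> s <= s' -> s' <= t -> (riem_dist g (c s) (c s') <= (T * (s' - s))%:E)%E.
  move=> s0; rewrite le_eqVlt => /orP[/eqP <- _|ss st].
    by rewrite subrr mulr0; exact: conn_dist (conn_refl g (c s)).
  have s'0 := le_trans s0 (ltW ss).
  have i1 := le_trans (inb s s0 (le_trans (ltW ss) st)) (ltW r'r).
  have i2 := le_trans (inb s' s'0 st) (ltW r'r).
  apply: conn_dist; apply: (conn_segment mb i1 i2); first by rewrite mulr_gt0 // subr_gt0.
  have -> : y + s' *: v - (y + s *: v) = (s' - s) *: v by apply/rowP => l; rewrite !mxE; ring.
  rewrite (gaugeZ gg) gtr0_norm ?subr_gt0 // mulrCA mulrC ler_pM2r ?subr_gt0 //.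
  by rewrite lerDl.
have ac : abs_continuous_curve g t c.
  move=> e e0; exists (e / T); first by rewrite divr_gt0.
  move=> m a b hab _; rewrite ltr_pdivlMr // => lt.
  apply: (@le_lt_trans _ _ (\sum_(k < m) (T * (b k - a k))%:E)%E).
    by apply: lee_sum => k _; have [a0 ab bt] := hab k; exact: dist.
  by rewrite sumEFin lte_fin -mulr_sumr mulrC.
have := hs (c 0) (c t) t (ltW t0).
have cE0 : c 0 = phi_inv i y by rewrite /c scale0r addr0.
rewrite cE0 => h; rewrite -lee_fin; apply: (le_trans h).
apply: (@le_trans _ _ ((t * K)%:E + (t * alpha)%:E)%E); last by rewrite -EFinD -mulrDr.
apply: leeD => //; apply: ge_ereal_inf; exists (action H t c); first by exists c.
apply: (@le_trans _ _ (\int[lebesgue_measure]_(s in `[0%R, t]) K%:E)%E).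
  apply: int_mono => s; rewrite !patchE; case: ifP => // /[!inE] /=; rewrite in_itv /= => /andP[s0 st].
  by rewrite lee_fin vel //; exact: hK.
by rewrite integral_cst //= lebesgue_measure_itv /= lte_fin t0 -EFinB -EFinM subr0 mulrC.
Qed.

(** Chart lines suffice as test curves: those of unit speed give the Lipschitz bound, short ones of
    fixed velocity the Dini bound. *)
Lemma subsolution_subsol (R : realType) (n : nat) (M : c2_manifold R n) (g : riemannian_metric M) (H : cotangent M -> R) Hx Hp alpha u :
  good g H Hx Hp -> subsolution g H alpha u -> subsol (shift_ham H alpha) u.
Proof.
move=> gH hs; have [C0 C00 hC0] := lag_upper 1 gH; split.
  move=> i z cz; have [r [kappa ni]] := good_loc gH cz; have [r0 gg cod cmp _] := ni.
  have k0 := gauge_gt0 gg.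
  have [C C_0 hC] := lag_upper kappa gH.
  exists (r / 2), (C + `|alpha|); split; first by rewrite divr_gt0.
  have r2 : r / 2 < r by move: r0; clra.
  have one y y' : `|y - z| <= r / 2 -> `|y' - z| <= r / 2 ->
      u (phi_inv i y') - u (phi_inv i y) <= (C + `|alpha|) * `|y' - y|.
    move=> yr y'r; have [->|ne] := eqVneq y' y; first by rewrite !subrr normr0 mulr0.
    have t0 : 0 < `|y' - y| by rewrite normr_gt0 subr_eq0.
    pose v := `|y' - y|^-1 *: (y' - y).
    have yE : y + `|y' - y| *: v = y' by rewrite /v scalerA divff ?gt_eqF // scale1r addrC subrK.
    have yr' := le_lt_trans yr r2.
    have y'r' : `|y + `|y' - y| *: v - z| < r by rewrite yE; exact: le_lt_trans y'r r2.
    have nv : `|v| <= 1 by rewrite normrZ normfV normr_id mulVf ?gt_eqF.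
    have := subsolution_line hs ni t0 yr' y'r' (_ : forall s, _ -> _ -> _ <= C).
    rewrite yE mulrC => h; apply: (le_trans (h _)).
      move=> s s0 st; have inb := segment_in_ball t0 s0 st yr y'r.
      have inr := le_trans inb (ltW r2); apply: hC; first exact: cod.
      have [_ _ [_ b] _] := cmp (y + s *: v) v 0 inr; apply: (le_trans b).
      by rewrite -[leRHS]mulr1 ler_pM2l.
    by rewrite ler_pM2r // lerD2l; exact: ler_norm.
  move=> y y' yr y'r; rewrite ler_norml; apply/andP; split; last exact: one.
  by rewrite lerNl opprB distrC; exact: one.
move=> i y cy v e e0; have [r [kappa ni]] := good_loc gH cy; have [r0 gg cod cmp hl] := ni.
rewrite (lag_shift alpha v gH cy).
have [C C_0 hC] := lag_lip `|v| hl.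
have v1 : 0 < `|v| + 1 by rewrite ltr_pwDr.
have Cv : 0 < C * `|v| + 1 by rewrite ltr_pwDr // mulr_ge0 // ltW.
exists (Num.min (r / (`|v| + 1)) (e / (C * `|v| + 1))); first by rewrite lt_min !divr_gt0.
move=> t t0; rewrite lt_min !ltr_pdivlMr // => /andP[tr te].
have yy : `|y - y| < r by rewrite subrr normr0.
have dist s : 0 <= s -> s <= t -> `|y + s *: v - y| <= t * `|v|.
  move=> s0 st; rewrite addrAC subrr add0r normrZ ger0_norm //; exact: ler_wpM2r.
have tv : t * `|v| < r by move: tr t0; rewrite mulrDr mulr1; clra.
have yt := le_lt_trans (dist t (ltW t0) (lexx t)) tv.
have := subsolution_line hs ni t0 yy yt (_ : forall s, _ -> _ -> _ <= lag (lh H i) y v + C * (t * `|v|)).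
move=> h; apply: (le_trans (h _)).
  move=> s s0 st; have d := dist s s0 st.
  have := hC y (y + s *: v) v v (ltW yy) (le_trans d (ltW tv)) (lexx _) (lexx _).
  rewrite subrr normr0 addr0 => h2; apply: (le_trans h2).
  by rewrite lerD2l ler_pM2l.
rewrite ler_pM2l //; have : C * (t * `|v|) <= e by move: te t0; clra.
by move: (lag _ _ _) (C * _) => a b; clear; intros; lra.
Qed.

(** * Regularization *)

Lemma geometric_limit (R : realType) (a : nat -> R) (c : R) :
  (forall k, `|a k.+1 - a k| <= c / 2 ^+ k.+1) -> exists d, forall k, `|d - a k| <= 2 * c / 2 ^+ k.
Proof.
move=> ha; have p2 k : 0 < 2 ^+ k :> R by exact: exprn_gt0.
have c0 : 0 <= c.
  by have := le_trans (normr_ge0 _) (ha 0%N); rewrite expr1 pmulr_lge0 // invr_gt0.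
have hS k : c / 2 ^+ k.+1 = c / 2 ^+ k / 2 by rewrite exprS invfM [2^-1 * _]mulrC mulrA.
have ck k : 0 <= c / 2 ^+ k by rewrite divr_ge0 // ltW.
have far k m : `|a (m + k)%N - a k| <= c / 2 ^+ k - c / 2 ^+ (m + k).
  elim: m => [|m IH]; first by rewrite !subrr normr0.
  have := ler_distD (a (m + k)%N) (a (m + k).+1) (a k); have := ha (m + k)%N.
  by rewrite addSn hS; move: IH; clra.
pose S := range (fun k => a k + 2 * c / 2 ^+ k).
have dist k j : a k - c / 2 ^+ k <= a j + 2 * c / 2 ^+ j.
  have ckk := ck k; have ckj := ck j; have c2 : 2 * c / 2 ^+ j = 2 * (c / 2 ^+ j) by rewrite mulrA.
  rewrite c2; have [kj|jk] := leqP k j.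
    have := far k (j - k)%N; rewrite subnK // ler_norml => /andP[h _]; move: h ckk ckj; clra.
  have := far j (k - j)%N; rewrite (subnK (ltnW jk)) ler_norml => /andP[_ h]; move: h ckk ckj; clra.
have hi : has_inf S by split; [exists (a 0%N + 2 * c / 2 ^+ 0); exists 0%N|exists (a 0%N - c / 2 ^+ 0) => _ [j _ <-]; exact: dist].
exists (inf S) => k; rewrite ler_norml; apply/andP; split.
  have : a k - c / 2 ^+ k <= inf S by apply: lb_le_inf; [exact: hi.1|move=> _ [j _ <-]; exact: dist].
  by have := ck k; rewrite -mulrA; clra.
have : inf S <= a k + 2 * c / 2 ^+ k by apply: ge_inf; [exact: hi.2|exists k].
by clra.
Qed.

Lemma sdN (R : realType) (n : nat) (f : 'rV[R]_n -> R) x h : sd (fun y => - f y) x h = - sd f x h.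
Proof. by rewrite /sd; ring. Qed.

Lemma semiconcaveN (R : realType) (n : nat) (f : 'rV[R]_n -> R) A z rho :
  semiconcave (fun y => - f y) A z rho <-> semiconvex f A z rho.
Proof. by split=> h x y xy; have := h x y xy; rewrite sdN lerNl. Qed.

Lemma semiconvexN (R : realType) (n : nat) (f : 'rV[R]_n -> R) A z rho :
  semiconvex (fun y => - f y) A z rho <-> semiconcave f A z rho.
Proof. by split=> h x y xy; have := h x y xy; rewrite sdN lerN2. Qed.

Lemma semiconcave_mono (R : realType) (n : nat) (f : 'rV[R]_n -> R) A A' z rho rho' :
  semiconcave f A z rho -> A <= A' -> rho' <= rho -> semiconcave f A' z rho'.
Proof.
move=> h AA rr x y xy; apply: (le_trans (h x y (le_trans xy rr))).
by rewrite ler_wpM2r // sqr_ge0.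
Qed.

Lemma semiconvex_mono (R : realType) (n : nat) (f : 'rV[R]_n -> R) A A' z rho rho' :
  semiconvex f A z rho -> A <= A' -> rho' <= rho -> semiconvex f A' z rho'.
Proof.
move=> h AA rr x y xy; apply: le_trans (h x y (le_trans xy rr)).
by rewrite lerN2 ler_wpM2r // sqr_ge0.
Qed.

Lemma uniform_time (R : realType) (P : nat -> R -> Prop) :
  (forall k, exists2 tau : R, 0 < tau & forall t, 0 < t -> t <= tau -> P k t) ->
  forall m, exists2 tau : R, 0 < tau & forall t, 0 < t -> t <= tau -> forall k, (k < m)%N -> P k t.
Proof.
move=> h; elim=> [|m [tau tau0 IH]]; first by exists 1.
have [tau' tau'0 h'] := h m; exists (Num.min tau tau'); first by rewrite lt_min tau0.
move=> t t0; rewrite le_min => /andP[t1 t2] k; rewrite ltnS leq_eqVlt => /orP[/eqP ->|km].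
  exact: h'.
exact: IH.
Qed.

(** Constants and radii deteriorate at a finite rate, so a prescribed loss eta is respected for all
    small t; the constant gained, on the other hand, depends on t. *)
Lemma lax_semi (R : realType) (n : nat) (M : c2_manifold R n) (g : riemannian_metric M) (H : cotangent M -> R) Hx Hp u i z r kappa :
  good g H Hx Hp -> subsol H u -> nice g H Hx Hp i z r kappa ->
  (forall A rho eta, 0 < eta -> 0 <= A -> rho <= r / 2 -> exists2 tau : R, 0 < tau & forall t, 0 < t -> t <= tau ->
    (semiconcave (u \o phi_inv i) A z rho -> semiconcave (lax H u t \o phi_inv i) (A + eta) z (rho - eta)) /\
    (semiconvex (u \o phi_inv i) A z rho -> semiconvex (lax H u t \o phi_inv i) (A + eta) z (rho - eta))) /\
  exists2 tau : R, 0 < tau & forall t, 0 < t -> t <= tau ->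
    exists2 A : R, 0 < A & semiconcave (lax H u t \o phi_inv i) A z (r / 4).
Proof.
move=> gH su ni; have [Rv Rv0 hv] := lax_value gH; have [r0 gg cod cmp hl] := ni.
have lv := hv u su i z r kappa 0 1 ni (lexx 0).
have WE t : (fun y => lax H u (0 + t) (phi_inv i y)) = lax H u t \o phi_inv i.
  by apply/funext => y; rewrite add0r.
have W0 : (fun y => lax H u (0 + 0) (phi_inv i y)) = u \o phi_inv i.
  by apply/funext => y; rewrite addr0 /= (@lax0 _ _ _ g H Hx Hp).
have hl2 : hamloc (lh H i) (Hx i) (Hp i) z (r / 2).
  by apply: (hamloc_sub hl); rewrite subrr normr0 add0r; move: r0; clra.
have k0 := gauge_gt0 gg; pose S := kappa * Rv.
have S0 : 0 <= S by rewrite mulr_ge0 // ltW.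
have hS v : tn g i z v <= Rv -> `|v| <= S.
  by move=> h; apply: (le_trans (gauge_lb gg v)); rewrite ler_pM2l.
split; last first.
  have S1 : 0 < 4 * (S + 1) by rewrite mulr_gt0 // ltr_pwDr.
  exists (Num.min 1 (r / (4 * (S + 1)))); first by rewrite lt_min ltr01 divr_gt0.
  move=> t t0; rewrite le_min ler_pdivlMr // => /andP[t1 tr].
  have rS : r / 4 + S * t <= r / 2 by move: tr t0; clra.
  have r4 : 0 <= r / 4 by rewrite divr_ge0 // ltW.
  by have := semiconcave_gain hl2 lv S0 hS t0 t1 r4 rS; rewrite WE.
move=> A rho eta eta0 A0 rr.
have [L1 L10 h1] := semiconcave_keep hl2 lv S0 hS.
have [L2 L20 h2] := semiconvex_keep hl2 lv S0 hS A0.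
have S1 : 0 < 2 * S + 1 by rewrite ltr_pwDr // mulr_ge0.
exists (Num.min 1 (Num.min (eta / (2 * S + 1)) (Num.min (eta / L1) (Num.min (eta / L2) (1 / L2))))).
  by rewrite !lt_min ltr01 !divr_gt0.
move=> t t0; rewrite !le_min !ler_pdivlMr // => /andP[t1 /and4P[tS tL1 tL2 tL2']].
have t00 := ltW t0; have St : 0 <= S * t by rewrite mulr_ge0.
have e1 : L1 * t <= eta by rewrite mulrC.
have e2 : L2 * t <= eta by rewrite mulrC.
have e3 : L2 * t <= 1 by rewrite mulrC.
have e4 : 2 * S * t <= eta by move: tS t0; clra.
have q1 : rho - eta + S * t <= rho by move: e4 St; clra.
have q2 : rho - eta + 2 * S * t <= rho by move: e4; clra.
split=> hu.
  have := h1 (rho - eta) t A t00 t1 (le_trans q1 rr).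
  rewrite W0 WE => h; apply: (semiconcave_mono (h _)) => //; last by rewrite lerD2l.
  exact: (semiconcave_mono hu).
have := h2 (rho - eta) t t00 t1 e3 (le_trans q2 rr).
rewrite W0 WE => h; apply: (semiconvex_mono (h _)) => //; last by rewrite lerD2l.
exact: (semiconvex_mono hu).
Qed.

Lemma half_le (R : realType) (e : R) : 0 < e -> e / 2 <= e.
Proof. by clra. Qed.

Lemma shrink_le (R : realType) (a e r : R) : 0 < e -> a <= r -> a - e / 2 <= r.
Proof. by clra. Qed.

Lemma quarter_le (R : realType) (r : R) : 0 < r -> r / 4 <= r / 2.
Proof. by clra. Qed.

Section Balls.
Variables (R : realType) (n : nat) (M : c2_manifold R n) (g : riemannian_metric M).
Variables (I : nat -> chart M) (Z : nat -> 'rV[R]_n) (Rd Kp : nat -> R).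

Definition reg k (A rho : R) (f : M -> R) : Prop :=
  semiconcave (f \o phi_inv (I k)) A (Z k) rho /\ semiconvex (f \o phi_inv (I k)) A (Z k) rho.

Lemma regN k A rho f : reg k A rho f -> reg k A rho (fun x => - f x).
Proof. by move=> [h1 h2]; split; [exact/semiconcaveN|exact/semiconvexN]. Qed.

Lemma lax_step (H : cotangent M -> R) Hx Hp u m (A rho : nat -> R) eta :
  good g H Hx Hp -> subsol H u -> (forall k, nice g H Hx Hp (I k) (Z k) (Rd k) (Kp k)) ->
  0 < eta -> (forall k, 0 <= A k) -> (forall k, rho k <= Rd k / 2) ->
  exists2 t : R, 0 < t & [/\ forall k, (k < m)%N ->
     (semiconcave (u \o phi_inv (I k)) (A k) (Z k) (rho k) ->
      semiconcave (lax H u t \o phi_inv (I k)) (A k + eta) (Z k) (rho k - eta)) /\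
     (semiconvex (u \o phi_inv (I k)) (A k) (Z k) (rho k) ->
      semiconvex (lax H u t \o phi_inv (I k)) (A k + eta) (Z k) (rho k - eta)),
    forall k, (k < m)%N -> exists2 A' : R, 0 < A' & semiconcave (lax H u t \o phi_inv (I k)) A' (Z k) (Rd k / 4) &
    forall x, `|lax H u t x - u x| <= eta].
Proof.
move=> gH su ni eta0 A0 rr.
have [tau tau0 h1] := uniform_time (fun k => (lax_semi gH su (ni k)).1 (A k) (rho k) eta eta0 (A0 k) (rr k)) m.
have [tau' tau'0 h2] := uniform_time (fun k => (lax_semi gH su (ni k)).2) m.
have st : setting g H Hx Hp u by [].
have [C C0 hC] := lax_le st; have C1 : 0 < C + 1 by rewrite ltr_pwDr.
pose t := Num.min tau (Num.min tau' (eta / (C + 1))).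
have t0 : 0 < t by rewrite !lt_min tau0 tau'0 divr_gt0.
have t1 : t <= tau by rewrite ge_min lexx.
have t2 : t <= tau' by rewrite !ge_min lexx ?orbT.
have t3 : t * (C + 1) <= eta by rewrite -ler_pdivlMr // !ge_min lexx ?orbT.
exists t => //; split=> [k km|k km|x]; [exact: h1|exact: h2|].
have a1 := hC t x (ltW t0); have a2 := lax_ge x st (ltW t0).
rewrite ger0_norm ?subr_ge0 //; move: a1 t3 t0; move: (lax _ _ _ _) (u x) => a b; clra.
Qed.

(** T^- for a time t makes ball m semiconcave with a constant that depends on t. T^+, which appears
    as the [lax] of [rev_ham H] on - v, is run for a time s chosen afterwards: it creates
    semiconvexity and spoils that constant by at most eta / 2. On earlier balls each of the two
    semigroups loses at most eta / 2. *)
Lemma regular_step (G H : cotangent M -> R) Gx Gp Hx Hp u m (A rho : nat -> R) eta :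
  good g G Gx Gp -> good g H Hx Hp -> commute_grad Gx Gp Hx Hp -> riem_complete g ->
  (forall k, nice g H Hx Hp (I k) (Z k) (Rd k) (Kp k)) ->
  (forall k, nice g (rev_ham H) (fun i y p => Hx i y (- p)) (fun i y p => - Hp i y (- p)) (I k) (Z k) (Rd k) (Kp k)) ->
  subsol G u -> subsol H u -> 0 < eta -> (forall k, 0 <= A k) -> (forall k, rho k <= Rd k / 2) ->
  (forall k, (k < m)%N -> reg k (A k) (rho k) u) ->
  exists w : M -> R, [/\ subsol G w, subsol H w, forall x, `|w x - u x| <= eta,
    forall k, (k < m)%N -> reg k (A k + eta) (rho k - eta) w &
    exists2 A' : R, 0 <= A' & reg m A' (Rd m / 4 - eta) w].
Proof.
move=> gG gH cGH cg niH niR sG sH eta0 A0 rr hreg.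
have r0 k : 0 < Rd k by case: (niH k).
have e0 : 0 < eta / 2 by rewrite divr_gt0.
have [t t0 [k1 k2 k3]] := lax_step m.+1 gH sH niH e0 A0 rr.
set v := lax H u t in k1 k2 k3.
have svG : subsol G v by apply: (lax_keep gG gH cGH cg) => //; exact: ltW.
have svH : subsol H v by apply: (lax_keep gH gH (@commute_refl _ _ _ _ _) cg) => //; exact: ltW.
have [A1 A10 hA1] := k2 m (ltnSn m).
(* Data after T^-: the balls k < m have lost eta / 2, and ball m carries the constant just gained on
   the radius Rd m / 4. *)
pose A' k := if (k < m)%N then A k + eta / 2 else A1.
pose rho' k := if (k < m)%N then rho k - eta / 2 else Rd k / 4.
have A'0 k : 0 <= A' k by rewrite /A'; case: ifP => _; [rewrite addr_ge0 // ltW|exact: ltW].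
have rr' k : rho' k <= Rd k / 2.
  by rewrite /rho'; case: ifP => _; [exact: shrink_le eta0 (rr k)|exact: quarter_le].
have gR := good_rev gH; have sRH := subsol_rev gH svH; have sRG := subsol_rev gG svG.
have [s s0 [l1 l2 l3]] := lax_step m.+1 gR sRH niR e0 A'0 rr'.
set w' := lax (rev_ham H) (fun x => - v x) s in l1 l2 l3.
have swG : subsol (rev_ham G) w'.
  by apply: (lax_keep (good_rev gG) gR (commute_rev cGH) cg) => //; exact: ltW.
have swH : subsol (rev_ham H) w'.
  by apply: (lax_keep gR gR (@commute_refl _ _ _ _ _) cg) => //; exact: ltW.
exists (fun x => - w' x); split.
- by have := subsol_rev (good_rev gG) swG; rewrite rev_hamK.
- by have := subsol_rev gR swH; rewrite rev_hamK.
- move=> x; have a1 := k3 x; have a2 := l3 x.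
  have -> : - w' x - u x = - (w' x - - v x) + (v x - u x) by ring.
  apply: (le_trans (ler_normD _ _)); rewrite normrN.
  by apply: (le_trans (lerD a2 a1)); rewrite -splitr.
- move=> k km; have [c1 c2] := hreg k km; have [b1 b2] := k1 k (ltnW km : (k < m.+1)%N).
  have [d1 d2] := l1 k (ltnW km : (k < m.+1)%N).
  have E1 : A' k = A k + eta / 2 by rewrite /A' km.
  have E2 : rho' k = rho k - eta / 2 by rewrite /rho' km.
  rewrite E1 E2 in d1 d2.
  have EA : A k + eta / 2 + eta / 2 = A k + eta by rewrite -addrA -splitr.
  have ER : rho k - eta / 2 - eta / 2 = rho k - eta by rewrite -addrA -opprD -splitr.
  rewrite EA ER in d1 d2.
  apply: regN; split; [apply: d1; exact/semiconcaveN/b2|apply: d2; exact/semiconvexN/b1].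
- have [_ d2] := l1 m (ltnSn m); have [A2 A20 g2] := l2 m (ltnSn m).
  have E1 : A' m = A1 by rewrite /A' ltnn.
  have E2 : rho' m = Rd m / 4 by rewrite /rho' ltnn.
  rewrite E1 E2 in d2.
  have {}d2 := d2 ((semiconvexN _ _ _ _).2 hA1).
  have rm1 : Rd m / 4 - eta <= Rd m / 4 by rewrite gerBl ltW.
  have rm2 : Rd m / 4 - eta <= Rd m / 4 - eta / 2 by rewrite lerD2l lerN2 half_le.
  exists (A1 + eta / 2 + A2); first by rewrite !addr_ge0 // ltW.
  apply: regN; split.
    by apply: (semiconcave_mono g2) => //; rewrite lerDr addr_ge0 // ltW.
  by apply: (semiconvex_mono d2) => //; rewrite lerDl ltW.
Qed.

End Balls.

(** * Second differences and C^{1,1} regularity *)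

Lemma halves_small (R : realType) (K e : R) : 0 < e -> exists k0, forall k, (k0 <= k)%N -> K * 2^-1 ^+ k <= e.
Proof.
move=> e0; exists (Num.truncn (`|K| / e)).+1 => k hk.
have h1 := truncnS_gt (`|K| / e); rewrite ltr_pdivrMr // in h1.
have p2 : 0 < 2 ^+ k :> R by exact: exprn_gt0.
rewrite exprVn ler_pdivrMr //; apply: (le_trans (ler_norm K)); apply: (le_trans (ltW h1)).
rewrite mulrC ler_pM2l // -natrX ler_nat; apply: (leq_trans hk); apply: ltnW; exact: ltn_expl.
Qed.

Lemma halves_le (R : realType) (x y K : R) k0 :
  (forall k, (k0 <= k)%N -> x <= y + K * 2^-1 ^+ k) -> x <= y.
Proof.
move=> h; apply: eps_le => e e0; have [k1 h1] := halves_small K e0.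
have := h (maxn k0 k1) (leq_maxl _ _); have := h1 (maxn k0 k1) (leq_maxr _ _); clra.
Qed.

(** For the error E of homogeneity at t >= 0, additivity gives m E = D (q h) - q D h with q the
    fractional part of m t. This stays bounded as m grows, which forces E = 0. *)
Lemma additive_scale (R : realType) (n : nat) (D : 'rV[R]_n -> R) (K : R) : (forall h h', D (h + h') = D h + D h') ->
  (forall h, `|D h| <= K * `|h|) -> forall (t : R) (h : 'rV[R]_n), D (t *: h) = t * D h.
Proof.
move=> DD DK.
have D0 : D 0 = 0 by have := DD 0 0; rewrite addr0; clra.
have Dn h m : D (m%:R *: h) = m%:R * D h.
  elim: m => [|m IH]; first by rewrite scale0r mul0r.
  by rewrite -natr1 scalerDl scale1r DD IH mulrDl mul1r.
have pos t h : 0 <= t -> D (t *: h) = t * D h.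
  move=> t0; pose E := D (t *: h) - t * D h.
  suff : `|E| <= 0 by rewrite normr_le0 subr_eq0 => /eqP.
  have key m : m%:R * `|E| <= K * `|h| + `|D h|.
    have mt : 0 <= m%:R * t by rewrite mulr_ge0.
    pose q := m%:R * t - (Num.truncn (m%:R * t))%:R.
    have q0 : 0 <= q by rewrite subr_ge0 truncn_le.
    have q1 : q <= 1 by have := truncnS_gt (m%:R * t); rewrite -natr1 /q; clra.
    have EE : m%:R * E = D (q *: h) - q * D h.
      have : D (m%:R *: (t *: h)) = D ((Num.truncn (m%:R * t))%:R *: h + q *: h).
        by congr D; rewrite -scalerDl scalerA addrC subrK.
      by rewrite DD !Dn /E /q; clra.
    rewrite -[m%:R]ger0_norm // -normrM EE; apply: (le_trans (ler_normB _ _)).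
    apply: lerD; last by rewrite normrM (ger0_norm q0) ler_piMl.
    apply: (le_trans (DK _)); rewrite normrZ (ger0_norm q0).
    have K0 : 0 <= K * `|h| by exact: le_trans (DK h).
    by rewrite mulrCA ler_piMl.
  rewrite leNgt; apply/negP => E0.
  have := truncnS_gt ((K * `|h| + `|D h|) / `|E|); rewrite ltr_pdivrMr // => lt.
  by have := lt_le_trans lt (key _); rewrite ltxx.
move=> t h; have [t0|t0] := leP 0 t; first exact: pos.
have := pos (- t) h; rewrite oppr_ge0 (ltW t0) => /(_ isT) E.
have := DD (t *: h) (- t *: h); rewrite -scalerDl subrr scale0r D0 E; clra.
Qed.

Lemma additive_pairing (R : realType) (n : nat) (D : 'rV[R]_n -> R) (K : R) : (forall h h', D (h + h') = D h + D h') ->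
  (forall h, `|D h| <= K * `|h|) -> exists p : 'rV[R]_n, forall h, D h = pairing p h.
Proof.
move=> DD DK; exists (\row_j D (delta_mx 0 j)) => h.
have D0 : D 0 = 0 by have := DD 0 0; rewrite addr0; clra.
rewrite {1}(row_sum_delta h) (big_morph D DD D0) /pairing; apply: eq_bigr => j _.
by rewrite (additive_scale DD DK) mxE mulrC.
Qed.

(** Successive dyadic difference quotients in the direction h differ by a second difference, so they
    converge geometrically to D h. The second difference centred at the midpoint of y + s h1 and y +
    s h2 makes D additive, hence linear thanks to the Lipschitz bound. *)
Lemma quad_expansion (R : realType) (n : nat) (f : 'rV[R]_n -> R) (z : 'rV[R]_n) (r A L : R) : 0 < r -> 0 <= A -> 0 <= L ->
  (forall x h, `|x - z| + `|h| <= r -> `|sd f x h| <= A * `|h| ^+ 2) ->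
  (forall y y', `|y - z| <= r -> `|y' - z| <= r -> `|f y' - f y| <= L * `|y' - y|) ->
  forall y, `|y - z| <= r / 2 -> exists p : 'rV[R]_n, (forall h, `|pairing p h| <= L * `|h|) /\
    forall h, `|h| <= r / 2 -> `|f (y + h) - f y - pairing p h| <= A * `|h| ^+ 2.
Proof.
move=> r0 A0 L0 hsd hlip y yz.
pose s k : R := 2^-1 ^+ k.
have s0 k : 0 < s k by rewrite exprn_gt0.
have sS k : s k.+1 = s k / 2 by rewrite /s exprSr.
have sle k m : (k <= m)%N -> s m <= s k.
  by move=> km; rewrite /s ler_wiXn2l // invf_le1 ?ler1n.
have r20 : 0 < r / 2 by rewrite divr_gt0.
have start (h : 'rV[R]_n) : exists k0, (`|h| <= r / 2 -> k0 = 0%N) /\ forall k, (k0 <= k)%N -> s k * `|h| <= r / 2.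
  have [hr|hr] := leP `|h| (r / 2).
    exists 0%N; split=> // k _; apply: le_trans hr; rewrite ler_piMl //.
    by have := sle 0%N k (leq0n k); rewrite /s expr0.
  have [k0 hk] := halves_small `|h| r20.
  by exists k0; split=> // k /hk; rewrite mulrC.
(* k0 = 0 for |h| <= r / 2: the estimate then holds at the full scale s 0 = 1, which is the
   conclusion. Larger h only serve to define D everywhere. *)
pose der (h : 'rV[R]_n) (d : R) := exists k0, (`|h| <= r / 2 -> k0 = 0%N) /\ forall k, (k0 <= k)%N ->
  s k * `|h| <= r / 2 /\ `|f (y + s k *: h) - f y - s k * d| <= A * (s k * `|h|) ^+ 2.
have exd (h : 'rV[R]_n) : exists d, der h d.
  have [k0 [hk0 hk]] := start h.
  pose a j := (s (k0 + j)%N)^-1 * (f (y + s (k0 + j)%N *: h) - f y).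
  have [j|d hd] := @geometric_limit R a (A * `|h| ^+ 2 * s k0 / 2).
    have sh := hk (k0 + j)%N (leq_addr _ _).
    rewrite /a addnS sS; set sg := s (k0 + j)%N in sh *.
    have sg0 : 0 < sg by exact: s0.
    (* Halving the scale changes the quotient by a second difference centred halfway along the
       step. *)
    have E : (sg / 2)^-1 * (f (y + (sg / 2) *: h) - f y) - sg^-1 * (f (y + sg *: h) - f y) =
      - (sg^-1 * sd f (y + (sg / 2) *: h) ((sg / 2) *: h)).
      have u1 : y + (sg / 2) *: h + (sg / 2) *: h = y + sg *: h by apply/rowP => l; rewrite !mxE; field.
      by rewrite /sd u1 addrK; field; exact: lt0r_neq0.
    rewrite E normrN normrM normfV (gtr0_norm sg0).
    have dom : `|y + (sg / 2) *: h - z| + `|(sg / 2) *: h| <= r.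
      rewrite addrAC; have := ler_normD (y - z) ((sg / 2) *: h); rewrite normrZ gtr0_norm ?divr_gt0 //.
      by move: yz sh; clra.
    have := ler_wpM2l (ltW (_ : 0 < sg^-1)) (hsd _ _ dom); rewrite invr_gt0 => /(_ sg0) h1.
    apply: (le_trans h1); rewrite normrZ gtr0_norm ?divr_gt0 //; apply: le_of_eq.
    have -> : sg = s k0 / 2 ^+ j by rewrite /sg /s exprD [2^-1 ^+ j]exprVn.
    rewrite [2 ^+ j.+1]exprS; have := s0 k0; have : 0 < 2 ^+ j :> R by exact: exprn_gt0.
    move: (s k0) (2 ^+ j) => b' a' a0' b0'; field.
    by rewrite !gt_eqF.
  exists d, k0; split=> // k k0k; split; first exact: hk.
  have := hd (k - k0)%N; rewrite /a subnKC //.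
  have -> : 2 * (A * `|h| ^+ 2 * s k0 / 2) / 2 ^+ (k - k0) = A * `|h| ^+ 2 * s k.
    rewrite -{2}(subnKC k0k) /s exprD [2^-1 ^+ (k - k0)]exprVn.
    have : 0 < 2 ^+ (k - k0) :> R by exact: exprn_gt0.
    by move: (2 ^+ (k - k0)) => b b0; field; rewrite gt_eqF.
  move=> h1; have sk := s0 k.
  have -> : f (y + s k *: h) - f y - s k * d = - (s k * (d - (s k)^-1 * (f (y + s k *: h) - f y))).
    by field; rewrite gt_eqF.
  rewrite normrN normrM (gtr0_norm sk); apply: (le_trans (ler_wpM2l (ltW sk) h1)).
  by apply: le_of_eq; ring.
have [D hD] := choice exd.
have ev (h : 'rV[R]_n) : exists k0, forall k, (k0 <= k)%N ->
    s k * `|h| <= r / 2 /\ `|f (y + s k *: h) - f y - s k * D h| <= A * (s k * `|h|) ^+ 2.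
  by have [k0 [_ hk]] := hD h; exists k0.
have DD h1 h2 : D (h1 + h2) = D h1 + D h2.
  have [k1 e1] := ev h1; have [k2 e2] := ev h2; have [k3 e3] := ev (h1 + h2).
  suff : `|D h1 + D h2 - D (h1 + h2)| <= 0 by rewrite normr_le0 subr_eq0 => /eqP.
  apply: (@halves_le _ _ _ (A * (`|h1| ^+ 2 + `|h2| ^+ 2 + `|h1 + h2| ^+ 2 + `|h1 - h2| ^+ 2)) (maxn k1 (maxn k2 k3)).+1).
  case=> // k; rewrite ltnS !geq_max => /and3P[k1k k2k k3'k].
  have [b1' _] := e1 k k1k; have [b2' _] := e2 k k2k; have k3k := leqW k3'k.
  have [_ c1] := e1 k.+1 (leqW k1k); have [_ c2] := e2 k.+1 (leqW k2k).
  have b1 : s k.+1 * `|h1| <= r / 4 by rewrite sS; move: b1'; clra.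
  have b2 : s k.+1 * `|h2| <= r / 4 by rewrite sS; move: b2'; clra.
  move: (k.+1) b1 b2 c1 c2 k3k => {b1' b2' k1k k2k k3'k} {}k b1 b2 c1 c2 k3k.
  have [b3 c3] := e3 k.+1 (leqW k3k); rewrite sS in b3 c3.
  rewrite add0r -/(s k); have sk := s0 k; set sg := s k in b1 b2 b3 c1 c2 c3 sk *.
  have E : sd f (y + (sg / 2) *: (h1 + h2)) ((sg / 2) *: (h1 - h2)) =
      f (y + sg *: h1) + f (y + sg *: h2) - 2 * f (y + (sg / 2) *: (h1 + h2)).
    have u1 : y + (sg / 2) *: (h1 + h2) + (sg / 2) *: (h1 - h2) = y + sg *: h1.
      by apply/rowP => l; rewrite !mxE; field.
    have u2 : y + (sg / 2) *: (h1 + h2) - (sg / 2) *: (h1 - h2) = y + sg *: h2.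
      by apply/rowP => l; rewrite !mxE; field.
    by rewrite /sd u1 u2.
  have n2 : `|(sg / 2) *: (h1 - h2)| = sg / 2 * `|h1 - h2| by rewrite normrZ gtr0_norm // divr_gt0.
  have dom : `|y + (sg / 2) *: (h1 + h2) - z| + `|(sg / 2) *: (h1 - h2)| <= r.
    have -> : y + (sg / 2) *: (h1 + h2) - z = (y - z) + (2^-1 *: (sg *: h1) + 2^-1 *: (sg *: h2)).
      by apply/rowP => l; rewrite !mxE; field.
    have t1 := ler_normD (y - z) (2^-1 *: (sg *: h1) + 2^-1 *: (sg *: h2)).
    have t2 := ler_normD (2^-1 *: (sg *: h1)) (2^-1 *: (sg *: h2)).
    have i2 : `|2^-1 : R| = 2^-1 by rewrite gtr0_norm // invr_gt0.
    rewrite !(normrZ 2^-1) !(normrZ sg) i2 (gtr0_norm sk) in t2.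
    have t3 := ler_wpM2l (ltW sk) (ler_normB h1 h2); rewrite n2.
    by move: t1 t2 t3 b1 b2 yz; clra.
  have c4 := hsd _ _ dom; rewrite E n2 in c4.
  rewrite -(ler_pM2l sk) -{1}(gtr0_norm sk) -normrM.
  move: c1 c2 c3 c4; set f1 := f (y + sg *: h1); set f2 := f (y + sg *: h2); set f3 := f (y + (sg / 2) *: (h1 + h2)) => c1 c2 c3 c4.
  have -> : sg * (D h1 + D h2 - D (h1 + h2)) =
    - (f1 - f y - sg * D h1) - (f2 - f y - sg * D h2) + 2 * (f3 - f y - sg / 2 * D (h1 + h2)) + (f1 + f2 - 2 * f3).
    by field.
  apply: (le_trans (ler_normD _ _)); apply: (le_trans (lerD (ler_normD _ _) (lexx _))).
  apply: (le_trans (lerD (lerD (ler_normB _ _) (lexx _)) (lexx _))).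
  rewrite normrN normrM [`|2|]ger0_norm //.
  have pA (q : R) : 0 <= A * (sg ^+ 2 * q ^+ 2) by rewrite mulr_ge0 // mulr_ge0 // sqr_ge0.
  have := pA `|h1 + h2|; have := pA `|h1 - h2|; have := pA `|h1|; have := pA `|h2|.
  have E1 (q : R) : A * (sg * q) ^+ 2 = A * (sg ^+ 2 * q ^+ 2) by ring.
  have E2 (q : R) : A * (sg / 2 * q) ^+ 2 = A * (sg ^+ 2 * q ^+ 2) / 4 by field.
  rewrite !E1 in c1 c2; rewrite E2 in c3; rewrite E2 in c4.
  have -> : sg * (A * (`|h1| ^+ 2 + `|h2| ^+ 2 + `|h1 + h2| ^+ 2 + `|h1 - h2| ^+ 2) * sg) =
    A * (sg ^+ 2 * `|h1| ^+ 2) + A * (sg ^+ 2 * `|h2| ^+ 2) + A * (sg ^+ 2 * `|h1 + h2| ^+ 2) + A * (sg ^+ 2 * `|h1 - h2| ^+ 2) by ring.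
  by move: c1 c2 c3 c4; clra.
have DL h : `|D h| <= L * `|h|.
  have [k0 e] := ev h; apply: (@halves_le _ _ _ (A * `|h| ^+ 2) k0) => k /e[b c].
  rewrite -/(s k); have sk := s0 k; set sg := s k in b c sk *.
  have yr : `|y - z| <= r by move: yz r0; clra.
  have yh : `|y + sg *: h - z| <= r.
    rewrite addrAC; have := ler_normD (y - z) (sg *: h); rewrite normrZ gtr0_norm //.
    by move: yz b; clra.
  have := hlip _ _ yr yh; rewrite addrAC subrr add0r normrZ gtr0_norm // => l.
  rewrite -(ler_pM2l sk) -{1}(gtr0_norm sk) -normrM.
  have -> : sg * D h = (f (y + sg *: h) - f y) - (f (y + sg *: h) - f y - sg * D h) by ring.
  apply: (le_trans (ler_normB _ _)); apply: (le_trans (lerD l c)); apply: le_of_eq; ring.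
have [p hp] := additive_pairing DD DL.
exists p; split=> [h|h hr]; first by rewrite -hp.
have [k0 [hk0 hk]] := hD h; have := hk 0%N; rewrite hk0 // => /(_ isT)[_].
by rewrite /s expr0 scale1r !mul1r hp.
Qed.

(** The expansions at y1 and y2 are compared at a third point y1 + u, with |u| <= |y1 - y2| in a
    direction that norms P y1 - P y2. The errors at distances 2, 1 and 1 times |y1 - y2| add up to 4
    + 1 + 1 = 6. *)
Lemma expansion_C11 (R : realType) (n : nat) (f : 'rV[R]_n -> R) (z : 'rV[R]_n) (r C : R) : 0 < r -> 0 <= C ->
  (forall y, `|y - z| <= r -> exists p, forall y', `|y' - z| <= r ->
    `|f y' - f y - pairing p (y' - y)| <= C * `|y' - y| ^+ 2) ->
  exists2 V : set 'rV[R]_n, nbhs z V &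
    (forall y, V y -> differentiable (f : 'rV[R]_n -> R^o) y) /\
    exists k : R, k.-lipschitz_V (fun y => \row_j ('d (f : 'rV[R]_n -> R^o) y (delta_mx 0 j) : R)).
Proof.
move=> r0 C0 h; exists [set y | `|y - z| < r / 4].
  apply/nbhs_ballP; exists (r / 4) => /=; first by rewrite divr_gt0.
  by move=> y; rewrite -ball_normE /= distrC.
have exP (y : 'rV[R]_n) : exists p, `|y - z| <= r -> forall y', `|y' - z| <= r ->
    `|f y' - f y - pairing p (y' - y)| <= C * `|y' - y| ^+ 2.
  by have [/h[p hp]|ny] := pselect (`|y - z| <= r); [exists p|exists 0].
have [P hP] := choice exP.
have dP (y : 'rV[R]_n) : `|y - z| < r / 4 ->
    differentiable (f : 'rV[R]_n -> R^o) y /\ forall v, 'd (f : 'rV[R]_n -> R^o) y v = pairing (P y) v.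
  move=> yz; have yr : `|y - z| <= r by move: yz r0; clra.
  pose l (v : 'rV[R]_n) : R^o := pairing (P y) v.
  have lin : linear l by move=> a u v; rewrite /l pairingDr pairingZr.
  pose L : {linear 'rV[R]_n -> R^o} := HB.pack l (GRing.isLinear.Build R 'rV[R]_n R^o *:%R l lin).
  have cL : continuous L.
    apply: (@lip_continuous R 'rV[R]_n R^o L (n%:R * `|P y|)) => u v.
    by rewrite /= /l -pairingBr; exact: pairing_le.
  have [e e0|d1 d2] := @eps_diff R 'rV[R]_n R^o f L y cL; last by split=> // v; rewrite d2.
  have C1 : 0 < C + 1 by rewrite ltr_pwDr.
  exists (Num.min (r / 2) (e / (C + 1))); first by rewrite lt_min !divr_gt0.
  move=> y'; rewrite lt_min => /andP[y1]; rewrite ltr_pdivlMr // => y2.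
  have y'r : `|y' - z| <= r.
    by have := ler_distD y y' z; move: yz y1 r0; clra.
  have q0 := normr_ge0 (y' - y).
  have b1 := le_trans (hP y yr y' y'r) (sq_le_lin C0 q0 (lexx _)).
  have b2 : C * `|y' - y| <= `|y' - y| * (C + 1) by rewrite mulrC; apply: ler_wpM2l => //; rewrite lerDl.
  exact: (le_trans b1 (ler_wpM2r q0 (le_trans b2 (ltW y2)))).
split=> [y /= /dP[]|] //; exists (6 * C) => -[y1 y2] /= [v1 v2].
have gE (y : 'rV[R]_n) : `|y - z| < r / 4 -> \row_j ('d (f : 'rV[R]_n -> R^o) y (delta_mx 0 j) : R) = P y.
  by move=> yz; apply/rowP => j; rewrite mxE (dP y yz).2 pairing_delta.
apply: (le_trans (le_of_eq (congr1 (fun a : 'rV[R]_n => `|a|) (congr2 (fun a b : 'rV[R]_n => a - b) (gE y1 v1) (gE y2 v2))))).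
have [->|ne] := eqVneq y1 y2; first by rewrite !subrr normr0 mulr0.
have q0 : 0 < `|y1 - y2| by rewrite normr_gt0 subr_eq0.
have [w [w1 hw]] := dual_sup (P y1 - P y2).
have y1r : `|y1 - z| <= r by move: v1 r0; clra.
have y2r : `|y2 - z| <= r by move: v2 r0; clra.
have qr : `|y1 - y2| <= r / 2.
  by have := ler_distD z y1 y2; rewrite [`|z - _|]distrC; move: v1 v2; clra.
pose u := `|y1 - y2| *: w.
have nu : `|u| <= `|y1 - y2| by rewrite normrZ normr_id ler_piMr.
have y3r : `|y1 + u - z| <= r.
  by rewrite addrAC; have := ler_normD (y1 - z) u; move: v1 nu qr r0; clra.
have h1 := hP y2 y2r _ y3r; have h2 := hP y1 y1r _ y3r; have h3 := hP y2 y2r _ y1r.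
have E1 : y1 + u - y1 = u by rewrite addrAC subrr add0r.
have E2 : y1 + u - y2 = (y1 - y2) + u by rewrite addrAC.
rewrite E1 in h2; rewrite E2 in h1.
have key : `|y1 - y2| * `|P y1 - P y2| <= 6 * C * `|y1 - y2| ^+ 2.
  rewrite -hw -pairingZl -/u pairingC.
  have -> : pairing (P y1 - P y2) u = (f (y1 + u) - f y2 - pairing (P y2) ((y1 - y2) + u)) -
      (f (y1 + u) - f y1 - pairing (P y1) u) - (f y1 - f y2 - pairing (P y2) (y1 - y2)).
    by rewrite pairingBl pairingDr; ring.
  apply: (le_trans (ler_norm _)); apply: (le_trans (ler_normB _ _)).
  apply: (le_trans (lerD (ler_normB _ _) (lexx _))).
  have sq (a : 'rV[R]_n) c : `|a| <= c * `|y1 - y2| -> C * `|a| ^+ 2 <= C * (c ^+ 2 * `|y1 - y2| ^+ 2).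
    move=> h'; rewrite -exprMn ler_wpM2l // lerXn2r ?nnegrE //; exact: le_trans h'.
  have a1 : `|y1 - y2 + u| <= 2 * `|y1 - y2| by have := ler_normD (y1 - y2) u; move: nu; clra.
  have a2 : `|u| <= 1 * `|y1 - y2| by rewrite mul1r.
  have s1 := le_trans h1 (sq _ _ a1); have s2 := le_trans h2 (sq _ _ a2).
  by move: s1 s2 h3; move: (`|_ - _ - _|) (`|_ - _ - _|) (`|_ - _ - _|) => x1 x2 x3; rewrite expr1n; clra.
by move: key; rewrite expr2 mulrA [X in X <= _ -> _]mulrC ler_pM2r.
Qed.

(** Regularity is known in a chart j and wanted in every chart i. A first-order expansion with
    quadratic error, unlike a bound on second differences, composes directly with a C^2 transition,
    whose curvature only costs L Ct. *)
Lemma reg_C11 (R : realType) (n : nat) (M : c2_manifold R n) (u : M -> R) : loclip u ->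
  (forall x, exists j z (rho A : R), [/\ dom j x, `|phi j x - z| < rho, 0 <= A,
     semiconcave (u \o phi_inv j) A z rho & semiconvex (u \o phi_inv j) A z rho]) -> C11 u.
Proof.
move=> lu hreg i y cy; pose x := phi_inv i y.
have di : dom i x := dom_phi_inv cy; have yE : phi i x = y := phi_phi_inv cy.
have [j [z [rho [A [dj xz A0 hc hv]]]]] := hreg x.
pose z' := phi j x.
have [rL [L0 [rL0 hL]]] := lu j z' (codom_phi dj).
pose L := `|L0|; have L_0 : 0 <= L by exact: normr_ge0.
have [r1 r10 [Ct Ct0 hT]] := trans_bounds di dj; rewrite yE in hT.
pose f := u \o phi_inv j.
pose r := Num.min (rho - `|z' - z|) rL.
have r0 : 0 < r by rewrite lt_min subr_gt0 xz.
have rr1 : r <= rho - `|z' - z| by rewrite ge_min lexx.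
have rr2 : r <= rL by rewrite ge_min lexx orbT.
have hsd (x0 h : 'rV[R]_n) : `|x0 - z'| + `|h| <= r -> `|sd f x0 h| <= A * `|h| ^+ 2.
  move=> xh; have xh' : `|x0 - z| + `|h| <= rho.
    by have := ler_distD z' x0 z; move: xh rr1; clra.
  by rewrite ler_norml hv // hc.
have hlip (a b : 'rV[R]_n) : `|a - z'| <= r -> `|b - z'| <= r -> `|f b - f a| <= L * `|b - a|.
  move=> ar br; apply: (le_trans (hL a b (le_trans ar rr2) (le_trans br rr2))).
  by rewrite ler_wpM2r // ler_norm.
have hq := quad_expansion r0 A0 L_0 hsd hlip.
pose r2 := Num.min r1 (r / (8 * Ct)).
have r20 : 0 < r2 by rewrite lt_min r10 divr_gt0 // mulr_gt0.
have r21 : r2 <= r1 by rewrite ge_min lexx.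
have r22 : Ct * r2 <= r / 8.
  have : r2 <= r / (8 * Ct) by rewrite ge_min lexx orbT.
  by rewrite ler_pdivlMr ?mulr_gt0 //; clra.
have trc : trans i j y = z' by rewrite /trans -/x.
apply: (@expansion_C11 R n (u \o phi_inv i) y r2 (A * Ct ^+ 2 + L * Ct)) => //.
  by rewrite addr_ge0 ?mulr_ge0 ?sqr_ge0 // ltW.
move=> y1 y1r.
have b1 : `|y1 - y| <= r1 := le_trans y1r r21.
have b0 : `|y - y| <= r1 by rewrite subrr normr0 ltW.
have inb (a : 'rV[R]_n) : `|a - y| <= r2 -> `|trans i j a - z'| <= r / 8.
  move=> ar; have [_ _ t _ _] := hT y a 0 b0 (le_trans ar r21).
  rewrite trc in t; apply: (le_trans t); apply: le_trans r22; by rewrite ler_pM2l.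
have c1 := inb y1 y1r.
have c1' : `|trans i j y1 - z'| <= r / 2 by move: c1 r0; clra.
have [p [pL hp]] := hq _ c1'.
exists (p *m (jac i j y1)^T) => y2 y2r; have c2 := inb y2 y2r.
have b2 := le_trans y2r r21.
have [ov t1 t2 _ _] := hT y1 y2 0 b1 b2; have [ov2 _ _ _ _] := hT y2 y1 0 b2 b1.
have fE a : overlap i j a -> (u \o phi_inv i) a = f (trans i j a).
  by move=> [x' [dx dx'] <-]; rewrite /f /trans /= (phi_invK dx) (phi_invK dx').
rewrite (fE y1 ov) (fE y2 ov2) pairing_mulmx.
have hh : `|trans i j y2 - trans i j y1| <= r / 2.
  by have := ler_distD z' (trans i j y2) (trans i j y1); rewrite [`|z' - _|]distrC; move: c1 c2 r0; clra.
have q1 := hp _ hh; rewrite [trans i j y1 + _]addrC subrK in q1.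
have q2 := pL (trans i j y2 - trans i j y1 - (y2 - y1) *m jac i j y1).
have -> : f (trans i j y2) - f (trans i j y1) - pairing p ((y2 - y1) *m jac i j y1) =
   (f (trans i j y2) - f (trans i j y1) - pairing p (trans i j y2 - trans i j y1)) +
   pairing p (trans i j y2 - trans i j y1 - (y2 - y1) *m jac i j y1).
  by rewrite (pairingBr p (trans i j y2 - trans i j y1)); ring.
apply: (le_trans (ler_normD _ _)); rewrite mulrDl; apply: lerD.
  apply: (le_trans q1); rewrite -mulrA -exprMn ler_wpM2l // lerXn2r ?nnegrE // mulr_ge0 //; exact: ltW.
by apply: (le_trans q2); rewrite -mulrA ler_wpM2l.
Qed.

Lemma loclip_on_segment (R : realType) (n : nat) (M : c2_manifold R n) (u : M -> R) i (y v : 'rV[R]_n) (t : R) : loclip u -> 0 <= t ->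
  (forall s, 0 <= s -> s <= t -> chart_cod i (y + s *: v)) ->
  exists L : R, forall s s', 0 <= s -> s <= t -> 0 <= s' -> s' <= t ->
    `|u (phi_inv i (y + s' *: v)) - u (phi_inv i (y + s *: v))| <= L * `|s' - s|.
Proof.
move=> lu t0 cod; pose f s := u (phi_inv i (y + s *: v)).
suff [L hL] : exists L : R, forall s s', 0 <= s -> s <= s' -> s' <= t -> `|f s' - f s| <= L * (s' - s).
  exists L => s s' s0 st s'0 s't; have [ss|ss] := leP s s'.
    by rewrite (ger0_norm (_ : 0 <= s' - s)) ?subr_ge0 //; exact: hL.
  rewrite distrC [`|s' - s|]distrC (ger0_norm (_ : 0 <= s - s')) ?subr_ge0 ?(ltW ss) //.
  by apply: hL => //; exact: ltW.
pose P a b := exists L : R, forall s s', a <= s -> s <= s' -> s' <= b -> `|f s' - f s| <= L * (s' - s).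
have : P 0 t; last by [].
apply: itv_glue t0 => [a b c _ ab bc _ [L1 h1] [L2 h2]|s0 /andP[s00 s0t]].
  exists (Num.max L1 L2) => s s' as_ ss sc.
  have m1 : L1 <= Num.max L1 L2 by rewrite le_max lexx.
  have m2 : L2 <= Num.max L1 L2 by rewrite le_max lexx orbT.
  have sle x y' L : L <= Num.max L1 L2 -> x <= y' -> L * (y' - x) <= Num.max L1 L2 * (y' - x).
    by move=> hL xy; rewrite ler_wpM2r // subr_ge0.
  case/orP: (le_total s' b) => h; first exact: le_trans (h1 s s' as_ ss h) (sle _ _ _ m1 ss).
  case/orP: (le_total b s) => h'; first exact: le_trans (h2 s s' h' ss sc) (sle _ _ _ m2 ss).
  have a1 := le_trans (h1 s b as_ h' (lexx b)) (sle _ _ _ m1 h').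
  have a2 := le_trans (h2 b s' (lexx b) h sc) (sle _ _ _ m2 h).
  have := ler_distD (f b) (f s') (f s); move: a1 a2; clra.
have [r [L [r0 hL]]] := lu i _ (cod s0 s00 s0t).
have v1 : 0 < `|v| + 1 by rewrite ltr_pwDr.
exists (r / (`|v| + 1)) => [|s1 s2 s10 s1s s0s2 s2t d1 d2]; first by rewrite divr_gt0.
have near q : s1 <= q -> q <= s2 -> `|y + q *: v - (y + s0 *: v)| <= r.
  move=> q1 q2; have -> : y + q *: v - (y + s0 *: v) = (q - s0) *: v.
    by apply/rowP => l; rewrite !mxE; ring.
  have dq : `|q - s0| < r / (`|v| + 1) by rewrite ltr_norml; move: q1 q2 d1 d2; clra.
  rewrite normrZ; rewrite ltr_pdivlMr // in dq; apply: le_trans (ltW dq).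
  by rewrite ler_wpM2l // lerDl.
exists (`|L| * `|v|) => s s' a1 a2 a3.
apply: (le_trans (hL _ _ (near s a1 (le_trans a2 a3)) (near s' (le_trans a1 a2) a3))).
have -> : y + s' *: v - (y + s *: v) = (s' - s) *: v by apply/rowP => l; rewrite !mxE; ring.
rewrite normrZ (ger0_norm (_ : 0 <= s' - s)) ?subr_ge0 // -mulrA [`|v| * _]mulrC.
by rewrite ler_wpM2r ?ler_norm // mulr_ge0 // subr_ge0.
Qed.

Lemma subsol_segment (R : realType) (n : nat) (M : c2_manifold R n) (g : riemannian_metric M) (H : cotangent M -> R) Hx Hp i z r kappa (V : R) :
  nice g H Hx Hp i z r kappa -> 0 <= V -> exists2 C : R, 0 < C & forall u y v t, subsol H u ->
  0 <= t -> `|v| <= V -> (forall s, 0 <= s -> s <= t -> `|y + s *: v - z| <= r) ->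
  u (phi_inv i (y + t *: v)) - u (phi_inv i y) <= t * lag (lh H i) y v + C * t ^+ 2.
Proof.
move=> [r0 gg cod cmp hl] V0; have [C C0 hC] := dini_segment hl V0; exists C => // u y v t [lu du] t0 vV seg.
have [L hL] := loclip_on_segment lu t0 (fun s s0 st => cod _ (seg s s0 st)).
apply: (hC (fun y => u (phi_inv i y)) y v t L t0 vV seg hL) => s e s0 st e0.
have [rho rho0 hr] := du i _ (cod _ (seg s s0 (ltW st))) v e e0.
by exists rho => // h h0 hh; rewrite scalerDl addrA; exact: hr.
Qed.

(** The Dini inequality itself does not pass to limits, but its integrated form on chart segments
    does, because the constant of [subsol_segment] is the same for all subsolutions. *)
Lemma subsol_limit (R : realType) (n : nat) (M : c2_manifold R n) (g : riemannian_metric M) (H : cotangent M -> R) Hx Hp (u : M -> R) :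
  good g H Hx Hp -> (forall e : R, 0 < e -> exists2 w, subsol H w & forall x, `|u x - w x| <= e) ->
  subsol H u.
Proof.
move=> gH hu.
have lim (x y : M) c : (forall w, subsol H w -> w x - w y <= c) -> u x - u y <= c.
  move=> h; apply: eps_le => e e0; have e2 : 0 < e / 2 by rewrite divr_gt0.
  have [w sw hw] := hu _ e2; have := h w sw; have := hw x; have := hw y.
  by rewrite !ler_norml => /andP[a1 a2] /andP[a3 a4]; move: a1 a2 a3 a4; clra.
split.
  move=> i z cz; have [r [kappa ni]] := good_loc gH cz; have [r0 gg cod cmp hl] := ni.
  have [C C0 hC] := subsol_segment ni (ler01 : (0 : R) <= 1).
  have k0 := gauge_gt0 gg; have [B B0 hB] := lag_upper kappa gH.
  pose K := B + C * (2 * r); have K0 : 0 <= K by rewrite addr_ge0 // mulr_ge0 ?mulr_ge0 // ltW.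
  have one y y' : `|y - z| <= r -> `|y' - z| <= r -> u (phi_inv i y') - u (phi_inv i y) <= K * `|y' - y|.
    move=> yr y'r; have [->|ne] := eqVneq y' y; first by rewrite !subrr normr0 mulr0.
    have t0 : 0 < `|y' - y| by rewrite normr_gt0 subr_eq0.
    pose v := `|y' - y|^-1 *: (y' - y).
    have nv : `|v| <= 1 by rewrite normrZ normfV normr_id mulVf ?gt_eqF.
    have yE : y + `|y' - y| *: v = y' by rewrite /v scalerA divff ?gt_eqF // scale1r addrC subrK.
    apply: lim => w sw; have := hC w y v `|y' - y| sw (ltW t0) nv.
    rewrite yE => h; apply: (le_trans (h _)); first by move=> s s0 st; exact: segment_in_ball.
    have lB : lag (lh H i) y v <= B.
      apply: hB; first exact: cod.
      have [_ _ [_ b] _] := cmp y v 0 yr; apply: (le_trans b).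
      by rewrite -[leRHS]mulr1 ler_pM2l.
    have t2 : `|y' - y| <= 2 * r.
      by have := ler_distD z y' y; rewrite [`|z - _|]distrC; move: yr y'r; clra.
    have := ler_wpM2l (ltW t0) lB; have := sq_le_lin (ltW C0) (ltW t0) t2.
    by rewrite /K; move: (lag _ _ _) `|y' - y| => a b; clra.
  exists r, K; split=> // y y' yr y'r; rewrite ler_norml; apply/andP; split; last exact: one.
  by rewrite lerNl opprB distrC; exact: one.
move=> i y cy v e e0; have [r [kappa ni]] := good_loc gH cy; have [r0 gg cod cmp hl] := ni.
have [C C0 hC] := subsol_segment ni (normr_ge0 v).
have v1 : 0 < `|v| + 1 by rewrite ltr_pwDr.
exists (Num.min (r / (`|v| + 1)) (e / C)); first by rewrite lt_min !divr_gt0.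
move=> t t0; rewrite lt_min !ltr_pdivlMr // => /andP[tr te].
apply: lim => w sw; have := hC w y v t sw (ltW t0) (lexx _) => h.
apply: (le_trans (h _)).
  move=> s s0 st; rewrite addrAC subrr add0r normrZ ger0_norm //.
  by apply: le_trans (ltW tr); apply: ler_pM => //; rewrite lerDl.
rewrite mulrDr lerD2l expr2 mulrCA ler_pM2l // mulrC; exact: ltW.
Qed.

Lemma regular_limit (R : realType) (n : nat) (M : c2_manifold R n) (g : riemannian_metric M) (G H : cotangent M -> R) Gx Gp Hx Hp
    (I : nat -> chart M) (Z : nat -> 'rV[R]_n) (Rd Kp : nat -> R) u0 :
  good g G Gx Gp -> good g H Hx Hp -> commute_grad Gx Gp Hx Hp -> riem_complete g ->
  (forall k, nice g H Hx Hp (I k) (Z k) (Rd k) (Kp k)) ->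
  (forall k, nice g (rev_ham H) (fun i y p => Hx i y (- p)) (fun i y p => - Hp i y (- p)) (I k) (Z k) (Rd k) (Kp k)) ->
  subsol G u0 -> subsol H u0 -> exists u : M -> R, [/\ subsol G u, subsol H u &
    forall k, exists2 A : R, 0 <= A & reg I Z k A (Rd k / 8) u].
Proof.
move=> gG gH cGH cg niH niR sG sH; have r0 k : 0 < Rd k by case: (niH k).
pose h m : R := 2^-1 ^+ m.
have h0 m : 0 < h m by rewrite exprn_gt0.
have hS m : h m = 2 * h m.+1 by rewrite /h exprS; field.
have h1 m : h m <= 1 by rewrite exprn_ile1 // invf_le1 ?ler1n.
(* Constants stay below q.2 k + 1 and radii above Rd k / 8; the loss allowed at stage m is governed
   by h m - h m.+1 = h m.+1. *)
pose P m (q : (M -> R) * (nat -> R)) := [/\ subsol G q.1, subsol H q.1, forall k, 0 <= q.2 k &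
  forall k, (k < m)%N -> reg I Z k (q.2 k + (1 - h m)) (Rd k / 8 * (1 + h m)) q.1].
have step (mq : nat * ((M -> R) * (nat -> R))) : exists q', P mq.1 mq.2 -> [/\ P mq.1.+1 q',
    forall x, `|q'.1 x - mq.2.1 x| <= h mq.1.+1 & forall k, (k < mq.1)%N -> q'.2 k = mq.2.2 k].
  case: mq => m [w a] /=; have [Pm|nP] := pselect (P m (w, a)); last by exists (w, a).
  have [sGw sHw a0 hreg] := Pm; rewrite /= in sGw sHw a0 hreg.
  (* The first bound is the loss of radius allowed on old balls. The second makes Rd m / 4 - eta at
     least 3 Rd m / 16, enough for the new ball as h m.+1 <= 1/2. *)
  pose Q k (t : R) := t <= Rd k / 8 * h m.+1 /\ t <= Rd k / 16.
  have hQ k : exists2 tau : R, 0 < tau & forall t, 0 < t -> t <= tau -> Q k t.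
    exists (Num.min (Rd k / 8 * h m.+1) (Rd k / 16)).
      by rewrite lt_min !mulr_gt0 // ?divr_gt0.
    by move=> t _; rewrite le_min => /andP.
  have [tau tau0 htau] := uniform_time hQ m.+1.
  pose eta := Num.min tau (h m.+1).
  have eta0 : 0 < eta by rewrite lt_min tau0 h0.
  have eta1 : eta <= h m.+1 by rewrite ge_min lexx orbT.
  have etaQ := htau eta eta0 (_ : _ <= _); have {}etaQ k : (k < m.+1)%N -> Q k eta.
    by apply: etaQ; rewrite ge_min lexx.
  have [|||w' [sGw' sHw' dw hr [A' A'0 hA]]] := @regular_step R n M g I Z Rd Kp G H Gx Gp Hx Hp w m
    (fun k => a k + (1 - h m)) (fun k => Rd k / 8 * (1 + h m)) eta gG gH cGH cg niH niR sGw sHw eta0.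
  - by move=> k; rewrite addr_ge0 // subr_ge0.
  - move=> k; have := ler_wpM2l (ltW (r0 k)) (h1 m); have := r0 k; clra.
  - exact: hreg.
  exists (w', fun k => if k == m then A' else a k) => _; split; last 2 first.
  - by move=> x; apply: (le_trans (dw x)).
  - by move=> k km; rewrite /= ltn_eqF.
  split=> //= [k|k]; first by case: ifP.
  rewrite ltnS leq_eqVlt => /orP[/eqP ->|km].
    rewrite eqxx; have [_ q2] := etaQ m (ltnSn m); have [c1 c2] := hA.
    have rr : Rd m / 8 * (1 + h m.+1) <= Rd m / 4 - eta.
      have hh : h m.+1 <= 1 / 2 by have := h1 m; rewrite hS; clra.
      have := ler_wpM2l (ltW (r0 m)) hh; move: q2; clra.
    have AA : A' <= A' + (1 - h m.+1) by rewrite lerDl subr_ge0.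
    by split; [exact: semiconcave_mono c1 AA rr|exact: semiconvex_mono c2 AA rr].
  rewrite ltn_eqF //; have [q1 _] := etaQ k (ltnW km : (k < m.+1)%N); have [c1 c2] := hr k km.
  have rr : Rd k / 8 * (1 + h m.+1) <= Rd k / 8 * (1 + h m) - eta by rewrite [h m]hS; move: q1; clra.
  have AA : a k + (1 - h m) + eta <= a k + (1 - h m.+1) by rewrite [h m]hS; move: eta1; clra.
  by split; [exact: semiconcave_mono c1 AA rr|exact: semiconvex_mono c2 AA rr].
have [f hf] := choice step.
pose st := nat_rect (fun _ => ((M -> R) * (nat -> R))%type) (u0, fun=> 0) (fun m q => f (m, q)).
have Pst m : P m (st m).
  elim: m => [|m IH]; first by split.
  by have [] := hf (m, st m) IH.
have dst m x : `|(st m.+1).1 x - (st m).1 x| <= 1 / 2 ^+ m.+1.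
  have [_ d _] := hf (m, st m) (Pst m); apply: (le_trans (d x)).
  by rewrite /h /= exprVn div1r.
(* The base constant of ball k is frozen once the ball has been treated, so it serves for the
   limit. *)
have cst k m : (st (m + k.+1)%N).2 k = (st k.+1).2 k.
  elim: m => [|m IH] //; rewrite -IH addSn.
  have [_ _ e] := hf (_, st (m + k.+1)%N) (Pst (m + k.+1)%N); apply: e => /=.
  by rewrite addnS ltnS leq_addl.
have [u hu] := choice (fun x => geometric_limit (fun m => dst m x)).
have app e : 0 < e -> exists m0, forall m, (m0 <= m)%N -> forall x, `|u x - (st m).1 x| <= e.
  move=> e0; have [m0 hm] := halves_small 2 e0; exists m0 => m /hm hm' x.
  by apply: (le_trans (hu x m)); rewrite mulr1; move: hm'; rewrite exprVn.
exists u; split.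
- apply: (subsol_limit gG) => e /app[m hm]; exists (st m).1; last exact: hm.
  by case: (Pst m).
- apply: (subsol_limit gH) => e /app[m hm]; exists (st m).1; last exact: hm.
  by case: (Pst m).
- move=> k; pose b := (st k.+1).2 k; have [_ _ b0 _] := Pst k.+1.
  exists (b + 1); first by apply: addr_ge0 => //; exact: b0.
  have key e : 0 < e -> exists2 w, (forall x, `|u x - w x| <= e) & reg I Z k (b + 1) (Rd k / 8) w.
    move=> /app[m hm]; exists (st (m + k.+1)%N).1; first by apply: hm; exact: leq_addr.
    have [_ _ _ /(_ k)] := Pst (m + k.+1)%N; rewrite cst -/b => hr.
    have [|c1 c2] := hr; first by rewrite addnS ltnS leq_addl.
    have AA : b + (1 - h (m + k.+1)%N) <= b + 1 by rewrite lerD2l gerBl ltW.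
    have rr : Rd k / 8 <= Rd k / 8 * (1 + h (m + k.+1)%N).
      by rewrite mulrDr mulr1 lerDl mulr_ge0 ?divr_ge0 // ltW.
    by split; [exact: semiconcave_mono c1 AA rr|exact: semiconvex_mono c2 AA rr].
  have sdd (w : M -> R) e x y : (forall x, `|u x - w x| <= e) ->
      `|sd (u \o phi_inv (I k)) x y - sd (w \o phi_inv (I k)) x y| <= 4 * e.
    move=> hw; have w1 := hw (phi_inv (I k) (x + y)); have w2 := hw (phi_inv (I k) (x - y)).
    have w3 := hw (phi_inv (I k) x); rewrite /sd /=; move: w1 w2 w3; rewrite !ler_norml.
    move: (u _) (u _) (u _) (w _) (w _) (w _) => a1 a2 a3 a4 a5 a6 /andP[? ?] /andP[? ?] /andP[? ?].
    by apply/andP; split; lra.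
  split=> x y xy; [apply: (@eps_mul_le _ _ _ 4)|rewrite -lerN2 opprK; apply: (@eps_mul_le _ _ _ 4)] => e e0;
    have [w hw [c1 c2]] := key e e0; have := sdd w e x y hw; have := c1 x y xy; have := c2 x y xy;
    rewrite ler_norml => a1 a2 /andP[a3 a4]; move: a1 a2 a3 a4; clra.
Qed.

(** To each basic open set contained in some N x one such x is attached, and there are countably
    many basic sets. *)
Lemma countable_cover (R : realType) (n : nat) (M : c2_manifold R n) (N : M -> set M) : (forall x, nbhs x (N x)) -> M ->
  exists X : nat -> M, forall x, exists k, N (X k) x.
Proof.
move=> hN x0; have [B /countable_injP[f finj] [Bo Bb]] := carrier_second_countable M.
have hX k : exists x, forall U x', B U -> f U = k -> U `<=` N x' -> U `<=` N x.
  have [[U [x [BU fU UN]]]|no] := pselect (exists U x, [/\ B U, f U = k & U `<=` N x]).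
    exists x => U' x' BU' fU' _; have -> : U' = U by apply: finj; rewrite ?inE // fU fU'.
    exact: UN.
  by exists x0 => U x' BU fU UN; exfalso; apply: no; exists U, x'.
have [X hX'] := choice hX; exists X => x.
have [U [BU Ux] UN] := Bb x _ (hN x); exists (f U).
exact: (hX' (f U) U x BU erefl UN x Ux).
Qed.

Theorem theorem0p4 (R : realType) (n : nat) (M : c2_manifold R n)
    (g : riemannian_metric M)
    (M_connected : connected [set: M]%classic)
    (M_complete : riem_complete g)
    (G H : cotangent M -> R)
    (G_tonelli : tonelli g G) (H_tonelli : tonelli g H)
    (GH_commute : poisson_commute G H)
    (alpha alpha' : R) :
  (exists u : M -> R, subsolution g G alpha u /\ subsolution g H alpha' u) ->
  exists u' : M -> R,
    [/\ C11 u', subsolution g G alpha u' & subsolution g H alpha' u'].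
Proof.
move=> [u [uG uH]].
(* On an empty manifold u itself qualifies, and the enumeration of balls below needs a point. *)
have [[x0 _]|noM] := pselect (exists x : M, True); last first.
  exists u; split=> // i y [x _]; exfalso; apply: noM; by exists x.
have gG := tonelli_good G_tonelli; have gH := tonelli_good H_tonelli.
have cGH := poisson_grad GH_commute.
have gG' := good_shift alpha gG; have gH' := good_shift alpha' gH.
have sG := subsolution_subsol gG uG; have sH := subsolution_subsol gH uH.
have gR := good_rev gH'.
(* The regularization runs the semigroups of H only, so the balls have to suit H and its reversal,
   but not G. *)
have balls (x : M) : exists rk : R * R,
    nice g (shift_ham H alpha') (grad_x H) (grad_p H) (chart_at x) (phi (chart_at x) x) rk.1 rk.2 /\
    nice g (rev_ham (shift_ham H alpha')) (fun i y p => grad_x H i y (- p))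
      (fun i y p => - grad_p H i y (- p)) (chart_at x) (phi (chart_at x) x) rk.1 rk.2.
  have cx := codom_phi (dom_chart_at x).
  have [r1 [k1 n1]] := good_loc gH' cx; have [r2 [k2 n2]] := good_loc gR cx.
  have r10 : 0 < r1 by case: n1. have r20 : 0 < r2 by case: n2.
  have m0 : 0 < Num.min r1 r2 by rewrite lt_min r10.
  have m1 : Num.min r1 r2 <= r1 by rewrite ge_min lexx.
  have m2 : Num.min r1 r2 <= r2 by rewrite ge_min lexx orbT.
  have n1' : nice g (shift_ham H alpha') (grad_x H) (grad_p H) _ _ _ _ := nice_sub n1 m0 m1.
  exists (Num.min r1 r2, k1); split; first exact: n1'.
  case: n1' => a1 a2 a3 a4 _; case: n2 => _ _ _ _ a5; split=> //.
  by apply: (hamloc_sub a5); rewrite subrr normr0 add0r.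
have [rk hrk] := choice balls.
have rk0 x : 0 < (rk x).1 / 8 by have [[r0 _ _ _ _] _] := hrk x; rewrite divr_gt0.
pose N (x : M) := [set x' | dom (chart_at x) x' /\
  `|phi (chart_at x) x' - phi (chart_at x) x| < (rk x).1 / 8].
have hN x : nbhs x (N x).
  have nb : nbhs (phi (chart_at x) x) [set y | `|y - phi (chart_at x) x| < (rk x).1 / 8].
    apply/nbhs_ballP; exists ((rk x).1 / 8); first exact: rk0.
    by move=> y; rewrite -ball_normE /= distrC.
  exact: (chart_pull (dom_chart_at x) nb).
have [X hX] := countable_cover hN x0.
have [w [wG wH wreg]] := regular_limit gG' gH' cGH M_complete (fun k => (hrk (X k)).1)
  (fun k => (hrk (X k)).2) sG sH.
exists w; split; [|exact: subsol_subsolution gG wG|exact: subsol_subsolution gH wH].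
apply: (reg_C11 wG.1) => x; have [k [dk xk]] := hX x; have [A A0 [c1 c2]] := wreg k.
by exists (chart_at (X k)), (phi (chart_at (X k)) (X k)), ((rk (X k)).1 / 8), A; split.
Qed.
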